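(* Let $T>0$ and let $f$ be a source term on $[0,T]\times\Omega$ with $f(0)=0$. Let $\mathbf{G_h}$ be the solution of the spatially semi-discrete scheme $$\mathcal{L}^{\alpha,\lambda}_t\mathbf{G_h}(t)=(\Delta+\gamma)^{\beta/2}_h\mathbf{G_h}(t)+\mathcal{V}f(t),\qquad \mathbf{G_h}(0)=0,$$ and, for $\tau=T/L$, $L\in\mathbb{N}^+$, $t_n=n\tau$, let $\mathbf{G_h^n}$ ($0\le n\le L$) be the solution of the fully discrete backward Euler scheme $$\frac1{\tau^\alpha}\sum_{k=0}^n\mathrm{diag}(\mathcal{V}d^{\alpha,\lambda}_k)\,\mathbf{G_h^{n-k}}=(\Delta+\gamma)^{\beta/2}_h\mathbf{G_h^n}+\mathcal{V}f(t_n),$$ where the functions $d^{\alpha,\lambda}_k$ on $\bar\Omega$ are defined by $$\sum_{j=0}^\infty d_j^{\alpha,\lambda}(\mathbf{x})\zeta^j=\big(1-\zeta+\tau\lambda-\tau r(\mathbf{x})-\tau J\rho U(\mathbf{x})\big)^\alpha-(\tau\lambda)^\alpha .$$ If $f\in L^\infty(0,T;L^2(\Omega))$ and $\int_0^t(t-s)^{\alpha-1}\|\mathcal{V}f'(s)\|_{l^2}ds<\infty$ for $t\in(0,T]$ (where $'$ denotes the time derivative), then there is a constant $C>0$, independent of $\tau$, $h$ and $n$, such that for $1\le n\le L$ $$\|\mathbf{G_h}(t_n)-\mathbf{G_h^n}\|_{l^2}\le C\tau\int_0^{t_n}(t_n-s)^{\alpha-1}\|\mathcal{V}f'(s)\|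_{l^2}ds.$$
   Context: Parameters: $\alpha\in(0,1)$, $\lambda>0$, $\beta\in(0,2)$, $\gamma\ge0$, $\sigma\in(\beta,2]$, $\rho\in\mathbb{R}$, $J=\sqrt{-1}$, $\Omega=(-l,l)^2$; $r,U:\bar\Omega\to\mathbb{R}$ are given with $\sup_{\bar\Omega}r<0$, and such that $\theta_\epsilon:=\inf_{\mathbf{x}\in\bar\Omega}\arccos\big(|\rho U(\mathbf{x})|/\sqrt{r(\mathbf{x})^2+(\rho U(\mathbf{x}))^2}\big)>0$. Complex powers use the principal branch. Time operator: with $a(\mathbf{x})=r(\mathbf{x})+J\rho U(\mathbf{x})$, $$\mathcal{L}^{\alpha,\lambda}_tv(t,\mathbf{x})=e^{a(\mathbf{x})t}e^{-\lambda t}\;{}^C_0D^\alpha_t\big(e^{\lambda t}e^{-a(\mathbf{x})t}v(t,\mathbf{x})\big)-\lambda^\alpha v(t,\mathbf{x}),\quad {}^C_0D^\alpha_tw(t)=\frac1{\Gamma(1-\alpha)}\int_0^t(t-s)^{-\alpha}w'(s)ds.$$ On grid vectors $\mathcal{L}^{\alpha,\lambda}_t$ acts componentwise, with $\mathbf{x}$ the corresponding grid point. Grid: $h=l/N$, $N\in\mathbb{N}^+$, $x_i=ih$, $y_j=jh$ for $-N\le i,j\le N$. $\mathcal{V}f\in\mathbb{C}^{(2N-1)^2}$ is the vector of values $f(x_p,y_q)$, $-N<p,q<N$; $\mathrm{diag}(\mathbf v)$ is the diagonal matrix with diagonal $\mathbf v$. $\|\mathbf{v}\|_{l^2}=\big(h^2\sum_i|v_i|^2\big)^{1/2}$.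 Discrete tempered fractional Laplacian: let $c_{2,\beta}=\frac{1}{2\pi|\Gamma(-\beta)|}$ if $\gamma>0$ and $\beta\ne1$, and $c_{2,\beta}=\frac{\beta\Gamma((2+\beta)/2)}{2^{1-\beta}\pi\Gamma(1-\beta/2)}$ if $\gamma=0$ or $\beta=1$. For a grid vector $v=(v_{p,q})_{-N<p,q<N}$, extended by $v_{i,j}=0$ when $|i|=N$ or $|j|=N$, and for $-N<p,q<N$, $$\big((\Delta+\gamma)^{\beta/2}_h v\big)_{p,q}=c_{2,\beta}\Big[\tfrac{k_\sigma}{4}W_{0,0}\,(\phi_{0,1}+\phi_{1,0}+\phi_{1,1})+\sum_{\substack{-N\le i,j\le N-1\\(i,j)\notin\mathcal{I}_{p,q}}}I_{p,q,i,j}-W^\infty_{p,q}v_{p,q}\Big].$$ Here $k_\sigma=1$ if $\sigma\in(\beta,2)$ and $k_\sigma=4/3$ if $\sigma=2$; $W_{0,0}=\int_0^h\int_0^h(\xi^2+\eta^2)^{(\sigma-2-\beta)/2}d\eta\,d\xi$; $$\phi_{a,b}=\frac{v_{p+a,q+b}+v_{p-a,q+b}+v_{p-a,q-b}+v_{p+a,q-b}-4v_{p,q}}{e^{\gamma h\sqrt{a^2+b^2}}\,(h\sqrt{a^2+b^2})^{\sigma}};$$ $\mathcal{I}_{p,q}=\{(p,q),(p-1,q),(p,q-1),(p-1,q-1)\}$; $$I_{p,q,i,j}=\int_{ih}^{(i+1)h}\int_{jh}^{(j+1)h}B_{i,j}(\xi,\eta)\,\big((\xi-x_p)^2+(\eta-y_q)^2\big)^{-(2+\beta)/2}d\eta\,d\xi,$$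 where $B_{i,j}$ is the bilinear interpolant on the cell $[ih,(i+1)h]\times[jh,(j+1)h]$ of the four corner values $(v_{i',j'}-v_{p,q})e^{-\gamma h\sqrt{(i'-p)^2+(j'-q)^2}}$, $i'\in\{i,i+1\}$, $j'\in\{j,j+1\}$; and $$W^\infty_{p,q}=\int\int_{\mathbb{R}^2\setminus\Omega}e^{-\gamma\sqrt{(\xi-x_p)^2+(\eta-y_q)^2}}\big((\xi-x_p)^2+(\eta-y_q)^2\big)^{-(2+\beta)/2}d\xi\,d\eta.$$ *)

(* Defs.v *)
(* Real numbers: an arbitrary [R : realType]; complex numbers: [R[i]].
   Points of the plane are pairs [x : R * R]. *)
From HB Require Import structures.
From mathcomp Require Import all_boot all_order all_algebra.
From mathcomp Require Import all_classical all_reals all_analysis.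
From mathcomp Require Import complex.

Set Implicit Arguments.
Unset Strict Implicit.
Unset Printing Implicit Defensive.

Import Order.TTheory GRing.Theory Num.Theory numFieldNormedType.Exports Normc.

Local Open Scope classical_set_scope.
Local Open Scope ring_scope.
Local Open Scope complex_scope.

Definition cexp (R : realType) (z : R[i]) : R[i] :=
  (expR (complex.Re z))%:C * (cos (complex.Im z) +i* sin (complex.Im z)).

(* Principal argument, with values in (-pi, pi] for z != 0. *)
Definition carg (R : realType) (z : R[i]) : R :=
  if 0 <= complex.Im z then acos (complex.Re z / normc z)
  else - acos (complex.Re z / normc z).

Definition cpow (R : realType) (z : R[i]) (a : R) : R[i] :=
  (normc z `^ a)%:C * (cos (a * carg z) +i* sin (a * carg z)).

Definition leb2 (R : realType) := (@lebesgue_measure R \x @lebesgue_measure R)%E.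

Definition cint (R : realType) (D : set R) (w : R -> R[i]) : R[i] :=
  (\int[@lebesgue_measure R]_(s in D) complex.Re (w s))
  +i* (\int[@lebesgue_measure R]_(s in D) complex.Im (w s)).

Definition cintegrable (R : realType) (D : set R) (w : R -> R[i]) : Prop :=
  (@lebesgue_measure R).-integrable D (EFin \o (fun s => complex.Re (w s))) /\
  (@lebesgue_measure R).-integrable D (EFin \o (fun s => complex.Im (w s))).

(* Absolute continuity on [0, T], as being the indefinite Lebesgue integral
   of an integrable function. *)
Definition abs_cont (R : realType) (T : R) (w : R -> R[i]) : Prop :=
  exists g : R -> R[i], cintegrable `[0, T] g /\
    forall t, 0 <= t <= T -> w t = w 0 + cint `[0, t] g.

(* For absolutely continuous [w] this is the derivative almost everywhere;
   [derive1] takes an arbitrary value on the remaining null set. *)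
Definition cderiv (R : realType) (w : R -> R[i]) (s : R) : R[i] :=
  derive1 (fun t => complex.Re (w t)) s +i* derive1 (fun t => complex.Im (w t)) s.

(* Euler's integral for x > 0; for negative non-integer x, the extension by
   Gamma (x + n) = x (x + 1) ... (x + n - 1) Gamma x with n > |x|. *)
Definition Gamma_pos (R : realType) (x : R) : R :=
  \int[@lebesgue_measure R]_(t in `]0, +oo[) (t `^ (x - 1) * expR (- t)).

Definition Gamma (R : realType) (x : R) : R :=
  if 0 < x then Gamma_pos x
  else let n := (Num.truncn `|x|).+1 in
       Gamma_pos (x + n%:R) / \prod_(i < n) (x + i%:R).

Definition caputo_integrand (R : realType) (alpha : R) (w : R -> R[i]) (t s : R)
    : R[i] :=
  ((t - s) `^ (- alpha))%:C * cderiv w s.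

Definition caputo (R : realType) (alpha : R) (w : R -> R[i]) (t : R) : R[i] :=
  ((Gamma (1 - alpha))^-1)%:C * cint `[0, t] (caputo_integrand alpha w t).

Definition acoef (R : realType) (rho : R) (r U : R * R -> R) (x : R * R) : R[i] :=
  r x +i* (rho * U x).

Definition untemper (R : realType) (lambda : R) (a : R[i]) (v : R -> R[i]) (s : R)
    : R[i] :=
  (expR (lambda * s))%:C * cexp (- (a * s%:C)) * v s.

(* The time operator at a fixed point x, where a = a(x). *)
Definition Lt (R : realType) (alpha lambda : R) (a : R[i]) (v : R -> R[i]) (t : R)
    : R[i] :=
  cexp (a * t%:C) * (expR (- (lambda * t)))%:C
    * caputo alpha (untemper lambda a v) t
  - (lambda `^ alpha)%:C * v t.

Definition Omega (R : realType) (l : R) : set (R * R) :=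
  [set x | - l < x.1 < l /\ - l < x.2 < l].

Definition Omega_bar (R : realType) (l : R) : set (R * R) :=
  [set x | - l <= x.1 <= l /\ - l <= x.2 <= l].

(* A vector of C^((2N-1)^2), as a square array. The rows and columns
   0, ..., 2N-2 stand for the grid indices -N < p < N, see [gidx]. *)
Definition gridvec (R : realType) (N : nat) := 'M[R[i]]_((2 * N).-1).

Definition gidx (N : nat) (p : 'I_((2 * N).-1)) : int := p%:Z - N%:Z + 1.

Definition gpoint (R : realType) (N : nat) (h : R) (p q : 'I_((2 * N).-1)) : R * R :=
  ((gidx p)%:~R * h, (gidx q)%:~R * h).

Definition gridV (R : realType) (N : nat) (h : R) (f : R * R -> R[i]) : gridvec R N :=
  \matrix_(p, q) f (gpoint h p q).

(* diag(u) v *)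
Definition diagmul (R : realType) (N : nat) (u v : gridvec R N) : gridvec R N :=
  \matrix_(p, q) (u p q * v p q).

Definition l2norm (R : realType) (N : nat) (h : R) (v : gridvec R N) : R :=
  Num.sqrt (h ^+ 2 * \sum_p \sum_q normc (v p q) ^+ 2).

(* The value v_{i,j} for integer indices, zero outside -N < i, j < N. *)
Definition gext (R : realType) (N : nat) (v : gridvec R N) (i j : int) : R[i] :=
  if ([pick p | gidx p == i], [pick q | gidx q == j]) is (Some p, Some q)
  then v p q else 0.

Definition c2 (R : realType) (beta gamma : R) : R :=
  if (0 < gamma) && (beta != 1) then (2 * pi * `|Gamma (- beta)|)^-1
  else beta * Gamma ((2 + beta) / 2)
       / (2 `^ (1 - beta) * pi * Gamma (1 - beta / 2)).

Definition ksigma (R : realType) (sigma : R) : R := if sigma < 2 then 1 else 4 / 3.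

Definition W00 (R : realType) (beta sigma h : R) : R :=
  \int[@lebesgue_measure R]_(xi in `[0, h])
    \int[@lebesgue_measure R]_(eta in `[0, h])
      (xi ^+ 2 + eta ^+ 2) `^ ((sigma - 2 - beta) / 2).

Definition kern (R : realType) (beta : R) (x y : R * R) : R :=
  ((x.1 - y.1) ^+ 2 + (x.2 - y.2) ^+ 2) `^ (- ((2 + beta) / 2)).

Definition phi (R : realType) (N : nat) (gamma sigma h : R) (v : gridvec R N)
    (p q : int) (a b : nat) : R[i] :=
  let d := h * Num.sqrt (a%:R ^+ 2 + b%:R ^+ 2) in
  (gext v (p + a%:Z) (q + b%:Z) + gext v (p - a%:Z) (q + b%:Z)
   + gext v (p - a%:Z) (q - b%:Z) + gext v (p + a%:Z) (q - b%:Z)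
   - 4%:R * gext v p q)
  / (expR (gamma * d) * d `^ sigma)%:C.

Definition corner (R : realType) (N : nat) (gamma h : R) (v : gridvec R N)
    (p q i j : int) : R[i] :=
  (gext v i j - gext v p q)
  * (expR (- (gamma * h
       * Num.sqrt ((i - p)%:~R ^+ 2 + (j - q)%:~R ^+ 2))))%:C.

(* Bilinear interpolant of the corner values on the cell
   [i h, (i+1) h] x [j h, (j+1) h]. *)
Definition bilin (R : realType) (N : nat) (gamma h : R) (v : gridvec R N)
    (p q i j : int) (xi eta : R) : R[i] :=
  let s := xi / h - i%:~R in
  let t := eta / h - j%:~R in
  ((1 - s) * (1 - t))%:C * corner gamma h v p q i j
  + (s * (1 - t))%:C * corner gamma h v p q (i + 1) j
  + ((1 - s) * t)%:C * corner gamma h v p q i (j + 1)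
  + (s * t)%:C * corner gamma h v p q (i + 1) (j + 1).

Definition Icell (R : realType) (N : nat) (beta gamma h : R) (v : gridvec R N)
    (p q i j : int) : R[i] :=
  cint `[i%:~R * h, (i + 1)%:~R * h] (fun xi =>
    cint `[j%:~R * h, (j + 1)%:~R * h] (fun eta =>
      bilin gamma h v p q i j xi eta
      * (kern beta (xi, eta) (p%:~R * h, q%:~R * h))%:C)).

Definition Winf (R : realType) (l beta gamma : R) (x : R * R) : R :=
  \int[@leb2 R]_(y in ~` Omega l)
    (expR (- (gamma * Num.sqrt ((y.1 - x.1) ^+ 2 + (y.2 - x.2) ^+ 2)))
     * kern beta y x).

(* The cell (i, j), -N <= i, j <= N-1, is (i' - N, j' - N) with i', j' < 2N. *)
Definition fracLap (R : realType) (N : nat) (l beta gamma sigma h : R)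
    (v : gridvec R N) : gridvec R N :=
  \matrix_(p0, q0)
    let p := gidx p0 in
    let q := gidx q0 in
    (c2 beta gamma)%:C *
    ((ksigma sigma / 4 * W00 beta sigma h)%:C
       * (phi gamma sigma h v p q 0 1 + phi gamma sigma h v p q 1 0
          + phi gamma sigma h v p q 1 1)
     + \sum_(i < 2 * N) \sum_(j < 2 * N |
           (i%:Z - N%:Z, j%:Z - N%:Z)
             \notin [:: (p, q); (p - 1, q); (p, q - 1); (p - 1, q - 1)])
         Icell beta gamma h v p q (i%:Z - N%:Z) (j%:Z - N%:Z)
     - (Winf l beta gamma (gpoint h p0 q0))%:C * v p0 q0).

(* f in L^oo(0, T; L^2(Omega)): up to null sets, f(t, .) is given by a jointly
   measurable g (equivalently, t |-> f(t, .) is strongly measurable into the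
   separable space L^2(Omega)), and ||f(t, .)||_{L^2} is essentially bounded. *)
Definition LinfL2 (R : realType) (T l : R) (f : R -> R * R -> R[i]) : Prop :=
  exists (g : R * (R * R) -> R[i]) (M : R),
    [/\ measurable_fun setT (fun y => complex.Re (g y)),
        measurable_fun setT (fun y => complex.Im (g y)),
        {ae @lebesgue_measure R, forall t, 0 < t < T ->
           {ae @leb2 R, forall x, Omega l x -> f t x = g (t, x)}} &
        {ae @lebesgue_measure R, forall t, 0 < t < T ->
           (\int[@leb2 R]_(x in Omega l) (normc (g (t, x)) ^+ 2)%:E <= M%:E)%E}].

Definition dt (R : realType) (f : R -> R * R -> R[i]) (s : R) (x : R * R) : R[i] :=
  cderiv (fun t => f t x) s.

Definition srcint (R : realType) (N : nat) (alpha h : R) (f : R -> R * R -> R[i])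
    (t : R) : \bar R :=
  (\int[@lebesgue_measure R]_(s in `[0%R, t])
     ((t - s) `^ (alpha - 1) * l2norm h (gridV N h (dt f s)))%:E)%E.

(* The integrability clause says that the Caputo derivative exists at t. *)
Definition semidiscrete_sol (R : realType) (N : nat)
    (alpha lambda beta gamma sigma rho l T h : R) (r U : R * R -> R)
    (f : R -> R * R -> R[i]) (G : R -> gridvec R N) : Prop :=
  [/\ forall p q, abs_cont T (fun t => G t p q),
      G 0 = 0 &
      forall t, 0 < t <= T -> forall p q,
        let a := acoef rho r U (gpoint h p q) in
        let v := fun s => G s p q in
        cintegrable `[0, t] (caputo_integrand alpha (untemper lambda a v) t) /\
        Lt alpha lambda a v t
          = fracLap l beta gamma sigma h (G t) p q + gridV N h (f t) p q].

(* The generating-function identity holds on the unit disc, where its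
   right-hand side is analytic: the base of the power has positive real part. *)
Definition euler_coeffs (R : realType) (alpha lambda rho l tau : R)
    (r U : R * R -> R) (d : nat -> R * R -> R[i]) : Prop :=
  forall x, Omega_bar l x -> forall z : R[i], normc z < 1 ->
    (fun m : nat => normc (\sum_(k < m) d k x * z ^+ k
       - (cpow (1 - z + (tau * lambda)%:C - tau%:C * acoef rho r U x) alpha
          - ((tau * lambda) `^ alpha)%:C))) @ \oo --> (0 : R).

Definition fullydiscrete_sol (R : realType) (N L : nat)
    (alpha beta gamma sigma l h tau : R) (f : R -> R * R -> R[i])
    (d : nat -> R * R -> R[i]) (G : nat -> gridvec R N) : Prop :=
  forall n : nat, (n <= L)%N ->
    ((tau `^ alpha)^-1)%:C *:
      (\sum_(k < n.+1) diagmul (gridV N h (d k)) (G (n - k)%N))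
    = fracLap l beta gamma sigma h (G n) + gridV N h (f (n%:R * tau)).

(* Main.v *)
Require Import Defs.
From HB Require Import structures.
From mathcomp Require Import all_boot all_order all_algebra.
From mathcomp Require Import all_classical all_reals all_analysis.
From mathcomp Require Import complex.
From mathcomp Require Import measurable_realfun.
From mathcomp Require Import ring lra zify.

Set Warnings "-notation-overridden,-notation-incompatible-prefix,-ambiguous-paths".
Set Implicit Arguments.
Unset Strict Implicit.
Unset Printing Implicit Defensive.

Import Order.TTheory GRing.Theory Num.Theory numFieldNormedType.Exports Normc.

Local Open Scope classical_set_scope.
Local Open Scope ring_scope.
Local Open Scope complex_scope.

(* Put b = lambda - a, so that Re b > lambda and |Im b| <= M Re b uniformly in x,
   and write A for the discrete tempered fractional Laplacian, which is a
   dissipative matrix (the generator of a symmetric random walk with killing). The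
   backward Euler scheme is the convolution equation whose symbol is
   (1 - z + tau b)^alpha - (tau lambda)^alpha - tau^alpha A, and dissipativity of A
   with coercivity of the symbol bounds the resolvent by a multiple of
   |1 - z|^(-alpha); bounds for its z-derivatives yield a decay n^(alpha-1) of
   the impulse response and n^(alpha-2) of its differences, with constants
   independent of tau, h and A.
   The substitution z |-> (1 + z) / 2 turns the symbol for tau / 2 into that for
   tau, so the coarse responses are averages of the fine ones against negative
   binomial weights concentrated around 2 n. Hence halving tau changes the
   solution at t_n by at most C tau times the integral of
   (t_n - s)^(alpha-1) |f'(s)|, and summing over all halvings gives the estimate,
   provided that for fixed h the discrete solutions converge to the semidiscrete
   one. For the latter, the averages of the semidiscrete solution against the
   Gamma densities exp(-t/tau) (t/tau)^n / (n! tau) solve the backward Euler scheme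
   exactly, with the averaged source, and these densities concentrate at n tau. *)

(** * Complex powers *)

(** The obstacle is that f' is only integrable, so that no Taylor expansion of the semidiscrete
    solution in time is available. Comparing the scheme with itself at half the step avoids this:
    both responses come from one symbol, and f enters through its increments alone. Convergence to
    the semidiscrete solution may then be merely qualitative and depend on h, since the geometric
    series of halvings has already produced the constant. No contour integral occurs. Coefficients
    are read off by Parseval's identity over roots of unity on the circle of radius 1 - 1/(2n),
    where |1 - z|^(-2) has an average of order n. Bounds are therefore brought to the form |1 -
    z|^(-alpha-2): z d/dz is applied twice for the response, and three times for its differences,
    whose factor 1 - z regains one power. Each derivative costs 1/|1 - z| uniformly in tau, because
    the sector condition keeps |1 - z + tau b| above a fixed fraction of |1 - z|. *)

Section ComplexPower.
Variable R : realType.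
Implicit Types (z w : R[i]) (a b x y : R).

Lemma complex_eqP z w :
  complex.Re z = complex.Re w -> complex.Im z = complex.Im w -> z = w.
Proof. by case: z => a b; case: w => c d /= -> ->. Qed.

Lemma ReM z w : complex.Re (z * w) =
  complex.Re z * complex.Re w - complex.Im z * complex.Im w.
Proof. by case: z => a b; case: w. Qed.

Lemma ImM z w : complex.Im (z * w) =
  complex.Re z * complex.Im w + complex.Im z * complex.Re w.
Proof. by case: z => a b; case: w. Qed.

Lemma ReD z w : complex.Re (z + w) = complex.Re z + complex.Re w.
Proof. by case: z => a b; case: w. Qed.

Lemma ImD z w : complex.Im (z + w) = complex.Im z + complex.Im w.
Proof. by case: z => a b; case: w. Qed.

Lemma ReR a : complex.Re a%:C = a. Proof. by []. Qed.

Lemma ReN z : complex.Re (- z) = - complex.Re z.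
Proof. by case: z => a b. Qed.

Lemma ImN z : complex.Im (- z) = - complex.Im z.
Proof. by case: z => a b. Qed.

Lemma Re_conj z : complex.Re (z^*)%C = complex.Re z.
Proof. by case: z. Qed.

Lemma Im_conj z : complex.Im (z^*)%C = - complex.Im z.
Proof. by case: z. Qed.

Lemma ReZ a z : complex.Re (a%:C * z) = a * complex.Re z.
Proof. by rewrite ReM /= mul0r subr0. Qed.

Lemma ImZ a z : complex.Im (a%:C * z) = a * complex.Im z.
Proof. by rewrite ImM /= mul0r addr0. Qed.

Lemma Re_sum (I : Type) (r : seq I) (P : pred I) (F : I -> R[i]) :
  complex.Re (\sum_(i <- r | P i) F i) = \sum_(i <- r | P i) complex.Re (F i).
Proof. by apply: (big_morph (@complex.Re R)) => // z w; exact: ReD. Qed.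

Lemma Im_sum (I : Type) (r : seq I) (P : pred I) (F : I -> R[i]) :
  complex.Im (\sum_(i <- r | P i) F i) = \sum_(i <- r | P i) complex.Im (F i).
Proof. by apply: (big_morph (@complex.Im R)) => // z w; exact: ImD. Qed.

Lemma normc_sqr z : normc z ^+ 2 = complex.Re z ^+ 2 + complex.Im z ^+ 2.
Proof. by case: z => a b /=; rewrite sqr_sqrtr // addr_ge0 ?sqr_ge0. Qed.

Lemma normc_ge0 z : 0 <= normc z.
Proof. by case: z => a b; rewrite sqrtr_ge0. Qed.

Lemma normc_real a : normc a%:C = `|a|.
Proof. by rewrite /= expr0n /= addr0 sqrtr_sqr. Qed.

Lemma normc_eq0 z : (normc z == 0) = (z == 0).
Proof. by apply/eqP/eqP => [/eq0_normc//|->]; exact: normc0. Qed.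

Lemma normc_gt0 z : (0 < normc z) = (z != 0).
Proof. by rewrite lt_def normc_ge0 andbT normc_eq0. Qed.

Lemma ler_normcD z w : normc (z + w) <= normc z + normc w.
Proof. exact: le_normcD. Qed.

Lemma normc_opp z : normc (- z) = normc z.
Proof. by case: z => a b /=; rewrite !sqrrN. Qed.

Lemma ler_normcB z w : normc (z - w) <= normc z + normc w.
Proof. by rewrite -(normc_opp w) ler_normcD. Qed.

Lemma ler_dist_normc z w : `|normc z - normc w| <= normc (z - w).
Proof.
rewrite ler_norml; apply/andP; split.
  rewrite lerNl opprB lerBlDr -[X in _ <= X + _]normc_opp opprB.
  by rewrite -{1}(subrK z w) ler_normcD.
by rewrite lerBlDr -{1}(subrK w z) ler_normcD.
Qed.

Lemma normcX z n : normc (z ^+ n) = normc z ^+ n.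
Proof.
by elim: n => [|n IH]; rewrite ?expr0 ?normc1 // !exprS normcM IH.
Qed.

Lemma normc_conj z : normc (z^*)%C = normc z.
Proof. by case: z => a b /=; rewrite sqrrN. Qed.

Lemma ler_Re_normc z : `|complex.Re z| <= normc z.
Proof.
rewrite -(@ler_pXn2r _ 2) ?nnegrE ?normc_ge0 // normc_sqr real_normK ?num_real //.
by rewrite lerDl sqr_ge0.
Qed.

Lemma ler_Im_normc z : `|complex.Im z| <= normc z.
Proof.
rewrite -(@ler_pXn2r _ 2) ?nnegrE ?normc_ge0 // normc_sqr real_normK ?num_real //.
by rewrite lerDr sqr_ge0.
Qed.

Lemma normc_le_ReIm z : normc z <= `|complex.Re z| + `|complex.Im z|.
Proof.
rewrite -(@ler_pXn2r _ 2) ?nnegrE ?normc_ge0 ?addr_ge0 // normc_sqr sqrrD.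
rewrite !real_normK ?num_real // lerD2r lerDl pmulrn_lge0 //.
Qed.

Lemma ler_normc_sum (I : Type) (r : seq I) (P : pred I) (F : I -> R[i]) :
  normc (\sum_(i <- r | P i) F i) <= \sum_(i <- r | P i) normc (F i).
Proof.
elim/big_ind2 : _ => // [|z x w y zx wy]; first by rewrite normc0.
exact: le_trans (ler_normcD _ _) (lerD zx wy).
Qed.

Lemma conj_mul_normc z : (z^*)%C * z = (normc z ^+ 2)%:C.
Proof.
apply: complex_eqP; first by rewrite ReM Re_conj Im_conj normc_sqr /= mulNr opprK !expr2.
by rewrite ImM Re_conj Im_conj /= mulNr mulrC subrr.
Qed.

Lemma Re_gt0_neq0 z : 0 < complex.Re z -> z != 0.
Proof. by move=> z0; apply/eqP => z1; rewrite z1 ltxx in z0. Qed.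

Lemma Re_gt0_normc z : 0 < complex.Re z -> 0 < normc z.
Proof. by rewrite normc_gt0; exact: Re_gt0_neq0. Qed.

Lemma cos_atan_ge x y : 0 < x ->
  cos (atan (y / x)) = x / Num.sqrt (x ^+ 2 + y ^+ 2).
Proof.
move=> x0; rewrite cos_atan.
have -> : 1 + (y / x) ^+ 2 = (x ^+ 2 + y ^+ 2) / x ^+ 2.
  by field; rewrite gt_eqF.
rewrite sqrtrM ?addr_ge0 ?sqr_ge0 // sqrtrV ?sqr_ge0 // sqrtr_sqr gtr0_norm //.
by rewrite invf_div.
Qed.

(** On the right half-plane, where all bases of powers lie, the two branches of [carg] merge into
    one smooth formula. *)
Lemma carg_atan z : 0 < complex.Re z -> carg z = atan (complex.Im z / complex.Re z).
Proof.
case: z => x y /= x0; rewrite /carg /= -cos_atan_ge //.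
have pi2 : pi / 2 <= pi :> R by have := pi_gt0 R; lra.
have xy := atan_ltpi2 (y / x); have xy' := atan_gtNpi2 (y / x).
case: leP => y0.
  rewrite cosK // in_itv /=; apply/andP; split; last first.
    by rewrite ltW // (lt_le_trans xy).
  by rewrite -(@atan0 R) le_atan // divr_ge0 // ltW.
rewrite cosKN ?opprK //; apply/andP; split.
  by rewrite ltW // (le_lt_trans _ xy') // lerN2.
by rewrite -(@atan0 R) le_atan // mulr_le0_ge0 ?invr_ge0 // ltW.
Qed.

Lemma cos_carg z : 0 < complex.Re z -> cos (carg z) = complex.Re z / normc z.
Proof. by move=> z0; rewrite carg_atan // cos_atan_ge //; case: z z0. Qed.

Lemma sin_carg z : 0 < complex.Re z -> sin (carg z) = complex.Im z / normc z.
Proof.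
move=> z0; rewrite carg_atan //.
set t := atan _.
have ct : cos t != 0.
  by rewrite gt_eqF // cos_gt0_pihalf // atan_gtNpi2 atan_ltpi2.
have -> : sin t = tan t * cos t by rewrite /tan mulfVK.
have -> : cos t = complex.Re z / normc z.
  by rewrite -cos_carg // carg_atan.
by rewrite /t atanK mulrA mulfVK // gt_eqF.
Qed.

Lemma carg_bound z : 0 < complex.Re z -> - (pi / 2) < carg z < pi / 2.
Proof. by move=> z0; rewrite carg_atan // atan_gtNpi2 atan_ltpi2. Qed.

Lemma normc_polar x : normc (cos x +i* sin x) = 1.
Proof. by rewrite /= cos2Dsin2 sqrtr1. Qed.

Lemma normc_cpow z a : normc (cpow z a) = normc z `^ a.
Proof. by rewrite /cpow normcM normc_polar mulr1 normc_real ger0_norm // powR_ge0. Qed.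

Lemma polarM x y : (cos x +i* sin x) * (cos y +i* sin y) = cos (x + y) +i* sin (x + y).
Proof.
by apply: complex_eqP; rewrite ?ReM ?ImM /= ?cosD ?sinD // addrC [cos x * _]mulrC mulrC.
Qed.

Lemma cpowD z a b : 0 < normc z -> cpow z (a + b) = cpow z a * cpow z b.
Proof.
move=> z0; rewrite /cpow mulrACA polarM -mulrDl -rmorphM -powRD //.
by apply/implyP => _; rewrite gt_eqF.
Qed.

Lemma cpow0 z : cpow z 0 = 1.
Proof. by rewrite /cpow powRr0 !mul0r cos0 sin0 mul1r. Qed.

Lemma cpow1 z : 0 < complex.Re z -> cpow z 1 = z.
Proof.
move=> z0; rewrite /cpow powRr1 ?normc_ge0 // mul1r cos_carg // sin_carg //.
have n0 : normc z != 0 by rewrite gt_eqF // Re_gt0_normc.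
by apply: complex_eqP; rewrite ?ReZ ?ImZ /= mulrCA divff // mulr1.
Qed.

Lemma cpow_real x a : 0 < x -> cpow x%:C a = (x `^ a)%:C.
Proof.
move=> x0; rewrite /cpow carg_atan //= mul0r atan0 mulr0 cos0 sin0.
by rewrite expr0n /= addr0 sqrtr_sqr gtr0_norm // mulr1.
Qed.

(** Concavity of cos between 0 and x. It trades the angle [a * carg z] of a power for [carg z],
    whose cosine is Re z / |z|. *)
Lemma cos_concave a x : 0 <= a <= 1 -> - (pi / 2) <= x <= pi / 2 ->
  1 - a + a * cos x <= cos (a * x).
Proof.
move=> /andP[a0 a1].
have p0 := pi_gt0 R.
wlog x0 : x / 0 <= x.
  move=> H /andP[x1 x2]; case: (leP 0 x) => x0; first by apply: H => //; rewrite x1.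
  rewrite -(cosN x) -(cosN (a * x)) -mulrN; apply: H; first by lra.
  by apply/andP; split; lra.
move=> /andP[_ x2].
(* The derivative a (sin t - sin (a t)) of [h] is nonnegative since a t <= t, and h(0) = 1 - a. *)
pose h t : R := cos (a * t) - a * cos t.
pose dh t : R := - (a * sin (a * t)) + a * sin t.
have hd (t : R) : is_derive t 1 h (dh t).
  rewrite /h /dh.
  apply: is_derive_eq.
  by rewrite /GRing.scale /=; ring.
have := @ger0_derive1_ndecr _ h 0 x.
have hd1 (t : R) : derive1 h t = dh t by rewrite derive1E; exact: derive_val.
have /[swap]/[apply] : (forall t, t \in `]0, x[%R -> derivable h t 1) by [].
have /[swap]/[apply] : (forall t, t \in `]0, x[%R -> 0 <= derive1 h t).
  move=> t; rewrite in_itv /= => /andP[t0 tx]; rewrite hd1 /dh addrC subr_ge0.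
  apply: ler_wpM2l => //.
  have at1 : a * t <= t by rewrite ger_pMl.
  have at0 : 0 <= a * t by rewrite mulr_ge0 // ltW.
  move: at1; rewrite le_eqVlt => /predU1P[->//|at1].
  by apply: ltW; rewrite ltr_sin // in_itv /=; apply/andP; split; lra.
have /[swap]/[apply] : {within `[0, x], continuous h}.
  by apply: derivable_within_continuous => t _; exact: ex_derive.
move=> /(_ 0 x); rewrite lexx !x0 lexx => /(_ isT isT isT).
rewrite /h !mulr0 cos0; lra.
Qed.

(** Common source of two lower bounds: the first summand alone controls the modulus, and both
    together give, by Bernoulli, a bound with constant 1. *)
Lemma Re_cpow_ge z a : 0 < complex.Re z -> 0 <= a <= 1 ->
  (1 - a) * normc z `^ a + a * (normc z `^ a / normc z * complex.Re z)
    <= complex.Re (cpow z a).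
Proof.
move=> z0 a01; rewrite /cpow ReZ /=.
have nz := Re_gt0_normc z0.
have /andP[c1 c2] := carg_bound z0.
have H := cos_concave a01 (introT andP (conj (ltW c1) (ltW c2))).
apply: le_trans (ler_wpM2l (powR_ge0 _ _) H).
by rewrite cos_carg // le_eqVlt; apply/orP; left; apply/eqP; ring.
Qed.

Lemma powR_young x y a : 0 < x -> 0 < y -> 0 < a < 1 ->
  x `^ a * y `^ (1 - a) <= a * x + (1 - a) * y.
Proof.
move=> x0 y0 /andP[a0 a1].
have b0 : 0 < 1 - a by rewrite subr_gt0.
have := @conjugate_powR R (x `^ a) (y `^ (1 - a)) a^-1 (1 - a)^-1.
rewrite !powR_ge0 !invr_gt0 a0 b0 !invrK.
have -> : a + (1 - a) = 1 by ring.
move=> /(_ isT isT isT isT erefl).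
rewrite -!powRrM !mulfV ?gt_eqF // !powRr1 ?(ltW x0) ?(ltW y0) //.
by rewrite [x * _]mulrC [y * _]mulrC.
Qed.

Lemma powR_bernoulli x a : 0 < x -> 0 < a < 1 -> x `^ a <= a * x + (1 - a).
Proof. by move=> x0 a01; have := @powR_young x 1 a x0 ltr01 a01; rewrite powR1 !mulr1. Qed.

(** With t = Re z / |z| this is |z|^a (a t + 1 - a) >= |z|^a t^a. Equality for real z matters: a
    constant below 1 would not survive the later subtraction of lambda^alpha. *)
Lemma Re_cpow_ge_Re z a : 0 < complex.Re z -> 0 < a < 1 ->
  complex.Re z `^ a <= complex.Re (cpow z a).
Proof.
move=> z0 a01; have /andP[a0 a1] := a01.
have nz := Re_gt0_normc z0.
apply: le_trans (Re_cpow_ge z0 _); last by rewrite (ltW a0) (ltW a1).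
have -> : (1 - a) * normc z `^ a + a * (normc z `^ a / normc z * complex.Re z)
  = normc z `^ a * (a * (complex.Re z / normc z) + (1 - a)) by ring.
apply: le_trans (ler_wpM2l (powR_ge0 _ _) (powR_bernoulli _ a01)).
  by rewrite -powRM ?normc_ge0 ?divr_ge0 ?(ltW z0) ?(ltW nz) // mulrCA divff ?gt_eqF // mulr1.
by rewrite divr_gt0.
Qed.

Lemma Re_cpow_ge_norm z a : 0 < complex.Re z -> 0 < a < 1 ->
  (1 - a) * normc z `^ a <= complex.Re (cpow z a).
Proof.
move=> z0 /andP[a0 a1]; apply: le_trans (Re_cpow_ge z0 _); last by rewrite (ltW a0) (ltW a1).
by rewrite lerDl mulr_ge0 ?(ltW a0) // mulr_ge0 ?(ltW z0) // divr_ge0 ?powR_ge0 ?normc_ge0.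
Qed.

End ComplexPower.

(** * Power series on the unit disc *)

Section PowerSeries.
Variable R : realType.
Implicit Types (p q : nat -> R[i]) (z w P Q : R[i]) (rho : R).

Definition psum p z (m : nat) : R[i] := \sum_(k < m) p k * z ^+ k.

Definition pscvg p z P : Prop :=
  (fun m : nat => normc (psum p z m - P)) @ \oo --> (0 : R).

(** Radius of convergence at least 1, in a form that is stable under the algebra of coefficient
    sequences without any limit. *)
Definition pscoef_bounded p : Prop :=
  forall rho, 0 <= rho < 1 -> exists B : R, forall k, normc (p k) * rho ^+ k <= B.

Definition abs_psum p rho (m : nat) : R := \sum_(k < m) normc (p k) * rho ^+ k.

(** Componentwise limits, so that completeness of [R] suffices; the value is meaningful once
    convergence is known. *)
Definition pseval p z : R[i] :=
  limn (fun m => complex.Re (psum p z m)) +i* limn (fun m => complex.Im (psum p z m)).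

Definition cauchy_prod p q (n : nat) : R[i] := \sum_(k < n.+1) p k * q (n - k)%N.

(** The Euler operator z d/dz on coefficients: a derivation that keeps the degree, so that decay in
    n becomes smoothness near z = 1. *)
Definition theta p (n : nat) : R[i] := n%:R * p n.

Lemma cvg0_normP (u : nat -> R) :
  (forall e, 0 < e -> exists N, forall m, (N <= m)%N -> `|u m| <= e) ->
  u @ \oo --> (0 : R).
Proof.
move=> H; apply/cvgrPdist_le => e e0; have [N HN] := H e e0.
by exists N => // m /= /HN; rewrite sub0r normrN.
Qed.

Lemma cvg0_leP (u : nat -> R) e : u @ \oo --> (0 : R) -> 0 < e ->
  exists N, forall m, (N <= m)%N -> `|u m| <= e.
Proof.
move=> /cvgrPdist_le H e0; have [N _ HN] := H e e0.
by exists N => m /HN; rewrite sub0r normrN.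
Qed.

Lemma le_cvg0 (u v : nat -> R) : (forall n, 0 <= u n <= v n) ->
  v @ \oo --> (0 : R) -> u @ \oo --> (0 : R).
Proof.
move=> uv; apply: squeeze_cvgr; last exact: cvg_cst.
exact: nearW.
Qed.

Lemma cvg0_le (u : nat -> R) (a : R) : u @ \oo --> (0 : R) ->
  (forall n, a <= u n) -> a <= 0.
Proof. by move=> u0 au; apply: (ler_cvg_to (cvg_cst a) u0); exact: nearW. Qed.

Lemma pscvg_unique p z P Q : pscvg p z P -> pscvg p z Q -> P = Q.
Proof.
move=> hP hQ; apply/eqP; rewrite -subr_eq0 -normc_eq0 eq_le normc_ge0 andbT.
have : (fun m => normc (psum p z m - P) + normc (psum p z m - Q)) @ \oo --> (0 + 0 : R).
  exact: cvgD.
rewrite addr0 => /cvg0_le; apply => n.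
have -> : P - Q = (psum p z n - Q) - (psum p z n - P) by ring.
by rewrite [X in _ <= X]addrC; apply: ler_normcB.
Qed.

Lemma pscvg_ext p q z P : p =1 q -> pscvg p z P -> pscvg q z P.
Proof. by move=> /funext ->. Qed.

Lemma pscvgD p q z P Q : pscvg p z P -> pscvg q z Q ->
  pscvg (fun k => p k + q k) z (P + Q).
Proof.
move=> hP hQ.
have : (fun m => normc (psum p z m - P) + normc (psum q z m - Q)) @ \oo --> (0 + 0 : R).
  exact: cvgD.
rewrite addr0; apply: le_cvg0 => n; rewrite normc_ge0 /=.
apply: le_trans (ler_normcD _ _); rewrite le_eqVlt; apply/orP; left; apply/eqP.
congr normc; rewrite /psum.
under eq_bigr do rewrite mulrDl.
by rewrite big_split /=; ring.
Qed.

Lemma pscvgZ a p z P : pscvg p z P -> pscvg (fun k => a * p k) z (a * P).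
Proof.
move=> hP.
have : (fun m => normc a * normc (psum p z m - P)) @ \oo --> (normc a * 0 : R).
  by apply: cvgM => //; exact: cvg_cst.
rewrite mulr0; apply: le_cvg0 => n; rewrite normc_ge0 /= -normcM /psum.
under eq_bigr do rewrite -mulrA.
by rewrite -mulr_sumr mulrBr.
Qed.

Lemma pscvgB p q z P Q : pscvg p z P -> pscvg q z Q ->
  pscvg (fun k => p k - q k) z (P - Q).
Proof.
move=> hP /(pscvgZ (-1)) hQ; rewrite -(mulN1r Q).
by apply: pscvg_ext (pscvgD hP hQ) => k; rewrite mulN1r.
Qed.

Lemma pscvg_sum (I : Type) (r : seq I) (F : I -> nat -> R[i]) z (S : I -> R[i]) :
  (forall i, pscvg (F i) z (S i)) ->
  pscvg (fun k => \sum_(i <- r) F i k) z (\sum_(i <- r) S i).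
Proof.
move=> H; elim: r => [|i r IH].
  rewrite big_nil; apply: (@pscvg_ext (fun _ => 0)) => [k|]; first by rewrite big_nil.
  rewrite /pscvg; apply: cvg0_normP => e e0; exists 0%N => m _.
  rewrite /psum big1 ?subr0 ?normc0 ?normr0 ?ltW // => k _; exact: mul0r.
rewrite big_cons; apply: pscvg_ext (pscvgD (H i) IH) => k; by rewrite big_cons.
Qed.

Lemma pscvg_fin p z n : (forall k, (n <= k)%N -> p k = 0) -> pscvg p z (psum p z n).
Proof.
move=> H; apply: cvg0_normP => e e0; exists n => m nm.
rewrite /psum -(subnKC nm) big_split_ord /= addrAC subrr add0r big1 ?normc0 ?normr0 ?ltW //.
by move=> k _; rewrite H ?mul0r // leq_addr.
Qed.

Lemma pscvg_delta0 z : pscvg (fun k => (k == 0%N)%:R) z 1.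
Proof.
have := @pscvg_fin (fun k => (k == 0%N)%:R) z 1.
rewrite /psum big_ord_recl big_ord0 /= expr0 mulr1 addr0; apply.
by case.
Qed.

Lemma abs_psum_ndecr p rho : 0 <= rho -> nondecreasing_seq (abs_psum p rho).
Proof.
move=> r0; apply/nondecreasing_seqP => n.
by rewrite /abs_psum big_ord_recr /= lerDl mulr_ge0 ?normc_ge0 ?exprn_ge0.
Qed.

Lemma geometric_sum_le (x : R) n : 0 <= x < 1 -> \sum_(k < n) x ^+ k <= (1 - x)^-1.
Proof.
move=> /andP[x0 x1]; have x10 : 0 < 1 - x by rewrite subr_gt0.
rewrite -(@ler_pM2l _ (1 - x)) // mulfV ?gt_eqF //.
have -> : (1 - x) * (\sum_(k < n) x ^+ k) = 1 - x ^+ n.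
  elim: n => [|n IH]; first by rewrite big_ord0 mulr0 expr0 subrr.
  by rewrite big_ord_recr /= mulrDr IH exprS; ring.
by rewrite gerBl exprn_ge0.
Qed.

Lemma natX_le (x : R) n : 0 <= x < 1 -> n%:R * x ^+ n <= (1 - x)^-1.
Proof.
move=> x01; apply: le_trans (geometric_sum_le n x01).
have /andP[x0 x1] := x01.
rewrite mulr_natl -[X in _ *+ X]card_ord -sumr_const; apply: ler_sum => k _.
by apply: ler_wiXn2l; rewrite ?(ltW x1) // ltnW.
Qed.

(** An intermediate radius r gives a geometric factor (rho / r)^k to spare, which pays for a
    summation or for a factor k. *)
Lemma mid_radius rho : 0 <= rho < 1 -> exists r, [/\ rho < r, 0 < r, r < 1 & 0 <= rho / r < 1].
Proof.
move=> /andP[r0 r1]; exists ((1 + rho) / 2).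
have h : 0 < (1 + rho) / 2 by lra.
by split; rewrite ?ltr_pdivrMr ?mul1r ?divr_ge0 ?(ltW h) //=; lra.
Qed.

Lemma abs_psum_bounded p rho : pscoef_bounded p -> 0 <= rho < 1 ->
  exists B, forall m, abs_psum p rho m <= B.
Proof.
move=> hp h; have [r [rr r0 r1 hx]] := mid_radius h.
have [B hB] := hp r (introT andP (conj (ltW r0) r1)).
have /andP[rho0 rho1] := h.
exists (B * (1 - rho / r)^-1) => m.
have B0 : 0 <= B by apply: le_trans (hB 0%N); rewrite mulr_ge0 ?normc_ge0 ?exprn_ge0 ?ltW.
apply: le_trans (ler_wpM2l B0 (geometric_sum_le m hx)).
rewrite mulr_sumr; apply: ler_sum => k _.
have -> : rho ^+ k = r ^+ k * (rho / r) ^+ k.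
  by rewrite -exprMn mulrCA divff ?mulr1 // gt_eqF.
rewrite mulrA; apply: ler_wpM2r => //.
by apply: exprn_ge0; case/andP: hx.
Qed.

Lemma abs_psum_tail p rho : pscoef_bounded p -> 0 <= rho < 1 ->
  exists t : nat -> R, t @ \oo --> (0 : R) /\
    forall m n, (m <= n)%N -> abs_psum p rho n - abs_psum p rho m <= t m.
Proof.
move=> hp h; have [B hB] := abs_psum_bounded hp h; have /andP[rho0 rho1] := h.
have nd := abs_psum_ndecr p rho0.
have cv : cvgn (abs_psum p rho).
  by apply: nondecreasing_is_cvgn => //; exists B => _ [m _ <-].
exists (fun m => limn (abs_psum p rho) - abs_psum p rho m); split.
  rewrite -(subrr (limn (abs_psum p rho))); apply: cvgB; [exact: cvg_cst|exact: cv].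
by move=> m n mn; rewrite lerD2r; exact: nondecreasing_cvgn_le.
Qed.

Lemma psum_dist p z m n : (m <= n)%N ->
  normc (psum p z n - psum p z m) <= abs_psum p (normc z) n - abs_psum p (normc z) m.
Proof.
move=> mn; rewrite /psum /abs_psum -(subnKC mn) !big_split_ord /=.
rewrite [_ + _ - _]addrAC subrr add0r [X in _ <= X]addrAC subrr add0r.
apply: le_trans (ler_normc_sum _ _ _) _.
by apply: ler_sum => k _; rewrite normcM normcX.
Qed.

Lemma Re_abs_le z e : normc z <= e -> `|complex.Re z| <= e.
Proof. exact: le_trans (ler_Re_normc _). Qed.

Lemma Im_abs_le z e : normc z <= e -> `|complex.Im z| <= e.
Proof. exact: le_trans (ler_Im_normc _). Qed.

Lemma pseval_cvg p z : pscoef_bounded p -> normc z < 1 -> pscvg p z (pseval p z).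
Proof.
move=> hp z1; have z01 : 0 <= normc z < 1 by rewrite normc_ge0.
have [t [t0 ht]] := abs_psum_tail hp z01.
have cauchy (g : R[i] -> R) : {morph g : x y / x - y} ->
    (forall w, `|g w| <= normc w) -> cvgn (fun m => g (psum p z m)).
  move=> gB g1; apply/cauchy_cvgP/cauchy_exP => e e0.
  have e20 : 0 < e / 2 by rewrite divr_gt0.
  have [N HN] := cvg0_leP t0 e20.
  exists (g (psum p z N)), N => // n /= Nn.
  rewrite /ball /= distrC -gB; apply: le_lt_trans (g1 _) _.
  apply: le_lt_trans (psum_dist _ _ Nn) _; apply: le_lt_trans (ht _ _ Nn) _.
  apply: le_lt_trans (ler_norm _) _; apply: le_lt_trans (HN _ (leqnn N)) _; lra.
have cR : cvgn (fun m => complex.Re (psum p z m)).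
  by apply: cauchy; [move=> x y; rewrite ReD ReN|exact: ler_Re_normc].
have cI : cvgn (fun m => complex.Im (psum p z m)).
  by apply: cauchy; [move=> x y; rewrite ImD ImN|exact: ler_Im_normc].
rewrite /pscvg /pseval.
set a := limn _; set b := limn _.
have : (fun m => `|complex.Re (psum p z m) - a| + `|complex.Im (psum p z m) - b|) @ \oo --> (0 + 0 : R).
  apply: cvgD; rewrite -(@normr0 _ R); apply: cvg_norm; rewrite -[X in _ --> X](@subrr _ a) // ?(@subrr _ b) ;
  [apply: cvgB; [exact: cR|exact: cvg_cst]|].
  by rewrite subrr -(subrr b); apply: cvgB; [exact: cI|exact: cvg_cst].
rewrite addr0; apply: le_cvg0 => n; rewrite normc_ge0 /=.
by apply: le_trans (normc_le_ReIm _) _; rewrite ReD ImD ReN ImN.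
Qed.

Lemma pscvg_pseval p z P : pscoef_bounded p -> normc z < 1 -> pscvg p z P -> pseval p z = P.
Proof. by move=> hp z1 hP; apply: pscvg_unique hP; exact: pseval_cvg. Qed.

(** The tail depends on z only through its modulus, so truncation is uniform on a circle and finite
    Fourier sums may be applied to polynomials. *)
Lemma psum_tail p rho : pscoef_bounded p -> 0 <= rho < 1 ->
  exists t : nat -> R, t @ \oo --> (0 : R) /\
    forall z, normc z = rho -> forall m, normc (psum p z m - pseval p z) <= t m.
Proof.
move=> hp h; have [t [t0 ht]] := abs_psum_tail hp h.
exists t; split => // z zr m.
have zc : pscvg p z (pseval p z) by apply: pseval_cvg; rewrite // zr; case/andP: h.
rewrite -subr_le0.
apply: (cvg0_le (u := fun n => normc (psum p z (m + n) - pseval p z))).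
  by have := zc; rewrite /pscvg -(cvg_shiftn m); under eq_fun do rewrite addnC.
move=> n; rewrite lerBlDr.
have -> : psum p z m - pseval p z = (psum p z (m + n) - pseval p z) - (psum p z (m + n) - psum p z m) by ring.
apply: le_trans (ler_normcB _ _) _; rewrite lerD2l.
have mn : (m <= m + n)%N by rewrite leq_addr.
by apply: le_trans (psum_dist _ _ mn) _; rewrite zr; exact: ht.
Qed.

Lemma pscoef_boundedD p q : pscoef_bounded p -> pscoef_bounded q ->
  pscoef_bounded (fun k => p k + q k).
Proof.
move=> hp hq rho h; have [B hB] := hp rho h; have [B' hB'] := hq rho h.
have /andP[h0 _] := h.
exists (B + B') => k; apply: le_trans (lerD (hB k) (hB' k)).
by rewrite -mulrDl; apply: ler_wpM2r; rewrite ?exprn_ge0 // ler_normcD.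
Qed.

Lemma pscoef_boundedZ a p : pscoef_bounded p -> pscoef_bounded (fun k => a * p k).
Proof.
move=> hp rho h; have [B hB] := hp rho h.
by exists (normc a * B) => k; rewrite normcM -mulrA; apply: ler_wpM2l; rewrite ?normc_ge0.
Qed.

Lemma pscoef_boundedB p q : pscoef_bounded p -> pscoef_bounded q ->
  pscoef_bounded (fun k => p k - q k).
Proof.
move=> hp /(pscoef_boundedZ (-1)) hq.
have -> : (fun k => p k - q k) = (fun k => p k + -1 * q k).
  by apply/funext => k; rewrite mulN1r.
exact: pscoef_boundedD.
Qed.

Lemma pscoef_bounded_sum (I : Type) (r : seq I) (F : I -> nat -> R[i]) :
  (forall i, pscoef_bounded (F i)) -> pscoef_bounded (fun k => \sum_(i <- r) F i k).
Proof.
move=> H; elim: r => [|i r IH].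
  by move=> rho _; exists 0 => k; rewrite big_nil normc0 mul0r.
have -> : (fun k => \sum_(j <- i :: r) F j k) = (fun k => F i k + \sum_(j <- r) F j k).
  by apply/funext => k; rewrite big_cons.
exact: pscoef_boundedD.
Qed.

Lemma pscoef_bounded_fin p n : (forall k, (n <= k)%N -> p k = 0) -> pscoef_bounded p.
Proof.
move=> H rho /andP[h _]; exists (\sum_(k < n) normc (p k) * rho ^+ k) => k.
case: (ltnP k n) => kn; last first.
  rewrite H // normc0 mul0r; apply: sumr_ge0 => i _.
  by rewrite mulr_ge0 ?normc_ge0 ?exprn_ge0.
rewrite (bigD1 (Ordinal kn)) //= lerDl; apply: sumr_ge0 => i _.
by rewrite mulr_ge0 ?normc_ge0 ?exprn_ge0.
Qed.

Lemma pscoef_bounded_theta p : pscoef_bounded p -> pscoef_bounded (theta p).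
Proof.
move=> hp rho h; have [r [rr r0 r1 hx]] := mid_radius h.
have [B hB] := hp r (introT andP (conj (ltW r0) r1)).
exists (B * (1 - rho / r)^-1) => k.
have -> : rho ^+ k = r ^+ k * (rho / r) ^+ k.
  by rewrite -exprMn mulrCA divff ?mulr1 // gt_eqF.
rewrite /theta normcM -[k%:R](rmorph_nat (real_complex R)) normc_real ger0_norm //.
have -> : k%:R * normc (p k) * (r ^+ k * (rho / r) ^+ k) =
  (normc (p k) * r ^+ k) * (k%:R * (rho / r) ^+ k) by ring.
apply: ler_pM; rewrite ?(natX_le _ hx) ?mulr_ge0 ?normc_ge0 ?exprn_ge0 ?(ltW r0) //; by case/andP: hx.
Qed.

Lemma pscoef_bounded_cauchy p q : pscoef_bounded p -> pscoef_bounded q ->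
  pscoef_bounded (cauchy_prod p q).
Proof.
move=> hp hq rho h; have /andP[h0 _] := h.
have [S hS] := abs_psum_bounded hp h; have [B hB] := hq rho h.
exists (S * B) => k.
have B0 : 0 <= B by apply: le_trans (hB 0%N); rewrite mulr_ge0 ?normc_ge0 ?exprn_ge0.
apply: le_trans (ler_wpM2r B0 (hS k.+1)).
rewrite /abs_psum mulr_suml.
apply: le_trans (ler_wpM2r (exprn_ge0 _ h0) (ler_normc_sum _ _ _)) _.
rewrite mulr_suml; apply: ler_sum => i _.
have ik : (i <= k)%N by rewrite -ltnS.
have -> : rho ^+ k = rho ^+ i * rho ^+ (k - i) by rewrite -exprD subnKC.
rewrite normcM mulrACA.
by apply: ler_wpM2l; rewrite ?mulr_ge0 ?normc_ge0 ?exprn_ge0.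
Qed.

(* The pairs with i + j < n contain the square i, j < n./2 and are contained
   in the square i, j < n, so both partial sums have the same limit. *)
Lemma cauchy_partial_dist (a b : nat -> R[i]) n :
  normc (\sum_(k < n) cauchy_prod a b k - (\sum_(i < n) a i) * (\sum_(j < n) b j))
  <= (\sum_(i < n) normc (a i)) * (\sum_(j < n) normc (b j))
     - (\sum_(i < n./2) normc (a i)) * (\sum_(j < n./2) normc (b j)).
Proof.
have E (V : pzRingType) (F : nat -> nat -> V) :
    \sum_(k < n) \sum_(i < k.+1) F i (k - i)%N
    = \sum_(i < n) \sum_(j < n | (i + j < n)%N) F i j.
  have -> : \sum_(k < n) \sum_(i < k.+1) F i (k - i)%N
    = \sum_(k < n) \sum_(i < n | (i <= k)%N) F i (k - i)%N.
    apply: eq_bigr => k _.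
    rewrite (big_ord_widen_cond n xpredT (fun i => F i (k - i)%N)) ?ltn_ord //.
  rewrite (exchange_big_dep xpredT) //=; apply: eq_bigr => i _.
  rewrite -(big_mkord (fun k => i <= k)%N (fun k => F i (k - i)%N)).
  rewrite -(big_mkord (fun j => i + j < n)%N (fun j => F i j)).
  rewrite (big_cat_nat (n := i)) //=; last by rewrite ltnW.
  rewrite big_nat_cond big1 ?add0r; last first.
    by move=> k /andP[/andP[_ ki] ik]; move: ki; rewrite ltnNge ik.
  rewrite [RHS](big_cat_nat (n := (n - i)%N)) ?leq_subr //=.
  rewrite [X in _ = _ + X]big_nat_cond [X in _ = _ + X]big1 ?addr0; last first.
    move=> j /andP[/andP[h _] h2]; exfalso.
    by move: h; rewrite leq_subLR leqNgt h2.
  rewrite -{1}(add0n i) big_addn [LHS]big_nat_cond [RHS]big_nat_cond.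
  apply: eq_big => [j|j _]; last by rewrite addnK.
  rewrite leq_addl andbT; case: (ltnP j (n - i)) => //=.
  by rewrite ltn_subRL => ->.
rewrite /cauchy_prod (E _ (fun i j => a i * b j)) !big_distrlr /=.
have -> : \sum_(i < n) \sum_(j < n) a i * b j =
  \sum_(i < n) \sum_(j < n | (i + j < n)%N) a i * b j +
  \sum_(i < n) \sum_(j < n | ~~ (i + j < n)%N) a i * b j.
  rewrite -big_split; apply: eq_bigr => i _ /=.
  by rewrite (bigID (fun j : 'I_n => (i + j < n)%N)).
rewrite opprD addrA subrr add0r normc_opp.
apply: le_trans (ler_normc_sum _ _ _) _.
rewrite lerBrDr.
have n2 : (n./2 <= n)%N by rewrite half_leq_self || (rewrite -{2}(odd_double_half n) -addnn addnA leq_addl).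
have -> : \sum_(i < n./2) \sum_(j < n./2) normc (a i) * normc (b j) =
  \sum_(i < n | (i < n./2)%N) \sum_(j < n | (j < n./2)%N) normc (a i) * normc (b j).
  rewrite (big_ord_widen_cond n xpredT (fun i => \sum_(j < n./2) normc (a i) * normc (b j))) //=.
  by apply: eq_bigr => i _; rewrite (big_ord_widen_cond n xpredT (fun j => normc (a i) * normc (b j))).
rewrite [X in _ + X]big_mkcond -big_split /=; apply: ler_sum => i _.
apply: le_trans (lerD (ler_normc_sum _ _ _) (lexx _)) _.
under [X in X + _ <= _]eq_bigr do rewrite normcM.
rewrite [X in _ <= X](bigID (fun j : 'I_n => ~~ (i + j < n)%N)) /= lerD2l.
case: ifP => i2; last by apply: sumr_ge0 => j _; rewrite mulr_ge0 ?normc_ge0.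
rewrite [X in X <= _]big_mkcond [X in _ <= X]big_mkcond /=; apply: ler_sum => j _.
case: ifP => j2; last by case: ifP => // _; rewrite mulr_ge0 ?normc_ge0.
have -> : (i + j < n)%N; last by [].
have := leq_add i2 (ltnW j2); rewrite addSn addnn => h.
by apply: leq_trans h _; rewrite -{2}(odd_double_half n) leq_addl.
Qed.

Lemma psum_cauchy p q z m :
  psum (cauchy_prod p q) z m =
  \sum_(k < m) cauchy_prod (fun i => p i * z ^+ i) (fun i => q i * z ^+ i) k.
Proof.
apply: eq_bigr => k _; rewrite /cauchy_prod mulr_suml; apply: eq_bigr => i _.
have ik : (i <= k)%N by rewrite -ltnS.
by rewrite mulrACA -exprD subnKC.
Qed.

Lemma pscvg_cauchy p q z P Q : pscoef_bounded p -> pscoef_bounded q -> normc z < 1 ->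
  pscvg p z P -> pscvg q z Q -> pscvg (cauchy_prod p q) z (P * Q).
Proof.
move=> hp hq z1 hP hQ; have z01 : 0 <= normc z < 1 by rewrite normc_ge0.
have cv (f : nat -> R[i]) : pscoef_bounded f -> cvgn (abs_psum f (normc z)).
  move=> hf; have [B hB] := abs_psum_bounded hf z01.
  apply: nondecreasing_is_cvgn; first by apply: abs_psum_ndecr; rewrite normc_ge0.
  by exists B => _ [m _ <-].
set a := abs_psum p (normc z); set b := abs_psum q (normc z).
have ca : a @ \oo --> limn a by exact: cv.
have cb : b @ \oo --> limn b by exact: cv.
(* The square of side n./2 is compared with that of side n; both products of partial sums have the
   same limit. *)
have half_cvg : (fun n => n./2) @ \oo --> \oo.
  move=> A [N _ NA]; exists N.*2 => // n /= Nn; apply: NA => /=.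
  by rewrite -(doubleK N) half_leq.
have d0 : (fun n => a n * b n - a n./2 * b n./2) @ \oo --> (0 : R).
  rewrite -(subrr (limn a * limn b)); apply: cvgB; first exact: cvgM.
  by apply: cvgM; [exact: (cvg_comp _ _ half_cvg ca)|exact: (cvg_comp _ _ half_cvg cb)].
have pb : exists B, forall m, normc (psum p z m) <= B.
  have [B hB] := abs_psum_bounded hp z01; exists B => m; apply: le_trans (hB m).
  by apply: le_trans (ler_normc_sum _ _ _) _; apply: ler_sum => k _; rewrite normcM normcX.
have [B hB] := pb.
have B0 : 0 <= B by apply: le_trans (normc_ge0 _) (hB 0%N).
have : (fun n => (a n * b n - a n./2 * b n./2) +
   (B * normc (psum q z n - Q) + normc Q * normc (psum p z n - P))) @ \oo --> (0 + (B * 0 + normc Q * 0) : R).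
  by apply: cvgD => //; apply: cvgD; apply: cvgM => //; exact: cvg_cst.
rewrite !mulr0 !addr0; apply: le_cvg0 => n; rewrite normc_ge0 /=.
have -> : psum (cauchy_prod p q) z n - P * Q =
  (psum (cauchy_prod p q) z n - psum p z n * psum q z n) +
  (psum p z n * (psum q z n - Q) + Q * (psum p z n - P)) by ring.
apply: le_trans (ler_normcD _ _) (lerD _ _).
  rewrite psum_cauchy; apply: le_trans (cauchy_partial_dist _ _ _) _.
  rewrite /a /b /abs_psum le_eqVlt; apply/orP; left; apply/eqP.
  by congr (_ * _ - _ * _); apply: eq_bigr => k _; rewrite normcM normcX.
apply: le_trans (ler_normcD _ _) (lerD _ _); rewrite normcM //.
by apply: ler_wpM2r; rewrite ?normc_ge0.
Qed.

(** Leibniz rule, from n = i + (n - i). *)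
Lemma theta_cauchy p q n :
  theta (cauchy_prod p q) n = cauchy_prod (theta p) q n + cauchy_prod p (theta q) n.
Proof.
rewrite /theta /cauchy_prod mulr_sumr -big_split /=; apply: eq_bigr => i _.
have ik : (i <= n)%N by rewrite -ltnS.
by rewrite -{1}(subnKC ik) natrD; ring.
Qed.

End PowerSeries.

(** * Parseval's identity and coefficient bounds *)

Section DiscreteFourier.
Variable R : realType.
Implicit Types (p q : {poly R[i]}) (z : R[i]) (rho : R).

Definition cis (x : R) : R[i] := cos x +i* sin x.

Lemma cisX x n : cis x ^+ n = cis (n%:R * x).
Proof.
elim: n => [|n IH]; first by rewrite expr0 mul0r /cis cos0 sin0.
by rewrite exprS IH /cis polarM -natr1 mulrDl mul1r addrC.
Qed.

Lemma cis_conj x : ((cis x)^*)%C = cis (- x).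
Proof. by rewrite /cis /= cosN sinN. Qed.

Lemma cos_lt1 (x : R) : 0 < x < pi *+ 2 -> cos x < 1.
Proof.
move=> /andP[x0 x2].
have -> : x = (x / 2) *+ 2 by rewrite -mulr_natr; field.
rewrite cos_mulr2n.
have s0 : 0 < sin (x / 2) by apply: sin_gt0_pi; move: x2; rewrite -mulr_natr; lra.
have := cos2Dsin2 (x / 2); have : 0 < sin (x / 2) ^+ 2 by rewrite exprn_gt0.
by rewrite -mulr_natr; lra.
Qed.

Definition unity_root (M k : nat) : R[i] := cis (k%:R * (pi *+ 2 / M%:R)).

Lemma normc_unity_root M k : normc (unity_root M k) = 1.
Proof. exact: normc_polar. Qed.

Lemma unity_rootX M k : (0 < M)%N -> unity_root M k ^+ M = 1.
Proof.
move=> M0; rewrite cisX.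
have -> : M%:R * (k%:R * (pi *+ 2 / M%:R)) = k%:R * (pi *+ 2) :> R.
  by rewrite mulrCA [M%:R * _]mulrC mulfVK // pnatr_eq0 -lt0n.
by rewrite -cisX /cis cos2pi sin2pi expr1n.
Qed.

Lemma unity_root_orthogonal M i j : (i < M)%N -> (j < M)%N ->
  \sum_(k < M) ((unity_root M k ^+ i)^*)%C * unity_root M k ^+ j = (M%:R * (i == j)%:R).
Proof.
move=> iM jM; have M0 : (0 < M)%N by apply: leq_ltn_trans iM.
have Mr : M%:R != 0 :> R by rewrite pnatr_eq0 -lt0n.
pose y : R := pi *+ 2 / M%:R.
have E k : ((unity_root M k ^+ i)^*)%C * unity_root M k ^+ j =
    cis ((j%:R - i%:R) * y) ^+ k.
  rewrite !cisX cis_conj /cis polarM -/y; congr (cos _ +i* sin _); ring.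
under eq_bigr do rewrite E.
set q := cis _.
case: eqVneq => ij.
  have -> : q = 1 by rewrite /q ij subrr mul0r /cis cos0 sin0.
  by rewrite (eq_bigr (fun=> 1)) => [|k _]; rewrite ?expr1n // sumr_const card_ord mulr1.
rewrite mulr0.
(* The angle of [q] is, up to sign, strictly between 0 and 2 pi, hence its real part is below 1; the
   sum is then a vanishing geometric sum. *)
have q1 : q != 1.
  have c1 (n : nat) : (0 < n)%N -> (n < M)%N -> cos (n%:R * y) < 1.
    move=> n0 nM; apply: cos_lt1; apply/andP; split.
      by rewrite mulr_gt0 ?ltr0n // divr_gt0 ?ltr0n // pmulrn_rgt0 // pi_gt0.
    rewrite /y mulrCA gtr_pMr; last by rewrite pmulrn_rgt0 // pi_gt0.
    by rewrite ltr_pdivrMr ?ltr0n // mul1r ltr_nat.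
  suff : complex.Re q < 1 by apply: contraTneq => ->; rewrite ltxx.
  rewrite /q /=; case: (ltngtP i j) ij => // ij _.
    by rewrite -natrB ?(ltnW ij) // c1 ?subn_gt0 // (leq_ltn_trans (leq_subr _ _)).
  rewrite -cosN -mulNr opprB -natrB ?(ltnW ij) // c1 ?subn_gt0 //.
  by rewrite (leq_ltn_trans (leq_subr _ _)).
have qM : q ^+ M = 1.
  rewrite /q cisX.
  have -> : M%:R * ((j%:R - i%:R) * y) = j%:R * (pi *+ 2) - i%:R * (pi *+ 2) :> R.
    by rewrite /y; field.
  rewrite /cis -polarM -/(cis _) -/(cis _) -cis_conj -!cisX /cis cos2pi sin2pi !expr1n.
  by rewrite conjc1 mulr1.
apply/eqP; rewrite -(inj_eq (mulfI (_ : q - 1 != 0))) ?subr_eq0 // mulr0.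
by rewrite -(big_mkord xpredT (fun k => q ^+ k)) big_mkord -subrX1 qM subrr.
Qed.

Definition circle_pt rho M k : R[i] := rho%:C * unity_root M k.

Lemma normc_circle_pt rho M k : 0 <= rho -> normc (circle_pt rho M k) = rho.
Proof. by move=> r0; rewrite normcM normc_unity_root mulr1 normc_real ger0_norm. Qed.

Lemma conjc_mul (x y : R[i]) : ((x * y)^*)%C = (x^*)%C * (y^*)%C.
Proof. by case: x => a b; case: y => c d; simpc; rewrite addrC. Qed.

(** Orthogonality of the characters of the M-th roots of unity: for degrees below M a finite average
    replaces the integral over the circle. *)
Lemma parseval p q rho M : (size p <= M)%N -> (size q <= M)%N ->
  \sum_(k < M) (p.[circle_pt rho M k]^*)%C * q.[circle_pt rho M k]
  = M%:R * \sum_(i < M) ((p`_i)^*)%C * q`_i * (rho ^+ i.*2)%:C.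
Proof.
move=> pM qM.
have E k : (p.[circle_pt rho M k]^*)%C * q.[circle_pt rho M k] =
  \sum_(i < M) \sum_(j < M) (((p`_i)^*)%C * q`_j * (rho ^+ (i + j))%:C) *
     (((unity_root M k ^+ i)^*)%C * unity_root M k ^+ j).
  rewrite (horner_coef_wide _ pM) (horner_coef_wide _ qM) rmorph_sum /= big_distrlr /=.
  apply: eq_bigr => i _; apply: eq_bigr => j _.
  rewrite /circle_pt !exprMn !conjc_mul -!rmorphXn exprD rmorphM conjc_real.
  by ring.
under eq_bigr do rewrite E.
rewrite exchange_big /= mulr_sumr; apply: eq_bigr => i _.
rewrite exchange_big /= (bigD1 i) //= [X in _ + X]big1 ?addr0 => [|j ji]; last first.
  by rewrite -mulr_sumr unity_root_orthogonal // eq_sym (inj_eq val_inj) (negbTE ji) !mulr0.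
by rewrite -mulr_sumr unity_root_orthogonal // eqxx mulr1 -addnn mulrC.
Qed.

Lemma parseval_norm p rho M : (size p <= M)%N ->
  \sum_(k < M) normc p.[circle_pt rho M k] ^+ 2
  = M%:R * \sum_(i < M) normc p`_i ^+ 2 * rho ^+ i.*2.
Proof.
move=> pM; apply: complexI; rewrite rmorph_sum rmorphM rmorph_nat rmorph_sum /=.
under eq_bigr do rewrite -conj_mul_normc.
rewrite parseval //; congr (_ * _); apply: eq_bigr => i _.
by rewrite conj_mul_normc; apply: complex_eqP; rewrite ?ReM ?ImM /=; ring.
Qed.

Lemma psum_poly (p : nat -> R[i]) z m : psum p z m = (\poly_(k < m) p k).[z].
Proof. by rewrite horner_poly. Qed.

(* The average of |1/(1-z)|^2 over the M-th roots of unity times rho: since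
   z^M = rho^M there, 1/(1-z) is the polynomial 1 + z + ... + z^(M-1) up to the
   constant factor 1/(1 - rho^M). *)
Lemma sum_invsqr_circle rho M : (0 < M)%N -> 0 <= rho < 1 ->
  \sum_(k < M) (normc (1 - circle_pt rho M k) ^- 2)
  <= M%:R * ((1 - rho ^+ 2)^-1 / (1 - rho ^+ M) ^+ 2).
Proof.
move=> M0 /andP[r0 r1].
have rM : rho ^+ M < 1 by rewrite exprn_ilt1 // -lt0n.
have rM0 : 0 < 1 - rho ^+ M by rewrite subr_gt0.
pose g : {poly R[i]} := \poly_(i < M) 1.
have E k : normc (1 - circle_pt rho M k) ^- 2 =
    normc g.[circle_pt rho M k] ^+ 2 / (1 - rho ^+ M) ^+ 2.
  set z := circle_pt rho M k.
  have zM : z ^+ M = (rho ^+ M)%:C by rewrite /z exprMn unity_rootX // mulr1 rmorphXn.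
  have gz : (1 - z) * g.[z] = (1 - rho ^+ M)%:C.
    rewrite horner_poly; under eq_bigr do rewrite mul1r.
    by rewrite -opprB mulNr -subrX1 zM opprB rmorphB.
  have := congr1 (fun x => normc x) gz; rewrite normcM normc_real gtr0_norm // => h.
  have z1 : normc (1 - z) != 0.
    by apply: contra_eq_neq h => ->; rewrite mul0r eq_sym gt_eqF.
  have g1 : normc g.[z] != 0.
    by apply: contra_eq_neq h => ->; rewrite mulr0 eq_sym gt_eqF.
  by rewrite -h; field; rewrite z1 g1.
under eq_bigr do rewrite E.
rewrite -mulr_suml parseval_norm ?size_poly // -mulrA; apply: ler_wpM2l => //.
apply: ler_wpM2r; first by rewrite invr_ge0 exprn_ge0 // ltW.
have r2 : 0 <= rho ^+ 2 < 1 by rewrite exprn_ge0 //= exprn_ilt1.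
apply: le_trans (geometric_sum_le M r2); apply: ler_sum => i _.
by rewrite coef_poly ltn_ord normc1 expr1n mul1r -exprM mul2n.
Qed.

Lemma exprn_le_eventually rho e : 0 <= rho < 1 -> 0 < e ->
  exists N, forall m, (N <= m)%N -> rho ^+ m <= e.
Proof.
move=> /andP[r0 r1] e0.
have h : (fun m => rho ^+ m) @ \oo --> (0 : R).
  by have := @cvg_geometric R 1 rho; rewrite /geometric /=; under eq_fun do rewrite mul1r;
  apply; rewrite ger0_norm.
have [N HN] := cvg0_leP h e0; exists N => m /HN.
by rewrite ger0_norm // exprn_ge0.
Qed.

(** The coefficient times rho^n is an average of p over the circle against a unimodular factor,
    hence at most B times the average of |1 - z|^(-2). It plays the role of Cauchy's estimate. *)
Lemma coef_bound (p : nat -> R[i]) n rho B : pscoef_bounded p -> 0 < rho < 1 -> 0 <= B ->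
  (forall z, normc z = rho -> normc (pseval p z) <= B / normc (1 - z) ^+ 2) ->
  normc (p n) * rho ^+ n <= 4 * B / (1 - rho ^+ 2).
Proof.
move=> hp /andP[r0 r1] B0 hB.
have h : 0 <= rho < 1 by rewrite ltW.
have [t [t0 ht]] := psum_tail hp h.
apply/ler_addgt0Pr => e e0.
have [N1 HN1] := cvg0_leP t0 e0.
have [N2 HN2] := exprn_le_eventually h (ltr0Sn R 1 : 0 < 2); move: HN2 => _.
have h2 : 0 < 2^-1 :> R by rewrite invr_gt0.
have [N3 HN3] := exprn_le_eventually h h2.
(* M exceeds n, makes the truncation error at most [e], and gives rho^M <= 1/2; the latter is where
   the factor 4 comes from. *)
pose M := (n + N1 + N3).+1.
have M0 : (0 < M)%N by [].
have nM : (n < M)%N by rewrite ltnS -addnA leq_addr.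
have tM : t M <= e.
  apply: le_trans (ler_norm _) _; apply: HN1.
  by rewrite /M -addnS -addnA addnCA leq_addr.
have rM : rho ^+ M <= 2^-1 by apply: HN3; rewrite /M -addnS addnS ltnW // ltnS leq_addl.
have Mr : 0 < M%:R :> R by rewrite ltr0n.
have r2 : 0 < 1 - rho ^+ 2 by rewrite subr_gt0 exprn_ilt1 // ltW.
(* Pairing with the monomial of degree n isolates the n-th coefficient. *)
pose a : {poly R[i]} := 'X^n.
pose b : {poly R[i]} := \poly_(k < M) p k.
have sa : (size a <= M)%N by rewrite size_polyXn.
have := @parseval a b rho M sa (size_poly _ _).
rewrite [X in _ = _ * X](bigD1 (Ordinal nM)) //= [X in _ = _ * (_ + X)]big1 ?addr0 => [|i ni]; last first.
  by rewrite coefXn; move: ni; rewrite -val_eqE /= => /negbTE ->; rewrite conjc0 !mul0r.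
rewrite coefXn eqxx conjc1 mul1r coef_poly nM => /(congr1 (fun x => normc x)).
rewrite normcM -(rmorph_nat (real_complex R)) normc_real ger0_norm ?ler0n //.
rewrite normcM normc_real ger0_norm ?exprn_ge0 ?(ltW r0) // => E.
have : M%:R * (normc (p n) * rho ^+ n.*2) <=
  rho ^+ n * (M%:R * (4 * B / (1 - rho ^+ 2) + e)).
  rewrite -E; apply: le_trans (ler_normc_sum _ _ _) _.
  have H (k : 'I_M) : true -> normc ((a.[circle_pt rho M k]^*)%C * b.[circle_pt rho M k])
     <= rho ^+ n * (B * normc (1 - circle_pt rho M k) ^- 2 + e).
    move=> _; rewrite normcM normc_conj hornerXn normcX normc_circle_pt ?(ltW r0) //.
    apply: ler_wpM2l; first by rewrite exprn_ge0 // ltW.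
    rewrite -psum_poly; set z := circle_pt _ _ _.
    have zr : normc z = rho by rewrite normc_circle_pt ?(ltW r0).
    rewrite -[psum p z M](subrK (pseval p z)) addrC.
    apply: le_trans (ler_normcD _ _) (lerD (hB _ zr) _).
    exact: le_trans (ht _ zr M) tM.
  apply: le_trans (ler_sum _ H) _; rewrite -mulr_sumr.
  apply: ler_wpM2l; first by rewrite exprn_ge0 // ltW.
  rewrite big_split /= sumr_const card_ord -mulr_sumr mulrDr -[e *+ _]mulr_natl lerD2r.
  apply: le_trans (ler_wpM2l B0 (sum_invsqr_circle M0 h)) _.
  rewrite mulrCA; apply: ler_wpM2l; first exact: ltW.
  rewrite mulrA [4 * B]mulrC -!mulrA; apply: ler_wpM2l => //.
  rewrite mulrC; apply: ler_wpM2r; first by rewrite invr_ge0 ltW.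
  rewrite -[X in _ <= X]invrK lef_pV2 ?posrE ?exprn_gt0 ?invr_gt0 //; try lra.
  have -> : 4^-1 = 2^-1 ^+ 2 :> R by field.
  by apply: lerXn2r; rewrite ?nnegrE; lra.
have -> : M%:R * (normc (p n) * rho ^+ n.*2) = rho ^+ n * (M%:R * (normc (p n) * rho ^+ n)).
  by rewrite -addnn exprD; ring.
by rewrite (ler_pM2l (exprn_gt0 _ r0)) (ler_pM2l Mr).
Qed.

(** Identity theorem for power series: the coefficient bound with B = 0 on the circle of radius
    1/2. *)
Lemma pscoef_unique (p q : nat -> R[i]) : pscoef_bounded p -> pscoef_bounded q ->
  (forall z, normc z < 1 -> pseval p z = pseval q z) -> p =1 q.
Proof.
move=> hp hq H n.
have hpq := pscoef_boundedB hp hq.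
have r01 : 0 < (2^-1 : R) < 1 by rewrite invr_gt0 ltr0n invf_lt1 ?ltr1n ?ltr0n.
have := @coef_bound (fun k => p k - q k) n 2^-1 0 hpq r01 (lexx _).
rewrite mulr0 !mul0r => h.
apply/eqP; rewrite -subr_eq0 -normc_eq0 eq_le normc_ge0 andbT.
rewrite -(@pmulr_lle0 _ (2^-1 ^+ n)) ?exprn_gt0 ?invr_gt0 //.
apply: h => z zr; have z1 : normc z < 1 by rewrite zr; lra.
rewrite mul0r (pscvg_pseval hpq z1 (pscvgB (pseval_cvg hp z1) (pseval_cvg hq z1))).
by rewrite H // subrr normc0.
Qed.

End DiscreteFourier.

(** * The binomial series *)

Section BinomialSeries.
Variable R : realType.
Implicit Types (p : nat -> R[i]) (c z : R[i]) (a : R).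

(** Taylor coefficients at 0 of z |-> (c - z)^a, through the ratio of consecutive terms. The ratio
    avoids binomial coefficients with real upper index. *)
Fixpoint bin_coef c a (k : nat) : R[i] :=
  if k is k'.+1 then bin_coef c a k' * ((k'%:R - a)%:C / (k'.+1%:R * c)) else cpow c a.

Lemma normc_natr n : normc (n%:R : R[i]) = n%:R.
Proof. by rewrite -(rmorph_nat (real_complex R)) normc_real ger0_norm ?ler0n. Qed.

Lemma pscoef_bounded_le1 p B : (forall k, normc (p k) <= B) -> pscoef_bounded p.
Proof.
move=> H rho /andP[r0 r1]; exists B => k.
have B0 : 0 <= B by apply: le_trans (normc_ge0 _) (H 0%N).
rewrite -[X in _ <= X]mulr1; apply: ler_pM; rewrite ?normc_ge0 ?exprn_ge0 //.
by rewrite exprn_ile1 // ltW.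
Qed.

(** Consecutive ratios have modulus at most 1, because |k - a| <= k + 1 and |c| >= 1. *)
Lemma bin_coef_bound c a k : -1 <= a <= 1 -> 1 <= complex.Re c ->
  normc (bin_coef c a k) <= normc (cpow c a).
Proof.
move=> /andP[a0 a1] c1; elim: k => [|k IH] //=.
rewrite normcM -[X in _ <= X]mulr1; apply: ler_pM; rewrite ?normc_ge0 //.
have cn : 1 <= normc c.
  by apply: le_trans c1 _; apply: le_trans (ler_norm _) (ler_Re_normc _).
have k0 : 0 < k.+1%:R :> R by rewrite ltr0n.
rewrite normcM normcV normcM normc_natr normc_real ler_pdivrMr ?mul1r; last first.
  by rewrite mulr_gt0 // (lt_le_trans ltr01).
apply: le_trans (_ : k.+1%:R <= _); last by rewrite ler_peMr // ltW.
by have k1 : 0 <= k%:R :> R := ler0n _ _; rewrite ler_norml -natr1; apply/andP; split; lra.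
Qed.

Lemma pscoef_bounded_bin c a : -1 <= a <= 1 -> 1 <= complex.Re c ->
  pscoef_bounded (bin_coef c a).
Proof. by move=> ha hc; apply: pscoef_bounded_le1 => k; apply: bin_coef_bound. Qed.

(** The differential equation (c - z) P' = - a P read on coefficients. *)
Lemma bin_coefS c a k : c != 0 ->
  c * (k.+1%:R * bin_coef c a k.+1) - k%:R * bin_coef c a k = - a%:C * bin_coef c a k.
Proof.
move=> c0 /=; rewrite rmorphB rmorph_nat.
have k0 : k.+1%:R != 0 :> R[i] by rewrite pnatr_eq0.
by field; rewrite -mulrS -natr1 natr1 k0 c0.
Qed.

Lemma pscoef_bounded_shift p : pscoef_bounded p -> pscoef_bounded (fun k => p k.+1).
Proof.
move=> hp rho h; have [r [rr r0 r1 _]] := mid_radius h; have /andP[h0 _] := h.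
have [B hB] := hp r (introT andP (conj (ltW r0) r1)).
exists (B / r) => k; rewrite ler_pdivlMr //; apply: le_trans (hB k.+1).
rewrite exprSr -mulrA; apply: ler_wpM2l; rewrite ?normc_ge0 //.
by apply: ler_wpM2r; rewrite ?(ltW r0) // lerXn2r ?nnegrE // ltW.
Qed.

Definition psderiv p (k : nat) : R[i] := k.+1%:R * p k.+1.

Lemma pscoef_bounded_deriv p : pscoef_bounded p -> pscoef_bounded (psderiv p).
Proof. by move=> /pscoef_bounded_theta/pscoef_bounded_shift. Qed.

Lemma pscvg_Re p z P : pscvg p z P -> (fun m => complex.Re (psum p z m)) @ \oo --> complex.Re P.
Proof.
move=> hP; apply/cvgrPdist_le => e e0; have [N HN] := cvg0_leP hP e0.
exists N => // m /= /HN; rewrite ger0_norm ?normc_ge0 // => /Re_abs_le.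
by rewrite ReD ReN distrC.
Qed.

Lemma pscvg_Im p z P : pscvg p z P -> (fun m => complex.Im (psum p z m)) @ \oo --> complex.Im P.
Proof.
move=> hP; apply/cvgrPdist_le => e e0; have [N HN] := cvg0_leP hP e0.
exists N => // m /= /HN; rewrite ger0_norm ?normc_ge0 // => /Im_abs_le.
by rewrite ImD ImN distrC.
Qed.

Lemma seriesRe p z (s : R) :
  pseries (fun k => complex.Re (p k * z ^+ k)) s = (fun m => complex.Re (psum p (s%:C * z) m)).
Proof.
apply/funext => m; rewrite /pseries /series /= big_mkord Re_sum; apply: eq_bigr => k _.
by rewrite exprMn -rmorphXn mulrCA ReZ mulrC.
Qed.

Lemma seriesIm p z (s : R) :
  pseries (fun k => complex.Im (p k * z ^+ k)) s = (fun m => complex.Im (psum p (s%:C * z) m)).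
Proof.
apply/funext => m; rewrite /pseries /series /= big_mkord Im_sum; apply: eq_bigr => k _.
by rewrite exprMn -rmorphXn mulrCA ImZ mulrC.
Qed.

Lemma diffsRe p z : pseries_diffs (fun k => complex.Re (p k * z ^+ k)) =
  (fun k => complex.Re (z * psderiv p k * z ^+ k)).
Proof.
apply/funext => k; rewrite /pseries_diffs /psderiv exprS.
have -> : z * (k.+1%:R * p k.+1) * z ^+ k = k.+1%:R * (p k.+1 * (z * z ^+ k)) by ring.
by rewrite -(rmorph_nat (real_complex R)) ReZ.
Qed.

Lemma diffsIm p z : pseries_diffs (fun k => complex.Im (p k * z ^+ k)) =
  (fun k => complex.Im (z * psderiv p k * z ^+ k)).
Proof.
apply/funext => k; rewrite /pseries_diffs /psderiv exprS.
have -> : z * (k.+1%:R * p k.+1) * z ^+ k = k.+1%:R * (p k.+1 * (z * z ^+ k)) by ring.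
by rewrite -(rmorph_nat (real_complex R)) ImZ.
Qed.

(** Differentiating only along the ray s z keeps the analysis real: the real and imaginary parts are
    real power series in s. *)
Lemma pseval_is_derive p z (s : R) : pscoef_bounded p -> normc z < 1 -> `|s| <= 1 ->
  is_derive s 1 (fun s : R => complex.Re (pseval p (s%:C * z)))
    (complex.Re (z * pseval (psderiv p) (s%:C * z))) /\
  is_derive s 1 (fun s : R => complex.Im (pseval p (s%:C * z)))
    (complex.Im (z * pseval (psderiv p) (s%:C * z))).
Proof.
move=> hp z1 s1.
have n0 := normc_ge0 z.
(* The endpoint s = 1 must be interior to the interval of convergence in s. *)
have [K K1 Kz] : exists2 K : R, 1 < K & K * normc z < 1.
  have h : 0 < 1 + normc z by lra.
  exists (2 / (1 + normc z)); first by rewrite ltr_pdivlMr //; lra.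
  by rewrite mulrAC ltr_pdivrMr //; lra.
have bd := pscoef_bounded_deriv hp.
have sz (t : R) : `|t| <= K -> normc (t%:C * z) < 1.
  move=> tK; rewrite normcM normc_real; apply: le_lt_trans Kz.
  exact: ler_wpM2r.
have KE : `|K| = K by rewrite gtr0_norm // (lt_trans ltr01).
have KK : `|K| <= K by rewrite KE.
have sK : `|s| < `|K| by rewrite KE; exact: le_lt_trans K1.
have sK' : `|s| <= K by rewrite -KE ltW.
have cv q (hq : pscoef_bounded q) t (ht : `|t| <= K) := pseval_cvg hq (sz t ht).
have EqR (q : nat -> R[i]) : (fun x : R => limn (pseries (fun k => complex.Re (q k * z ^+ k)) x))
    = (fun s : R => complex.Re (pseval q (s%:C * z))).
  by apply/funext => x; rewrite seriesRe.
have EqI (q : nat -> R[i]) : (fun x : R => limn (pseries (fun k => complex.Im (q k * z ^+ k)) x))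
    = (fun s : R => complex.Im (pseval q (s%:C * z))).
  by apply/funext => x; rewrite seriesIm.
have zd := pscoef_boundedZ z bd.
have zE : pseval (fun k => z * psderiv p k) (s%:C * z) = z * pseval (psderiv p) (s%:C * z).
  by apply: pscvg_pseval => //; [exact: sz|apply: pscvgZ; exact: cv].
rewrite -zE; split.
- have := @pseries_snd_diffs R (fun k => complex.Re (p k * z ^+ k)) K s.
  rewrite EqR !diffsRe !seriesRe; apply => //.
  + by apply: cvgP; exact: pscvg_Re (cv _ hp _ KK).
  + by apply: cvgP; exact: pscvg_Re (cv _ zd _ KK).
  + have zdd := pscoef_boundedZ z (pscoef_bounded_deriv zd).
    by apply: cvgP; exact: pscvg_Re (cv _ zdd _ KK).
- have := @pseries_snd_diffs R (fun k => complex.Im (p k * z ^+ k)) K s.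
  rewrite EqI !diffsIm !seriesIm; apply => //.
  + by apply: cvgP; exact: pscvg_Im (cv _ hp _ KK).
  + by apply: cvgP; exact: pscvg_Im (cv _ zd _ KK).
  + have zdd := pscoef_boundedZ z (pscoef_bounded_deriv zd).
    by apply: cvgP; exact: pscvg_Im (cv _ zdd _ KK).
Qed.

Lemma cpow_exp z a : 0 < complex.Re z ->
  cpow z a = (expR (a * (ln (complex.Re z ^+ 2 + complex.Im z ^+ 2) / 2)))%:C *
             cis (a * atan (complex.Im z / complex.Re z)).
Proof.
move=> z0; rewrite /cpow -carg_atan //; congr (_%:C * _).
have nz := Re_gt0_normc z0.
rewrite /powR gt_eqF //; congr (expR (_ * _)).
by rewrite -normc_sqr lnXn // -mulr_natr; field.
Qed.

Lemma cpow_is_derive c z a (s : R) : 0 < complex.Re (c - s%:C * z) ->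
  let D := - a%:C * z * cpow (c - s%:C * z) a / (c - s%:C * z) in
  is_derive s 1 (fun s : R => complex.Re (cpow (c - s%:C * z) a)) (complex.Re D) /\
  is_derive s 1 (fun s : R => complex.Im (cpow (c - s%:C * z) a)) (complex.Im D).
Proof.
move=> cs0 D.
have E (t : R) : c - t%:C * z =
  (complex.Re c - t * complex.Re z) +i* (complex.Im c - t * complex.Im z).
  by apply: complex_eqP; rewrite ?ReD ?ReN ?ImD ?ImN ?ReZ ?ImZ.
pose x (t : R) := complex.Re c - t * complex.Re z.
pose y (t : R) := complex.Im c - t * complex.Im z.
have xs0 : 0 < x s by move: cs0; rewrite E.
have dx : is_derive s 1 x (- complex.Re z).
  by apply: is_derive_eq; rewrite /GRing.scale /=; ring.
have dy : is_derive s 1 y (- complex.Im z).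
  by apply: is_derive_eq; rewrite /GRing.scale /=; ring.
have xn : \near s, 0 < x s.
  have cx : {for s, continuous x} by apply: differentiable_continuous; apply/derivable1_diffP; exact: ex_derive.
  exact: cx (lt_nbhsl _ _) || exact: (cvgr_gt _ cx).
pose m (t : R) := x t ^+ 2 + y t ^+ 2.
have ms0 : 0 < m s by rewrite ltr_pwDl ?exprn_gt0 ?sqr_ge0.
pose l (t : R) : R := a * (ln (m t) / 2).
pose th (t : R) : R := a * atan (y t / x t).
have dm : is_derive s 1 m (- 2 * (x s * complex.Re z + y s * complex.Im z)).
  by apply: is_derive_eq; rewrite /GRing.scale /=; ring.
have dl : is_derive s 1 l (- a * (x s * complex.Re z + y s * complex.Im z) / m s).
  have dln := is_derive1_comp (is_derive1_ln ms0) dm.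
  rewrite /l; apply: is_derive_eq; rewrite /GRing.scale /=; field; exact: lt0r_neq0.
have dth : is_derive s 1 th (a * (y s * complex.Re z - x s * complex.Im z) / m s).
  have dxi : is_derive s 1 (fun t => (x t)^-1) (- (x s) ^- 2 * (- complex.Re z)).
    by refine (is_derive_eq (is_deriveV _ dx) _); first exact: lt0r_neq0.
  pose g (t : R) := y t * (x t)^-1.
  have dyx : is_derive s 1 g ((y s * complex.Re z - x s * complex.Im z) / x s ^+ 2).
    by apply: is_derive_eq; rewrite /GRing.scale /=; field; exact: lt0r_neq0.
  have dat := is_derive1_comp (g := g) (is_derive1_atan (g s)) dyx.
  rewrite /th; apply: is_derive_eq; rewrite /GRing.scale /= /g /m; field.
  by rewrite (lt0r_neq0 ms0) lt0r_neq0 //= -/(m s) lt0r_neq0.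
pose w := cpow (c - s%:C * z) a.
have xn0 : x s != 0 by exact: lt0r_neq0.
have cw (t : R) : 0 < x t -> cpow (c - t%:C * z) a = (expR (l t))%:C * cis (th t).
  by move=> xt; rewrite E cpow_exp //=.
(* The logarithmic derivative - a z / (c - s z) has as real and imaginary parts the derivatives of
   [l] and [th]. *)
have DE : D = ((- a * (x s * complex.Re z + y s * complex.Im z) / m s) +i*
     (a * (y s * complex.Re z - x s * complex.Im z) / m s)) * w.
  rewrite /D -/w E -/(x s) -/(y s) mulrAC; congr (_ * w).
  have u0 : (x s +i* y s) != 0.
    by apply/eqP => /(congr1 (@complex.Re R)) /= /eqP; rewrite (negbTE xn0).
  apply: (mulIf u0); rewrite mulfVK //.
  have mn0 : m s != 0 by exact: lt0r_neq0.
  apply: complex_eqP; rewrite ?(ReM, ImM) /= /m in mn0 *; field; exact: mn0.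
have wE : w = (expR (l s))%:C * cis (th s) by exact: cw.
rewrite DE wE; split.
- apply: (near_eq_is_derive (f := fun t => expR (l t) * cos (th t))).
    by near=> t; rewrite cw ?ReZ //; near: t.
  have d1 := is_derive1_comp (is_derive_expR (l s)) dl.
  have d2 := is_derive1_comp (is_derive_cos (th s)) dth.
  apply: (is_derive_eq (is_deriveM d1 d2)).
  by rewrite [RHS]ReM ReZ ImZ /cis /= /GRing.scale /=; ring.
- apply: (near_eq_is_derive (f := fun t => expR (l t) * sin (th t))).
    by near=> t; rewrite cw ?ImZ //; near: t.
  have d1 := is_derive1_comp (is_derive_expR (l s)) dl.
  have d2 := is_derive1_comp (is_derive_sin (th s)) dth.
  apply: (is_derive_eq (is_deriveM d1 d2)).
  by rewrite [RHS]ImM ReZ ImZ /cis /= /GRing.scale /=; ring.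
Unshelve. all: by end_near. Qed.

Lemma psderiv_bin c a z : c != 0 -> -1 <= a <= 1 -> 1 <= complex.Re c -> normc z < 1 ->
  (c - z) * pseval (psderiv (bin_coef c a)) z = - a%:C * pseval (bin_coef c a) z.
Proof.
move=> c0 ha hc z1.
have hb := pscoef_bounded_bin ha hc; have hd := pscoef_bounded_deriv hb.
have ht := pscoef_bounded_theta hb.
have zE : z * pseval (psderiv (bin_coef c a)) z = pseval (theta (bin_coef c a)) z.
  apply: pscvg_unique (pseval_cvg ht z1).
  have E m : psum (theta (bin_coef c a)) z m.+1 = psum (fun k => z * psderiv (bin_coef c a) k) z m.
    rewrite /psum big_ord_recl /theta mul0r mul0r add0r.
    by apply: eq_bigr => k _; rewrite /psderiv /= /bump /= add1n exprS; ring.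
  have h := pscvgZ z (pseval_cvg hd z1).
  have : (fun m => normc (psum (theta (bin_coef c a)) z m.+1 -
       z * pseval (psderiv (bin_coef c a)) z)) @ \oo --> (0 : R).
    by under eq_fun do rewrite E.
  by rewrite (cvg_shiftS (fun m => normc (psum (theta (bin_coef c a)) z m -
       z * pseval (psderiv (bin_coef c a)) z))).
rewrite mulrBl zE.
apply: (@pscvg_unique _ (fun k => c * psderiv (bin_coef c a) k - theta (bin_coef c a) k) z).
  by apply: pscvgB; [apply: pscvgZ|]; exact: pseval_cvg.
apply: (@pscvg_ext _ (fun k => - a%:C * bin_coef c a k)).
  by move=> k; rewrite /psderiv /theta bin_coefS.
by apply: pscvgZ; exact: pseval_cvg.
Qed.

Lemma const_segment (f : R -> R) : (forall s : R, 0 <= s <= 1 -> is_derive s 1 f 0) -> f 1 = f 0.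
Proof.
move=> H; apply/eqP; rewrite -subr_eq0; apply/eqP.
have h (s : R) : s \in `]0, 1[ -> is_derive s 1 f (cst 0 s).
  by rewrite in_itv /= => /andP[s0 s1]; apply: H; rewrite !ltW.
have cf : {within `[0 : R, 1 : R], continuous f}.
  apply: derivable_within_continuous => s; rewrite in_itv /= => hs.
  by have hh := H s hs; exact: ex_derive.
by have [t _ ->] := MVT ltr01 h cf; rewrite mul0r.
Qed.

Lemma is_derive_mul0 (f g : R -> R[i]) (s : R) (df dg : R[i]) :
  is_derive s 1 (fun t : R => complex.Re (f t)) (complex.Re df) ->
  is_derive s 1 (fun t : R => complex.Im (f t)) (complex.Im df) ->
  is_derive s 1 (fun t : R => complex.Re (g t)) (complex.Re dg) ->
  is_derive s 1 (fun t : R => complex.Im (g t)) (complex.Im dg) ->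
  df * g s + f s * dg = 0 ->
  is_derive s 1 (fun t : R => complex.Re (f t * g t)) 0 /\
  is_derive s 1 (fun t : R => complex.Im (f t * g t)) 0.
Proof.
move=> f1 f2 g1 g2 Z; split.
- under eq_fun do rewrite ReM.
  apply: is_derive_eq; rewrite /GRing.scale /=.
  by rewrite -[RHS](congr1 (@complex.Re R) Z) ReD !ReM; ring.
- under eq_fun do rewrite ImM.
  apply: is_derive_eq; rewrite /GRing.scale /=.
  by rewrite -[RHS](congr1 (@complex.Im R) Z) ImD !ImM; ring.
Qed.

(** Along the segment from 0 to z the series [Y] and the power satisfy the same linear differential
    equation, so [Y] times the power of exponent - a is constant; at 0 it equals 1. *)
Theorem binomial_series c a z : -1 <= a <= 1 -> 1 <= complex.Re c -> normc z < 1 ->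
  pscvg (bin_coef c a) z (cpow (c - z) a).
Proof.
move=> ha hc z1.
have c0 : c != 0 by apply: Re_gt0_neq0; exact: lt_le_trans hc.
have hb := pscoef_bounded_bin ha hc.
suff <- : pseval (bin_coef c a) z = cpow (c - z) a by exact: pseval_cvg.
have Rpos (s : R) : 0 <= s <= 1 -> 0 < complex.Re (c - s%:C * z).
  move=> /andP[s0 s1]; rewrite ReD ReN ReZ subr_gt0; apply: lt_le_trans hc.
  apply: le_lt_trans z1; apply: le_trans (ler_norm _) _; rewrite normrM (ger0_norm s0).
  apply: le_trans (ler_Re_normc z); apply: ler_piMl => //.
have nsz (s : R) : 0 <= s <= 1 -> normc (s%:C * z) < 1.
  move=> /andP[s0 s1]; rewrite normcM normc_real ger0_norm //.
  by apply: le_lt_trans z1; apply: ler_piMl => //; exact: normc_ge0.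
pose Y s := pseval (bin_coef c a) (s%:C * z).
pose V s := cpow (c - s%:C * z) (- a).
have key (s : R) : 0 <= s <= 1 ->
  is_derive s 1 (fun s => complex.Re (Y s * V s)) 0 /\ is_derive s 1 (fun s => complex.Im (Y s * V s)) 0.
  move=> hs; have /andP[s0 s1] := hs.
  have s1' : `|s| <= 1 by rewrite ger0_norm.
  have [dY1 dY2] := pseval_is_derive hb z1 s1'.
  have [dV1 dV2] := @cpow_is_derive c z (- a) s (Rpos _ hs).
  have u0 := Re_gt0_neq0 (Rpos _ hs).
  have YE := psderiv_bin c0 ha hc (nsz _ hs).
  set DY := z * _ in dY1 dY2; set DV := _ / _ in dV1 dV2.
  have Z : DY * V s + Y s * DV = 0.
    apply: (mulfI u0); rewrite mulr0 /DY /DV /V.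
    have -> : (- a)%:C = - a%:C :> R[i] by rewrite rmorphN.
    have -> : pseval (psderiv (bin_coef c a)) (s%:C * z) = - a%:C * Y s / (c - s%:C * z).
      by apply: (mulfI u0); rewrite YE /Y [RHS]mulrC mulfVK.
    field; exact: u0.
  exact: (is_derive_mul0 dY1 dY2 dV1 dV2 Z).
have YV : Y 1 * V 1 = Y 0 * V 0.
  apply: complex_eqP.
    by apply: (@const_segment (fun s => complex.Re (Y s * V s))) => s /key [].
  by apply: (@const_segment (fun s => complex.Im (Y s * V s))) => s /key [].
have Rc : 0 < complex.Re c by exact: lt_le_trans hc.
have Rcz : 0 < complex.Re (c - z).
  by have := Rpos 1; rewrite mul1r; apply; rewrite ler01 lexx.
have YV0 : Y 0 * V 0 = 1.
  rewrite /Y /V !mul0r subr0.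
  have -> : pseval (bin_coef c a) 0 = cpow c a.
    apply: pscvg_pseval => //; first by rewrite normc0.
    apply: cvg0_normP => e e0; exists 1%N; case=> // m _.
    rewrite /psum big_ord_recl /= expr0 mulr1 big1 ?addr0 ?subrr ?normc0 ?normr0 ?ltW //.
    by move=> k _; rewrite expr0n mulr0.
  by rewrite -cpowD ?Re_gt0_normc // subrr cpow0.
have Vn : V 1 * cpow (c - z) a = 1.
  by rewrite /V mul1r -cpowD ?Re_gt0_normc // addNr cpow0.
have Y1 : pseval (bin_coef c a) z = Y 1 by rewrite /Y mul1r.
by rewrite Y1 -[LHS]mulr1 -Vn mulrA YV YV0 mul1r.
Qed.

End BinomialSeries.

(** * The symbol of the scheme *)

Section FiniteVectors.
Variables (R : realType) (I : finType).
Implicit Types (x y f g : I -> R[i]).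

Definition vnorm x : R := Num.sqrt (\sum_i normc (x i) ^+ 2).
Definition vdot g x : R[i] := \sum_i ((g i)^*)%C * x i.

Lemma vnorm_ge0 x : 0 <= vnorm x. Proof. exact: sqrtr_ge0. Qed.

Lemma vnorm_sqr x : vnorm x ^+ 2 = \sum_i normc (x i) ^+ 2.
Proof. by rewrite sqr_sqrtr //; apply: sumr_ge0 => i _; rewrite exprn_ge0 ?normc_ge0. Qed.

Lemma vdot_self x : vdot x x = (vnorm x ^+ 2)%:C.
Proof. by rewrite vnorm_sqr rmorph_sum; apply: eq_bigr => i _; rewrite conj_mul_normc. Qed.

Lemma normc_le_vnorm x i : normc (x i) <= vnorm x.
Proof.
rewrite -(@ler_pXn2r _ 2) ?nnegrE ?normc_ge0 ?vnorm_ge0 // vnorm_sqr (bigD1 i) //= lerDl.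
by apply: sumr_ge0 => j _; rewrite exprn_ge0 ?normc_ge0.
Qed.

Lemma vnorm_eq0 x : vnorm x = 0 -> forall i, x i = 0.
Proof.
move=> x0 i; apply/eqP; rewrite -normc_eq0 eq_le normc_ge0 andbT -x0.
exact: normc_le_vnorm.
Qed.

Lemma cauchy_schwarz_sum x y :
  \sum_i normc (x i) * normc (y i) <= vnorm x * vnorm y.
Proof.
have [x0|x0] := eqVneq (vnorm x) 0.
  by rewrite x0 mul0r big1 // => i _; rewrite vnorm_eq0 // normc0 mul0r.
have [y0|y0] := eqVneq (vnorm y) 0.
  by rewrite y0 mulr0 big1 // => i _; rewrite (vnorm_eq0 y0) normc0 mulr0.
have xp : 0 < vnorm x by rewrite lt_def x0 vnorm_ge0.
have yp : 0 < vnorm y by rewrite lt_def y0 vnorm_ge0.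
(* Weighted arithmetic-geometric mean, with the weights that balance the two norms after
   summation. *)
have H i : true -> normc (x i) * normc (y i) <=
    (vnorm y / vnorm x * normc (x i) ^+ 2 + vnorm x / vnorm y * normc (y i) ^+ 2) / 2.
  move=> _; rewrite -subr_ge0.
  have -> : (vnorm y / vnorm x * normc (x i) ^+ 2 + vnorm x / vnorm y * normc (y i) ^+ 2) / 2
    - normc (x i) * normc (y i) =
    (vnorm y * normc (x i) - vnorm x * normc (y i)) ^+ 2 / (2 * (vnorm x * vnorm y)).
    by field; rewrite x0 y0.
  by rewrite divr_ge0 ?sqr_ge0 // mulr_ge0 // mulr_ge0 ?vnorm_ge0.
apply: le_trans (ler_sum _ H) _.
rewrite -mulr_suml big_split /= -!mulr_sumr -!vnorm_sqr le_eqVlt; apply/orP; left.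
by apply/eqP; field; rewrite x0 y0.
Qed.

Lemma normc_vdot g x : normc (vdot g x) <= vnorm g * vnorm x.
Proof.
apply: le_trans (cauchy_schwarz_sum g x); apply: le_trans (ler_normc_sum _ _ _) _.
by apply: ler_sum => i _; rewrite normcM normc_conj.
Qed.

(** Testing against every g reduces vector sequences to scalar power series; the supremum is
    attained at g = x. *)
Lemma vnorm_le_dual x B : 0 <= B ->
  (forall g, normc (vdot g x) <= vnorm g * B) -> vnorm x <= B.
Proof.
move=> B0 /(_ x); rewrite vdot_self normc_real ger0_norm ?exprn_ge0 ?vnorm_ge0 //.
have [->//|x0] := eqVneq (vnorm x) 0.
by rewrite expr2 ler_pM2l // lt_def x0 vnorm_ge0.
Qed.

Lemma vdotDr g x y : vdot g (fun i => x i + y i) = vdot g x + vdot g y.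
Proof. by rewrite /vdot -big_split; apply: eq_bigr => i _; rewrite mulrDr. Qed.

Lemma vdotZr g a x : vdot g (fun i => a * x i) = a * vdot g x.
Proof. by rewrite /vdot mulr_sumr; apply: eq_bigr => i _; rewrite mulrCA. Qed.

Lemma vnormD x y : vnorm (fun i => x i + y i) <= vnorm x + vnorm y.
Proof.
apply: vnorm_le_dual => [|g]; first by rewrite addr_ge0 ?vnorm_ge0.
rewrite vdotDr mulrDr; apply: le_trans (ler_normcD _ _) (lerD _ _); exact: normc_vdot.
Qed.

Lemma vnormZ a x : vnorm (fun i => a * x i) = normc a * vnorm x.
Proof.
rewrite /vnorm -[X in X * _]ger0_norm ?normc_ge0 // -sqrtr_sqr -sqrtrM ?exprn_ge0 ?normc_ge0 //.
by congr Num.sqrt; rewrite mulr_sumr; apply: eq_bigr => i _; rewrite normcM exprMn.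
Qed.

Lemma vnorm_diag_le (d x : I -> R[i]) B : 0 <= B -> (forall i, normc (d i) <= B) ->
  vnorm (fun i => d i * x i) <= B * vnorm x.
Proof.
move=> B0 hd; rewrite -(@ler_pXn2r _ 2) ?nnegrE ?mulr_ge0 ?vnorm_ge0 // exprMn !vnorm_sqr mulr_sumr.
apply: ler_sum => i _; rewrite normcM -exprMn lerXn2r ?nnegrE ?mulr_ge0 ?normc_ge0 //.
by apply: ler_wpM2r; rewrite ?normc_ge0.
Qed.

Lemma vnorm_sum (J : Type) (r : seq J) (F : J -> I -> R[i]) :
  vnorm (fun i => \sum_(j <- r) F j i) <= \sum_(j <- r) vnorm (F j).
Proof.
elim: r => [|j r IH].
  rewrite big_nil /vnorm big1 ?sqrtr0 // => i _; by rewrite big_nil normc0 expr0n.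
rewrite big_cons; apply: le_trans (lerD (lexx _) IH); apply: le_trans (vnormD _ _).
by under eq_fun do rewrite big_cons.
Qed.

Lemma vnorm_ext x y : x =1 y -> vnorm x = vnorm y.
Proof. by move=> /funext ->. Qed.

Lemma vnormN x : vnorm (fun i => - x i) = vnorm x.
Proof. by congr Num.sqrt; apply: eq_bigr => i _; rewrite normc_opp. Qed.

End FiniteVectors.

(** * Coercivity and logarithmic derivatives of the symbol *)

Section SymbolBounds.
Variable R : realType.
Implicit Types (b z : R[i]) (al la ka M : R).

(** Coefficients of (1 + b - z)^al - la^al. In use b = tau (lambda - a(x)) and la = tau lambda, so
    the time step is hidden in these two parameters. *)
Definition symb b al la (k : nat) : R[i] :=
  bin_coef (1 + b) al k - (k == 0%N)%:R * (la `^ al)%:C.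

(** Multiplication of the generating function by z. *)
Definition shiftc (p : nat -> R[i]) (k : nat) : R[i] := if k is k'.+1 then p k' else 0.

Lemma pscoef_bounded_shiftc p : pscoef_bounded p -> pscoef_bounded (shiftc p).
Proof.
move=> hp rho h; have [B hB] := hp rho h; have /andP[r0 r1] := h.
exists B => -[|k]; rewrite ?[shiftc p _]/=.
  by rewrite normc0 mul0r; apply: le_trans (hB 0%N); rewrite mulr_ge0 ?normc_ge0 ?exprn_ge0.
apply: le_trans (hB k); apply: ler_wpM2l; rewrite ?normc_ge0 //.
by apply: ler_wiXn2l; rewrite // ltW.
Qed.

Lemma pscvg_shiftc p z P : pscvg p z P -> pscvg (shiftc p) z (z * P).
Proof.
move=> hp.
have E m : psum (shiftc p) z m.+1 = psum (fun k => z * p k) z m.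
  rewrite /psum big_ord_recl /= mul0r add0r.
  by apply: eq_bigr => k _; rewrite /= exprS; ring.
have h := pscvgZ z hp.
have : (fun m => normc (psum (shiftc p) z m.+1 - z * P)) @ \oo --> (0 : R).
  by under eq_fun do rewrite E.
by rewrite (cvg_shiftS (fun m => normc (psum (shiftc p) z m - z * P))).
Qed.

(** The last two conditions are homogeneous in (b, la), so one pair (ka, M) serves all time steps:
    [ka] measures the gap above la, [M] the opening of a sector. *)
Record symbol_params b al la ka M : Prop := SymbolParams {
  sp_al : 0 < al < 1; sp_la : 0 < la; sp_ka : 0 < ka; sp_M : 0 <= M;
  sp_Re : (1 + ka) * la <= complex.Re b;
  sp_Im : `|complex.Im b| <= M * complex.Re b }.

Section OneSymbol.
Variables (b : R[i]) (al la ka M : R).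
Hypothesis H : symbol_params b al la ka M.

Let c := 1 + b.
Let p := bin_coef c al.

Lemma sp_Re_gt0 : 0 < complex.Re b.
Proof.
case: H => _ la0 ka0 _ + _; apply: lt_le_trans; rewrite mulr_gt0 //.
by rewrite addr_gt0.
Qed.

Lemma sp_Re_c : 1 <= complex.Re c.
Proof. by rewrite /c ReD /= lerDl ltW // sp_Re_gt0. Qed.

Lemma sp_al_range : -1 <= al <= 1.
Proof. by case: H => /andP[a0 a1] *; apply/andP; split; lra. Qed.

Lemma pscoef_bounded_p : pscoef_bounded p.
Proof. exact: pscoef_bounded_bin sp_al_range sp_Re_c. Qed.

Lemma pseval_p z : normc z < 1 -> pseval p z = cpow (c - z) al.
Proof.
move=> z1; apply: pscvg_pseval => //; first exact: pscoef_bounded_p.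
exact: binomial_series sp_al_range sp_Re_c z1.
Qed.

Lemma pscoef_bounded_symb : pscoef_bounded (symb b al la).
Proof.
apply: pscoef_boundedB; first exact: pscoef_bounded_p.
by apply: (@pscoef_bounded_fin _ _ 1); case=> // n _; rewrite mul0r.
Qed.

Lemma pscvg_symb z : normc z < 1 -> pscvg (symb b al la) z (cpow (c - z) al - (la `^ al)%:C).
Proof.
move=> z1; apply: pscvgB; first exact: binomial_series sp_al_range sp_Re_c z1.
have := pscvgZ (la `^ al)%:C (pscvg_delta0 z); rewrite mulr1.
by apply: pscvg_ext => k; rewrite mulrC.
Qed.

Lemma pseval_symb z : normc z < 1 -> pseval (symb b al la) z = cpow (c - z) al - (la `^ al)%:C.
Proof. by move=> z1; apply: pscvg_pseval (pscvg_symb z1) => //; exact: pscoef_bounded_symb. Qed.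

Lemma Re_disc z : normc z < 1 -> 0 < complex.Re (1 - z).
Proof.
by move=> z1; rewrite ReD ReN subr_gt0; apply: le_lt_trans z1; apply: le_trans (ler_norm _) (ler_Re_normc z).
Qed.

Lemma normc_disc_le2 z : normc z < 1 -> normc (1 - z) <= 2.
Proof. by move=> z1; apply: le_trans (ler_normcB _ _) _; rewrite normc1; lra. Qed.

Lemma Re_base z : normc z < 1 -> complex.Re b < complex.Re (c - z).
Proof.
by move=> z1; have := Re_disc z1; rewrite /c !ReD !ReN /=; lra.
Qed.

Lemma Re_base_gt0 z : normc z < 1 -> 0 < complex.Re (c - z).
Proof. by move=> z1; apply: lt_trans (Re_base z1); exact: sp_Re_gt0. Qed.

(** Since 1 - z = (c - z) - b and |b| <= (1 + M) Re b <= (1 + M) |c - z|, the bound holds whatever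
    the size of b, hence for all time steps at once. *)
Lemma base_ge z : normc z < 1 -> normc (1 - z) <= (2 + M) * normc (c - z).
Proof.
move=> z1; case: H => _ _ _ M0 _ hI.
have -> : 1 - z = (c - z) - b by rewrite /c; ring.
apply: le_trans (ler_normcB _ _) _.
have h1 : normc b <= (1 + M) * complex.Re b.
  apply: le_trans (normc_le_ReIm b) _; rewrite gtr0_norm ?sp_Re_gt0 //.
  by rewrite mulrDl mul1r lerD2l.
have h2 : complex.Re b <= normc (c - z).
  apply: le_trans (ltW (Re_base z1)) _; apply: le_trans (ler_norm _) (ler_Re_normc _).
have h3 : (1 + M) * complex.Re b <= (1 + M) * normc (c - z) by apply: ler_wpM2l => //; lra.
by lra.
Qed.

Lemma coercive_const_gt0 : 0 < (1 - (1 + ka) `^ (- al)) * (1 - al).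
Proof.
case: H => /andP[a0 a1] _ k0 _ _ _; rewrite mulr_gt0 ?subr_gt0 //.
rewrite powRN invf_lt1 ?powR_gt0 ?addr_gt0 //.
have : 1 `^ al < (1 + ka) `^ al by rewrite gt0_ltr_powR ?nnegrE //; lra.
by rewrite powR1.
Qed.

(** As Re b >= (1 + ka) la, the subtracted la^al is at most the fraction (1 + ka)^(-al) of the real
    part of the power, and a fixed share of it remains. *)
Lemma symb_coercive z : normc z < 1 ->
  (1 - (1 + ka) `^ (- al)) * (1 - al) * normc (c - z) `^ al
    <= complex.Re (pseval (symb b al la) z).
Proof.
move=> z1; rewrite pseval_symb //; set P := cpow _ _; rewrite ReD ReN (ReR (la `^ al)).
have w0 := Re_base_gt0 z1; case: (H) => a01 l0 k0 M0 hR hI; have /andP[a0 a1] := a01.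
have k1 : 0 < 1 + ka by lra.
have h1 : la `^ al <= (1 + ka) `^ (- al) * complex.Re P.
  rewrite powRN mulrC ler_pdivlMr ?powR_gt0 // -powRM ?(ltW l0) ?(ltW k1) //.
  apply: le_trans (Re_cpow_ge_Re w0 a01).
  rewrite ge0_ler_powR ?nnegrE ?(ltW a0) ?(ltW w0) ?mulr_ge0 ?(ltW l0) ?(ltW k1) //.
  by rewrite mulrC; apply: le_trans hR (ltW (Re_base z1)).
have k2 : 0 <= 1 - (1 + ka) `^ (- al).
  have := coercive_const_gt0; rewrite pmulr_lgt0; first by move/ltW.
  by lra.
have h2 := ler_wpM2l k2 (Re_cpow_ge_norm w0 a01).
by rewrite -mulrA; apply: le_trans h2 _; rewrite -/P; lra.
Qed.

(** A lower bound uniform in z but degenerating with la; it serves only the qualitative boundedness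
    of the response. *)
Lemma symb_lower z : normc z < 1 ->
  ((1 + ka) `^ al - 1) * la `^ al <= complex.Re (pseval (symb b al la) z).
Proof.
move=> z1; rewrite pseval_symb //; set P := cpow _ _; rewrite ReD ReN (ReR (la `^ al)).
have w0 := Re_base_gt0 z1; case: (H) => a01 l0 k0 M0 hR hI; have /andP[a0 a1] := a01.
have k1 : 0 < 1 + ka by lra.
rewrite mulrBl mul1r lerD2r; apply: le_trans (Re_cpow_ge_Re w0 a01).
rewrite -powRM ?(ltW l0) ?(ltW k1) //.
rewrite ge0_ler_powR ?nnegrE ?(ltW a0) ?(ltW w0) ?mulr_ge0 ?(ltW l0) ?(ltW k1) //.
by apply: le_trans hR (ltW (Re_base z1)).
Qed.

(* The recursion of the binomial coefficients reads (c - z) theta P = - al z P,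
   and theta turns it into relations for theta^2 P and theta^3 P. *)
Lemma bin_coef_theta k : c * theta p k =
  shiftc (theta p) k - al%:C * shiftc p k.
Proof.
have c0 : c != 0 by apply: Re_gt0_neq0; apply: lt_le_trans sp_Re_c.
case: k => [|k]; rewrite /theta /=; first by rewrite mul0r !mulr0 subr0.
have h := bin_coefS al k c0; rewrite -/p in h.
by rewrite -[LHS](subrK (k%:R * p k)) h; ring.
Qed.

Lemma theta_shiftc q k : theta (shiftc q) k = shiftc (fun n => theta q n + q n) k.
Proof. by case: k => [|k]; rewrite /theta /= ?mul0r // -natr1; ring. Qed.

Lemma bin_coef_theta2 k : c * theta (theta p) k =
  shiftc (fun n => theta (theta p) n + theta p n) k - al%:C * shiftc (fun n => theta p n + p n) k.
Proof.
rewrite -!theta_shiftc /theta mulrCA -/(theta p k) bin_coef_theta /theta; ring.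
Qed.

Lemma bin_coef_theta3 k : c * theta (theta (theta p)) k =
  shiftc (fun n => theta (theta (theta p)) n + theta (theta p) n + (theta (theta p) n + theta p n)) k
  - al%:C * shiftc (fun n => theta (theta p) n + theta p n + (theta p n + p n)) k.
Proof.
rewrite (_ : (fun n => theta (theta (theta p)) n + _ + _) =
  (fun n => theta (fun n => theta (theta p) n + theta p n) n + (theta (theta p) n + theta p n))); last first.
  by apply/funext => n; rewrite /theta; ring.
rewrite (_ : (fun n => theta (theta p) n + theta p n + _) =
  (fun n => theta (fun n => theta p n + p n) n + (theta p n + p n))); last first.
  by apply/funext => n; rewrite /theta; ring.
rewrite -!theta_shiftc [in LHS]/theta mulrCA -/(theta (theta p) k) bin_coef_theta2 /theta; ring.
Qed.

Lemma theta_symb : theta (symb b al la) = theta p.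
Proof. apply/funext => -[|k]; rewrite /theta /symb; first by rewrite mulr0n !mul0r.
by rewrite [_ == _]/= mulr0n mul0r subr0. Qed.

Local Opaque pseval.

Section AtPoint.
Variables (z : R[i]) (z1 : normc z < 1).
Let e0 := pseval p z.
Let e1 := pseval (theta p) z.
Let e2 := pseval (theta (theta p)) z.
Let e3 := pseval (theta (theta (theta p))) z.
Let w := c - z.

Lemma theta_evals :
  [/\ w * e1 = - al%:C * z * e0, w * e2 = z * (e1 - al%:C * (e1 + e0)) &
      w * e3 = z * (e2 + e2 + e1 - al%:C * (e2 + e1 + (e1 + e0)))].
Proof.
have b0 := pscoef_bounded_p; have b1 := pscoef_bounded_theta b0.
have b2 := pscoef_bounded_theta b1; have b3 := pscoef_bounded_theta b2.
have c0 := pseval_cvg b0 z1; have c1 := pseval_cvg b1 z1.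
have c2 := pseval_cvg b2 z1; have c3 := pseval_cvg b3 z1.
have E1 : c * e1 = z * e1 - al%:C * (z * e0).
  apply: pscvg_unique (pscvgZ c c1) _.
  apply: pscvg_ext (fsym bin_coef_theta) _.
  exact: pscvgB (pscvg_shiftc c1) (pscvgZ al%:C (pscvg_shiftc c0)).
have E2 : c * e2 = z * (e2 + e1) - al%:C * (z * (e1 + e0)).
  apply: pscvg_unique (pscvgZ c c2) _.
  apply: pscvg_ext (fsym bin_coef_theta2) _.
  exact: pscvgB (pscvg_shiftc (pscvgD c2 c1)) (pscvgZ al%:C (pscvg_shiftc (pscvgD c1 c0))).
have E3 : c * e3 = z * (e3 + e2 + (e2 + e1)) - al%:C * (z * (e2 + e1 + (e1 + e0))).
  apply: pscvg_unique (pscvgZ c c3) _.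
  apply: pscvg_ext (fsym bin_coef_theta3) _.
  exact: pscvgB (pscvg_shiftc (pscvgD (pscvgD c3 c2) (pscvgD c2 c1)))
    (pscvgZ al%:C (pscvg_shiftc (pscvgD (pscvgD c2 c1) (pscvgD c1 c0)))).
rewrite /w !(mulrBl _ _ c) || rewrite /w.
by split; rewrite mulrBl ?E1 ?E2 ?E3; ring.
Qed.

Let y := normc (1 - z).
Let K := 2 + M.
Let F := y `^ al / y.

Lemma disc_gt0 : 0 < y. Proof. by apply: Re_gt0_normc; exact: Re_disc. Qed.

(** The exponent al - 1 is negative, so the lower bound [base_ge] on |w| becomes an upper bound;
    K^(1 - al) <= K as K >= 1. *)
Lemma normc_e0_div : normc e0 / normc w <= K * F.
Proof.
case: (H) => /andP[a0 a1] _ _ M0 _ _.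
have y0 := disc_gt0; have w0 := Re_gt0_normc (Re_base_gt0 z1).
have K1 : 1 <= K by rewrite /K; lra.
have K0 : 0 < K by lra.
rewrite /e0 pseval_p // normc_cpow -/w /F.
have powB (x : R) : 0 < x -> x `^ al / x = (x `^ (1 - al))^-1.
  move=> x0; rewrite -powRN opprB powRB ?powRr1 ?(ltW x0) //.
  by apply/implyP => _; rewrite gt_eqF.
rewrite !powB // -[K]invrK -invfM lef_pV2 ?posrE ?powR_gt0 ?mulr_gt0 ?invr_gt0 ?powR_gt0 //.
rewrite mulrC ler_pdivrMr // [X in _ <= X]mulrC.
have a10 : 0 <= 1 - al by lra.
apply: le_trans (_ : (K * normc w) `^ (1 - al) <= _).
  rewrite ge0_ler_powR ?nnegrE ?(ltW y0) ?mulr_ge0 ?(ltW K0) ?(ltW w0) //.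
  exact: base_ge.
rewrite powRM ?(ltW K0) ?(ltW w0) //; apply: ler_wpM2r; rewrite ?powR_ge0 //.
by apply: ler1_powR; lra.
Qed.

(** Each relation of [theta_evals] divides by w, which costs K / y: one application of theta per
    power of 1 / y. *)
Lemma theta_bounds :
  [/\ normc (pseval (theta (symb b al la)) z) <= K * F,
      normc (pseval (theta (theta (symb b al la))) z) <= 4 * K ^+ 2 * (F / y) &
      normc (pseval (theta (theta (theta (symb b al la)))) z) <= 22 * K ^+ 3 * (F / y ^+ 2)].
Proof.
rewrite theta_symb -/e1 -/e2 -/e3.
case: (H) => /andP[a0 a1] _ _ M0 _ _.
have y0 := disc_gt0; have w0 := Re_gt0_normc (Re_base_gt0 z1).
have K1 : 2 <= K by rewrite /K; lra.
have K0 : 0 < K by lra.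
have [E1 E2 E3] := theta_evals.
have B0 := normc_e0_div.
have F0 : 0 <= F by rewrite /F divr_ge0 ?powR_ge0 ?ltW.
have z0 := normc_ge0 z.
have nal : normc al%:C = al by rewrite normc_real gtr0_norm.
have yw : (normc w)^-1 <= K / y.
  rewrite -[K]invrK -invfM lef_pV2 ?posrE ?mulr_gt0 ?invr_gt0 //.
  by rewrite mulrC ler_pdivrMr // mulrC; exact: base_ge.
(* With y <= 2 and K >= 2, every term with fewer powers of 1 / y is absorbed by the leading one; the
   constants 4 and 22 leave some slack. *)
have y2 : 1 <= 2 / y by rewrite ler_pdivlMr // mul1r; exact: normc_disc_le2.
have key (e r : R[i]) B : w * e = z * r -> normc r <= B -> normc e <= B / normc w.
  move=> he hr; rewrite ler_pdivlMr // mulrC -normcM he normcM.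
  apply: le_trans hr; apply: ler_piMl; rewrite ?normc_ge0 // ltW //.
have n0 := normc_ge0 e0; have n1 := normc_ge0 e1; have n2 := normc_ge0 e2.
have A1 : normc e1 <= normc e0 / normc w.
  apply: (key _ (- al%:C * e0)); first by rewrite E1; ring.
  rewrite normcM normc_opp nal; apply: ler_piMl => //; exact: ltW.
have A2 : normc e2 <= (2 * normc e1 + normc e0) / normc w.
  apply: key E2 _; apply: le_trans (ler_normcB _ _) _; rewrite normcM nal.
  have := ler_normcD e1 e0 => h.
  have h2 : al * normc (e1 + e0) <= normc e1 + normc e0.
    by apply: le_trans h; apply: ler_piMl; rewrite ?normc_ge0 // ltW.
  lra.
have A3 : normc e3 <= (3 * normc e2 + 3 * normc e1 + normc e0) / normc w.
  apply: key E3 _; apply: le_trans (ler_normcB _ _) _; rewrite normcM nal.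
  have h : normc (e2 + e1 + (e1 + e0)) <= normc e2 + normc e1 + (normc e1 + normc e0).
    by apply: le_trans (ler_normcD _ _) (lerD _ _); exact: ler_normcD.
  have h2 : al * normc (e2 + e1 + (e1 + e0)) <= normc e2 + normc e1 + (normc e1 + normc e0).
    by apply: le_trans h; apply: ler_piMl; rewrite ?normc_ge0 // ltW.
  have h3 : normc (e2 + e2 + e1) <= normc e2 + normc e2 + normc e1.
    by apply: le_trans (ler_normcD _ _) _; rewrite lerD2r ler_normcD.
  lra.
have C1 : normc e1 <= K * F by exact: le_trans B0.
have Fy : 0 <= F / y by rewrite divr_ge0 // ltW.
have FE : F <= 2 * (F / y) by rewrite mulrCA ler_peMr.
have FE2 : F / y <= 2 * (F / y ^+ 2).
  have -> : 2 * (F / y ^+ 2) = F / y * (2 / y) by field; rewrite gt_eqF.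
  by rewrite ler_peMr.
have Fy2 : 0 <= F / y ^+ 2 by rewrite divr_ge0 // exprn_ge0 // ltW.
have iw : 0 <= (normc w)^-1 by rewrite invr_ge0 ltW.
have C2 : normc e2 <= 4 * K ^+ 2 * (F / y).
  apply: le_trans A2 _; rewrite mulrDl.
  have h1 : 2 * normc e1 / normc w <= 2 * (K * F) * (K / y).
    by apply: ler_pM => //; [rewrite mulr_ge0|rewrite ler_pM2l].
  have h2 : K * F <= K ^+ 2 * (F / y).
    have -> : K ^+ 2 * (F / y) = K * (K * (F / y)) by ring.
    rewrite ler_pM2l //; apply: le_trans FE _; exact: ler_wpM2r.
  have h3 : 2 * (K * F) * (K / y) = 2 * (K ^+ 2 * (F / y)) by ring.
  have h4 : 0 <= K ^+ 2 * (F / y) by rewrite mulr_ge0 // exprn_ge0 // ltW.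
  have -> : 4 * K ^+ 2 * (F / y) = 4 * (K ^+ 2 * (F / y)) by ring.
  apply: le_trans (lerD h1 B0) _; rewrite h3; lra.
split => //.
apply: le_trans A3 _; rewrite mulrDl [X in X + _ <= _]mulrDl.
set X := K ^+ 3 * (F / y ^+ 2).
have X0 : 0 <= X by rewrite mulr_ge0 // exprn_ge0 // ltW.
have h1 : 3 * normc e2 / normc w <= 3 * (4 * K ^+ 2 * (F / y)) * (K / y).
  by apply: ler_pM => //; [rewrite mulr_ge0|rewrite ler_pM2l].
have h1' : 3 * (4 * K ^+ 2 * (F / y)) * (K / y) = 12 * X.
  by rewrite /X; field; rewrite gt_eqF.
have h2 : 3 * normc e1 / normc w <= 3 * (K * F) * (K / y).
  by apply: ler_pM => //; [rewrite mulr_ge0|rewrite ler_pM2l].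
have Q : K ^+ 2 * (F / y) <= X.
  rewrite /X [K ^+ 3]exprSr -mulrA ler_pM2l ?exprn_gt0 //.
  by apply: le_trans FE2 _; exact: ler_wpM2r.
have h2' : 3 * (K * F) * (K / y) = 3 * (K ^+ 2 * (F / y)) by ring.
have h3 : K * F <= X.
  apply: le_trans Q.
  have -> : K ^+ 2 * (F / y) = K * (K * (F / y)) by ring.
  by rewrite ler_pM2l //; apply: le_trans FE _; exact: ler_wpM2r.
have -> : 22 * K ^+ 3 * (F / y ^+ 2) = 22 * X by rewrite /X; ring.
apply: le_trans (lerD (lerD h1 h2) B0) _; rewrite h1' h2'; lra.
Qed.

End AtPoint.
End OneSymbol.
End SymbolBounds.

(** * Decay of the impulse response *)

Section ScalarSeries.
Variable R : realType.

(* Parseval's identity turns positivity of the real part of the symbol on the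
   disc into a weighted l2 estimate for truncated sequences. *)
Lemma energy_scalar (d x : nat -> R[i]) (c0 rho : R) (N : nat) :
  pscoef_bounded d -> 0 < c0 -> 0 < rho < 1 ->
  (forall z, normc z < 1 -> c0 <= complex.Re (pseval d z)) ->
  c0 / 2 * (\sum_(n < N.+1) normc (x n) ^+ 2 * rho ^+ n.*2)
  <= complex.Re (\sum_(n < N.+1) ((x n)^*)%C * cauchy_prod d x n * (rho ^+ n.*2)%:C).
Proof.
move=> hd c00 /andP[r0 r1] hc.
have h : 0 <= rho < 1 by rewrite ltW.
have [t [t0 ht]] := psum_tail hd h.
(* Half of the coercivity is given up to the truncation of d. *)
have c2 : 0 < c0 / 2 by rewrite divr_gt0.
have [J0 HJ] := cvg0_leP t0 c2.
(* J > N makes the truncated product agree with the Cauchy product up to degree N, and M holds the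
   whole product, so that no aliasing occurs. *)
pose J := (J0 + N.+1)%N; pose M := (J + N.+1)%N.
have JJ : (J0 <= J)%N by rewrite leq_addr.
have NJ : (N < J)%N by rewrite /J addnS ltnS leq_addl.
have NM : (N.+1 <= M)%N by rewrite leq_addl.
pose X : {poly R[i]} := \poly_(n < N.+1) x n.
pose D : {poly R[i]} := \poly_(k < J) d k.
have sX : (size X <= M)%N by apply: leq_trans (size_poly _ _) NM.
have sDX : (size (D * X)%R <= M)%N.
  apply: leq_trans (size_polyMleq _ _) _; apply: leq_trans (leq_pred _) _.
  by apply: leq_add; exact: size_poly.
have M0 : 0 < M%:R :> R by rewrite ltr0n /M addnS.
have cX n : X`_n = if (n < N.+1)%N then x n else 0 by rewrite coef_poly.
have E1 : \sum_(i < M) ((X`_i)^*)%C * (D * X)`_i * (rho ^+ i.*2)%:C =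
    \sum_(n < N.+1) ((x n)^*)%C * cauchy_prod d x n * (rho ^+ n.*2)%:C.
  rewrite (big_ord_widen_cond M xpredT (fun n => ((x n)^*)%C * cauchy_prod d x n * (rho ^+ n.*2)%:C)) //=.
  rewrite [RHS]big_mkcond; apply: eq_bigr => n _; rewrite cX.
  case: ifP => nN; last by rewrite conjc0 !mul0r.
  congr (_ * _ * _); rewrite coefM; apply: eq_bigr => k _.
  have kn : (k <= n)%N by rewrite -ltnS.
  rewrite coef_poly cX.
  rewrite (leq_ltn_trans kn (leq_ltn_trans _ NJ)) //.
  by rewrite (leq_ltn_trans (leq_subr _ _) nN).
have E2 : \sum_(i < M) normc X`_i ^+ 2 * rho ^+ i.*2 =
    \sum_(n < N.+1) normc (x n) ^+ 2 * rho ^+ n.*2.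
  rewrite (big_ord_widen_cond M xpredT (fun n => normc (x n) ^+ 2 * rho ^+ n.*2)) //=.
  rewrite [RHS]big_mkcond; apply: eq_bigr => n _; rewrite cX.
  by case: ifP => // _; rewrite normc0 expr0n mul0r.
have P1 := @parseval _ X (D * X) rho M sX sDX.
have P2 := @parseval_norm _ X rho M sX.
rewrite -E1 -E2 -(@ler_pM2l _ M%:R) // mulrCA -P2.
rewrite -(ReZ M%:R) rmorph_nat -P1 Re_sum mulr_sumr; apply: ler_sum => k _.
set z := circle_pt rho M k.
have zr : normc z = rho by rewrite normc_circle_pt // ltW.
have z1 : normc z < 1 by rewrite zr.
have -> : (X.[z]^*)%C * (D * X).[z] = (normc X.[z] ^+ 2)%:C * D.[z].
  by rewrite hornerM -conj_mul_normc; ring.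
rewrite ReZ mulrC; apply: ler_wpM2l; first by rewrite exprn_ge0 ?normc_ge0.
have := ht z zr J; rewrite psum_poly -/D => hz.
have := le_trans (ler_norm _) (HJ J JJ) => hz2.
have := le_trans (Re_abs_le (le_trans hz hz2)) (lexx _); rewrite ReD ReN => /ler_normlP[+ _].
by have := hc z z1; rewrite opprB; lra.
Qed.

(** On the circle of radius 1 - 1/(2n) one has |1 - z|^(-al) <= (2n)^al <= 2 n^al, 1 / (1 - rho^2)
    <= 2n and rho^n >= 1/2. With the factor 4 of [coef_bound] the product of constants is 32. *)
Lemma weighted_coef_bound (q : nat -> R[i]) (al B0 : R) : 0 < al < 1 -> 0 <= B0 ->
  pscoef_bounded q ->
  (forall z, normc z < 1 ->
     normc (pseval q z) <= B0 / normc (1 - z) `^ al / normc (1 - z) ^+ 2) ->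
  forall n, (0 < n)%N -> normc (q n) <= 32 * B0 * n%:R `^ al * n%:R.
Proof.
move=> /andP[a0 a1] B00 hq hb n n0.
have nr : 1 <= n%:R :> R by rewrite ler1n.
pose eta : R := (2 * n%:R)^-1.
have e0 : 0 < eta by rewrite invr_gt0; lra.
have e1 : eta <= 2^-1 by rewrite lef_pV2 ?posrE; lra.
pose rho := 1 - eta.
have rho01 : 0 < rho < 1 by rewrite /rho; apply/andP; split; lra.
have ea : 0 < eta `^ al by rewrite powR_gt0.
have B1 : 0 <= B0 / eta `^ al by rewrite divr_ge0 // ltW.
have hb' z : normc z = rho -> normc (pseval q z) <= (B0 / eta `^ al) / normc (1 - z) ^+ 2.
  move=> zr; have z1 : normc z < 1 by rewrite zr; case/andP: rho01.
  apply: le_trans (hb z z1) _.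
  have y1 : eta <= normc (1 - z).
    apply: le_trans (ler_dist_normc 1 z); rewrite normc1 zr /rho opprB addrCA subrr addr0.
    exact: ler_norm.
  apply: ler_wpM2r; first by rewrite invr_ge0 exprn_ge0 ?normc_ge0.
  apply: ler_wpM2l => //; rewrite lef_pV2 ?posrE ?powR_gt0 //; last exact: lt_le_trans y1.
  by rewrite ge0_ler_powR ?nnegrE ?normc_ge0 // ltW.
have := coef_bound n hq rho01 B1 hb'.
have bern : 2^-1 <= rho ^+ n.
  have H m : 1 - m%:R * eta <= rho ^+ m.
    elim: m => [|m IH]; first by rewrite mul0r subr0 expr0.
    rewrite exprS; have h : rho * (1 - m%:R * eta) <= rho * rho ^+ m.
      by rewrite ler_pM2l //; case/andP: rho01.
    apply: le_trans h; rewrite /rho -natr1.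
    have : 0 <= m%:R * eta * eta by rewrite !mulr_ge0 // ltW.
    by lra.
  apply: le_trans (H n); rewrite /eta invfM mulrCA mulfV ?mulr1; last by rewrite gt_eqF; lra.
  by lra.
have r2 : eta <= 1 - rho ^+ 2.
  have -> : 1 - rho ^+ 2 = eta + eta * (1 - eta) by rewrite /rho; ring.
  by rewrite lerDl mulr_ge0; lra.
move=> h.
have h1 : normc (q n) / 2 <= 4 * (B0 / eta `^ al) / eta.
  apply: le_trans (le_trans h _).
    by apply: ler_wpM2l; rewrite ?normc_ge0.
  apply: ler_wpM2l; first by rewrite mulr_ge0.
  by rewrite lef_pV2 ?posrE //; exact: lt_le_trans r2.
have iea : (eta `^ al)^-1 <= 2 * n%:R `^ al.
  rewrite -powRN /eta -powR_inv1; last by lra.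
  rewrite -powRrM mulrN mulN1r opprK powRM ?ler0n //; apply: ler_wpM2r; first exact: powR_ge0.
  by apply: ler1_powR; lra.
have h2 : 4 * (B0 / eta `^ al) / eta <= 4 * (B0 * (2 * n%:R `^ al)) * (2 * n%:R).
  rewrite {2}/eta invrK; apply: ler_wpM2r; first by lra.
  by apply: ler_wpM2l => //; apply: ler_wpM2l.
have -> : 32 * B0 * n%:R `^ al * n%:R = 2 * (4 * (B0 * (2 * n%:R `^ al)) * (2 * n%:R)) by ring.
by lra.
Qed.

End ScalarSeries.

Lemma vdot_psum_cvg (R : realType) (I : finType) (g : I -> R[i]) (q : I -> nat -> R[i]) z (S : I -> R[i]) :
  (forall i, pscvg (q i) z (S i)) -> pscvg (fun n => vdot g (fun i => q i n)) z (vdot g S).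
Proof. by move=> hq; apply: pscvg_sum => i; apply: pscvgZ. Qed.

Lemma pscoef_bounded_vdot (R : realType) (I : finType) (g : I -> R[i]) (q : I -> nat -> R[i]) :
  (forall i, pscoef_bounded (q i)) -> pscoef_bounded (fun n => vdot g (fun i => q i n)).
Proof. by move=> hq; apply: pscoef_bounded_sum => i; apply: pscoef_boundedZ. Qed.

(** The sum 52 + 3 * 6 + 3 * 2 + 4 = 80, isolated so that linear arithmetic sees only atoms. *)
Lemma chained_bound (R : realType) (x0 x1 x2 x3 y0 y1 y2 y3 : R) : x0 <= x1 -> x1 <= x2 -> x2 <= x3 ->
  y0 <= 4 * x0 -> y1 <= 2 * x1 -> y2 <= 6 * x2 -> y3 <= 52 * x3 ->
  y3 + (3 * y2 + 3 * y1 + y0) <= 80 * x3.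
Proof. lra. Qed.

Local Opaque pseval symb.

Ltac nneg := repeat lazymatch goal with
  | |- is_true (0 <= _ * _) => apply: mulr_ge0
  | |- is_true (0 <= _ + _) => apply: addr_ge0
  | |- is_true (0 <= _ ^+ _) => apply: exprn_ge0
  | |- is_true (0 <= _ ^-1) => rewrite invr_ge0
  | |- is_true (0 <= _ `^ _) => apply: powR_ge0
  | |- is_true (0 <= normc _) => apply: normc_ge0
  | |- is_true (0 <= vnorm _) => apply: vnorm_ge0
  | |- is_true (0 <= _ %:R) => exact: ler0n
  | H : is_true (0 <= ?x) |- is_true (0 <= ?x) => exact: H
  | H : is_true (0 < ?x) |- is_true (0 <= ?x) => exact: (ltW H)
  end.

(** * Resolvent estimate and decay of the impulse response *)

Section Resolvent.
Variables (R : realType) (I : finType).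
Variables (b : I -> R[i]) (al la ka M : R).
Hypotheses (Hal : 0 < al < 1) (Hla : 0 < la) (Hka : 0 < ka) (HM : 0 <= M).
Hypothesis H : forall i, symbol_params (b i) al la ka M.
Variable a : I -> I -> R[i].
Hypothesis a_diss : forall x : I -> R[i],
  complex.Re (vdot x (fun i => \sum_j a i j * x j)) <= 0.

Let d i := symb (b i) al la.

(** The scheme multiplied by tau^alpha: the time step survives only inside [b], [la] and [a]. *)
Definition scheme_lhs (u : nat -> I -> R[i]) (n : nat) (i : I) : R[i] :=
  cauchy_prod (d i) (fun k => u k i) n - \sum_j a i j * u n j.

Definition coercive_const : R := (1 - (1 + ka) `^ (- al)) * (1 - al).
Definition resolvent_const : R := (2 + M) `^ al / coercive_const.

Lemma coercive_const_pos : 0 < coercive_const.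
Proof.
have /andP[a0 a1] := Hal; have k0 := Hka.
rewrite mulr_gt0 ?subr_gt0 // powRN invf_lt1 ?powR_gt0 ?addr_gt0 //.
have : 1 `^ al < (1 + ka) `^ al by rewrite gt0_ltr_powR ?nnegrE //; lra.
by rewrite powR1.
Qed.

Lemma resolvent_const_gt0 : 0 < resolvent_const.
Proof. by rewrite divr_gt0 ?coercive_const_pos // powR_gt0 //; have := HM; lra. Qed.

(** Pair the equation with x. The diagonal part contributes at least m |x|^2 to the real part and
    the dissipative part has the favourable sign, so neither the size of [a] nor the dimension
    enters. *)
Lemma resolvent_bound (x f : I -> R[i]) z : normc z < 1 ->
  (forall i, pseval (d i) z * x i - \sum_j a i j * x j = f i) ->
  vnorm x <= resolvent_const / normc (1 - z) `^ al * vnorm f.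
Proof.
move=> z1 hx; have /andP[a0 a1] := Hal.
have c0 := coercive_const_pos.
have y0 := @disc_gt0 R z z1.
have K0 : 0 < 2 + M by have := HM; lra.
set y := normc (1 - z) in y0 *.
pose m := coercive_const * (y / (2 + M)) `^ al.
have m0 : 0 < m by rewrite mulr_gt0 // powR_gt0 // divr_gt0.
have hm i : m <= complex.Re (pseval (d i) z).
  apply: le_trans (symb_coercive (H i) z1); apply: ler_wpM2l; first exact: ltW.
  rewrite ge0_ler_powR ?nnegrE ?normc_ge0 ?divr_ge0 ?(ltW a0) ?(ltW y0) ?(ltW K0) //.
  by rewrite ler_pdivrMr // mulrC (base_ge (H i) z1).
have -> : resolvent_const / y `^ al = m^-1.
  rewrite /resolvent_const /m powRM ?(ltW y0) ?invr_ge0 ?(ltW K0) //.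
  rewrite -(powR_inv1 (ltW K0)) -powRrM mulN1r powRN; field.
  by rewrite !gt_eqF ?powR_gt0.
rewrite mulrC ler_pdivlMr // mulrC.
have E : m * vnorm x ^+ 2 <= vnorm x * vnorm f.
  apply: le_trans (normc_vdot x f).
  apply: le_trans (le_trans (ler_norm _) (ler_Re_normc _)).
  have -> : vdot x f = vdot x (fun i => pseval (d i) z * x i) -
       vdot x (fun i => \sum_j a i j * x j).
    rewrite /vdot -sumrB; apply: eq_bigr => i _; by rewrite -hx mulrBr.
  rewrite ReD ReN; apply: le_trans (_ : complex.Re (vdot x (fun i => pseval (d i) z * x i)) <= _); last first.
    by rewrite lerDl oppr_ge0.
  rewrite vnorm_sqr mulr_sumr /vdot Re_sum; apply: ler_sum => i _.
  have -> : ((x i)^*)%C * (pseval (d i) z * x i) = (normc (x i) ^+ 2)%:C * pseval (d i) z.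
    by rewrite -conj_mul_normc; ring.
  rewrite ReZ mulrC; apply: ler_wpM2l => //.
  by rewrite exprn_ge0 ?normc_ge0.
have [x0|x0] := eqVneq (vnorm x) 0; first by rewrite x0 mulr0 vnorm_ge0.
have xp : 0 < vnorm x by rewrite lt_def x0 vnorm_ge0.
by rewrite -(ler_pM2l xp); apply: le_trans E; rewrite mulrCA expr2.
Qed.

Section Impulse.
Variables (v : I -> R[i]) (u : nat -> I -> R[i]).
Hypothesis Hu : forall n i, scheme_lhs u n i = (n == 0%N)%:R * v i.

Let ui i n := u n i.

(** Evaluating the generating function in the disc presupposes its convergence there. The energy
    inequality provides it: summed over all components, only the term n = 0 of the right-hand side
    survives dissipativity, so the weighted sum of squares is bounded independently of N. *)
Lemma impulse_bounded i : pscoef_bounded (ui i).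
Proof.
have k1 : 1 < (1 + ka) `^ al.
  have /andP[a0 a1] := Hal; have k0 := Hka.
  have : 1 `^ al < (1 + ka) `^ al by rewrite gt0_ltr_powR ?nnegrE //; lra.
  by rewrite powR1.
pose c0 := ((1 + ka) `^ al - 1) * la `^ al.
have c00 : 0 < c0 by rewrite mulr_gt0 ?subr_gt0 // powR_gt0.
pose E := vnorm (u 0%N) * vnorm v.
have E0 : 0 <= E by rewrite mulr_ge0 ?vnorm_ge0.
move=> rho0 h; have [rho [rr r0 r1 _]] := mid_radius h; have /andP[h0 h1] := h.
exists (1 + 2 * E / c0) => N.
have B0 : 0 <= 2 * E / c0 by apply: divr_ge0; [apply: mulr_ge0|exact: ltW].
apply: le_trans (_ : normc (u N i) * rho ^+ N <= _).
  by apply: ler_wpM2l; rewrite ?normc_ge0 // lerXn2r ?nnegrE // ltW.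
have rp : 0 < rho < 1 by rewrite r0.
have key : c0 / 2 * (normc (u N i) ^+ 2 * rho ^+ N.*2) <= E.
  have S j := @energy_scalar R (d j) (ui j) c0 rho N (pscoef_bounded_symb (H j)) c00 rp
    (fun z z1 => symb_lower (H j) z1).
  have := ler_sum (P := xpredT) (index_enum I) (fun j _ => S j) => SS.
  apply: le_trans (le_trans _ SS) _.
    rewrite -mulr_sumr ler_pM2l ?divr_gt0 //.
    have ge0 j (n : nat) : 0 <= normc (ui j n) ^+ 2 * rho ^+ n.*2.
      by rewrite mulr_ge0 ?exprn_ge0 ?normc_ge0 ?(ltW r0).
    rewrite (bigD1 i) //= big_ord_recr /= addrAC lerDr addr_ge0 //.
      by apply: sumr_ge0.
    by apply: sumr_ge0 => j _; apply: sumr_ge0.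
  rewrite -Re_sum exchange_big /= Re_sum.
  have T (n : 'I_N.+1) : true -> complex.Re (\sum_j ((ui j n)^*)%C * cauchy_prod (d j) (ui j) n * (rho ^+ n.*2)%:C)
     <= (n == 0%N :> nat)%:R * E.
    move=> _; rewrite -mulr_suml mulrC ReZ.
    have -> : \sum_j ((ui j n)^*)%C * cauchy_prod (d j) (ui j) n =
       vdot (u n) (fun i => \sum_j a i j * u n j) + (n == 0%N :> nat)%:R * vdot (u n) v.
      rewrite /vdot mulr_sumr -big_split /=; apply: eq_bigr => j _.
      have := Hu n j; rewrite /scheme_lhs -/(ui j) => /eqP; rewrite subr_eq => /eqP ->.
      by rewrite /ui; ring.
    rewrite ReD mulrDr; apply: le_trans (_ : rho ^+ n.*2 * complex.Re ((n == 0%N :> nat)%:R * vdot (u n) v) <= _).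
      by rewrite gerDr mulr_ge0_le0 // exprn_ge0 // ltW.
    case: n => [[|n] nN] /=; last by rewrite !mul0r ReR mulr0.
    rewrite expr0 !mul1r; apply: le_trans (normc_vdot _ _).
    exact: le_trans (ler_norm _) (ler_Re_normc _).
  apply: le_trans (ler_sum _ T) _.
  rewrite big_ord_recl /= mul1r big1 ?addr0 // => n _; by rewrite mul0r.
set X := normc _ * _.
have X0 : 0 <= X by rewrite /X; nneg.
have X2 : X ^+ 2 <= 2 * E / c0.
  rewrite ler_pdivlMr // exprMn -exprM mulrC muln2; move: key; lra.
(* From X^2 <= 2 E / c0 and 2 X <= X^2 + 1. *)
have : 0 <= (X - 1) ^+ 2 by rewrite sqr_ge0.
rewrite sqrrB1; have := X2; move: (X ^+ 2) => Y; lra.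
Qed.

Let hd i := pscoef_bounded_symb (H i).

Section AtPoint.
Variables (z : R[i]) (z1 : normc z < 1).

Let d0 i := pseval (d i) z.
Let d1 i := pseval (theta (d i)) z.
Let d2 i := pseval (theta (theta (d i))) z.
Let d3 i := pseval (theta (theta (theta (d i)))) z.
Let U0 i := pseval (ui i) z.
Let U1 i := pseval (theta (ui i)) z.
Let U2 i := pseval (theta (theta (ui i))) z.
Let U3 i := pseval (theta (theta (theta (ui i)))) z.

(** Theta kills the source, which sits at n = 0. By Leibniz each derivative then solves the same
    resolvent equation, with lower derivatives as data. *)
Lemma impulse_eval :
  [/\ forall i, d0 i * U0 i - \sum_j a i j * U0 j = v i,
      forall i, d0 i * U1 i - \sum_j a i j * U1 j = - (d1 i * U0 i),
      forall i, d0 i * U2 i - \sum_j a i j * U2 j = - (2 * d1 i * U1 i + d2 i * U0 i) &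
      forall i, d0 i * U3 i - \sum_j a i j * U3 j
        = - (3 * d1 i * U2 i + 3 * d2 i * U1 i + d3 i * U0 i)].
Proof.
have td i := pscoef_bounded_theta (hd i).
have bu := @impulse_bounded.
have tu i := pscoef_bounded_theta (bu i).
have td2 i := pscoef_bounded_theta (td i).
have tu2 i := pscoef_bounded_theta (tu i).
have td3 i := pscoef_bounded_theta (td2 i).
have tu3 i := pscoef_bounded_theta (tu2 i).
have ev p (hp : pscoef_bounded p) := pseval_cvg hp z1.
have A (F : I -> nat -> R[i]) (hF : forall j, pscoef_bounded (F j)) i :
    pscvg (fun n => \sum_j a i j * F j n) z (\sum_j a i j * pseval (F j) z).
  by apply: pscvg_sum => j; apply: pscvgZ; exact: ev.
have Cc p q (hp : pscoef_bounded p) (hq : pscoef_bounded q) :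
    pscvg (cauchy_prod p q) z (pseval p z * pseval q z).
  exact: pscvg_cauchy hp hq z1 (ev _ hp) (ev _ hq).
have E i n : cauchy_prod (d i) (ui i) n = \sum_j a i j * ui j n + (n == 0%N)%:R * v i.
  by have := Hu n i; rewrite /scheme_lhs -/(ui i) => /eqP; rewrite subr_eq addrC => /eqP.
have tA (F : I -> nat -> R[i]) i n : theta (fun n => \sum_j a i j * F j n) n = \sum_j a i j * theta (F j) n.
  by rewrite /theta mulr_sumr; apply: eq_bigr => j _; rewrite mulrCA.
have E1 i n : cauchy_prod (theta (d i)) (ui i) n + cauchy_prod (d i) (theta (ui i)) n = \sum_j a i j * theta (ui j) n.
  rewrite -theta_cauchy -tA /theta E mulrDr; case: n => [|n]; first by rewrite mulr0n !mul0r addr0.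
  by rewrite /= mul0r mulr0 addr0.
have tD p q n : theta (fun n => p n + q n) n = theta p n + theta q n by rewrite /theta mulrDr.
have E2 i n : cauchy_prod (theta (theta (d i))) (ui i) n + cauchy_prod (theta (d i)) (theta (ui i)) n +
   (cauchy_prod (theta (d i)) (theta (ui i)) n + cauchy_prod (d i) (theta (theta (ui i))) n)
   = \sum_j a i j * theta (theta (ui j)) n.
  rewrite -!theta_cauchy -tD -tA /theta; congr (_ * _); rewrite -E1; by rewrite /theta.
have E3 i n : cauchy_prod (theta (theta (theta (d i)))) (ui i) n + cauchy_prod (theta (theta (d i))) (theta (ui i)) n +
   (cauchy_prod (theta (theta (d i))) (theta (ui i)) n + cauchy_prod (theta (d i)) (theta (theta (ui i))) n) +
   (cauchy_prod (theta (theta (d i))) (theta (ui i)) n + cauchy_prod (theta (d i)) (theta (theta (ui i))) n +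
   (cauchy_prod (theta (d i)) (theta (theta (ui i))) n + cauchy_prod (d i) (theta (theta (theta (ui i)))) n))
   = \sum_j a i j * theta (theta (theta (ui j))) n.
  rewrite -!theta_cauchy -!tD -tA /theta; congr (_ * _); rewrite -E2; by rewrite /theta.
split=> i.
- apply/eqP; rewrite subr_eq addrC; apply/eqP.
  apply: pscvg_unique (Cc _ _ (hd i) (@impulse_bounded i)) _.
  apply: pscvg_ext (fsym (E i)) _; apply: pscvgD (A _ (@impulse_bounded) i) _.
  have := pscvgZ (v i) (pscvg_delta0 z); rewrite mulr1.
  by apply: pscvg_ext => n; rewrite mulrC.
- have : d1 i * U0 i + d0 i * U1 i = \sum_j a i j * U1 j.
    apply: pscvg_unique (A _ tu i).
    exact: pscvg_ext (E1 i) (pscvgD (Cc _ _ (td i) (bu i)) (Cc _ _ (hd i) (tu i))).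
  by move=> <-; ring.
- have : d2 i * U0 i + d1 i * U1 i + (d1 i * U1 i + d0 i * U2 i) = \sum_j a i j * U2 j.
    apply: pscvg_unique (A _ tu2 i).
    exact: pscvg_ext (E2 i) (pscvgD (pscvgD (Cc _ _ (td2 i) (bu i)) (Cc _ _ (td i) (tu i)))
      (pscvgD (Cc _ _ (td i) (tu i)) (Cc _ _ (hd i) (tu2 i)))).
  by move=> <-; ring.
- have : d3 i * U0 i + d2 i * U1 i + (d2 i * U1 i + d1 i * U2 i) +
    (d2 i * U1 i + d1 i * U2 i + (d1 i * U2 i + d0 i * U3 i)) = \sum_j a i j * U3 j.
    apply: pscvg_unique (A _ tu3 i).
    exact: pscvg_ext (E3 i) (pscvgD (pscvgD (pscvgD (Cc _ _ (td3 i) (bu i)) (Cc _ _ (td2 i) (tu i)))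
      (pscvgD (Cc _ _ (td2 i) (tu i)) (Cc _ _ (td i) (tu2 i))))
      (pscvgD (pscvgD (Cc _ _ (td2 i) (tu i)) (Cc _ _ (td i) (tu2 i)))
      (pscvgD (Cc _ _ (td i) (tu2 i)) (Cc _ _ (hd i) (tu3 i))))).
  by move=> <-; ring.
Qed.

Let y := normc (1 - z).
Let K := 2 + M.
Definition theta_const : R := (1 + resolvent_const) * (2 + M).
Let T := theta_const.

(** The factor |1 - z|^(-al) of the resolvent cancels the |1 - z|^al of the differentiated symbol,
    so each theta costs only T / |1 - z|. The constants follow Leibniz: 6 = 2 + 4 and 52 = 3 * 6 +
    12 + 22. *)
Lemma impulse_theta_bounds :
  [/\ vnorm U0 <= resolvent_const / y `^ al * vnorm v,
      vnorm U1 <= T / y * vnorm U0, vnorm U2 <= 6 * T ^+ 2 / y ^+ 2 * vnorm U0 &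
      vnorm U3 <= 52 * T ^+ 3 / y ^+ 3 * vnorm U0].
Proof.
have [e0 e1 e2 e3] := impulse_eval.
have y0 : 0 < y by exact: disc_gt0.
have ya0 : 0 < y `^ al by exact: powR_gt0.
have R0 := resolvent_const_gt0; set r := resolvent_const in R0 *.
have K2 : 2 <= K by rewrite /K; have := HM; lra.
have K0 : 0 < K by lra.
have F0 : 0 < y `^ al / y by exact: divr_gt0.
have b1 i : normc (d1 i) <= K * (y `^ al / y) by have [] := theta_bounds (H i) z1.
have b2 i : normc (d2 i) <= 4 * K ^+ 2 * (y `^ al / y / y) by have [] := theta_bounds (H i) z1.
have b3 i : normc (d3 i) <= 22 * K ^+ 3 * (y `^ al / y / y ^+ 2) by have [] := theta_bounds (H i) z1.
have nD := vnorm_diag_le.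
set n0 := vnorm U0; set n1 := vnorm U1; set n2 := vnorm U2.
have n00 : 0 <= n0 := vnorm_ge0 _; have n10 : 0 <= n1 := vnorm_ge0 _; have n20 : 0 <= n2 := vnorm_ge0 _.
have B1 x : vnorm (fun i => d1 i * x i) <= K * (y `^ al / y) * vnorm x.
  by apply: vnorm_diag_le => //; rewrite mulr_ge0 ?ltW.
have B2 x : vnorm (fun i => d2 i * x i) <= 4 * K ^+ 2 * (y `^ al / y / y) * vnorm x.
  by apply: vnorm_diag_le => //; rewrite !mulr_ge0 ?exprn_ge0 ?invr_ge0 ?powR_ge0 // ltW.
have B3 x : vnorm (fun i => d3 i * x i) <= 22 * K ^+ 3 * (y `^ al / y / y ^+ 2) * vnorm x.
  by apply: vnorm_diag_le => //; rewrite !mulr_ge0 ?exprn_ge0 ?invr_ge0 ?exprn_ge0 ?powR_ge0 // ltW.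
have T0 : 0 < T by rewrite /T /theta_const -/r mulr_gt0 //; lra.
have rK : r * K <= T by rewrite /T /theta_const -/r -/K ler_pM2r //; lra.
have KT : K <= T by rewrite /T /theta_const -/r -/K ler_peMl //; lra.
have ry : 0 <= r / y `^ al by rewrite divr_ge0 // ltW.
have ynz : y != 0 by rewrite gt_eqF.
have yanz : y `^ al != 0 by rewrite gt_eqF.
have iy0 : 0 < y^-1 by rewrite invr_gt0.
have N1 : n1 <= T / y * n0.
  have h := resolvent_bound z1 e1; rewrite vnormN in h.
  apply: le_trans h _; apply: le_trans (ler_wpM2l ry (B1 U0)) _.
  have -> : r / normc (1 - z) `^ al * (K * (y `^ al / y) * vnorm U0) = r * K / y * n0.
    by rewrite -/y /n0; field; rewrite ynz yanz.
  rewrite -(mulrA (r * K)) -(mulrA T); apply: ler_wpM2r => //.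
  by nneg.
have Tp : 0 <= T ^+ 2 by rewrite exprn_ge0 // ltW.
have TT : r * K ^+ 2 <= T ^+ 2.
  have -> : r * K ^+ 2 = (r * K) * K by ring.
  by rewrite (expr2 T); apply: ler_pM => //; nneg.
have TTT : r * K ^+ 3 <= T ^+ 3.
  have -> : r * K ^+ 3 = (r * K ^+ 2) * K by ring.
  by rewrite (exprSr T); apply: ler_pM => //; nneg.
have iy2 : 0 < y ^- 2 by rewrite invr_gt0 exprn_gt0.
have iy3 : 0 < y ^- 3 by rewrite invr_gt0 exprn_gt0.
have N2 : n2 <= 6 * T ^+ 2 / y ^+ 2 * n0.
  have h := resolvent_bound z1 e2; rewrite vnormN in h.
  apply: le_trans h _.
  have := vnormD (fun i => 2 * d1 i * U1 i) (fun i => d2 i * U0 i) => h.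
  have h2 : vnorm (fun i => 2 * d1 i * U1 i) = 2 * vnorm (fun i => d1 i * U1 i).
    under eq_fun do rewrite -mulrA; rewrite vnormZ; congr (_ * _); exact: (normc_natr R 2).
  apply: le_trans (ler_wpM2l ry h) _; rewrite h2.
  apply: le_trans (ler_wpM2l ry (lerD (ler_wpM2l _ (B1 U1)) (B2 U0))) _ => //.
  rewrite -/n0 -/n1 -/y.
  have -> : r / y `^ al * (2 * (K * (y `^ al / y) * n1) + 4 * K ^+ 2 * (y `^ al / y / y) * n0)
    = 2 * (r * K * (y^-1 * n1)) + 4 * (r * K ^+ 2 * (y ^- 2 * n0)).
    by field; rewrite ynz yanz.
  have q1 : r * K * (y^-1 * n1) <= T * (y^-1 * (T / y * n0)).
    apply: ler_pM; try by nneg.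
    by apply: ler_wpM2l; rewrite ?(ltW iy0).
  have q2 : r * K ^+ 2 * (y ^- 2 * n0) <= T ^+ 2 * (y ^- 2 * n0).
    by apply: ler_wpM2r => //; rewrite mulr_ge0 // ltW.
  have -> : 6 * T ^+ 2 / y ^+ 2 * n0 = 2 * (T * (y^-1 * (T / y * n0))) + 4 * (T ^+ 2 * (y ^- 2 * n0)).
    by field; exact: ynz.
  by apply: lerD; rewrite ler_pM2l.
split => //; first exact: resolvent_bound z1 e0.
have h := resolvent_bound z1 e3; rewrite vnormN in h.
apply: le_trans h _.
have n3 : normc (3 : R[i]) = 3 := normc_natr R 3.
have h1 : vnorm (fun i => 3 * d1 i * U2 i) = 3 * vnorm (fun i => d1 i * U2 i).
  by under eq_fun do rewrite -mulrA; rewrite vnormZ n3.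
have h2 : vnorm (fun i => 3 * d2 i * U1 i) = 3 * vnorm (fun i => d2 i * U1 i).
  by under eq_fun do rewrite -mulrA; rewrite vnormZ n3.
have := vnormD (fun i => 3 * d1 i * U2 i + 3 * d2 i * U1 i) (fun i => d3 i * U0 i) => h.
have := vnormD (fun i => 3 * d1 i * U2 i) (fun i => 3 * d2 i * U1 i) => h'.
rewrite h1 h2 in h'.
have h'' := le_trans h (lerD h' (lexx _)).
apply: le_trans (ler_wpM2l ry h'') _.
apply: le_trans (ler_wpM2l ry (lerD (lerD (ler_wpM2l _ (B1 U2)) (ler_wpM2l _ (B2 U1))) (B3 U0))) _ => //.
rewrite -/n0 -/n1 -/n2 -/y.
have -> : r / y `^ al * (3 * (K * (y `^ al / y) * n2) + 3 * (4 * K ^+ 2 * (y `^ al / y / y) * n1)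
     + 22 * K ^+ 3 * (y `^ al / y / y ^+ 2) * n0)
  = 3 * (r * K * (y^-1 * n2)) + 12 * (r * K ^+ 2 * (y ^- 2 * n1)) + 22 * (r * K ^+ 3 * (y ^- 3 * n0)).
  by field; rewrite ynz yanz.
have q1 : r * K * (y^-1 * n2) <= T * (y^-1 * (6 * T ^+ 2 / y ^+ 2 * n0)).
  apply: ler_pM; try by nneg.
  by apply: ler_wpM2l; rewrite ?(ltW iy0).
have q2 : r * K ^+ 2 * (y ^- 2 * n1) <= T ^+ 2 * (y ^- 2 * (T / y * n0)).
  apply: ler_pM; try by nneg.
  by apply: ler_wpM2l; rewrite ?(ltW iy2).
have q3 : r * K ^+ 3 * (y ^- 3 * n0) <= T ^+ 3 * (y ^- 3 * n0).
  by apply: ler_wpM2r => //; rewrite mulr_ge0 // ltW.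
have -> : 52 * T ^+ 3 / y ^+ 3 * n0 = 3 * (T * (y^-1 * (6 * T ^+ 2 / y ^+ 2 * n0))) +
   12 * (T ^+ 2 * (y ^- 2 * (T / y * n0))) + 22 * (T ^+ 3 * (y ^- 3 * n0)).
  by field; exact: ynz.
by rewrite !lerD // ler_pM2l.
Qed.

End AtPoint.

Lemma pseval0 (p : nat -> R[i]) : pscoef_bounded p -> pseval p 0 = p 0%N.
Proof.
move=> hp; apply: pscvg_pseval => //; first by rewrite normc0.
apply: cvg0_normP => e e0; exists 1%N; case=> // m _.
rewrite /psum big_ord_recl /= expr0 mulr1 big1 ?addr0 ?subrr ?normc0 ?normr0 ?ltW //.
by move=> k _; rewrite expr0n mulr0.
Qed.

Lemma impulse_start : vnorm (u 0%N) <= resolvent_const * vnorm v.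
Proof.
have z0 : normc (0 : R[i]) < 1 by rewrite normc0.
have [h _ _ _] := impulse_theta_bounds z0.
move: h; rewrite subr0 normc1 powR1 divr1; apply: le_trans.
rewrite le_eqVlt; apply/orP; left; apply/eqP; apply: vnorm_ext => i.
by rewrite pseval0 //; exact: impulse_bounded.
Qed.

Lemma theta_const_ge1 : 1 <= theta_const.
Proof.
have := resolvent_const_gt0; have := HM; rewrite /theta_const => m0 r0.
by rewrite -[X in X <= _]mulr1; apply: ler_pM; lra.
Qed.

(** 192 = 32 * 6, and in the next constant 2560 = 32 * 80: the factor of [weighted_coef_bound] times
    that of the derivatives. *)
Definition decay_const : R := 192 * theta_const ^+ 2 * resolvent_const.
Definition diff_const : R := 2560 * theta_const ^+ 3 * resolvent_const.

Lemma natr_ge1 n : (0 < n)%N -> 1 <= n%:R :> R. Proof. by rewrite ler1n. Qed.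

(** Theta applied twice multiplies the n-th coefficient by n^2 and yields a function of size |1 -
    z|^(-al-2), with coefficients of order n^(al+1). *)
Lemma impulse_decay n : (0 < n)%N ->
  vnorm (u n) <= decay_const * (n%:R `^ al / n%:R) * vnorm v.
Proof.
move=> n0; have n1 := natr_ge1 n0; have T1 := theta_const_ge1; have r0 := resolvent_const_gt0.
have np : 0 < n%:R :> R by lra.
have T0 : 0 <= theta_const by lra.
apply: vnorm_le_dual => [|g]; first by rewrite /decay_const; nneg.
pose q := theta (theta (fun n => vdot g (u n))).
have qE : q = (fun n => vdot g (fun i => theta (theta (ui i)) n)).
  by apply/funext => k; rewrite /q /theta -!vdotZr.
have bq i : pscoef_bounded (theta (theta (ui i))).
  by do 2! apply: pscoef_bounded_theta; exact: impulse_bounded.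
have hq : pscoef_bounded q by rewrite qE; exact: pscoef_bounded_vdot.
pose B0 := vnorm g * (6 * theta_const ^+ 2 * resolvent_const * vnorm v).
have B00 : 0 <= B0 by rewrite /B0; nneg.
have := weighted_coef_bound Hal B00 hq _ n0.
have /[swap]/[apply] : forall z, normc z < 1 ->
   normc (pseval q z) <= B0 / normc (1 - z) `^ al / normc (1 - z) ^+ 2.
  move=> z z1; have y0 := disc_gt0 z1; have [h0 _ h2 _] := impulse_theta_bounds z1.
  rewrite qE (pscvg_pseval (pscoef_bounded_vdot _ bq) z1 (vdot_psum_cvg _ (fun i => pseval_cvg (bq i) z1))).
  apply: le_trans (normc_vdot _ _) _; rewrite /B0 -2!(mulrA (vnorm g)); apply: ler_wpM2l; rewrite ?vnorm_ge0 //.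
  have Y2 : 0 <= 6 * theta_const ^+ 2 / normc (1 - z) ^+ 2 by nneg.
  apply: le_trans h2 (le_trans (ler_wpM2l Y2 h0) _).
  rewrite le_eqVlt; apply/orP; left; apply/eqP; field.
  by rewrite !gt_eqF // powR_gt0.
rewrite /q /theta !normcM !normc_natr mulrA => h.
have n2 : 0 < n%:R * n%:R :> R by rewrite mulr_gt0.
rewrite -(ler_pM2l n2); apply: le_trans h _.
rewrite le_eqVlt; apply/orP; left; apply/eqP; rewrite /B0 /decay_const; field.
by rewrite gt_eqF.
Qed.

(** Differences correspond to the factor 1 - z, which offsets one derivative. A third theta is thus
    affordable at the same singularity |1 - z|^(-al-2), and the gain is n^3 instead of n^2. *)
Lemma impulse_diff n :
  vnorm (fun i => u n.+1 i - u n i) <= diff_const * (n.+1%:R `^ al / n.+1%:R ^+ 2) * vnorm v.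
Proof.
have n0 : (0 < n.+1)%N by []; have n1 := natr_ge1 n0; have T1 := theta_const_ge1.
have r0 := resolvent_const_gt0; have np : 0 < n.+1%:R :> R by lra.
have T0 : 0 <= theta_const by lra.
apply: vnorm_le_dual => [|g]; first by rewrite /diff_const; nneg.
pose w i k := ui i k - shiftc (ui i) k.
pose q := theta (theta (theta (fun n => vdot g (fun i => w i n)))).
have qE : q = (fun n => vdot g (fun i => theta (theta (theta (w i))) n)).
  by apply/funext => k; rewrite /q /theta -!vdotZr.
have bu := @impulse_bounded; have bu1 i := pscoef_bounded_theta (bu i).
have bu2 i := pscoef_bounded_theta (bu1 i); have bu3 i := pscoef_bounded_theta (bu2 i).
have bw i : pscoef_bounded (w i) by apply: pscoef_boundedB => //; exact: pscoef_bounded_shiftc.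
have bq i : pscoef_bounded (theta (theta (theta (w i)))) by do 3! apply: pscoef_bounded_theta.
have hq : pscoef_bounded q by rewrite qE; exact: pscoef_bounded_vdot.
(* On a product with z, theta^3 acts as z (theta + 1)^3, whence the coefficients 1, 3, 3, 1. *)
have wE i k : theta (theta (theta (w i))) k = theta (theta (theta (ui i))) k
    - shiftc (fun n => theta (theta (theta (ui i))) n + (theta (theta (ui i)) n + theta (theta (ui i)) n
    + theta (theta (ui i)) n + (theta (ui i) n + theta (ui i) n + theta (ui i) n) + ui i n)) k.
  by case: k => [|k]; rewrite /w /theta /= ?mul0r ?subrr // -natr1; ring.
pose B0 := vnorm g * (80 * theta_const ^+ 3 * resolvent_const * vnorm v).
have B00 : 0 <= B0 by rewrite /B0; nneg.
have := weighted_coef_bound Hal B00 hq _ n0.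
have /[swap]/[apply] : forall z, normc z < 1 ->
   normc (pseval q z) <= B0 / normc (1 - z) `^ al / normc (1 - z) ^+ 2.
  move=> z z1; have y0 := disc_gt0 z1; have [h0 h1 h2 h3] := impulse_theta_bounds z1.
  set y := normc (1 - z) in y0 h0 h1 h2 h3 *.
  rewrite qE (pscvg_pseval (pscoef_bounded_vdot _ bq) z1 (vdot_psum_cvg _ (fun i => pseval_cvg (bq i) z1))).
  apply: le_trans (normc_vdot _ _) _; rewrite /B0 -2!(mulrA (vnorm g)); apply: ler_wpM2l; rewrite ?vnorm_ge0 //.
  set U0 := (fun i => pseval (ui i) z) in h0 h1 h2 h3.
  set U1 := (fun i => pseval (theta (ui i)) z) in h1.
  set U2 := (fun i => pseval (theta (theta (ui i))) z) in h2.
  set U3 := (fun i => pseval (theta (theta (theta (ui i)))) z) in h3.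
  have -> : vnorm (fun i => pseval (theta (theta (theta (w i)))) z) =
    vnorm (fun i => (1 - z) * U3 i + (- z) * (3 * U2 i + 3 * U1 i + U0 i)).
    apply: vnorm_ext => i; apply: pscvg_pseval => //.
    apply: pscvg_ext (fsym (wE i)) _.
    have -> : (1 - z) * U3 i + (- z) * (3 * U2 i + 3 * U1 i + U0 i) =
      U3 i - z * (U3 i + (U2 i + U2 i + U2 i + (U1 i + U1 i + U1 i) + U0 i)) by ring.
    have c0 := pseval_cvg (bu i) z1; have c1 := pseval_cvg (bu1 i) z1.
    have c2 := pseval_cvg (bu2 i) z1; have c3 := pseval_cvg (bu3 i) z1.
    exact: pscvgB c3 (pscvg_shiftc (pscvgD c3 (pscvgD (pscvgD (pscvgD (pscvgD c2 c2) c2) (pscvgD (pscvgD c1 c1) c1)) c0))).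
  have y2 : y <= 2 := normc_disc_le2 z1.
  have z1' : normc (- z) <= 1 by rewrite normc_opp ltW.
  have N3 : normc (3 : R[i]) = 3 := normc_natr R 3.
  have tri : vnorm (fun i => 3 * U2 i + 3 * U1 i + U0 i) <= 3 * vnorm U2 + 3 * vnorm U1 + vnorm U0.
    apply: le_trans (vnormD _ _) _; rewrite lerD2r; apply: le_trans (vnormD _ _) _.
    by rewrite !vnormZ N3.
  have : vnorm (fun i => (1 - z) * U3 i + (- z) * (3 * U2 i + 3 * U1 i + U0 i)) <=
     y * vnorm U3 + (3 * vnorm U2 + 3 * vnorm U1 + vnorm U0).
    apply: le_trans (vnormD _ _) _; rewrite !vnormZ -/y lerD2l.
    apply: le_trans tri; apply: ler_piMl => //; exact: vnorm_ge0.
  move=> h; apply: le_trans h _.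
  set T := theta_const in T1 T0 h1 h2 h3 *.
  set n0' := vnorm U0 in h0 h1 h2 h3 *.
  have n00 : 0 <= n0' := vnorm_ge0 _.
  have Y : 0 < y ^- 2 by rewrite invr_gt0 exprn_gt0.
  have a3 : y * vnorm U3 <= 52 * (T ^+ 3 * (y ^- 2 * n0')).
    have -> : 52 * (T ^+ 3 * (y ^- 2 * n0')) = y * (52 * T ^+ 3 / y ^+ 3 * n0') by field; rewrite gt_eqF.
    by rewrite ler_pM2l.
  have t1 : y ^- 2 * n0' <= T * (y ^- 2 * n0') by apply: ler_peMl => //; nneg.
  have t2 : T * (y ^- 2 * n0') <= T ^+ 2 * (y ^- 2 * n0').
    by rewrite (expr2 T) -(mulrA T); apply: ler_peMl => //; nneg.
  have t3 : T ^+ 2 * (y ^- 2 * n0') <= T ^+ 3 * (y ^- 2 * n0').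
    by rewrite (exprS T 2) -(mulrA T); apply: ler_peMl => //; nneg.
  have a2 : vnorm U2 <= 6 * (T ^+ 2 * (y ^- 2 * n0')).
    by move: h2; have -> : 6 * T ^+ 2 / y ^+ 2 * n0' = 6 * (T ^+ 2 * (y ^- 2 * n0')) by ring.
  have yq : y <= 2 -> 1 <= 2 * y^-1 by move=> _; rewrite ler_pdivlMr // mul1r.
  have a1 : vnorm U1 <= 2 * (T * (y ^- 2 * n0')).
    apply: le_trans h1 _.
    have -> : 2 * (T * (y ^- 2 * n0')) = (2 * y^-1) * (T / y * n0') by field; rewrite gt_eqF.
    by apply: ler_peMl; [nneg|exact: yq].
  have a0 : n0' <= 4 * (y ^- 2 * n0').
    have -> : 4 * (y ^- 2 * n0') = (2 * y^-1) ^+ 2 * n0' by field; rewrite gt_eqF.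
    by apply: ler_peMl => //; rewrite exprn_ege1 // yq.
  apply: le_trans (_ : 80 * (T ^+ 3 * (y ^- 2 * n0')) <= _).
    exact: (chained_bound t1 t2 t3 a0 a1 a2 a3).
  have Z0 : 0 <= 80 * T ^+ 3 * y ^- 2 by nneg.
  apply: le_trans (_ : 80 * T ^+ 3 * y ^- 2 * (resolvent_const / y `^ al * vnorm v) <= _).
    have -> : 80 * (T ^+ 3 * (y ^- 2 * n0')) = 80 * T ^+ 3 * y ^- 2 * n0' by ring.
    exact: ler_wpM2l.
  move: (T ^+ 3) (y ^- 2) (y `^ al)^-1 resolvent_const (vnorm v) => c1 c2 c3 c4 c5.
  by rewrite le_eqVlt; apply/orP; left; apply/eqP; ring.
rewrite /q /theta !normcM !normc_natr (mulrA n.+1%:R) (mulrA (n.+1%:R * n.+1%:R)) => h.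
have n3 : 0 < n.+1%:R * n.+1%:R * n.+1%:R :> R by rewrite !mulr_gt0.
rewrite -(ler_pM2l n3); apply: le_trans h _.
rewrite le_eqVlt; apply/orP; left; apply/eqP; rewrite /B0 /diff_const; field.
by rewrite gt_eqF.
Qed.

End Impulse.
End Resolvent.

Local Transparent pseval symb.

(** * Halving the time step *)

Section Subordination.
Variable R : realType.
Implicit Types (p q : nat -> R[i]) (z : R[i]).

Definition ones (k : nat) : R[i] := 1.
Definition partial_sum p (n : nat) : R[i] := \sum_(k < n.+1) p k.

Lemma partial_sumE p : partial_sum p = cauchy_prod p ones.
Proof. by apply/funext => n; apply: eq_bigr => k _; rewrite mulr1. Qed.

Lemma pscoef_bounded_ones : pscoef_bounded ones.
Proof. by apply: (@pscoef_bounded_le1 _ _ 1) => k; rewrite normc1. Qed.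

Lemma disc_neq0 z : normc z < 1 -> 1 - z != 0.
Proof. by move=> z1; apply: Re_gt0_neq0; exact: Re_disc. Qed.

Lemma pscvg_ones z : normc z < 1 -> pscvg ones z (1 - z)^-1.
Proof.
move=> z1; have z0 := disc_neq0 z1; have P := pseval_cvg pscoef_bounded_ones z1.
suff <- : pseval ones z = (1 - z)^-1 by [].
apply: (mulfI z0); rewrite divff // mulrBl mul1r.
apply: pscvg_unique (pscvgB P (pscvg_shiftc P)) _.
apply: pscvg_ext (pscvg_delta0 z) => -[|k]; by rewrite /= ?subr0 ?subrr.
Qed.

Lemma partial_sum_ones n : partial_sum ones n = n.+1%:R.
Proof. by rewrite /partial_sum sumr_const card_ord. Qed.

Lemma partial_sum_natS n : partial_sum (fun k => k.+1%:R) n = n.+1%:R * n.+2%:R / 2.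
Proof.
have two : (2 : R[i]) != 0 by rewrite pnatr_eq0.
rewrite /partial_sum; elim: n => [|n IH]; first by rewrite big_ord_recl big_ord0 addr0 mul1r divff.
by rewrite big_ord_recr /= IH -!natr1; field.
Qed.

(** Probability that the (m+1)-st head of a fair coin shows at toss j + 1. *)
Definition half_wt (m j : nat) : R := 'C(j, m)%:R * (2^-1) ^+ j.+1.

Lemma half_wt_ge0 m j : 0 <= half_wt m j.
Proof. by rewrite mulr_ge0 ?exprn_ge0 ?invr_ge0. Qed.

Definition midpoint z : R[i] := (1 + z) / 2.

Lemma normc_midpoint z : normc z < 1 -> normc (midpoint z) < 1.
Proof.
move=> z1; rewrite /midpoint normcM normcV (normc_natr R 2).
rewrite ltr_pdivrMr // mul1r; apply: le_lt_trans (ler_normcD _ _) _; rewrite normc1; lra.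
Qed.

(* The half-step substitution z |-> (1 + z) / 2 acts on coefficients as an
   average against the negative binomial weights half_wt m. *)
Lemma half_step_coef p q : pscoef_bounded p -> pscoef_bounded q ->
  (forall z, normc z < 1 -> pseval q z = pseval p (midpoint z) / 2) ->
  forall m, (fun J => normc (\sum_(j < J) (half_wt m j)%:C * p j - q m)) @ \oo --> (0 : R).
Proof.
move=> hp hq hpq m; apply: cvg0_normP => e e0.
have two : (2 : R[i]) != 0 by rewrite pnatr_eq0.
have r01 : 0 < (2^-1 : R) < 1 by rewrite invr_gt0 ltr0n invf_lt1 ?ltr1n ?ltr0n.
(* The midpoint of 1 and a point of modulus 1/2 has modulus at most 3/4. *)
have r34 : 0 <= (3 / 4 : R) < 1 by apply/andP; split; lra.
pose c : R := 2^-1 ^+ m.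
have c0 : 0 < c by rewrite exprn_gt0 // invr_gt0.
(* On radius 1/2 [coef_bound] multiplies the bound 4 e' by 16/3, and 64/3 <= 32. *)
pose e' := e * c / 32.
have e'0 : 0 < e' by rewrite !mulr_gt0 // invr_gt0.
have [t [t0 ht]] := abs_psum_tail hp r34.
have [J0 HJ0] := cvg0_leP t0 e'0.
exists J0 => J J0J; rewrite ger0_norm ?normc_ge0 //.
(* Truncating p at J leaves finite sums to exchange; the binomial theorem identifies the generating
   function of [pJ] at z with the truncated p at the midpoint, halved. *)
pose pJ (k : nat) : R[i] := \sum_(j < J) (half_wt k j)%:C * p j.
have hpJ : pscoef_bounded pJ.
  apply: pscoef_bounded_sum => j.
  apply: (@pscoef_bounded_fin _ _ J) => k Jk.
  by rewrite /half_wt bin_small ?mul0r // (leq_trans (ltn_ord j)).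
have evJ z : normc z < 1 -> pseval pJ z = psum p (midpoint z) J / 2.
  move=> z1; apply: pscvg_pseval => //.
  have -> : psum p (midpoint z) J / 2 = psum pJ z J.
    rewrite /psum /pJ mulr_suml.
    under [RHS]eq_bigr do rewrite mulr_suml.
    rewrite exchange_big /=; apply: eq_bigr => j _.
    rewrite /midpoint expr_div_n exprDn.
    have -> : \sum_(i < J) (half_wt i j)%:C * p j * z ^+ i = \sum_(i < j.+1) (half_wt i j)%:C * p j * z ^+ i.
      rewrite [in RHS](big_ord_widen_cond J xpredT (fun i => (half_wt i j)%:C * p j * z ^+ i)) ?ltn_ord //=.
      rewrite [RHS]big_mkcond; apply: eq_bigr => i _; case: ifP => // /negbT; rewrite -leqNgt => ji.
      by rewrite /half_wt bin_small // mul0r !mul0r.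
    rewrite mulr_suml mulr_sumr mulr_suml; apply: eq_bigr => i _.
    rewrite expr1n mul1r /half_wt rmorphM rmorph_nat rmorphXn fmorphV rmorph_nat exprSr.
    by rewrite exprVn -mulr_natl; field; rewrite expf_neq0.
  apply: pscvg_fin => k Jk; rewrite /pJ big1 // => j _.
  by rewrite /half_wt bin_small ?mul0r // (leq_trans (ltn_ord j)).
have hd := pscoef_boundedB hpJ hq.
have B0 : 0 <= 4 * e' by rewrite mulr_ge0 // ltW.
have := @coef_bound R (fun k => pJ k - q k) m 2^-1 (4 * e') hd r01 B0.
have /[swap]/[apply] : forall z, normc z = 2^-1 ->
    normc (pseval (fun k => pJ k - q k) z) <= 4 * e' / normc (1 - z) ^+ 2.
  move=> z zr; have z1 : normc z < 1 by rewrite zr; case/andP: r01.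
  rewrite (pscvg_pseval hd z1 (pscvgB (pseval_cvg hpJ z1) (pseval_cvg hq z1))).
  rewrite evJ // hpq // -mulrBl normcM normcV (normc_natr R 2).
  have m1 := normc_midpoint z1.
  have mr : normc (midpoint z) <= 3 / 4.
    rewrite /midpoint normcM normcV (normc_natr R 2) ler_pdivrMr //.
    by apply: le_trans (ler_normcD _ _) _; rewrite normc1 zr; lra.
  have lim_le : normc (psum p (midpoint z) J - pseval p (midpoint z)) <= e'.
    rewrite -subr_le0.
    apply: (cvg0_le (u := fun n => normc (psum p (midpoint z) (J + n) - pseval p (midpoint z)))).
      by have := pseval_cvg hp m1; rewrite /pscvg -(cvg_shiftn J); under eq_fun do rewrite addnC.
    move=> n; rewrite lerBlDr.
    have -> : psum p (midpoint z) J - pseval p (midpoint z) = (psum p (midpoint z) (J + n) - pseval p (midpoint z)) - (psum p (midpoint z) (J + n) - psum p (midpoint z) J) by ring.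
    apply: le_trans (ler_normcB _ _) _; rewrite lerD2l.
    have mn : (J <= J + n)%N by rewrite leq_addr.
    apply: le_trans (_ : abs_psum p (3 / 4) (J + n) - abs_psum p (3 / 4) J <= _); last first.
      apply: le_trans (ht _ _ mn) _; apply: le_trans (ler_norm _) _; exact: HJ0.
    apply: le_trans (psum_dist _ _ mn) _.
    rewrite /abs_psum !big_split_ord /= !(addrAC _ _ (- _)) !subrr !add0r.
    apply: ler_sum => k _; apply: ler_wpM2l; rewrite ?normc_ge0 // lerXn2r ?nnegrE ?normc_ge0 //.
  have y2 := normc_disc_le2 z1; have y0 := disc_gt0 z1.
  apply: le_trans (_ : e' <= _).
    by have := normc_ge0 (psum p (midpoint z) J - pseval p (midpoint z)); lra.
  rewrite ler_pdivlMr ?exprn_gt0 // mulrC ler_pM2r //.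
  have -> : 4 = 2 ^+ 2 :> R by ring.
  by rewrite lerXn2r ?nnegrE ?normc_ge0.
rewrite -/c -/(pJ m) => h.
rewrite -(ler_pM2r c0); apply: le_trans h _.
have -> : e * c = 32 * e' by rewrite /e'; field.
have -> : 4 * (4 * e') / (1 - 2^-1 ^+ 2) = 64 / 3 * e' :> R by field.
by lra.
Qed.

Lemma half_wt_small m j : (j < m)%N -> half_wt m j = 0.
Proof. by move=> jm; rewrite /half_wt bin_small // mul0r. Qed.

(** Since 1 - (1 + z) / 2 = (1 - z) / 2, the powers of 1 / (1 - z) are mapped to multiples of
    themselves; the first three encode total mass, mean and second moment of j + 1. *)
Lemma half_wt_moments m :
  [/\ (fun J => normc (\sum_(j < J) (half_wt m j)%:C * 1 - 1)) @ \oo --> (0 : R),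
      (fun J => normc (\sum_(j < J) (half_wt m j)%:C * j.+1%:R - 2 * m.+1%:R)) @ \oo --> (0 : R) &
      (fun J => normc (\sum_(j < J) (half_wt m j)%:C * (j.+1%:R * j.+2%:R / 2) - 2 * (m.+1%:R * m.+2%:R))) @ \oo --> (0 : R)].
Proof.
have two : (2 : R[i]) != 0 by rewrite pnatr_eq0.
have b1 := pscoef_bounded_ones.
have E2 : cauchy_prod ones ones = (fun n => n.+1%:R).
  by rewrite -partial_sumE; apply/funext => n; rewrite partial_sum_ones.
have E3 : cauchy_prod (fun n => n.+1%:R) ones = (fun n => n.+1%:R * n.+2%:R / 2).
  by rewrite -partial_sumE; apply/funext => n; rewrite partial_sum_natS.
have b2 : pscoef_bounded (fun n => n.+1%:R : R[i]) by rewrite -E2; exact: pscoef_bounded_cauchy.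
have b3 : pscoef_bounded (fun n => n.+1%:R * n.+2%:R / 2 : R[i]) by rewrite -E3; exact: pscoef_bounded_cauchy.
have c1 := pscvg_ones.
have c2 z : normc z < 1 -> pscvg (fun n => n.+1%:R) z ((1 - z)^-1 * (1 - z)^-1).
  by move=> z1; rewrite -E2; apply: pscvg_cauchy => //; exact: c1.
have c3 z : normc z < 1 -> pscvg (fun n => n.+1%:R * n.+2%:R / 2) z ((1 - z)^-1 * (1 - z)^-1 * (1 - z)^-1).
  by move=> z1; rewrite -E3; apply: pscvg_cauchy => //; [exact: c2|exact: c1].
have midE z : normc z < 1 -> (1 - midpoint z)^-1 = 2 / (1 - z).
  move=> z1; have z0 := disc_neq0 z1; rewrite /midpoint.
  have -> : 1 - (1 + z) / 2 = (1 - z) / 2 by field.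
  by rewrite invf_div.
split.
- apply: (half_step_coef (p := ones) (q := ones)) => // z z1.
  have m1 := normc_midpoint z1.
  by rewrite (pscvg_pseval b1 z1 (c1 z z1)) (pscvg_pseval b1 m1 (c1 _ m1)) midE // mulrAC divff // mul1r.
- apply: (half_step_coef (p := fun n => n.+1%:R) (q := fun n => 2 * n.+1%:R)) => //.
    exact: pscoef_boundedZ.
  move=> z z1; have m1 := normc_midpoint z1; have z0 := disc_neq0 z1.
  rewrite (pscvg_pseval (pscoef_boundedZ 2 b2) z1 (pscvgZ 2 (c2 z z1))) (pscvg_pseval b2 m1 (c2 _ m1)) midE //.
  by field; rewrite ?z0.
- apply: (half_step_coef (p := fun n => n.+1%:R * n.+2%:R / 2) (q := fun n => 2 * (n.+1%:R * n.+2%:R))) => //.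
    have -> : (fun n => 2 * (n.+1%:R * n.+2%:R)) = (fun n => 4 * (n.+1%:R * n.+2%:R / 2 : R[i])).
      by apply/funext => n; field.
    exact: pscoef_boundedZ.
  move=> z z1; have m1 := normc_midpoint z1; have z0 := disc_neq0 z1.
  rewrite (_ : (fun n => 2 * (n.+1%:R * n.+2%:R)) = (fun n => 4 * (n.+1%:R * n.+2%:R / 2 : R[i]))); last first.
    by apply/funext => n; field.
  rewrite (pscvg_pseval (pscoef_boundedZ 4 b3) z1 (pscvgZ 4 (c3 z z1))) (pscvg_pseval b3 m1 (c3 _ m1)) midE //.
  by field; rewrite ?z0.
Qed.

(** First-order Taylor expansion of the partial sums about N: their increments are e, which varies
    by at most [ka] per step, so the remainder is quadratic. *)
Lemma taylor_sum (e : nat -> R[i]) (m N : nat) (ka : R) : (m <= N)%N -> 0 <= ka ->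
  (forall i, (m <= i)%N -> normc (e i.+1 - e i) <= ka) ->
  forall j, (m <= j)%N ->
  normc (partial_sum e j - partial_sum e N - (j%:R - N%:R) * e N) <= ka * (j%:R - N%:R) ^+ 2.
Proof.
move=> mN ka0 he.
have lip i k : (m <= i)%N -> normc (e (i + k)%N - e i) <= ka * k%:R.
  move=> mi; elim: k => [|k IH]; first by rewrite addn0 subrr normc0 mulr0.
  have -> : e (i + k.+1)%N - e i = (e (i + k).+1 - e (i + k)%N) + (e (i + k)%N - e i) by rewrite addnS; ring.
  apply: le_trans (ler_normcD _ _) _; rewrite -natr1 mulrDr mulr1 addrC; apply: lerD => //.
  by apply: he; rewrite (leq_trans mi) // leq_addr.
have key i k : (m <= i)%N -> forall c : R[i],
    (forall l, (l < k)%N -> normc (e (i + l.+1)%N - c) <= ka * k%:R) ->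
    normc (partial_sum e (i + k) - partial_sum e i - k%:R * c) <= ka * k%:R ^+ 2.
  move=> mi c hc.
  have -> : partial_sum e (i + k) - partial_sum e i - k%:R * c = \sum_(l < k) (e (i + l.+1)%N - c).
    rewrite /partial_sum -addSn big_split_ord /= (addrC (\sum_(k0 < i.+1) _)) addrK sumrB sumr_const card_ord mulr_natl.
    by congr (_ - _); apply: eq_bigr => l _; rewrite addSnnS.
  apply: le_trans (ler_normc_sum _ _ _) _.
  have H (l : 'I_k) : true -> normc (e (i + l.+1)%N - c) <= ka * k%:R by move=> _; exact: hc.
  apply: le_trans (ler_sum _ H) _.
  by rewrite sumr_const card_ord expr2 mulrA -[_ *+ k]mulr_natr.
have natE (V : pzRingType) (i k : nat) : (i + k)%:R - i%:R = k%:R :> V by rewrite natrD addrC addKr.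
move=> j mj; case: (leqP N j) => [Nj|/ltnW jN].
  rewrite -(subnKC Nj); move: (j - N)%N => k; rewrite !natE.
  apply: key => // l lk; apply: le_trans (lip _ _ mN) _.
  by apply: ler_wpM2l => //; rewrite ler_nat.
have [c eN] : exists c, c = e N by exists (e N).
rewrite -eN; move: jN => /subnKC; move: (N - j)%N => k kN.
rewrite -normc_opp.
have -> : - (partial_sum e j - partial_sum e N - (j%:R - N%:R) * c) =
  partial_sum e (j + k) - partial_sum e j - k%:R * c.
  by rewrite kN -(natE _ j k) kN; ring.
have -> : (j%:R - N%:R) ^+ 2 = k%:R ^+ 2 :> R by rewrite -(natE _ j k) kN; ring.
apply: key => // l lk; rewrite -normc_opp opprB eN -kN.
have -> : (j + k = j + l.+1 + (k - l.+1))%N by rewrite -addnA subnKC.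
apply: le_trans (lip _ _ _) _; first by rewrite (leq_trans mj) // leq_addr.
by apply: ler_wpM2l => //; rewrite ler_nat leq_subr.
Qed.

(** The weights on j + 1 have mean 2 (m + 1) and variance 2 (m + 1). Expanding about N with N + 1 =
    2 (m + 1) makes the linear term average out, and the variance is the error. *)
Lemma half_step_error (e c : nat -> R[i]) (m : nat) (ka : R) : 0 <= ka ->
  (forall i, (m <= i)%N -> normc (e i.+1 - e i) <= ka) ->
  (fun J => normc (\sum_(j < J) (half_wt m j)%:C * partial_sum e j - c m)) @ \oo --> (0 : R) ->
  normc (c m - partial_sum e m.*2.+1) <= ka * (2 * m.+1%:R).
Proof.
move=> ka0 he hc; have [M0 M1 M2] := half_wt_moments m.
set N := m.*2.+1.
have mN : (m <= N)%N by rewrite /N -addnn -addnS leq_addr.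
have T := taylor_sum mN ka0 he.
set p := partial_sum e in hc T *.
(* All errors due to stopping the sums at J, arranged to tend to 0. *)
pose D J := normc (\sum_(j < J) (half_wt m j)%:C * p j - c m)
  + (normc (p N - (N.+1)%:R * e N) * normc (\sum_(j < J) (half_wt m j)%:C * 1 - 1)
  + normc (e N) * normc (\sum_(j < J) (half_wt m j)%:C * j.+1%:R - 2 * m.+1%:R)
  + ka * (2 * normc (\sum_(j < J) (half_wt m j)%:C * (j.+1%:R * j.+2%:R / 2) - 2 * (m.+1%:R * m.+2%:R))
  + (4 * m.+1%:R + 1) * normc (\sum_(j < J) (half_wt m j)%:C * j.+1%:R - 2 * m.+1%:R)
  + 4 * m.+1%:R ^+ 2 * normc (\sum_(j < J) (half_wt m j)%:C * 1 - 1))).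
have D0 : D @ \oo --> (0 : R).
  have -> : 0 = 0 + (normc (p N - (N.+1)%:R * e N) * 0 + normc (e N) * 0 + ka * (2 * 0 + (4 * m.+1%:R + 1) * 0 + 4 * m.+1%:R ^+ 2 * 0)) :> R by rewrite !mulr0 !addr0 mulr0 !addr0.
  apply: cvgD => //; apply: cvgD; [apply: cvgD; apply: cvgM => //; exact: cvg_cst|].
  apply: cvgM; first exact: cvg_cst.
  by apply: cvgD; [apply: cvgD|]; apply: cvgM => //; exact: cvg_cst.
rewrite -subr_le0; apply: cvg0_le D0 _ => J; rewrite lerBlDr /D.
have s2 : N.+1%:R = 2 * m.+1%:R :> R by rewrite /N -natrM mul2n doubleS.
have s2c : N.+1%:R = 2 * m.+1%:R :> R[i] by rewrite /N -natrM mul2n doubleS.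
pose w j := half_wt m j.
set A := \sum_(j < J) _ * (_ * _ / _); set B := \sum_(j < J) _ * _.+1%:R; set Cc := \sum_(j < J) _ * 1.
set S0 := \sum_(j < J) _ * p _.
pose A' := \sum_(j < J) w j * (j.+1%:R * j.+2%:R / 2).
pose B' := \sum_(j < J) w j * j.+1%:R.
pose C' := \sum_(j < J) w j.
have AE : A = A'%:C.
  rewrite /A' rmorph_sum; apply: eq_bigr => j _.
  by rewrite !rmorphM fmorphV !rmorph_nat.
have BE : B = B'%:C.
  rewrite /B' rmorph_sum; apply: eq_bigr => j _.
  by rewrite [RHS]rmorphM [X in _ = _ * X]rmorph_nat.
have CE : Cc = C'%:C by rewrite /C' rmorph_sum; apply: eq_bigr => j _; rewrite mulr1.
pose S1 := \sum_(j < J) (w j)%:C * (p j - p N - (j%:R - N%:R) * e N).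
have E : c m - p N = - (S0 - c m) + S1 + ((p N - N.+1%:R * e N) * (Cc - 1) + e N * (B - 2 * m.+1%:R)).
  have -> : S1 = S0 - p N * Cc - e N * (B - N.+1%:R * Cc).
    rewrite /S1 /S0 /B /Cc !mulr_sumr -!sumrB mulr_sumr -sumrB; apply: eq_bigr => j _.
    by rewrite -(@natr1 _ j) -(@natr1 _ N); ring.
  by rewrite s2c; ring.
(* With s = m + 1, (j - N)^2 = (j + 1)(j + 2) - (4 s + 1)(j + 1) + 4 s^2 in terms of the three known
   moments. *)
have hS1 : normc S1 <= ka * (2 * A' - (4 * m.+1%:R + 1) * B' + 4 * m.+1%:R ^+ 2 * C').
  have -> : ka * (2 * A' - (4 * m.+1%:R + 1) * B' + 4 * m.+1%:R ^+ 2 * C') = \sum_(j < J) w j * (ka * (j%:R - N%:R) ^+ 2).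
    rewrite /A' /B' /C' !mulr_sumr -sumrB -big_split mulr_sumr; apply: eq_bigr => j _ /=.
    have -> : N%:R = 2 * m.+1%:R - 1 :> R by rewrite -s2 -natr1 addrK.
    by rewrite -(@natr1 _ j.+1) -(@natr1 _ j); field.
  apply: le_trans (ler_normc_sum _ _ _) _; apply: ler_sum => j _.
  have w0 : 0 <= w j := half_wt_ge0 _ _.
  rewrite normcM normc_real ger0_norm //.
  case: (ltnP j m) => jm; first by rewrite /w half_wt_small // !mul0r.
  by apply: ler_wpM2l => //; exact: T.
rewrite E AE BE CE.
have nat2 : 2 * m.+1%:R = (2 * m.+1%:R)%:C :> R[i] by rewrite rmorphM !rmorph_nat.
have nat3 : 2 * (m.+1%:R * m.+2%:R) = (2 * (m.+1%:R * m.+2%:R))%:C :> R[i] by rewrite !rmorphM !rmorph_nat.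
have one : 1 = 1%:C :> R[i] by [].
apply: le_trans (ler_normcD _ _) _.
apply: le_trans (lerD (ler_normcD _ _) (ler_normcD _ _)) _.
rewrite normc_opp !normcM -!addrA lerD2l.
set a1 := normc (S0 - c m); set a2 := _ * normc (C'%:C - 1); set a3 := _ * normc (_ - 2 * m.+1%:R).
rewrite addrC -!addrA lerD2l lerD2l -mulrDr; apply: le_trans hS1 _; apply: ler_wpM2l => //.
rewrite nat2 nat3 one -!rmorphB !normc_real.
have h1 := ler_norm (A' - 2 * (m.+1%:R * m.+2%:R)).
have h2 : 2 * m.+1%:R - B' <= `|B' - 2 * m.+1%:R| by rewrite distrC ler_norm.
have h3 := ler_norm (C' - 1).
have p1 : 0 <= 4 * m.+1%:R + 1 :> R by rewrite addr_ge0 // mulr_ge0.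
have p2 : 0 <= 4 * m.+1%:R ^+ 2 :> R by rewrite mulr_ge0 // exprn_ge0.
have q2 := ler_wpM2l p1 h2; have q3 := ler_wpM2l p2 h3.
have -> : m.+2%:R = m.+1%:R + 1 :> R by rewrite natr1.
rewrite -(@natr1 _ m.+1) in h1; move: h1 q2 q3.
set n1 := `|A' - _|; set n2 := `|B' - _|; set n3 := `|C' - 1|.
set s := m.+1%:R; move=> h1 q2 q3.
have : 2 * A' <= 2 * n1 + 4 * (s * (s + 1)) by move: h1; lra.
have -> : 4 * (s * (s + 1)) = 4 * s ^+ 2 + 4 * s by ring.
move: q2 q3; rewrite !mulrBr mulr1.
have -> : (4 * s + 1) * (2 * s) = 8 * s ^+ 2 + 2 * s by ring.
by lra.
Qed.

End Subordination.

(** * Step responses for the time steps tau and 2 tau *)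

Section HalfStep.
Variables (R : realType) (I : finType).
Variables (b : I -> R[i]) (al la ka M : R).
Hypotheses (Hal : 0 < al < 1) (Hla : 0 < la) (Hka : 0 < ka) (HM : 0 <= M).
Hypothesis H : forall i, symbol_params (b i) al la ka M.
Variable a : I -> I -> R[i].
Hypothesis a_diss : forall x : I -> R[i],
  complex.Re (vdot x (fun i => \sum_j a i j * x j)) <= 0.

Let b2 i := 2 * b i.
Let a2 i j := (2 `^ al)%:C * a i j.

Lemma symbol_params_double i : symbol_params (b2 i) al (2 * la) ka M.
Proof.
case: (H i) => h1 h2 h3 h4 h5 h6.
have two : (2 : R[i]) = (2 : R)%:C by rewrite rmorph_nat.
split=> //; rewrite /b2 ?two ?ReZ ?ImZ; first by rewrite mulr_gt0.
  by rewrite mulrCA ler_pM2l.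
by rewrite normrM ger0_norm // mulrCA ler_pM2l.
Qed.

Lemma diss_double (x : I -> R[i]) :
  complex.Re (vdot x (fun i => \sum_j a2 i j * x j)) <= 0.
Proof.
have -> : vdot x (fun i => \sum_j a2 i j * x j) = (2 `^ al)%:C * vdot x (fun i => \sum_j a i j * x j).
  rewrite -vdotZr; congr vdot; apply/funext => i.
  by rewrite mulr_sumr; apply: eq_bigr => j _; rewrite /a2 mulrA.
by rewrite ReZ mulr_ge0_le0 // powR_ge0.
Qed.

Lemma cpow_scale (w : R[i]) (r : R) : 0 < r -> 0 < complex.Re w ->
  cpow (r%:C * w) al = (r `^ al)%:C * cpow w al.
Proof.
move=> r0 w0; rewrite /cpow normcM normc_real gtr0_norm // powRM ?normc_ge0 ?ltW //.
have w0' : 0 < complex.Re (r%:C * w) by rewrite ReZ mulr_gt0.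
rewrite carg_atan // carg_atan // ReZ ImZ -mulf_div divff ?gt_eqF // mul1r.
by rewrite rmorphM mulrA.
Qed.

(** Homogeneity of the power: 1 + 2 b - z = 2 (1 + b - (1 + z) / 2). *)
Lemma symb_half_step i z : normc z < 1 ->
  pseval (symb (b2 i) al (2 * la)) z = (2 `^ al)%:C * pseval (symb (b i) al la) (midpoint z).
Proof.
move=> z1; have m1 := normc_midpoint z1.
rewrite (pseval_symb (symbol_params_double i)) // (pseval_symb (H i)) //.
have w0 := Re_base_gt0 (H i) m1.
rewrite mulrBr -cpow_scale // -rmorphM -powRM ?(ltW Hla) //.
by congr (cpow _ _ - _); rewrite /b2 /midpoint rmorph_nat; field.
Qed.

Variables (v : I -> R[i]) (e c : nat -> I -> R[i]).
Hypothesis He : forall n i, scheme_lhs b al la a e n i = (n == 0%N)%:R * v i.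
Hypothesis Hc : forall n i, scheme_lhs b2 al (2 * la) a2 c n i = (n == 0%N)%:R * ((2 `^ al)%:C * v i).

Let Hla2 : 0 < 2 * la. Proof. by rewrite mulr_gt0. Qed.
Let be := impulse_bounded Hal Hla Hka H a_diss He.
Let bc := impulse_bounded Hal Hla2 Hka symbol_params_double diss_double Hc.

(** Both sides solve the same resolvent equation at z, and the resolvent bound makes its solution
    unique. *)
Lemma impulse_half_step i z : normc z < 1 ->
  pseval (fun n => c n i) z = pseval (fun n => e n i) (midpoint z).
Proof.
move=> z1; have m1 := normc_midpoint z1.
have [hc _ _ _] := impulse_eval Hal Hla2 Hka symbol_params_double diss_double Hc z1.
have [he _ _ _] := impulse_eval Hal Hla Hka H a_diss He m1.
pose x i := pseval (fun n => c n i) z - pseval (fun n => e n i) (midpoint z).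
have hx (k : I) : pseval (symb (b2 k) al (2 * la)) z * x k - \sum_j a2 k j * x j = 0.
  rewrite /x mulrBr.
  have -> : \sum_j a2 k j * (pseval (fun n => c n j) z - pseval (fun n => e n j) (midpoint z)) =
    \sum_j a2 k j * pseval (fun n => c n j) z - (2 `^ al)%:C * \sum_j a k j * pseval (fun n => e n j) (midpoint z).
    rewrite mulr_sumr -sumrB; apply: eq_bigr => j _; rewrite /a2.
    by rewrite mulrBr; congr (_ - _); exact: esym (mulrA _ _ _).
  rewrite symb_half_step //.
  have h1 := hc k; have h2 := he k; rewrite symb_half_step // in h1.
  have gen (t P X Y S1 S2 w : R[i]) : t * P * X - S1 = t * w -> P * Y - S2 = w ->
    t * P * X - t * P * Y - (S1 - t * S2) = 0.
    move=> e1 e2; have -> : t * P * X - t * P * Y - (S1 - t * S2) =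
      (t * P * X - S1) - t * (P * Y - S2) by ring.
    by rewrite e1 e2 subrr.
  exact: gen h1 h2.
have := @resolvent_bound R I b2 al (2 * la) ka M Hal Hka HM symbol_params_double a2 diss_double x (fun _ => 0) z z1 hx.
have -> : vnorm (fun _ : I => (0 : R[i])) = 0.
  by rewrite /vnorm big1 ?sqrtr0 // => j _; rewrite normc0 expr0n.
rewrite mulr0 => h.
have x0 : vnorm x = 0 by apply/eqP; rewrite eq_le h vnorm_ge0.
by apply/eqP; rewrite -subr_eq0; apply/eqP; exact: vnorm_eq0 x0 i.
Qed.

Let F n i := partial_sum (e^~ i) n.
Let Fc n i := partial_sum (c^~ i) n.

(** The first term is the quadratic remainder; the second pays for one impulse coefficient at even
    indices. *)
Definition half_step_const : R := 4 * diff_const al ka M + decay_const al ka M.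

Lemma decay_const_ge0 : 0 <= decay_const al ka M.
Proof.
have := theta_const_ge1 Hal Hka HM; have r0 := resolvent_const_gt0 Hal Hka HM => T1.
have T0 : 0 <= theta_const al ka M by lra.
by rewrite /decay_const; nneg.
Qed.

Lemma diff_const_ge0 : 0 <= diff_const al ka M.
Proof.
have := theta_const_ge1 Hal Hka HM; have r0 := resolvent_const_gt0 Hal Hka HM => T1.
have T0 : 0 <= theta_const al ka M by lra.
by rewrite /diff_const; nneg.
Qed.

Lemma powR_div_decr (x y : R) : 0 < x -> x <= y -> y `^ al / y <= x `^ al / x.
Proof.
move=> x0 xy; have y0 : 0 < y by exact: lt_le_trans xy.
have /andP[a0 a1] := Hal.
have powB (t : R) : 0 < t -> t `^ al / t = (t `^ (1 - al))^-1.
  move=> t0; rewrite -powRN opprB powRB ?powRr1 ?(ltW t0) //.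
  by apply/implyP => _; rewrite gt_eqF.
rewrite !powB // lef_pV2 ?posrE ?powR_gt0 //.
by rewrite ge0_ler_powR ?nnegrE ?(ltW x0) ?(ltW y0) // subr_ge0 ltW.
Qed.

Lemma powR_half_succ (n : nat) :
  (n./2.+1)%:R `^ al / (n./2.+1)%:R <= 2 * (n.+1%:R `^ al / n.+1%:R).
Proof.
have n1 : 0 < n.+1%:R :> R by rewrite ltr0n.
have ns : n.+1%:R <= 2 * (n./2.+1)%:R :> R.
  rewrite -natrM ler_nat mul2n doubleS -{1}(odd_double_half n) -addSn.
  by case: (odd n) => /=; rewrite ?add2n ?add1n.
apply: le_trans (powR_div_decr (x := n.+1%:R / 2) _ _) _; first by rewrite divr_gt0.
  by rewrite ler_pdivrMr // mulrC.
move: n.+1%:R n1 {ns} => s s0.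
rewrite powRM ?(ltW s0) ?invr_ge0 // invf_div.
have h2 : 2^-1 `^ al <= 1 :> R.
  rewrite -[X in _ <= X](powRr0 2^-1); apply: ger_powR.
    by rewrite invr_gt0 ltr0n invf_le1 ?ltr0n // ler1n.
  by case/andP: Hal => /ltW.
have -> : s `^ al * 2^-1 `^ al * (2 / s) = 2^-1 `^ al * (2 * (s `^ al / s)).
  by rewrite [s `^ al * _]mulrC -!mulrA; congr (_ * _); rewrite mulrCA.
by apply: ler_piMl => //; rewrite mulr_ge0 // divr_ge0 ?powR_ge0 // ltW.
Qed.

Lemma partial_sum_vec_dot (g : I -> R[i]) (u : nat -> I -> R[i]) n :
  vdot g (fun i => partial_sum (u^~ i) n) = partial_sum (fun k => vdot g (u k)) n.
Proof.
rewrite /vdot /partial_sum exchange_big /=; apply: eq_bigr => i _.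
by rewrite mulr_sumr.
Qed.

(** The m + 1 coarse terms up to index m match the 2 (m + 1) fine terms up to index 2 m + 1. An odd
    n fits exactly into [half_step_error]; an even n = 2 m lacks one fine term, estimated by
    [impulse_decay]. *)
Theorem half_step_step_response n :
  vnorm (fun i => Fc n./2 i - F n i) <= half_step_const * (n.+1%:R `^ al / n.+1%:R) * vnorm v.
Proof.
have dc0 := decay_const_ge0; have df0 := diff_const_ge0.
set m := n./2; set s : R := m.+1%:R.
have s1 : 1 <= s by rewrite ler1n.
have s0 : 0 < s by lra.
have v0 := vnorm_ge0 v.
pose kap := diff_const al ka M * (s `^ al / s ^+ 2) * vnorm v.
have kap0 : 0 <= kap by rewrite /kap; nneg.
have odd_case : vnorm (fun i => Fc m i - F m.*2.+1 i) <= kap * (2 * s).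
  apply: vnorm_le_dual => [|g]; first by rewrite mulr_ge0 // mulr_ge0 // ltW.
  have -> : vdot g (fun i => Fc m i - F m.*2.+1 i) =
      partial_sum (fun k => vdot g (c k)) m - partial_sum (fun k => vdot g (e k)) m.*2.+1.
    rewrite -!partial_sum_vec_dot /vdot -sumrB; apply: eq_bigr => i _; by rewrite mulrBr.
  rewrite mulrA; apply: (half_step_error (e := fun k => vdot g (e k)) (c := partial_sum (fun k => vdot g (c k)))).
  - by rewrite mulr_ge0 ?vnorm_ge0.
  - move=> i mi.
    have -> : vdot g (e i.+1) - vdot g (e i) = vdot g (fun j => e i.+1 j - e i j).
      by rewrite /vdot -sumrB; apply: eq_bigr => j _; rewrite mulrBr.
    apply: le_trans (normc_vdot _ _) _; apply: ler_wpM2l; rewrite ?vnorm_ge0 //.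
    apply: le_trans (impulse_diff Hal Hla Hka HM H a_diss He i) _.
    rewrite /kap; apply: ler_wpM2r => //; apply: ler_wpM2l => //.
    have is0 : 0 < i.+1%:R :> R by rewrite ltr0n.
    have si : s <= i.+1%:R by rewrite ler_nat ltnS.
    rewrite !expr2 !invfM !mulrA; apply: ler_pM.
    + by rewrite divr_ge0 ?powR_ge0 ?ltW.
    + by rewrite invr_ge0 ltW.
    + exact: powR_div_decr.
    + by rewrite lef_pV2 ?posrE.
  - have bge : pscoef_bounded (fun k => vdot g (e k)).
      by apply: pscoef_bounded_vdot => i; exact: be.
    have bgc : pscoef_bounded (fun k => vdot g (c k)).
      by apply: pscoef_bounded_vdot => i; exact: bc.
    have bps p : pscoef_bounded p -> pscoef_bounded (partial_sum p).
      by move=> hp; rewrite partial_sumE; apply: pscoef_bounded_cauchy => //; exact: pscoef_bounded_ones.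
    have ev p z : pscoef_bounded p -> normc z < 1 -> pseval (partial_sum p) z = pseval p z / (1 - z).
      move=> hp z1; apply: pscvg_pseval => //; first exact: bps.
      rewrite partial_sumE; apply: pscvg_cauchy (pseval_cvg hp z1) (pscvg_ones z1) => //.
      exact: pscoef_bounded_ones.
    apply: half_step_coef; [exact: bps|exact: bps|].
    move=> z z1; have m1 := normc_midpoint z1.
    rewrite !ev //.
    have -> : pseval (fun k => vdot g (c k)) z = pseval (fun k => vdot g (e k)) (midpoint z).
      rewrite (pscvg_pseval bgc z1 (vdot_psum_cvg g (fun i => pseval_cvg (bc i) z1))).
      rewrite (pscvg_pseval bge m1 (vdot_psum_cvg g (fun i => pseval_cvg (be i) m1))).
      by congr vdot; apply/funext => i; exact: impulse_half_step.
    have z0 := disc_neq0 z1; rewrite /midpoint.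
    have -> : 1 - (1 + z) / 2 = (1 - z) / 2 by field.
    by move: (pseval _ _) => X; field; rewrite ?z0.
have n1 : 0 < n.+1%:R :> R by rewrite ltr0n.
have sd : s `^ al / s <= 2 * (n.+1%:R `^ al / n.+1%:R) by exact: powR_half_succ.
set Q := n.+1%:R `^ al / n.+1%:R in sd *.
have Q0 : 0 <= Q by rewrite divr_ge0 ?powR_ge0 // ltW.
have kapE : kap * (2 * s) <= 4 * diff_const al ka M * Q * vnorm v.
  have -> : kap * (2 * s) = diff_const al ka M * (2 * (s `^ al / s)) * vnorm v.
    by rewrite /kap; field; rewrite gt_eqF.
  apply: ler_wpM2r => //.
  have -> : 4 * diff_const al ka M * Q = diff_const al ka M * (4 * Q).
    by rewrite [4 * _]mulrC mulrA.
  by apply: ler_wpM2l => //; move: sd; clearbody Q; move: (_ / s) => X; lra.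
have dQ : 0 <= decay_const al ka M * Q * vnorm v by nneg.
rewrite /half_step_const (mulrDl (4 * _)) (mulrDl (4 * _ * _)).
have [nodd|neven] := boolP (odd n).
  have nE : n = m.*2.+1 by rewrite -{1}(odd_double_half n) nodd.
  rewrite {1}nE; apply: le_trans odd_case _; apply: le_trans kapE _.
  by rewrite lerDl.
have nE : n = m.*2 by rewrite -{1}(odd_double_half n) (negbTE neven).
have -> : (fun i => Fc m i - F n i) = (fun i => (Fc m i - F m.*2.+1 i) + e n.+1 i).
  apply/funext => i; rewrite -nE.
  have -> : F n.+1 i = F n i + e n.+1 i by rewrite /F /partial_sum big_ord_recr.
  by rewrite opprD addrA subrK.
apply: le_trans (vnormD _ _) (lerD _ _); first exact: le_trans odd_case kapE.
exact: (impulse_decay Hal Hla Hka HM H a_diss He (ltn0Sn n)).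
Qed.

End HalfStep.

(** * Stability and the halving error *)

Section CauchyShift.
Variable R : realType.
Implicit Types (p q : nat -> R[i]).

Lemma cauchy_prod_shiftc p q n :
  cauchy_prod p (shiftc q) n = shiftc (cauchy_prod p q) n.
Proof.
case: n => [|n] /=; first by rewrite /cauchy_prod big_ord_recl big_ord0 mulr0 addr0.
rewrite /cauchy_prod big_ord_recr /= subnn mulr0 addr0; apply: eq_bigr => k _.
by rewrite subSn // -ltnS.
Qed.

Lemma shiftc_iterE p k n : iter k (@shiftc R) p n = if (n < k)%N then 0 else p (n - k)%N.
Proof.
elim: k n => [|k IH] n /=; first by rewrite subn0.
by case: n => [|n] //=; rewrite IH ltnS subSS.
Qed.

Lemma cauchy_prod_shift_iter p q k n :
  cauchy_prod p (iter k (@shiftc R) q) n = iter k (@shiftc R) (cauchy_prod p q) n.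
Proof.
elim: k n => [|k IH] n //=; rewrite cauchy_prod_shiftc.
by case: n => [|n] //=; exact: IH.
Qed.

Lemma cauchy_prod_recl p q n :
  cauchy_prod p q n = p 0%N * q n + \sum_(k < n) p k.+1 * q (n - k.+1)%N.
Proof. by rewrite /cauchy_prod big_ord_recl subn0. Qed.

Lemma cauchy_prod_sumr (J : Type) (r : seq J) p (q : J -> nat -> R[i]) n :
  cauchy_prod p (fun k => \sum_(j <- r) q j k) n = \sum_(j <- r) cauchy_prod p (q j) n.
Proof.
by rewrite /cauchy_prod exchange_big /=; apply: eq_bigr => k _; rewrite mulr_sumr.
Qed.

Lemma sum_rev (F : nat -> R[i]) n :
  \sum_(k < n.+1) F (n - k)%N = \sum_(k < n.+1) F k.
Proof.
rewrite (reindex_inj rev_ord_inj) /=; apply: eq_bigr => k _.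
by rewrite subSS subKn // -ltnS.
Qed.

Lemma sum_triangle (F : nat -> nat -> R[i]) n :
  \sum_(k < n.+1) \sum_(m < k) F m (n - k)%N = \sum_(m < n) \sum_(j < n - m) F m j.
Proof.
have -> : \sum_(k < n.+1) \sum_(m < k) F m (n - k)%N =
    \sum_(k < n.+1) \sum_(m < n | (m < n - k)%N) F m k.
  rewrite -(sum_rev (fun k => \sum_(m < n | (m < n - k)%N) F m k)); apply: eq_bigr => k _.
  have kn : (k <= n)%N by rewrite -ltnS.
  by rewrite subKn //; exact: (big_ord_widen n (fun m => F m (n - k)%N)).
rewrite (exchange_big_dep xpredT) //=; apply: eq_bigr => m _.
have mn : (n - m <= n.+1)%N by rewrite (leq_trans (leq_subr _ _)).
rewrite (big_ord_widen n.+1 (F m) mn); apply: eq_bigl => k.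
by rewrite !ltn_subRL addnC.
Qed.

End CauchyShift.

(** Bernoulli at the ratio n / (n + 1) shows that n^al grows by at least al (n + 1)^(al - 1) in the
    next step. *)
Lemma sum_powR_le (R : realType) (al : R) n : 0 < al < 1 ->
  al * \sum_(m < n) ((m.+1)%:R `^ al / (m.+1)%:R) <= n%:R `^ al.
Proof.
move=> /andP[a0 a1]; elim: n => [|n IH]; first by rewrite big_ord0 mulr0 powR_ge0.
rewrite big_ord_recr mulrDr; apply: le_trans (lerD IH (lexx _)) _ => /=.
have s0 : 0 < n.+1%:R :> R by rewrite ltr0n.
case: n s0 {IH} => [|n] s0.
  by rewrite !powR1 invr1 mulr1 powR0 ?gt_eqF // add0r mulr1 ltW.
have n0 : 0 < n.+1%:R / n.+2%:R :> R by rewrite divr_gt0 ?ltr0n.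
have hB := powR_bernoulli n0 (introT andP (conj a0 a1)).
have -> : n.+1%:R `^ al = n.+2%:R `^ al * (n.+1%:R / n.+2%:R) `^ al :> R.
  rewrite -powRM ?(ltW s0) ?(ltW n0) //; congr (_ `^ _).
  by rewrite mulrCA divff ?mulr1 ?gt_eqF.
set P := n.+2%:R `^ al.
have P0 : 0 <= P by exact: powR_ge0.
have e : n.+1%:R / n.+2%:R = 1 - n.+2%:R^-1 :> R.
  have n2 : n.+2%:R != 0 :> R by rewrite pnatr_eq0.
  by apply: (mulIf n2); rewrite mulrBl mul1r mulfVK // mulVf // -(natr1 n.+1) addrK.
rewrite e in hB *.
have := ler_wpM2l P0 hB; set B := _ `^ al; set t := n.+2%:R^-1.
have -> : P * (al * (1 - t) + (1 - al)) = P - al * (P * t) by ring.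
by move: (P * t) (P * B) => X Y; lra.
Qed.

(** * Solvability, Duhamel's formula and stability of the scheme *)

Section Discrete.
Variables (R : realType) (I : finType).
Variables (b : I -> R[i]) (al la ka M : R).
Hypotheses (Hal : 0 < al < 1) (Hla : 0 < la) (Hka : 0 < ka) (HM : 0 <= M).
Hypothesis H : forall i, symbol_params (b i) al la ka M.
Variable a : I -> I -> R[i].
Hypothesis a_diss : forall x : I -> R[i],
  complex.Re (vdot x (fun i => \sum_j a i j * x j)) <= 0.

Local Notation scheme := (scheme_lhs b al la a).
Let d i := symb (b i) al la.

Lemma scheme_sum (J : Type) (r : seq J) (u : J -> nat -> I -> R[i]) n i :
  scheme (fun m k => \sum_(j <- r) u j m k) n i = \sum_(j <- r) scheme (u j) n i.
Proof.
rewrite /scheme_lhs cauchy_prod_sumr sumrB; congr (_ - _).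
by rewrite exchange_big; apply: eq_bigr => j _; rewrite mulr_sumr.
Qed.

Lemma scheme_sub u w n i :
  scheme (fun m k => u m k - w m k) n i = scheme u n i - scheme w n i.
Proof.
have e1 : cauchy_prod (d i) (fun k => u k i - w k i) n =
    cauchy_prod (d i) (u^~ i) n - cauchy_prod (d i) (w^~ i) n.
  by rewrite /cauchy_prod -sumrB; apply: eq_bigr => k _; rewrite mulrBr.
have e2 : \sum_j a i j * (u n j - w n j) = \sum_j a i j * u n j - \sum_j a i j * w n j.
  by rewrite -sumrB; apply: eq_bigr => j _; rewrite mulrBr.
by rewrite /scheme_lhs e1 e2; ring.
Qed.

Lemma scheme_shift k u n i :
  scheme (fun m j => iter k (@shiftc R) (u^~ j) m) n i =
  if (n < k)%N then 0 else scheme u (n - k)%N i.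
Proof.
rewrite /scheme_lhs cauchy_prod_shift_iter shiftc_iterE.
under eq_bigr do rewrite shiftc_iterE.
by case: ifP => // _; rewrite big1 ?subr0 // => j _; rewrite mulr0.
Qed.

(** The resolvent bound at z = 0, where the symbol reduces to its leading coefficient. *)
Lemma head_inj (x w : I -> R[i]) : (forall i, d i 0%N * x i - \sum_j a i j * x j = w i) ->
  vnorm x <= resolvent_const al ka M * vnorm w.
Proof.
move=> h; have z0 : normc (0 : R[i]) < 1 by rewrite normc0.
have := @resolvent_bound R I b al la ka M Hal Hka HM H a a_diss x w 0 z0.
rewrite subr0 normc1 powR1 divr1; apply => i.
by rewrite pseval0; [exact: h|exact: pscoef_bounded_symb (H i)].
Qed.

Lemma vnorm0 : vnorm (fun _ : I => (0 : R[i])) = 0.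
Proof. by rewrite /vnorm big1 ?sqrtr0 // => j _; rewrite normc0 expr0n. Qed.

(** A square matrix with trivial kernel is invertible. *)
Lemma head_solvable (w : I -> R[i]) :
  exists x : I -> R[i], forall i, d i 0%N * x i - \sum_j a i j * x j = w i.
Proof.
pose B : 'M[R[i]]_#|I| := \matrix_(s, t) ((s == t)%:R * d (enum_val s) 0%N - a (enum_val s) (enum_val t)).
have BE (y : 'cV[R[i]]_#|I|) s : (B *m y) s 0 =
    d (enum_val s) 0%N * y s 0 - \sum_j a (enum_val s) j * y (enum_rank j) 0.
  rewrite mxE (reindex (@enum_val I I)) /=; last first.
    by exists enum_rank => t _; [exact: enum_valK|exact: enum_rankK].
  under [X in _ = _ - X]eq_bigr do rewrite enum_valK.
  have -> : d (enum_val s) 0%N * y s 0 = \sum_t (s == t)%:R * d (enum_val s) 0%N * y t 0.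
    rewrite (bigD1 s) //= eqxx mul1r big1 ?addr0 // => t ts.
    by rewrite eq_sym (negbTE ts) !mul0r.
  by rewrite -sumrB; apply: eq_bigr => t _; rewrite mxE mulrBl.
have Bu : B \in unitmx.
  rewrite -unitmx_tr -row_free_unit -kermx_eq0; apply/rowV0P => u /sub_kermxP uB.
  have Bu0 : B *m u^T = 0 by rewrite -[B]trmxK -trmx_mul uB trmx0.
  have h i : d i 0%N * u 0 (enum_rank i) - \sum_j a i j * u 0 (enum_rank j) = 0.
    have := congr1 (fun A : 'cV[R[i]]_#|I| => A (enum_rank i) 0) Bu0.
    by rewrite BE enum_rankK !mxE; under eq_bigr do rewrite mxE.
  have := head_inj h; rewrite vnorm0 mulr0 => x0.
  have x1 : vnorm (fun i => u 0 (enum_rank i)) = 0 by apply/eqP; rewrite eq_le x0 vnorm_ge0.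
  by apply/rowP => t; rewrite mxE -(enum_valK t); exact: vnorm_eq0 x1 _.
pose y := invmx B *m (\col_t w (enum_val t)).
have By : B *m y = \col_t w (enum_val t) by exact: mulKVmx.
exists (fun i => y (enum_rank i) 0) => i; clearbody y.
have := congr1 (fun A : 'cV[R[i]]_#|I| => A (enum_rank i) 0) By.
by rewrite BE mxE enum_rankK.
Qed.

Lemma scheme_unique (L : nat) u w :
  (forall n i, (n <= L)%N -> scheme u n i = scheme w n i) ->
  forall n i, (n <= L)%N -> u n i = w n i.
Proof.
move=> h n i nL; apply/eqP; rewrite -subr_eq0; apply/eqP.
move: i; elim/ltn_ind: n nL => n IH nL.
suff : vnorm (fun i => u n i - w n i) = 0 by move=> h0 i; exact: vnorm_eq0 h0 i.
have h0 i : d i 0%N * (u n i - w n i) - \sum_j a i j * (u n j - w n j) = 0.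
  have := scheme_sub u w n i; rewrite h // subrr {1}/scheme_lhs cauchy_prod_recl.
  rewrite [X in _ + X - _]big1 ?addr0 // => k _; rewrite IH ?mulr0 //.
    by rewrite ltn_subrL /= (leq_ltn_trans _ (ltn_ord k)).
  exact: leq_trans (leq_subr _ _) nL.
by have := head_inj h0; rewrite vnorm0 mulr0 => x0; apply/eqP; rewrite eq_le x0 vnorm_ge0.
Qed.

Lemma scheme_solvable (g : nat -> I -> R[i]) : exists u, forall n i, scheme u n i = g n i.
Proof.
pose solve w := projT1 (cid (head_solvable w)).
have solveP w i : d i 0%N * solve w i - \sum_j a i j * solve w j = w i.
  exact: (projT2 (cid (head_solvable w))).
pose x0 : I -> R[i] := fun=> 0.
pose next m (s : seq (I -> R[i])) :=
  solve (fun i => g m i - \sum_(k < m) d i k.+1 * nth x0 s (m - k.+1)%N i).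
(* Carrying the list of earlier values turns the recursion on the whole history into a structural
   one. *)
pose fix sols n : seq (I -> R[i]) :=
  if n is m.+1 then rcons (sols m) (next m (sols m)) else [::].
have ssz n : size (sols n) = n by elim: n => //= n IH; rewrite size_rcons IH.
pose u n := nth x0 (sols n.+1) n.
have uE n : u n = next n (sols n) by rewrite /u /= nth_rcons ssz ltnn eqxx.
have sE n k : (k < n)%N -> nth x0 (sols n) k = u k.
  elim: n => //= n IH; rewrite ltnS leq_eqVlt => /orP[/eqP ->|kn].
    by rewrite nth_rcons ssz ltnn eqxx uE.
  by rewrite nth_rcons ssz kn IH.
exists u => n i; rewrite /scheme_lhs cauchy_prod_recl addrAC uE solveP.
rewrite -addrA addrC -[RHS]add0r; congr (_ + _).
rewrite addrC -sumrB big1 // => k _; rewrite sE ?subrr //.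
by rewrite ltn_subrL /= (leq_ltn_trans _ (ltn_ord k)).
Qed.

Definition impulse (v : I -> R[i]) : nat -> I -> R[i] :=
  projT1 (cid (scheme_solvable (fun n i => (n == 0%N)%:R * v i))).

Lemma impulseP v n i : scheme (impulse v) n i = (n == 0%N)%:R * v i.
Proof. exact: (projT2 (cid (scheme_solvable (fun n i => (n == 0%N)%:R * v i)))). Qed.

(** [impulse] is a chosen solution, so its additivity rests on uniqueness and not on its
    construction. *)
Lemma impulse_sum (J : Type) (r : seq J) (v : J -> I -> R[i]) n i :
  impulse (fun k => \sum_(j <- r) v j k) n i = \sum_(j <- r) impulse (v j) n i.
Proof.
apply: (@scheme_unique n _ (fun n i => \sum_(j <- r) impulse (v j) n i)) (leqnn n) => m k _.
rewrite scheme_sum impulseP mulr_sumr; apply: eq_bigr => j _; by rewrite impulseP.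
Qed.

(** The superposition of shifted impulse responses satisfies the same recursion, and solutions are
    unique. *)
Lemma duhamel (L : nat) u (g : nat -> I -> R[i]) :
  (forall n i, (n <= L)%N -> scheme u n i = g n i) ->
  forall n i, (n <= L)%N -> u n i = \sum_(k < n.+1) impulse (g k) (n - k)%N i.
Proof.
move=> h n i nL.
pose w m j := \sum_(k < n.+1) iter k (@shiftc R) ((impulse (g k))^~ j) m.
have hw m j : (m <= n)%N -> scheme w m j = g m j.
  move=> mn; rewrite scheme_sum (bigD1 (Ordinal (mn : (m < n.+1)%N))) //=.
  rewrite scheme_shift ltnn subnn impulseP mul1r big1 ?addr0 // => k km.
  rewrite scheme_shift; case: ltnP => // kn; rewrite impulseP subn_eq0.
  rewrite leqNgt ltn_neqAle kn andbT (_ : (k != m :> nat)) ?mul0r //.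
rewrite (@scheme_unique n u w) //; last by move=> m j mn; rewrite hw // h // (leq_trans mn).
by apply: eq_bigr => k _; rewrite shiftc_iterE ltnNge -ltnS ltn_ord.
Qed.

(** Summation by parts moves the difference onto the source, which is how f' enters the estimate; g
    vanishing at 0 removes the boundary term. *)
Lemma duhamel_increments (L : nat) u (g : nat -> I -> R[i]) : g 0%N =1 (fun=> 0) ->
  (forall n i, (n <= L)%N -> scheme u n i = g n i) ->
  forall n i, (n <= L)%N -> u n i =
    \sum_(k < n) partial_sum ((impulse (fun j => g k.+1 j - g k j))^~ i) (n - k.+1)%N.
Proof.
move=> g0 h n i nL; rewrite (duhamel h) //.
pose dg k j := g k.+1 j - g k j.
have gE k : g k = fun j => \sum_(m < k) dg m j.
  apply/funext => j; elim: k => [|k IH]; first by rewrite big_ord0 g0.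
  by rewrite big_ord_recr /= -IH /dg addrC subrK.
under eq_bigr => k _ do rewrite gE impulse_sum.
rewrite /partial_sum.
rewrite (sum_triangle (fun m j => impulse (dg m) j i)); apply: eq_bigr => k _.
by rewrite subnSK.
Qed.

Lemma decay_all (v : I -> R[i]) n :
  vnorm (impulse v n) <= (2 * decay_const al ka M + resolvent_const al ka M) *
    (n.+1%:R `^ al / n.+1%:R) * vnorm v.
Proof.
have d0 : 0 <= decay_const al ka M := decay_const_ge0 Hal Hka HM.
have r0 : 0 < resolvent_const al ka M := resolvent_const_gt0 Hal Hka HM.
have v0 := vnorm_ge0 v.
case: n => [|n].
  rewrite powR1 divr1 mulr1; apply: le_trans (impulse_start Hal Hla Hka HM H a_diss (impulseP v)) _.
  by apply: ler_wpM2r => //; rewrite lerDr mulr_ge0.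
apply: le_trans (impulse_decay Hal Hla Hka HM H a_diss (impulseP v) (ltn0Sn n)) _.
apply: ler_wpM2r => //.
have h : n.+1%:R `^ al / n.+1%:R <= 2 * (n.+2%:R `^ al / n.+2%:R) :> R.
  have n1 : 0 < n.+1%:R :> R by rewrite ltr0n.
  have n2 : 0 < n.+2%:R :> R by rewrite ltr0n.
  rewrite mulrCA; apply: ler_pM; rewrite ?powR_ge0 ?invr_ge0 ?(ltW n1) //.
    by rewrite ge0_ler_powR ?nnegrE ?ler_nat //; case/andP: Hal => /ltW.
  rewrite -[X in X <= _]mul1r ler_pdivrMr // mulrAC ler_pdivlMr // mul1r -natrM ler_nat; lia.
have Q0 : 0 <= n.+2%:R `^ al / n.+2%:R :> R by rewrite divr_ge0 ?powR_ge0.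
apply: le_trans (ler_wpM2l d0 h) _.
have gen (D r Q : R) : 0 <= r -> 0 <= Q -> D * (2 * Q) <= (2 * D + r) * Q.
  move=> r00 Q00; have -> : (2 * D + r) * Q = D * (2 * Q) + r * Q by ring.
  by rewrite lerDl mulr_ge0.
by apply: gen => //; exact: ltW.
Qed.

Definition stab_const : R := (2 * decay_const al ka M + resolvent_const al ka M) / al.

(** The decay k^(al-1) sums to (n+1)^al / al. For a source scaled by tau^al this stays bounded up to
    a fixed time. *)
Lemma scheme_stable (L : nat) u (g : nat -> I -> R[i]) (dl : R) : 0 <= dl ->
  (forall n i, (n <= L)%N -> scheme u n i = g n i) ->
  (forall n, (n <= L)%N -> vnorm (g n) <= dl) ->
  forall n, (n <= L)%N -> vnorm (u n) <= stab_const * n.+1%:R `^ al * dl.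
Proof.
move=> dl0 h hg n nL; have /andP[a0 a1] := Hal.
have d0 : 0 <= decay_const al ka M := decay_const_ge0 Hal Hka HM.
have r0 : 0 < resolvent_const al ka M := resolvent_const_gt0 Hal Hka HM.
set K := 2 * decay_const al ka M + resolvent_const al ka M.
have K0 : 0 <= K by rewrite /K; lra.
have -> : u n = fun i => \sum_(k < n.+1) impulse (g k) (n - k)%N i.
  by apply/funext => i; exact: (duhamel h).
apply: le_trans (vnorm_sum _ _) _.
apply: (@le_trans _ _ (\sum_(k < n.+1) K * ((n - k).+1%:R `^ al / (n - k).+1%:R) * dl)).
  apply: ler_sum => k _; apply: le_trans (decay_all _ _) _; apply: ler_wpM2l.
    by rewrite mulr_ge0 // divr_ge0 ?powR_ge0.
  by apply: hg; apply: leq_trans nL; rewrite -ltnS.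
rewrite -mulr_suml; apply: ler_wpM2r => //.
rewrite -mulr_sumr /stab_const -/K -[X in _ <= X]mulrA; apply: ler_wpM2l => //.
rewrite mulrC ler_pdivlMr // mulrC.
rewrite (reindex_inj rev_ord_inj) /=.
rewrite (_ : \sum_j _ = \sum_(j < n.+1) ((j.+1)%:R `^ al / (j.+1)%:R)); first exact: sum_powR_le.
by apply: eq_bigr => k _; rewrite subSS subKn // -ltnS.
Qed.

Lemma partial_impulse_sum (J : Type) (r : seq J) (v : J -> I -> R[i]) n i :
  partial_sum ((impulse (fun k => \sum_(j <- r) v j k))^~ i) n =
  \sum_(j <- r) partial_sum ((impulse (v j))^~ i) n.
Proof.
rewrite /partial_sum exchange_big /=; apply: eq_bigr => k _; exact: impulse_sum.
Qed.

End Discrete.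

(** * Effect of halving the time step on the discrete solution *)

Section Halving.
Variables (R : realType) (I : finType).
Variables (b : I -> R[i]) (al la ka M : R).
Hypotheses (Hal : 0 < al < 1) (Hla : 0 < la) (Hka : 0 < ka) (HM : 0 <= M).
Hypothesis H : forall i, symbol_params (b i) al la ka M.
Variable a : I -> I -> R[i].
Hypothesis a_diss : forall x : I -> R[i],
  complex.Re (vdot x (fun i => \sum_j a i j * x j)) <= 0.

Let b2 i := 2 * b i.
Let a2 i j := (2 `^ al)%:C * a i j.
Let Hla2 : 0 < 2 * la. Proof. by rewrite mulr_gt0. Qed.
Let H2 := symbol_params_double H.
Let a2_diss := diss_double al a_diss.

(** Each coarse increment of g is the sum of two fine ones, and both are charged to the coarse step
    response of index (2n - k - 1)./2. The comparison of the two solutions is then termwise in the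
    fine increments. *)
Lemma halving_error (L : nat) (uc uf g : nat -> I -> R[i]) : g 0%N =1 (fun=> 0) ->
  (forall n i, (n <= L)%N ->
     scheme_lhs b2 al (2 * la) a2 uc n i = (2 `^ al)%:C * g n.*2 i) ->
  (forall n i, (n <= L.*2)%N -> scheme_lhs b al la a uf n i = g n i) ->
  forall n, (n <= L)%N ->
    vnorm (fun i => uc n i - uf n.*2 i) <=
    \sum_(k < n.*2) half_step_const al ka M * ((n.*2 - k)%:R `^ al / (n.*2 - k)%:R) *
       vnorm (fun i => g k.+1 i - g k i).
Proof.
move=> g0 hc hf n nL.
pose dg k i := g k.+1 i - g k i.
pose Pf k i j := partial_sum ((impulse Hal Hka HM H a_diss (dg k))^~ i) j.
pose Pc k i j := partial_sum ((impulse Hal Hka HM H2 a2_diss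
   (fun i => (2 `^ al)%:C * dg k i))^~ i) j.
have uf_E i : uf n.*2 i = \sum_(k < n.*2) Pf k i (n.*2 - k.+1)%N.
  by apply: (duhamel_increments Hal Hka HM H a_diss g0 hf); rewrite leq_double.
have uc_E i : uc n i = \sum_(k < n) (Pc k.*2 i (n - k.+1)%N + Pc k.*2.+1 i (n - k.+1)%N).
  pose g2 k i := (2 `^ al)%:C * g k.*2 i.
  have g20 : g2 0%N =1 (fun=> 0) by move=> j; rewrite /g2 g0 mulr0.
  rewrite (duhamel_increments Hal Hka HM H2 a2_diss g20 hc) //; apply: eq_bigr => k _.
  pose v (j : bool) i := (2 `^ al)%:C * dg (j + k.*2)%N i.
  have -> : (fun j => g2 k.+1 j - g2 k j) = (fun i => \sum_(j <- [:: false; true]) v j i).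
    apply/funext => j; rewrite 2!big_cons big_nil addr0 /v /g2 /dg doubleS /= add0n add1n.
    by rewrite -mulrBr -mulrDr [in RHS]addrC addrA subrK.
  by rewrite partial_impulse_sum 2!big_cons big_nil addr0 /Pc /v /= add0n add1n.
have pairs (F : nat -> R[i]) m : \sum_(k < m.*2) F k = \sum_(k < m) (F k.*2 + F k.*2.+1).
  elim: m => [|m IH]; first by rewrite !big_ord0.
  by rewrite doubleS 2!big_ord_recr [in RHS]big_ord_recr /= -IH addrA.
have uc_E2 i : uc n i = \sum_(k < n.*2) Pc k i ((n.*2 - k.+1)./2)%N.
  rewrite uc_E (pairs (fun k => Pc k i (n.*2 - k.+1)./2)); apply: eq_bigr => k _.
  have kn := ltn_ord k.
  have e1 : ((n.*2 - k.*2.+1)./2 = n - k.+1)%N.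
    rewrite (_ : (n.*2 - k.*2.+1 = (n - k.+1).*2.+1)%N) /= ?uphalf_double //.
    by rewrite doubleB doubleS -!muln2; lia.
  have e2 : ((n.*2 - k.*2.+2)./2 = n - k.+1)%N by rewrite -doubleS -doubleB doubleK.
  by rewrite e1 e2.
have -> : (fun i => uc n i - uf n.*2 i) =
  (fun i => \sum_(k < n.*2) (Pc k i (n.*2 - k.+1)./2 - Pf k i (n.*2 - k.+1)%N)).
  by apply/funext => i; rewrite uc_E2 uf_E sumrB.
apply: le_trans (vnorm_sum _ _) _; apply: ler_sum => k _.
have := half_step_step_response Hal Hla Hka HM H a_diss
  (impulseP Hal Hka HM H a_diss (dg k))
  (impulseP Hal Hka HM H2 a2_diss (fun i => (2 `^ al)%:C * dg k i)) (n.*2 - k.+1).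
by rewrite -subSn // subSS.
Qed.

End Halving.

(** * The discrete tempered fractional Laplacian is dissipative *)

Section Reflection.
Variable R : realType.
Local Notation mu := (@lebesgue_measure R).

Definition reflect (c : R) : measurableTypeR R -> measurableTypeR R := fun x => c - x.

Lemma measurable_reflect c : measurable_fun setT (reflect c).
Proof. exact: measurable_funB. Qed.

HB.instance Definition _ c := isMeasurableFun.Build _ _ _ _ (reflect c) (measurable_reflect c).

Lemma lebesgue_measure_reflect c (A : set R) : measurable A ->
  pushforward mu (reflect c) A = mu A.
Proof.
move=> mA; apply/esym/lebesgue_measure_unique => //= _ [[a b]] _ <-.
rewrite /pushforward.
have -> : reflect c @^-1` [set` `]a, b]%R] = [set` `[c - b, c - a[%R].
  apply/seteqP; split => x /=; rewrite !in_itv /= /reflect => /andP[h1 h2]; apply/andP; split; lra.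
by rewrite !lebesgue_measure_itv /= !lte_fin ltrD2l ltrN2; case: ifP => // _; congr (_%:E); ring.
Qed.

Lemma ge0_integral_reflect (c : R) (f : R -> \bar R) : measurable_fun setT f ->
  (forall x, 0 <= f x)%E -> (\int[mu]_x f x = \int[mu]_x f (c - x)%R)%E.
Proof.
move=> mf f0.
have := @ge0_integral_pushforward _ _ _ _ R (reflect c) (measurable_reflect c) mu setT f measurableT mf.
rewrite preimage_setT => <- //.
by apply: eq_measure_integral => //= A mA _; exact/esym/lebesgue_measure_reflect.
Qed.

Lemma Rintegral_reflect (c a b : R) (f : R -> R) : measurable_fun `[a, b] f ->
  (forall x, x \in `[a, b] -> 0 <= f x) ->
  \int[mu]_(x in `[a, b]) f x = \int[mu]_(x in `[c - b, c - a]) f (c - x).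
Proof.
move=> mf f0; rewrite /Rintegral; congr fine.
rewrite integral_mkcond [in RHS]integral_mkcond (@ge0_integral_reflect c).
- apply: eq_integral => x _; rewrite /patch !mem_setE /= !in_itv /=.
  by rewrite lerBlDr -lerBlDl lerBrDr -lerBrDl andbC.
- by apply: (measurable_restrictT _ _).1 => //; exact/measurable_EFinP.
- by move=> x; rewrite /patch; case: ifP => //; rewrite mem_setE => /f0; rewrite lee_fin.
Qed.

End Reflection.

(** * Iterated integrals over rectangles *)

Section Rectangle.
Variable R : realType.
Local Notation mu := (@lebesgue_measure R).
Variables (a b c d B : R) (K : R -> R -> R).
Hypothesis mK : measurable_fun setT (fun z : R * R => K z.1 z.2).
Hypothesis Kb : forall x y, a <= x <= b -> c <= y <= d -> 0 <= K x y <= B.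

Lemma mu_itv_fin (s t : R) : (mu `[s, t] < +oo)%E.
Proof. by rewrite lebesgue_measure_itv /=; case: ifP => // _; rewrite -EFinB ltry. Qed.

Lemma rect_inner_integrable x : a <= x <= b -> mu.-integrable `[c, d] (EFin \o K x).
Proof.
move=> xab; apply: measurable_bounded_integrable => //; first exact: mu_itv_fin.
  apply: measurable_funTS; exact: (measurableT_comp mK (pair1_measurable x)).
exists B; split; first by rewrite num_real.
move=> M BM y /=; rewrite in_itv /= => ycd.
have /andP[k0 k1] := Kb xab ycd.
by rewrite ger0_norm // (le_trans k1) // ltW.
Qed.

Lemma rect_inner_ge0 x : a <= x <= b -> 0 <= \int[mu]_(y in `[c, d]) K x y.
Proof.
move=> xab; apply: Rintegral_ge0 => y /=; rewrite in_itv /= => ycd.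
by have /andP[] := Kb xab ycd.
Qed.

Lemma rect_outer_integrable :
  mu.-integrable `[a, b] (EFin \o (fun x => \int[mu]_(y in `[c, d]) K x y)).
Proof.
pose G (z : R * R) : \bar R := ((fun z : R * R => K z.1 z.2) \_ (`[a, b] `*` `[c, d]) z)%:E.
have mS : measurable (`[a, b]%classic `*` `[c, d]%classic : set (R * R)) by exact: measurableX.
have iG : (mu \x mu)%E.-integrable setT G.
  have -> : G = (EFin \o (fun z : R * R => K z.1 z.2)) \_ (`[a, b] `*` `[c, d]).
    by rewrite restrict_EFin.
  have := @integrable_mkcond _ _ R (mu \x mu)%E (`[a, b] `*` `[c, d])
    (EFin \o (fun z : R * R => K z.1 z.2)).
  move=> /(_ (measurableX (measurable_itv _) (measurable_itv _))) [h _]; apply: h. apply: measurable_bounded_integrable => //.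
  - rewrite [X in (X < _)%E](_ : _ = mu `[a, b] * mu `[c, d])%E; last first.
      by apply: product_measure1E; exact: measurable_itv.
    rewrite lte_mul_pinfty //; last exact: mu_itv_fin.
    by rewrite ge0_fin_numE // mu_itv_fin.
  - exact: measurable_funTS.
  - exists B; split; first by rewrite num_real.
    move=> M BM z /= []; rewrite !in_itv /= => h1 h2.
    have /andP[k0 k1] := Kb h1 h2.
    by rewrite ger0_norm // (le_trans k1) // ltW.
have iF : mu.-integrable `[a, b] (fubini_F mu G).
  by apply: integrableS (integrable_fubini_F iG) => //; exact: measurable_itv.
apply: eq_integrable iF => // x; rewrite inE /= in_itv /= => xab.
rewrite /fubini_F /Rintegral fineK; last first.
  by apply: integrable_fin_num => //; exact: rect_inner_integrable.
rewrite [RHS]integral_mkcond; apply: eq_integral => y _.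
rewrite /G /patch in_setX /= (_ : x \in [set` _]) //; last by rewrite inE /= in_itv.
by rewrite andTb; case: ifP.
Qed.

End Rectangle.

Section RintegrableOps.
Variable R : realType.
Local Notation mu := (@lebesgue_measure R).
Variables (D : set R) (mD : measurable D).

Lemma RintegrableD (f g : R -> R) : mu.-integrable D (EFin \o f) -> mu.-integrable D (EFin \o g) ->
  mu.-integrable D (EFin \o (fun x => f x + g x)).
Proof.
move=> hf hg; rewrite (_ : EFin \o _ = ((EFin \o f) \+ (EFin \o g))%E); first exact: integrableD.
by apply/funext => x.
Qed.

Lemma RintegrableZr (f : R -> R) k : mu.-integrable D (EFin \o f) ->
  mu.-integrable D (EFin \o (fun x => f x * k)).
Proof.
move=> hf; rewrite (_ : EFin \o _ = (fun x => (EFin \o f) x * k%:E)%E); first exact: integrableZr.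
by apply/funext => x.
Qed.

End RintegrableOps.

Lemma Rintegral_sum (R : realType) (D : set R) (J : Type) (s : seq J) (F : J -> R -> R) :
  measurable D -> (forall j, (@lebesgue_measure R).-integrable D (EFin \o F j)) ->
  (@lebesgue_measure R).-integrable D (EFin \o (fun x => \sum_(j <- s) F j x)) /\
  \int[@lebesgue_measure R]_(x in D) \sum_(j <- s) F j x =
  \sum_(j <- s) \int[@lebesgue_measure R]_(x in D) F j x.
Proof.
move=> mD iF; elim: s => [|j s [IH1 IH2]].
  have e : (fun x : R => \sum_(j <- [::]) F j x) = cst 0 by apply/funext => x; rewrite big_nil.
  split; first by rewrite e; exact: integrable0.
  by rewrite big_nil e /Rintegral integral0_eq.
have e : (fun x : R => \sum_(j <- j :: s) F j x) = (fun x => F j x + \sum_(j <- s) F j x).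
  by apply/funext => x; rewrite big_cons.
split; first by rewrite e; exact: RintegrableD.
by rewrite e big_cons -IH2 RintegralD.
Qed.

Lemma rect_integral_lin (R : realType) (a b c d B : R) (J : Type) (s : seq J)
    (K : J -> R -> R -> R) (x : J -> R) :
  (forall j, measurable_fun setT (fun z : R * R => K j z.1 z.2)) ->
  (forall j y z, a <= y <= b -> c <= z <= d -> 0 <= K j y z <= B) ->
  \int[@lebesgue_measure R]_(y in `[a, b]) \int[@lebesgue_measure R]_(z in `[c, d])
    \sum_(j <- s) K j y z * x j =
  \sum_(j <- s) (\int[@lebesgue_measure R]_(y in `[a, b])
     \int[@lebesgue_measure R]_(z in `[c, d]) K j y z) * x j.
Proof.
move=> mK Kb.
transitivity (\int[@lebesgue_measure R]_(y in `[a, b])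
    \sum_(j <- s) (\int[@lebesgue_measure R]_(z in `[c, d]) K j y z) * x j).
  apply: eq_Rintegral => y; rewrite inE /= in_itv /= => yab.
  have iK j : (@lebesgue_measure R).-integrable `[c, d] (EFin \o K j y).
    by apply: (rect_inner_integrable (mK j)) yab; exact: Kb.
  have iKx j : (@lebesgue_measure R).-integrable `[c, d] (EFin \o (fun z => K j y z * x j)).
    exact: RintegrableZr.
  have [_ ->] := Rintegral_sum s (measurable_itv `[c, d]) iKx.
  by apply: eq_bigr => j _; rewrite RintegralZr.
have iJ j : (@lebesgue_measure R).-integrable `[a, b]
    (EFin \o (fun y => \int[@lebesgue_measure R]_(z in `[c, d]) K j y z)).
  by apply: (rect_outer_integrable (mK j)); exact: Kb.
have iJx j : (@lebesgue_measure R).-integrable `[a, b]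
    (EFin \o (fun y => (\int[@lebesgue_measure R]_(z in `[c, d]) K j y z) * x j)).
  exact: RintegrableZr.
have [_ ->] := Rintegral_sum s (measurable_itv `[a, b]) iJx.
by apply: eq_bigr => j _; rewrite RintegralZr.
Qed.

(** * Quadrature weights of a cell and their symmetry *)

Section CellWeights.
Variables (R : realType) (beta gamma h : R).
Hypotheses (Hbeta : 0 < beta) (h0 : 0 < h).
Local Notation mu := (@lebesgue_measure R).
Implicit Types (a b : bool) (i j p q : int).

(** The two linear shape functions of a unit interval; [a] selects the node at its right end. Their
    tensor products are the bilinear basis. *)
Definition hat a (s : R) : R := if a then s else 1 - s.

Definition cell_integrand a b i j p q (xi eta : R) : R :=
  hat a (xi / h - i%:~R) * hat b (eta / h - j%:~R) *
  kern beta (xi, eta) (p%:~R * h, q%:~R * h).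

Definition cell_weight a b i j p q : R :=
  \int[mu]_(xi in `[i%:~R * h, (i + 1)%:~R * h])
    \int[mu]_(eta in `[j%:~R * h, (j + 1)%:~R * h]) cell_integrand a b i j p q xi eta.

(** The four cells touching the node, where alone the kernel is singular. *)
Definition adjacent i j p q : bool :=
  (i, j) \in [:: (p, q); (p - 1, q); (p, q - 1); (p - 1, q - 1)].

Lemma measurable_hat a i : measurable_fun setT (fun x : R => hat a (x / h - i%:~R)).
Proof.
have m1 : measurable_fun setT (fun x : R => x / h - i%:~R).
  by apply: measurable_funB => //; exact: measurable_funM.
by case: a => //=; exact: measurable_funB.
Qed.

Lemma measurable_kern (y : R * R) : measurable_fun setT (fun z : R * R => kern beta z y).
Proof.
apply: (measurableT_comp (measurable_powR _)); apply: measurable_funD;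
  apply: measurable_funX; apply: measurable_funB => //.
Qed.

Lemma measurable_cell_integrand a b i j p q :
  measurable_fun setT (fun z : R * R => cell_integrand a b i j p q z.1 z.2).
Proof.
apply: measurable_funM; first apply: measurable_funM.
- exact: (measurableT_comp (measurable_hat a i) measurable_fst).
- exact: (measurableT_comp (measurable_hat b j) measurable_snd).
- rewrite (_ : (fun _ => _) = (fun z : R * R => kern beta z (p%:~R * h, q%:~R * h))).
    exact: measurable_kern.
  by apply/funext => -[].
Qed.

Lemma hat01 a i (x : R) : i%:~R * h <= x <= (i + 1)%:~R * h -> 0 <= hat a (x / h - i%:~R) <= 1.
Proof.
move=> /andP[h1 h2].
have h3 : 0 <= x / h - i%:~R by rewrite subr_ge0 ler_pdivlMr.
have h4 : x / h - i%:~R <= 1 by rewrite lerBlDl -intrD1 ler_pdivrMr.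
by case: a => /=; apply/andP; split; lra.
Qed.

Lemma axis_gap i p (x : R) : i%:~R * h <= x <= (i + 1)%:~R * h -> i != p -> i != p - 1 ->
  h ^+ 2 <= (x - p%:~R * h) ^+ 2.
Proof.
move=> /andP[h1 h2] ip ip1.
have [pi|ip2] : (p + 1 <= i) \/ (i <= p - 2) by move: ip ip1; lia.
  have : (p%:~R + 1) * h <= i%:~R * h by rewrite ler_pM2r // -intrD1 ler_int.
  rewrite mulrDl mul1r => h3; rewrite ler_pXn2r ?nnegrE //; first by lra.
  - exact: ltW.
  - by lra.
have : (i + 1)%:~R * h <= (p%:~R - 1) * h.
  by rewrite ler_pM2r // -[X in _ <= _ - X](mulr1z 1) -intrB ler_int; lia.
rewrite mulrBl mul1r => h3; rewrite -[X in _ <= X]sqrrN ler_pXn2r ?nnegrE //; first by lra.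
- exact: ltW.
- by lra.
Qed.

Definition far_bound : R := (h ^+ 2) `^ (- ((2 + beta) / 2)).

Lemma cell_integrand_bound a b i j p q (xi eta : R) : ~~ adjacent i j p q ->
  i%:~R * h <= xi <= (i + 1)%:~R * h -> j%:~R * h <= eta <= (j + 1)%:~R * h ->
  0 <= cell_integrand a b i j p q xi eta <= far_bound.
Proof.
move=> nadj hxi heta.
have /andP[u0 u1] := hat01 a hxi; have /andP[v0 v1] := hat01 b heta.
have k0 : 0 <= kern beta (xi, eta) (p%:~R * h, q%:~R * h) by exact: powR_ge0.
apply/andP; split; first by rewrite !mulr_ge0.
rewrite -[X in _ <= X]mul1r /cell_integrand; apply: ler_pM => //; rewrite ?mulr_ge0 //.
  by rewrite -[X in _ <= X]mul1r; apply: ler_pM.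
have h20 : 0 < h ^+ 2 by rewrite exprn_gt0.
have far : h ^+ 2 <= (xi - p%:~R * h) ^+ 2 + (eta - q%:~R * h) ^+ 2.
  move: nadj; rewrite /adjacent !inE !xpair_eqE !negb_or !negb_and => /and4P[n1 n2 n3 n4].
  have [|] : (i != p /\ i != p - 1) \/ (j != q /\ j != q - 1).
    by move: n1 n2 n3 n4; do 2!case: (_ == _) => //=; do 2!case: (_ == _) => //=; auto.
  - move=> [e1 e2]; apply: le_trans (axis_gap hxi e1 e2) _.
    by rewrite lerDl sqr_ge0.
  - move=> [e1 e2]; apply: le_trans (axis_gap heta e1 e2) _.
    by rewrite lerDr sqr_ge0.
rewrite /kern /far_bound !powRN lef_pV2 ?posrE ?powR_gt0 //; last exact: lt_le_trans far.
rewrite ge0_ler_powR ?nnegrE ?addr_ge0 ?sqr_ge0 ?(ltW h20) //.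
by rewrite divr_ge0 // addr_ge0 // ltW.
Qed.

Lemma cell_weight_ge0 a b i j p q : ~~ adjacent i j p q -> 0 <= cell_weight a b i j p q.
Proof.
move=> nadj; apply: Rintegral_ge0 => xi; rewrite /= in_itv /= => hxi.
apply: Rintegral_ge0 => eta; rewrite /= in_itv /= => heta.
by have /andP[] := cell_integrand_bound a b nadj hxi heta.
Qed.

(* Reflection of the cell through the midpoint of the two nodes. *)
Lemma cell_weight_reflect a b i j p q : ~~ adjacent i j p q ->
  cell_weight a b i j p q =
  cell_weight (~~ a) (~~ b) (p - (~~ a)%:Z) (q - (~~ b)%:Z) (i + a%:Z) (j + b%:Z).
Proof.
move=> nadj; rewrite /cell_weight.
have mK := measurable_cell_integrand a b i j p q.
have Kb x y := @cell_integrand_bound a b i j p q x y nadj.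
have itvE (e : bool) (k m : int) : ((m - (~~ e)%:Z)%:~R * h = (k + m + e%:Z)%:~R * h - (k + 1)%:~R * h) /\
   ((m - (~~ e)%:Z + 1)%:~R * h = (k + m + e%:Z)%:~R * h - k%:~R * h).
  by rewrite -!mulrBl -!intrB; split; congr (_%:~R * _); case: e => /=; lia.
have hatE (e : bool) (k m : int) (x : R) :
    hat e (((k + m + e%:Z)%:~R * h - x) / h - k%:~R) = hat (~~ e) (x / h - (m - (~~ e)%:Z)%:~R).
  rewrite mulrBl mulfK ?gt_eqF // !intrD !mulrNz.
  by case: e => /=; rewrite ?mulr1z ?mulr0z; ring.
rewrite (@Rintegral_reflect _ ((i + p + a%:Z)%:~R * h)).
- have [-> ->] := itvE a i p; apply: eq_Rintegral => xi; rewrite inE /= in_itv /= => hxi.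
  rewrite (@Rintegral_reflect _ ((j + q + b%:Z)%:~R * h)).
  + have [-> ->] := itvE b j q; apply: eq_Rintegral => eta _.
    rewrite /cell_integrand !hatE /kern /=; congr (_ * _ `^ _).
    by rewrite !intrD; ring.
  + apply: measurable_funTS.
    exact: (measurableT_comp mK (pair1_measurable _)).
  + move=> eta; rewrite in_itv /= => heta.
    have hxi' : i%:~R * h <= (i + p + a%:Z)%:~R * h - xi <= (i + 1)%:~R * h.
      by move: hxi => /andP[g1 g2]; apply/andP; split; lra.
    by have /andP[] := Kb _ _ hxi' heta.
- by have /integrableP[/measurable_EFinP] := rect_outer_integrable mK Kb.
- by move=> xi; rewrite in_itv /=; exact: (rect_inner_ge0 Kb).
Qed.

End CellWeights.

(** * Dissipativity of symmetric random walks with killing *)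

Section GraphForms.
Variables (R : realType) (N : nat).
Local Notation I := ('I_((2 * N).-1) * 'I_((2 * N).-1))%type.
Local Notation op := (gridvec R N -> I -> R[i]).
Implicit Types (L : op) (v : gridvec R N) (P K : I).

(* Generators of symmetric random walks with killing. *)
Definition graph_form L : Prop :=
  exists (w : I -> I -> R) (r : I -> R),
    [/\ forall P K, 0 <= w P K, forall P K, w P K = w K P,
        forall P, \sum_K w P K <= r P &
        forall v P, L v P = \sum_K (w P K)%:C * v K.1 K.2 - (r P)%:C * v P.1 P.2].

Lemma graph_formD L1 L2 : graph_form L1 -> graph_form L2 ->
  graph_form (fun v P => L1 v P + L2 v P).
Proof.
move=> [w1 [r1 [a1 a2 a3 a4]]] [w2 [r2 [b1 b2 b3 b4]]].
exists (fun P K => w1 P K + w2 P K), (fun P => r1 P + r2 P); split.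
- by move=> P K; rewrite addr_ge0.
- by move=> P K; rewrite a2 b2.
- by move=> P; rewrite big_split lerD.
- move=> v P; rewrite a4 b4 addrACA -big_split; congr (_ + _).
    by apply: eq_bigr => K _; rewrite rmorphD mulrDl.
  by rewrite rmorphD mulrDl opprD.
Qed.

Lemma graph_formZ L (c : R) : 0 <= c -> graph_form L -> graph_form (fun v P => c%:C * L v P).
Proof.
move=> c0 [w [r [a1 a2 a3 a4]]].
exists (fun P K => c * w P K), (fun P => c * r P); split.
- by move=> P K; rewrite mulr_ge0.
- by move=> P K; rewrite a2.
- by move=> P; rewrite -mulr_sumr ler_wpM2l.
- move=> v P; rewrite a4 mulrBr mulr_sumr; congr (_ - _); last by rewrite rmorphM mulrA.
  by apply: eq_bigr => K _; rewrite rmorphM mulrA.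
Qed.

Lemma graph_form_diag (r : I -> R) : (forall P, 0 <= r P) ->
  graph_form (fun v P => - ((r P)%:C * v P.1 P.2)).
Proof.
move=> r0; exists (fun _ _ => 0), r; split=> // [P|v P]; first by rewrite big1.
by rewrite big1 ?add0r // => K _; rewrite mul0r.
Qed.

Lemma graph_form_ext L1 L2 : (forall v P, L1 v P = L2 v P) -> graph_form L1 -> graph_form L2.
Proof.
by move=> e [w [r [a1 a2 a3 a4]]]; exists w, r; split=> // v P; rewrite -e a4.
Qed.

Definition gidx2 (P : I) : int * int := (gidx P.1, gidx P.2).

Lemma gidx_inj : injective (@gidx N).
Proof. by move=> p q; rewrite /gidx => /addIr /addIr [] /val_inj. Qed.

Lemma gidx2_inj : injective gidx2.
Proof. by move=> [p q] [p' q'] [] /gidx_inj -> /gidx_inj ->. Qed.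

Lemma gextE v (z : int * int) :
  gext v z.1 z.2 = \sum_K ((z == gidx2 K)%:R : R)%:C * v K.1 K.2.
Proof.
rewrite /gext; case: pickP => [p /eqP hp|hp]; last first.
  rewrite big1 // => -[p q] _; rewrite /gidx2 [z]surjective_pairing xpair_eqE /=.
  by rewrite eq_sym hp mul0r.
case: pickP => [q /eqP hq|hq]; last first.
  rewrite big1 // => -[p' q] _; rewrite /gidx2 [z]surjective_pairing xpair_eqE /=.
  by rewrite [X in _ && X]eq_sym hq andbF mul0r.
rewrite (bigD1 (p, q)) //= /gidx2 /= hp hq -surjective_pairing eqxx mul1r.
rewrite big1 ?addr0 // => K Kpq; rewrite (_ : z == _ = false) ?mul0r //.
apply/negbTE; apply: contra Kpq => /eqP zE; apply/eqP; apply: gidx2_inj.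
by rewrite /gidx2 -zE /= hp hq; case: (z).
Qed.

Lemma gext_node v P : gext v (gidx P.1) (gidx P.2) = v P.1 P.2.
Proof.
have := gextE v (gidx2 P) => /= ->.
rewrite (bigD1 P) //= eqxx mul1r big1 ?addr0 // => K KP.
by rewrite (inj_eq gidx2_inj) eq_sym (negbTE KP) mul0r.
Qed.

(** Bonds that leave the interior grid reach the value 0 and contribute to the killing only, so
    symmetry is required just between interior nodes. *)
Lemma graph_form_bonds (T : finType) (W : T -> I -> R) (tgt : T -> I -> int * int) :
  (forall t P, 0 <= W t P) ->
  (forall P K, \sum_t W t P * (tgt t P == gidx2 K)%:R = \sum_t W t K * (tgt t K == gidx2 P)%:R) ->
  graph_form (fun v P => \sum_t (W t P)%:C * (gext v (tgt t P).1 (tgt t P).2 - v P.1 P.2)).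
Proof.
move=> W0 Ws.
exists (fun P K => \sum_t W t P * (tgt t P == gidx2 K)%:R), (fun P => \sum_t W t P); split.
- by move=> P K; apply: sumr_ge0 => t _; rewrite mulr_ge0.
- exact: Ws.
- move=> P; rewrite exchange_big /=; apply: ler_sum => t _; rewrite -mulr_sumr.
  rewrite -[X in _ <= X]mulr1; apply: ler_wpM2l => //.
  have [/existsP[K /eqP tK]|/existsPn h] := boolP [exists K, tgt t P == gidx2 K].
    rewrite (bigD1 K) //= tK eqxx big1 ?addr0 // => K' K'K.
    by rewrite (inj_eq gidx2_inj) eq_sym (negbTE K'K).
  by rewrite big1 // => K _; rewrite (negbTE (h K)).
- move=> v P; rewrite rmorph_sum mulr_suml.
  under [X in _ = X - _]eq_bigr do rewrite rmorph_sum mulr_suml.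
  rewrite exchange_big -sumrB; apply: eq_bigr => t _; rewrite mulrBr gextE mulr_sumr.
  by congr (_ - _); apply: eq_bigr => K _; rewrite rmorphM mulrA.
Qed.

(** By |x_P| |x_K| <= (|x_P|^2 + |x_K|^2) / 2 and the symmetry of the weights, the off-diagonal part
    is at most the sum over P of the row sum times |x_P|^2, which the diagonal dominates. *)
Lemma graph_form_diss L : graph_form L ->
  exists a : I -> I -> R[i],
    (forall v P, L v P = \sum_K a P K * v K.1 K.2) /\
    (forall x : I -> R[i], complex.Re (vdot x (fun P => \sum_K a P K * x K)) <= 0).
Proof.
move=> [w [r [w0 ws wr hL]]].
pose a P K := (w P K - (P == K)%:R * r P)%:C.
have aE (x : I -> R[i]) P : \sum_K a P K * x K = \sum_K (w P K)%:C * x K - (r P)%:C * x P.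
  under eq_bigr do rewrite /a rmorphB rmorphM mulrBl.
  rewrite sumrB; congr (_ - _); rewrite (bigD1 P) //= eqxx mul1r big1 ?addr0 // => K KP.
  by rewrite eq_sym (negbTE KP) !mul0r.
exists a; split; first by move=> v P; rewrite hL (aE (fun K => v K.1 K.2)).
move=> x; rewrite /vdot Re_sum.
have term P : complex.Re ((x P)^*%C * \sum_K a P K * x K) <=
    \sum_K w P K * ((normc (x P) ^+ 2 + normc (x K) ^+ 2) / 2) - \sum_K w P K * normc (x P) ^+ 2.
  rewrite aE mulrBr ReD ReN mulr_sumr Re_sum lerB //.
    apply: ler_sum => K _; rewrite mulrCA ReZ; apply: ler_wpM2l => //.
    apply: (@le_trans _ _ (normc (x P) * normc (x K))).
      rewrite -[normc (x P)]normc_conj -normcM.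
      exact: le_trans (ler_norm _) (ler_Re_normc _).
    by have := sqr_ge0 (normc (x P) - normc (x K)); rewrite sqrrB; lra.
  rewrite mulrCA conj_mul_normc ReZ ReR -mulr_suml.
  by apply: ler_wpM2r => //; rewrite exprn_ge0 ?normc_ge0.
apply: le_trans (ler_sum _ (fun P _ => term P)) _.
rewrite sumrB subr_le0.
under eq_bigr do under eq_bigr do rewrite mulrA mulrDr mulrDl.
under eq_bigr do rewrite big_split /=.
rewrite big_split /= [X in _ + X]exchange_big /=.
under [X in _ + X]eq_bigr do under eq_bigr do rewrite ws.
rewrite -big_split /=; apply: ler_sum => P _; rewrite -big_split /=; apply: ler_sum => K _.
by rewrite -mulrDr; lra.
Qed.

End GraphForms.

(** * The discrete Laplacian as a random walk generator *)

Section FracLap.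
Variables (R : realType) (N : nat) (l beta gamma sigma h : R).
Hypotheses (Hbeta : 0 < beta < 2) (h0 : 0 < h).
Local Notation I := ('I_((2 * N).-1) * 'I_((2 * N).-1))%type.

Lemma W00_ge0 : 0 <= W00 beta sigma h.
Proof. by do 2!(apply: Rintegral_ge0 => ? _); exact: powR_ge0. Qed.

Lemma Winf_ge0 x : 0 <= Winf l beta gamma x.
Proof. by apply: Rintegral_ge0 => y _; rewrite mulr_ge0 ?expR_ge0 ?powR_ge0. Qed.

Lemma Gamma_ge0 x : 0 < x -> 0 <= Gamma x :> R.
Proof.
move=> x0; rewrite /Gamma x0; apply: Rintegral_ge0 => t _.
by rewrite mulr_ge0 ?expR_ge0 ?powR_ge0.
Qed.

Lemma c2_ge0 : 0 <= c2 beta gamma.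
Proof.
have /andP[b0 b2] := Hbeta; rewrite /c2; case: ifP => _.
  by rewrite invr_ge0 !mulr_ge0 ?pi_ge0.
by rewrite divr_ge0 ?mulr_ge0 ?powR_ge0 ?pi_ge0 ?(ltW b0) ?Gamma_ge0 //; lra.
Qed.

(** Indexing bonds by pairs of signs counts coinciding targets twice when a or b is 0, exactly as
    [phi] does. *)
Lemma graph_form_phi (a b : nat) : graph_form (fun v (P : I) =>
  phi gamma sigma h v (gidx P.1) (gidx P.2) a b).
Proof.
pose sg (e : bool) (k : nat) : int := if e then k%:Z else - k%:Z.
pose d := h * Num.sqrt (a%:R ^+ 2 + b%:R ^+ 2).
pose E : R := (expR (gamma * d) * d `^ sigma)^-1.
have E0 : 0 <= E by rewrite invr_ge0 mulr_ge0 ?expR_ge0 ?powR_ge0.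
apply: (@graph_form_ext _ _ (fun v P => \sum_(t : bool * bool) E%:C *
    (gext v (gidx P.1 + sg t.1 a) (gidx P.2 + sg t.2 b) - v P.1 P.2))).
  move=> v P; rewrite /phi -mulr_sumr mulrC -/d -fmorphV -/E.
    congr (_ * _); rewrite (gext_node v P).
    rewrite -(pair_bigA _ (fun s t => gext v (gidx P.1 + sg s a) (gidx P.2 + sg t b) - v P.1 P.2)).
    by rewrite /= !big_bool /sg /=; ring.
apply: (graph_form_bonds (W := fun _ _ => E)
  (tgt := fun t P => (gidx P.1 + sg t.1 a, gidx P.2 + sg t.2 b))) => // P K.
(* Reversing both signs exchanges the two ends of a bond. *)
rewrite (reindex_inj (h := fun t : bool * bool => (~~ t.1, ~~ t.2))) /=; last first.
  by move=> [[] []] [[] []].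
apply: eq_bigr => -[s t] _; congr (_ * _%:R); rewrite /gidx2 !xpair_eqE /=.
by congr (nat_of_bool (_ && _)); apply/eqP/eqP; rewrite /sg; [case: s|case: s|case: t|case: t] => /=; lia.
Qed.

Definition bond_weight (a b : bool) (i j p q : int) : R :=
  if adjacent i j p q then 0 else cell_weight beta h a b i j p q *
    expR (- (gamma * h * Num.sqrt ((i + a%:Z - p)%:~R ^+ 2 + (j + b%:Z - q)%:~R ^+ 2))).

Lemma bond_weight_ge0 a b i j p q : 0 <= bond_weight a b i j p q.
Proof.
rewrite /bond_weight; case: ifPn => // nadj.
by rewrite mulr_ge0 ?expR_ge0 ?cell_weight_ge0 //; case/andP: Hbeta.
Qed.

Lemma bond_weight_reflect a b i j p q : bond_weight a b i j p q =
  bond_weight (~~ a) (~~ b) (p - (~~ a)%:Z) (q - (~~ b)%:Z) (i + a%:Z) (j + b%:Z).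
Proof.
have adjE : adjacent (p - (~~ a)%:Z) (q - (~~ b)%:Z) (i + a%:Z) (j + b%:Z) = adjacent i j p q.
  rewrite /adjacent !inE !xpair_eqE.
  have e1 (s : bool) (x y : int) : (y - (~~ s)%:Z == x + s%:Z) = (x == y - 1).
    by apply/eqP/eqP; case: s => /=; lia.
  have e2 (s : bool) (x y : int) : (y - (~~ s)%:Z == x + s%:Z - 1) = (x == y).
    by apply/eqP/eqP; case: s => /=; lia.
  rewrite !e1 !e2; do 4!case: (_ == _) => //=.
rewrite /bond_weight adjE; case: ifPn => // nadj.
rewrite (cell_weight_reflect _ _ _ _ nadj) //; last by case/andP: Hbeta.
congr (_ * expR (- (_ * Num.sqrt _))).
have e (s : bool) (x y : int) : ((y - (~~ s)%:Z + (~~ s)%:Z - (x + s%:Z))%:~R : R) ^+ 2 =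
    (x + s%:Z - y)%:~R ^+ 2.
  by rewrite subrK -sqrrN -mulrNz opprB.
by rewrite !e.
Qed.

Lemma Icell_weights (v : gridvec R N) (P : I) i j : ~~ adjacent i j (gidx P.1) (gidx P.2) ->
  Icell beta gamma h v (gidx P.1) (gidx P.2) i j =
  \sum_(t : bool * bool) (bond_weight t.1 t.2 i j (gidx P.1) (gidx P.2))%:C *
    (gext v (i + t.1%:Z) (j + t.2%:Z) - v P.1 P.2).
Proof.
move=> nadj; have /andP[b0 _] := Hbeta.
set p := gidx P.1; set q := gidx P.2.
pose x (t : bool * bool) := corner gamma h v p q (i + t.1%:Z) (j + t.2%:Z).
pose K (t : bool * bool) := cell_integrand beta h t.1 t.2 i j p q.
have bE xi eta : bilin gamma h v p q i j xi eta * (kern beta (xi, eta) (p%:~R * h, q%:~R * h))%:C =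
    \sum_t (K t xi eta)%:C * x t.
  rewrite -(pair_bigA _ (fun s t => (K (s, t) xi eta)%:C * x (s, t))) /= !big_bool.
  rewrite /bilin /x /K /cell_integrand /hat /= !addr0.
  move: (kern _ _ _) (corner _ _ _ _ _ _ _) (corner _ _ _ _ _ (i + 1) j) (corner _ _ _ _ _ i (j + 1)).
  move=> k c1 c2 c3; rewrite !rmorphM; ring.
have lin (y : bool * bool -> R) := @rect_integral_lin R (i%:~R * h) ((i + 1)%:~R * h) (j%:~R * h)
  ((j + 1)%:~R * h) (far_bound beta h) _ (index_enum (bool * bool)%type) K y
  (fun t => measurable_cell_integrand _ _ _ _ _ _ _ _)
  (fun t xi eta => @cell_integrand_bound R beta h b0 h0 t.1 t.2 i j p q xi eta nadj).
have -> : Icell beta gamma h v p q i j = \sum_t (cell_weight beta h t.1 t.2 i j p q)%:C * x t.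
  apply: complex_eqP; rewrite ?Re_sum ?Im_sum /=.
    rewrite -[RHS](eq_bigr _ (fun t _ => esym (ReZ _ _))) -lin.
    apply: eq_Rintegral => xi _; apply: eq_Rintegral => eta _.
    by rewrite bE Re_sum; apply: eq_bigr => t _; rewrite ReZ.
  rewrite -[RHS](eq_bigr _ (fun t _ => esym (ImZ _ _))) -lin.
  apply: eq_Rintegral => xi _; apply: eq_Rintegral => eta _.
  by rewrite bE Im_sum; apply: eq_bigr => t _; rewrite ImZ.
apply: eq_bigr => t _; rewrite /bond_weight (negbTE nadj) /x /corner gext_node rmorphM.
by rewrite -[RHS]mulrA; congr (_ * _); exact: mulrC.
Qed.

(** A bond joins the node P to a corner K of a cell. Reflection sends the cell to one that has P as
    opposite corner, seen from K, with equal weight and distance. *)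
Lemma graph_form_cells : graph_form (fun v (P : I) =>
  \sum_(i < 2 * N) \sum_(j < 2 * N | ~~ adjacent (i%:Z - N%:Z) (j%:Z - N%:Z) (gidx P.1) (gidx P.2))
    Icell beta gamma h v (gidx P.1) (gidx P.2) (i%:Z - N%:Z) (j%:Z - N%:Z)).
Proof.
pose T : finType := ((('I_(2 * N) * 'I_(2 * N)) * (bool * bool))%type : finType).
pose ci (t : T) : int := t.1.1%:Z - N%:Z.
pose cj (t : T) : int := t.1.2%:Z - N%:Z.
pose W (t : T) (P : I) := bond_weight t.2.1 t.2.2 (ci t) (cj t) (gidx P.1) (gidx P.2).
pose tgt (t : T) (_ : I) := (ci t + t.2.1%:Z, cj t + t.2.2%:Z).
apply: (@graph_form_ext _ _ (fun v P => \sum_t (W t P)%:C *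
    (gext v (tgt t P).1 (tgt t P).2 - v P.1 P.2))).
  move=> v P.
  rewrite -(pair_bigA _ (fun c s => (W (c, s) P)%:C *
    (gext v (tgt (c, s) P).1 (tgt (c, s) P).2 - v P.1 P.2))) /=.
  rewrite -(pair_bigA _ (fun i j => \sum_s (W ((i, j), s) P)%:C *
    (gext v (tgt ((i, j), s) P).1 (tgt ((i, j), s) P).2 - v P.1 P.2))) /=.
  apply: eq_bigr => i _; rewrite [RHS]big_mkcond; apply: eq_bigr => j _.
  case: ifPn => nadj; first by rewrite Icell_weights.
  by rewrite big1 // => s _; rewrite /W /bond_weight /ci /cj /= (negbNE nadj) mul0r.
apply: (graph_form_bonds (W := W) (tgt := tgt)) => [t P|P K]; first exact: bond_weight_ge0.
(* In each direction a node and the side on which it sits determine the cell, which lies in the grid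
   because the node is interior. *)
have pick1 (p : 'I_((2 * N).-1)) (s : bool) (F : int -> R) :
    \sum_(i < 2 * N) F (i%:Z - N%:Z) * (i%:Z - N%:Z + s%:Z == gidx p)%:R = F (gidx p - s%:Z).
  have pN := ltn_ord p.
  have iP : (p + ~~ s < 2 * N)%N by move: pN; case: s => /=; lia.
  have iE : (Ordinal iP)%:Z - N%:Z = gidx p - s%:Z.
    by rewrite /gidx /=; case: (s) => /=; lia.
  rewrite (bigD1 (Ordinal iP)) //= -/(_%:Z) iE subrK eqxx mulr1 big1 ?addr0 // => i /eqP ii.
  rewrite (_ : (_ == _) = false) ?mulr0 //; apply/eqP => e; apply: ii; apply: val_inj.
  by move: e iE; rewrite /gidx /=; case: (s) => /=; lia.
have collect (A B : I) : \sum_t W t A * (tgt t A == gidx2 B)%:R =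
    \sum_(s : bool * bool) bond_weight s.1 s.2 (gidx B.1 - s.1%:Z) (gidx B.2 - s.2%:Z) (gidx A.1) (gidx A.2).
  rewrite -(pair_bigA _ (fun c s => W (c, s) A * (tgt (c, s) A == gidx2 B)%:R)) exchange_big /=.
  apply: eq_bigr => s _.
  rewrite -(pair_bigA _ (fun i j => W ((i, j), s) A * (tgt ((i, j), s) A == gidx2 B)%:R)) /=.
  rewrite -(pick1 B.1 s.1 (fun i => bond_weight s.1 s.2 i (gidx B.2 - s.2%:Z) (gidx A.1) (gidx A.2))).
  apply: eq_bigr => i _.
  rewrite -(pick1 B.2 s.2 (fun j => bond_weight s.1 s.2 (i%:Z - N%:Z) j (gidx A.1) (gidx A.2))).
  rewrite mulr_suml; apply: eq_bigr => j _.
  rewrite /W /tgt /ci /cj /gidx2 /= xpair_eqE -mulrA; congr (_ * _).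
  by rewrite andbC -mulnb natrM.
(* Opposite corners are exchanged, so that [bond_weight_reflect] applies term by term. *)
rewrite !collect (reindex_inj (h := fun t : bool * bool => (~~ t.1, ~~ t.2))) /=; last first.
  by move=> [[] []] [[] []].
apply: eq_bigr => -[s t] _ /=; rewrite [RHS]bond_weight_reflect; congr bond_weight.
all: by rewrite subrK.
Qed.

Theorem fracLap_dissipative : exists a : I -> I -> R[i],
  (forall (v : gridvec R N) p q, fracLap l beta gamma sigma h v p q = \sum_K a (p, q) K * v K.1 K.2) /\
  (forall x : I -> R[i], complex.Re (vdot x (fun P => \sum_K a P K * x K)) <= 0).
Proof.
have gf : graph_form (fun v (P : I) => fracLap l beta gamma sigma h v P.1 P.2).
  have k0 : 0 <= ksigma sigma / 4 * W00 beta sigma h.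
    by rewrite mulr_ge0 ?W00_ge0 // divr_ge0 // /ksigma; case: ifP => _; lra.
  have gphi := graph_formZ k0 (graph_formD (graph_formD (graph_form_phi 0 1) (graph_form_phi 1 0))
    (graph_form_phi 1 1)).
  have gdiag := @graph_form_diag R N (fun P => Winf l beta gamma (gpoint h P.1 P.2))
    (fun P => Winf_ge0 _).
  apply: graph_form_ext (graph_formZ c2_ge0 (graph_formD (graph_formD gphi graph_form_cells) gdiag)).
  by move=> v P; rewrite mxE.
have [a [aE ad]] := graph_form_diss gf.
by exists a; split=> // v p q; rewrite -(aE v (p, q)).
Qed.

End FracLap.

(** * Absolutely continuous functions *)

Section LowerIntegral.
Variable R : realType.
Local Notation mu := (@lebesgue_measure R).

(* The integral of a nonnegative function is a supremum over simple functions
   below it, hence monotone even if the larger function is not measurable. *)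
Lemma ae_ge0_le_integral_lower (D : set R) (f1 f2 : R -> \bar R) : measurable D ->
  measurable_fun D f1 -> (forall x, D x -> 0 <= f1 x)%E -> (forall x, D x -> 0 <= f2 x)%E ->
  {ae mu, forall x, D x -> (f1 x <= f2 x)%E} ->
  (\int[mu]_(x in D) f1 x <= \int[mu]_(x in D) f2 x)%E.
Proof.
move=> mD mf1 f10 f20 [Z [mZ Z0 hZ]].
rewrite (ge0_negligible_integral mZ) // integral_mkcond [leRHS]integral_mkcond.
rewrite !ge0_integralTE; last 2 first.
- by move=> x; apply: erestrict_ge0 => y; exact: f20.
- by move=> x; apply: erestrict_ge0 => y [Dy _]; exact: f10.
apply: le_ereal_sup => _ [s hs <-]; exists s => // x; apply: le_trans (hs x) _.
rewrite /patch; case: ifPn => [|_].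
  rewrite inE => -[Dx Zx]; rewrite (mem_set Dx).
  by apply: contrapT => h; apply: Zx; apply: hZ => /= /(_ Dx).
by case: ifPn => //; rewrite inE => /f20.
Qed.

End LowerIntegral.

(** * Integrals of vector-valued functions *)

Section VectorIntegrals.
Variables (R : realType) (I : finType).
Local Notation mu := (@lebesgue_measure R).
Variables (D : set R) (mD : measurable D) (g : R -> I -> R[i]).
Hypothesis ig : forall i, cintegrable D (g^~ i).

Lemma measurable_vnorm : measurable_fun D (fun s => vnorm (g s)).
Proof.
apply: (measurable_comp (F := setT)) => //.
  by apply: continuous_measurable_fun; exact: sqrt_continuous.
apply: measurable_sum => i; have [/integrableP[m1 _] /integrableP[m2 _]] := ig i.
rewrite (_ : (fun _ => _) = (fun s => complex.Re (g s i) ^+ 2 + complex.Im (g s i) ^+ 2)).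
  by apply: measurable_funD; apply: measurable_funX; exact/measurable_EFinP.
by apply/funext => s; rewrite normc_sqr.
Qed.

Lemma RintegrableZl (f : R -> R) k : mu.-integrable D (EFin \o f) ->
  mu.-integrable D (EFin \o (fun x => k * f x)).
Proof. by under [X in _ -> _.-integrable _ (_ \o X)]eq_fun do rewrite mulrC; exact: RintegrableZr. Qed.

Lemma vnorm_le_sum (x : I -> R[i]) :
  vnorm x <= \sum_i (`|complex.Re (x i)| + `|complex.Im (x i)|).
Proof.
apply: (@le_trans _ _ (\sum_i normc (x i))); last first.
  by apply: ler_sum => i _; exact: normc_le_ReIm.
have s0 : 0 <= \sum_i normc (x i) by apply: sumr_ge0 => i _; exact: normc_ge0.
rewrite -(@ler_pXn2r _ 2) ?nnegrE ?vnorm_ge0 // vnorm_sqr expr2 mulr_suml.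
apply: ler_sum => i _; rewrite expr2; apply: ler_wpM2l; rewrite ?normc_ge0 //.
by rewrite (bigD1 i) //= lerDl sumr_ge0 // => j _; exact: normc_ge0.
Qed.

Lemma vnorm_integrable : mu.-integrable D (EFin \o (fun s => vnorm (g s))).
Proof.
pose B s := \sum_i (`|complex.Re (g s i)| + `|complex.Im (g s i)|).
have iB : mu.-integrable D (EFin \o B).
  have h i : mu.-integrable D (EFin \o (fun s => `|complex.Re (g s i)| + `|complex.Im (g s i)|)).
    by have [h1 h2] := ig i; apply: RintegrableD => //; exact: integrable_norm.
  by have [] := Rintegral_sum (index_enum I) mD h.
apply: le_integrable iB => //; first by apply/measurable_EFinP; exact: measurable_vnorm.
move=> s Ds /=; rewrite lee_fin ger0_norm ?vnorm_ge0 //.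
by apply: le_trans (vnorm_le_sum _) (ler_norm _).
Qed.

(** Pairing with the integral x itself: |x|^2 is the integral of Re <x, g>, at most |x| times the
    integral of |g|. *)
Lemma vnorm_cint_le : vnorm (fun i => cint D (g^~ i)) <= \int[mu]_(s in D) vnorm (g s).
Proof.
set x := fun i => _; set W := \int[mu]_(s in D) _.
have W0 : 0 <= W by apply: Rintegral_ge0 => s _; exact: vnorm_ge0.
have [->//|x0] := eqVneq (vnorm x) 0.
have xp : 0 < vnorm x by rewrite lt_def x0 vnorm_ge0.
rewrite -(ler_pM2l xp) -expr2.
pose F i s := complex.Re (x i) * complex.Re (g s i) + complex.Im (x i) * complex.Im (g s i).
have iF i : mu.-integrable D (EFin \o F i).
  by have [h1 h2] := ig i; apply: RintegrableD => //; exact: RintegrableZl.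
have [iS eS] := Rintegral_sum (index_enum I) mD iF.
have FE s : \sum_i F i s = complex.Re (vdot x (g s)).
  by rewrite /vdot Re_sum; apply: eq_bigr => i _; rewrite ReM /F; case: (x i) => u v /=; ring.
have -> : vnorm x ^+ 2 = \int[mu]_(s in D) \sum_i F i s.
  rewrite eS vnorm_sqr; apply: eq_bigr => i _; have [h1 h2] := ig i.
  by rewrite RintegralD ?RintegralZl // ?RintegralZl //; [rewrite normc_sqr !expr2 | exact: RintegrableZl..].
rewrite -RintegralZl //; last exact: vnorm_integrable.
apply: le_Rintegral => //; first by apply: RintegrableZl; exact: vnorm_integrable.
move=> s _; rewrite FE; apply: le_trans (ler_norm _) _.
exact: le_trans (ler_Re_normc _) (normc_vdot _ _).
Qed.

End VectorIntegrals.

Section AbsContIncrements.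
Variables (R : realType) (T : R).
Local Notation mu := (@lebesgue_measure R).

Lemma Rintegral_increment (g : R -> R) (a b : R) : 0 <= a <= b -> b <= T ->
  mu.-integrable `[0, T] (EFin \o g) ->
  \int[mu]_(s in `[0, b]) g s - \int[mu]_(s in `[0, a]) g s = \int[mu]_(s in `[a, b[) g s.
Proof.
move=> /andP[a0 ab] bT ig.
have igs (A : set R) : measurable A -> A `<=` `[0, b] -> mu.-integrable A (EFin \o g).
  move=> mA Ab; apply: integrableS ig => // s /Ab /=; rewrite !in_itv /= => /andP[-> /=].
  by move=> /le_trans; apply.
rewrite Rintegral_itvB ?bnd_simp //; last by apply: igs.
rewrite Rintegral_itv_obnd_cbnd; last first.
  by apply: igs => // s /=; rewrite !in_itv /= => /andP[h1 ->]; rewrite (le_trans a0) // ltW.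
rewrite Rintegral_itv_bndo_bndc //.
by apply: igs => // s /=; rewrite !in_itv /= => /andP[h1 /ltW ->]; rewrite (le_trans a0).
Qed.

Lemma cint_increment (g : R -> R[i]) (a b : R) : 0 <= a <= b -> b <= T ->
  cintegrable `[0, T] g -> cint `[0, b] g - cint `[0, a] g = cint `[a, b[ g.
Proof.
by move=> ab bT [h1 h2]; apply: complex_eqP; rewrite ?ReD ?ReN ?ImD ?ImN /=; exact: Rintegral_increment.
Qed.

(** Lebesgue's differentiation theorem. [F] is given by its density only on [0, T], so the
    conclusion is confined to the open interval. *)
Lemma ae_is_derive (g F : R -> R) : mu.-integrable `[0, T] (EFin \o g) ->
  (forall t, 0 <= t <= T -> F t = F 0 + \int[mu]_(s in `[0, t]) g s) ->
  {ae mu, forall s, 0 < s < T -> is_derive s (1 : R) F (g s)}.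
Proof.
(* Extension by zero, to use the fundamental theorem for integrals from minus infinity. *)
move=> ig hF; pose g0 := g \_ `[0, T].
have ig0 : mu.-integrable setT (EFin \o g0).
  have := @integrable_mkcond _ _ R mu `[0, T] (EFin \o g) (measurable_itv _).
  by rewrite restrict_EFin => -[h _]; exact: h.
have ig0y (y : R) : mu.-integrable `]-oo, y] (EFin \o g0) by apply: integrableS ig0.
have lg0 : locally_integrable setT g0 := integrable_locally (measurable_itv `[0, T]) ig.
have := FTC1Ny ig0y lg0; apply: filterS; first exact: (ae_filter_ringOfSetsType mu).
move=> s [ds gs] /andP[s0 sT].
have -> : g s = g0 s by rewrite /g0 patchE mem_set //= in_itv /= !ltW.
have dG : is_derive s (1 : R) (fun x => \int[mu]_(t in `]-oo, x]) g0 t) (g0 s).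
  by split; [exact: ds | rewrite -derive1E; exact: gs].
have := is_deriveD (is_derive_cst (F 0) s (1 : R)) dG; rewrite add0r.
have e0 : 0 < Num.min s (T - s) by rewrite lt_min s0 subr_gt0.
apply: near_eq_is_derive; near=> x => /=.
have : ball s (Num.min s (T - s)) x by near: x; exact: nbhsx_ballx.
rewrite /ball /= lt_min => /andP[/ltr_distlDr h1 /ltr_distlCDr h2].
have x0 : 0 <= x by lra.
have xT : x <= T by lra.
rewrite -[LHS]/(F 0 + \int[mu]_(t in `]-oo, x]) g0 t).
rewrite [RHS]hF ?x0 ?xT //; congr (_ + _).
rewrite Rintegral_mkcond [RHS]Rintegral_mkcond; apply: eq_Rintegral => t _.
rewrite /g0 /patch !mem_setE /= !in_itv /=.
by case: (leP t x) => [tx|xt]; rewrite ?andbF ?andbT //=; rewrite (le_trans tx xT) andbT.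
Unshelve. all: by end_near. Qed.

End AbsContIncrements.

(** * From sums over time cells to the weighted integral *)

Section CellSums.
Variables (R : realType) (al tau : R).
Hypotheses (Hal : 0 < al < 1) (tau0 : 0 < tau).
Local Notation mu := (@lebesgue_measure R).

Lemma sum_cells_le (phi : R -> \bar R) n : measurable_fun `[0, n%:R * tau] phi ->
  (forall s, 0 <= phi s)%E ->
  (\sum_(k < n) \int[mu]_(s in `[(k%:R * tau)%R, (k.+1%:R * tau)%R[) phi s <=
   \int[mu]_(s in `[0%R, (n%:R * tau)%R]) phi s)%E.
Proof.
move=> mphi phi0.
have t0 (k : nat) : 0 <= k%:R * tau by rewrite mulr_ge0 // ltW.
have tS (k : nat) : k%:R * tau <= k.+1%:R * tau by rewrite ler_pM2r // ler_nat.
have mS k : (k <= n)%N -> measurable_fun `[0, k%:R * tau[ phi.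
  move=> kn; apply: measurable_funS mphi => // s /=; rewrite !in_itv /= => /andP[-> /ltW /= h].
  by apply: le_trans h _; rewrite ler_pM2r // ler_nat.
have -> : (\sum_(k < n) \int[mu]_(s in `[(k%:R * tau)%R, (k.+1%:R * tau)%R[) phi s =
    \int[mu]_(s in `[0%R, (n%:R * tau)%R[) phi s)%E.
  move: mS; elim: n {mphi} => [_|k IH mS].
    by rewrite big_ord0 mul0r set_itv_ge ?bnd_simp ?ltxx // integral_set0.
  rewrite big_ord_recr /= IH; last by move=> j jk; apply: mS; exact: ltnW.
  rewrite -ge0_integral_setU //=; first by rewrite -itv_bndbnd_setU ?bnd_simp.
    by rewrite -itv_bndbnd_setU ?bnd_simp //; exact: mS.
  apply/disj_setPS => y [/=]; rewrite !in_itv /= => /andP[_ h] /andP[+ _].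
  by rewrite leNgt h.
apply: ge0_subset_integral => //.
by move=> s /=; rewrite !in_itv /= => /andP[-> /ltW].
Qed.

(** On the k-th cell t_n - s <= (n - k) tau, and the power al - 1 is decreasing, so the discrete
    weight is below the continuous one; tau^al m^(al-1) = tau (m tau)^(al-1) yields the factor
    tau. *)
Lemma weighted_cells_le (w : R -> R) (T : R) n : n%:R * tau <= T ->
  (forall s, 0 <= w s) -> mu.-integrable `[0, T] (EFin \o w) ->
  ((\sum_(k < n) tau `^ al * ((n - k)%:R `^ al / (n - k)%:R) *
      \int[mu]_(s in `[k%:R * tau, k.+1%:R * tau[) w s)%:E <=
   tau%:E * \int[mu]_(s in `[0%R, (n%:R * tau)%R]) ((n%:R * tau - s) `^ (al - 1) * w s)%:E)%E.
Proof.
move=> nT w0 iw.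
have t0 (k : nat) : 0 <= k%:R * tau by rewrite mulr_ge0 // ltW.
have mw : measurable_fun `[0, n%:R * tau] w.
  have /integrableP[/measurable_EFinP mw _] := iw.
  by apply: measurable_funS mw => // s /=; rewrite !in_itv /= => /andP[-> /= /le_trans]; apply.
pose ph s := ((n%:R * tau - s) `^ (al - 1) * w s)%:E.
have mph : measurable_fun `[0, n%:R * tau] ph.
  apply/measurable_EFinP; apply: measurable_funM => //.
  by apply: measurable_funTS; apply: (measurableT_comp (measurable_powR _)); exact: measurable_funB.
have ph0 s : (0 <= ph s)%E by rewrite lee_fin mulr_ge0 ?powR_ge0.
apply: le_trans (lee_wpmul2l _ (sum_cells_le mph ph0)); last by rewrite lee_fin ltW.
rewrite ge0_sume_distrr; last by move=> k _; exact: integral_ge0.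
rewrite -sumEFin; apply: lee_sum => k _.
have kn := ltn_ord k.
have sub : `[k%:R * tau, k.+1%:R * tau[ `<=` `[0, n%:R * tau].
  move=> s /=; rewrite !in_itv /= => /andP[h1 /ltW h2]; rewrite (le_trans (t0 k) h1) /=.
  by apply: le_trans h2 _; rewrite ler_pM2r // ler_nat.
have iwk : mu.-integrable `[k%:R * tau, k.+1%:R * tau[ (EFin \o w).
  apply: integrableS iw => // s /sub /=; rewrite !in_itv /= => /andP[-> /=].
  by move=> /le_trans; apply.
have mphk : measurable_fun `[k%:R * tau, k.+1%:R * tau[ ph by exact: measurable_funS mph.
rewrite EFinM fineK; last by apply: integrable_fin_num.
have c0 : 0 <= tau `^ al * ((n - k)%:R `^ al / (n - k)%:R).
  by rewrite mulr_ge0 ?divr_ge0 ?powR_ge0.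
rewrite -!ge0_integralZl //; first last.
- by move=> s _; rewrite lee_fin.
- by have /integrableP[] := iwk.
- by rewrite lee_fin ltW.
apply: ge0_le_integral => //.
- by move=> s _; rewrite mule_ge0 // ?lee_fin.
- by apply: measurable_funeM; have /integrableP[] := iwk.
- exact: measurable_funeM.
move=> s /=; rewrite in_itv /= => /andP[h1 h2].
rewrite /ph -!EFinM lee_fin [leRHS]mulrA; apply: ler_wpM2r => //.
set m := (n - k)%:R : R.
have m0 : 0 < m by rewrite ltr0n subn_gt0.
have x0 : 0 < n%:R * tau - s.
  by rewrite subr_gt0; apply: lt_le_trans h2 _; rewrite ler_pM2r // ler_nat.
have xm : n%:R * tau - s <= m * tau.
  by rewrite /m natrB ?(ltnW kn) // mulrBl; lra.
have := powR_div_decr Hal x0 xm.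
have powB (t : R) : 0 < t -> t `^ (al - 1) = t `^ al / t.
  by move=> tt; rewrite powRB ?powRr1 ?(ltW tt) //; apply/implyP => _; rewrite gt_eqF.
rewrite (powB _ x0) => h.
have -> : tau `^ al * (m `^ al / m) = tau * ((m * tau) `^ al / (m * tau)).
  by rewrite powRM ?(ltW m0) ?(ltW tau0) //; field; rewrite !gt_eqF.
by apply: ler_wpM2l => //; exact: ltW.
Qed.

End CellSums.

(** * Gamma integrals *)

Section HalfLine.
Variable R : realType.
Local Notation mu := (@lebesgue_measure R).
Variables (f F : R -> R).
Hypothesis dF : forall u : R, 0 < u -> is_derive u (1 : R) F (f u).
Hypothesis cf : forall u : R, 0 < u -> {for u, continuous f}.

(** The offset 2 gives lo m < 1 < hi m for every m. *)
Let lo (m : nat) : R := m.+2%:R^-1.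
Let hi (m : nat) : R := m.+2%:R.
Let J (m : nat) : set R := `[lo m, hi m].

Let lo0 m : 0 < lo m. Proof. by rewrite invr_gt0 ltr0n. Qed.
Let lohi m : lo m < hi m.
Proof. by apply: (@lt_trans _ _ 1); rewrite ?invf_lt1 ?ltr1n ?ltr0n. Qed.

Let Jsub m : J m `<=` `]0, +oo[.
Proof. by move=> u /=; rewrite !in_itv /= andbT => /andP[h _]; exact: lt_le_trans (lo0 m) h. Qed.

Lemma half_line_measurable : measurable_fun `]0 : R, +oo[ f.
Proof.
apply: open_continuous_measurable_fun; first exact: interval_open.
by move=> u; rewrite inE /= in_itv /= andbT => u0; exact: cf.
Qed.

Lemma half_line_segment m :
  (\int[mu]_(u in J m) (f u)%:E = (F (hi m) - F (lo m))%:E)%E.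
Proof.
have cF u : 0 < u -> {for u, continuous F}.
  by move=> u0; apply/differentiable_continuous/derivable1_diffP; have [] := dF u0.
have pos u : lo m <= u -> 0 < u by exact: lt_le_trans.
rewrite EFinB (@continuous_FTC2 _ f F) //.
- apply: continuous_in_subspaceT => u; rewrite inE /= in_itv /= => /andP[h _].
  by apply: cf; exact: pos.
- split.
  + by move=> u; rewrite in_itv /= => /andP[/ltW/pos h _]; have [] := dF h.
  + by apply: cvg_at_right_filter; exact: cF.
  + by apply: cvg_at_left_filter; apply: cF; apply: pos; exact: ltW.
- move=> u; rewrite in_itv /= => /andP[/ltW/pos h _].
  by rewrite derive1E; have [_ ->] := dF h.
Qed.

Lemma half_line_mem (u : R) : 0 < u -> exists M, forall m, (M <= m)%N -> J m u.
Proof.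
move=> u0; pose M := Num.truncn (u + u^-1).
exists M => m Mm; have v0 : 0 < u^-1 by rewrite invr_gt0.
have h : u + u^-1 < m.+2%:R.
  apply: lt_le_trans (truncnS_gt _) _; rewrite ler_nat ltnS; exact: leq_trans Mm _.
rewrite /J /= in_itv /= /lo /hi; apply/andP; split; last by lra.
by rewrite -[leRHS]invrK lef_pV2 ?posrE ?ltr0n //; lra.
Qed.

Let fJ m := (fun u => (f u)%:E) \_ (J m).

Let fJ_cvg u : 0 < u -> fJ ^~ u @ \oo --> (f u)%:E.
Proof.
move=> u0; have [M HM] := half_line_mem u0.
apply: cvg_near_cst; exists M => // m /= /HM Ju.
by rewrite /fJ patchE mem_set.
Qed.

Let int_fJ m : (\int[mu]_(u in `]0%R, +oo[) fJ m u = (F (hi m) - F (lo m))%:E)%E.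
Proof.
rewrite -half_line_segment integral_mkcond [RHS]integral_mkcond; apply: eq_integral => u _.
rewrite /fJ /patch; case: ifPn => // /negP h; case: ifPn => // h2; exfalso; apply: h.
by rewrite inE in h2; rewrite inE; exact: Jsub h2.
Qed.

Let mfJ m : measurable_fun `]0 : R, +oo[ (fJ m).
Proof.
apply: measurable_funTS; apply: (measurable_restrictT _ _).1; first exact: measurable_itv.
by apply/measurable_EFinP; apply: measurable_funS half_line_measurable => //; exact: Jsub.
Qed.

(** The fundamental theorem on the segments [J m] that exhaust the half-line, and dominated
    convergence. *)
Lemma half_line_integral (l0 l1 : R) :
  (fun m => F m.+2%:R^-1) @ \oo --> l0 -> (fun m => F m.+2%:R) @ \oo --> l1 ->
  mu.-integrable `]0, +oo[ (EFin \o f) ->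
  \int[mu]_(u in `]0, +oo[) f u = l1 - l0.
Proof.
move=> h0 h1 intf.
have [] := @dominated_convergence _ _ R mu `]0, +oo[ (measurable_itv _) fJ
  (EFin \o f) (fun u => `|(f u)%:E|)%E mfJ.
- by apply/measurable_EFinP; exact: half_line_measurable.
- by apply: aeW => u; rewrite /= in_itv /= andbT => u0; exact: fJ_cvg.
- exact: integrable_abse intf.
- apply: aeW => u m _; rewrite /fJ /patch; case: ifP => // _.
  by rewrite -[point]/(0%R%:E) abse0 lee_fin normr_ge0.
move=> _ _; under eq_fun do rewrite int_fJ; move=> h.
have h2 : (fun m => (F (hi m) - F (lo m))%:E) @ \oo --> (l1 - l0)%:E.
  by apply/cvg_EFin; [exact: nearW | exact: cvgB h1 h0].
by rewrite /Rintegral (cvg_unique _ h h2).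
Qed.

(** The integrals of a nonnegative derivative over [J m] are increments of F, bounded by 2 B;
    monotone convergence concludes. *)
Lemma half_line_integrable (B : R) : (forall u : R, 0 < u -> 0 <= f u) ->
  (forall u : R, 0 < u -> `|F u| <= B) -> mu.-integrable `]0, +oo[ (EFin \o f).
Proof.
move=> f0 FB.
have fJ_mono (u : R) m n : `]0 : R, +oo[%classic u -> (m <= n)%N -> (fJ m u <= fJ n u)%E.
  rewrite /= in_itv /= andbT => u0 mn; rewrite /fJ /patch; case: ifPn => [|_].
    rewrite inE => Ju; rewrite mem_set //; move: Ju; rewrite /J /= !in_itv /= => /andP[h1 h2].
    apply/andP; split; last by apply: le_trans h2 _; rewrite ler_nat !ltnS.
    by apply: le_trans h1; rewrite lef_pV2 ?posrE ?ltr0n // ler_nat !ltnS.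
  by case: ifP => // _; rewrite lee_fin f0.
apply/integrableP; split; first by apply/measurable_EFinP; exact: half_line_measurable.
have -> : (\int[mu]_(u in `]0%R, +oo[) `|(EFin \o f) u| = \int[mu]_(u in `]0%R, +oo[) limn (fJ^~ u))%E.
  apply: eq_integral => u; rewrite inE /= in_itv /= andbT => u0.
  by rewrite ger0_norm ?f0 //; apply/esym/cvg_lim => //; exact: fJ_cvg.
rewrite monotone_convergence //.
- apply: le_lt_trans (ltry (B + B)); apply: lime_le.
    apply: ereal_nondecreasing_is_cvgn => m n mn.
    apply: ge0_le_integral => //.
    + by move=> u Du; rewrite /fJ /patch; case: ifP => // _; rewrite lee_fin f0 //; move: Du; rewrite /= in_itv /= andbT.
    + exact: mfJ.
    + exact: mfJ.
    + by move=> u Du; exact: fJ_mono.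
  apply: nearW => m; rewrite int_fJ lee_fin; apply: le_trans (ler_norm _) _.
  by apply: le_trans (ler_normB _ _) _; apply: lerD; apply: FB => //.
- by move=> m u Du; rewrite /fJ /patch; case: ifP => // _; rewrite lee_fin f0 //; move: Du; rewrite /= in_itv /= andbT.
- by move=> u Du m n mn; exact: fJ_mono.
Qed.

End HalfLine.

(** * The Gamma integral with a complex parameter *)

Section GammaIntegrals.
Variable R : realType.

Lemma cvg0_abs (u : nat -> R) : (fun m => `|u m|) @ \oo --> (0 : R) -> u @ \oo --> (0 : R).
Proof.
by move=> h; apply: cvg0_normP => e e0; have [N HN] := cvg0_leP h e0; exists N => m /HN; rewrite normr_id.
Qed.

Local Notation mu := (@lebesgue_measure R).
Implicit Types (x p q th u : R).

(** With w = p + i q, the phases 0 and pi / 2 give the real and imaginary parts of u^(x-1) exp (- w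
    u); a free phase treats both at once. *)
Definition gamma_kernel x p q th u : R := u `^ (x - 1) * expR (- (p * u)) * cos (q * u + th).

Definition gamma_integral x p q th : R := \int[mu]_(u in `]0, +oo[) gamma_kernel x p q th u.

Lemma cosDpihalf y : cos (y + pi / 2) = - sin y :> R.
Proof. by rewrite cosD cos_pihalf sin_pihalf mulr0 mulr1 sub0r. Qed.

Lemma powR_le_expR x dl u : 0 < x -> 0 < dl -> 0 < u -> u `^ x <= dl `^ (- x) * expR (x * dl * u).
Proof.
move=> x0 d0 u0.
have h : u <= dl^-1 * expR (dl * u).
  rewrite mulrC ler_pdivlMr // mulrC; apply: le_trans (expR_ge1Dx _).
  by rewrite lerDr.
apply: le_trans (_ : (dl^-1 * expR (dl * u)) `^ x <= _).
  by rewrite ge0_ler_powR ?nnegrE ?(ltW x0) ?(ltW u0) // mulr_ge0 ?expR_ge0 ?invr_ge0 // ltW.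
rewrite powRM ?expR_ge0 ?invr_ge0 ?(ltW d0) // -expRM mulrC.
rewrite -(powR_inv1 (ltW d0)) -powRrM mulN1r mulrC.
by rewrite (_ : dl * u * x = x * dl * u) //; ring.
Qed.

Definition growth_const x p : R := (p / (2 * x)) `^ (- x).

Lemma growth_const_ge0 x p : 0 <= growth_const x p. Proof. exact: powR_ge0. Qed.

Lemma powR_expR_bound x p u : 0 < x -> 0 < p -> 0 < u ->
  u `^ x * expR (- (p * u)) <= growth_const x p * expR (- (p / 2 * u)).
Proof.
move=> x0 p0 u0; have d0 : 0 < p / (2 * x) by rewrite divr_gt0 // mulr_gt0.
have := powR_le_expR x0 d0 u0; rewrite -/(growth_const x p).
have -> : x * (p / (2 * x)) * u = p / 2 * u by field; rewrite gt_eqF.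
move=> h; apply: le_trans (ler_wpM2r (expR_ge0 _) h) _.
by rewrite -(mulrA (growth_const x p)) -expRD (_ : p / 2 * u - p * u = - (p / 2 * u)) //; field.
Qed.

Lemma gamma_kernel_norm x p q th u : `|gamma_kernel x p q th u| <= u `^ (x - 1) * expR (- (p * u)).
Proof.
rewrite /gamma_kernel normrM [X in X * _]ger0_norm ?mulr_ge0 ?powR_ge0 ?expR_ge0 //.
by rewrite -[leRHS]mulr1; apply: ler_wpM2l; rewrite ?mulr_ge0 ?powR_ge0 ?expR_ge0 // ler_norml cos_geN1 cos_le1.
Qed.

Lemma is_derive_linear_expR p u : is_derive u (1 : R) (fun u : R => expR (- (p * u))) (- p * expR (- (p * u))).
Proof. by apply: is_derive_eq; rewrite /GRing.scale /=; ring. Qed.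

Lemma gamma_kernel_is_derive x p q th u : 0 < u ->
  is_derive u (1 : R) (gamma_kernel (x + 1) p q th)
    (x * gamma_kernel x p q th u - p * gamma_kernel (x + 1) p q th u
     + q * gamma_kernel (x + 1) p q (th + pi / 2) u).
Proof.
move=> u0; rewrite /gamma_kernel addrK addrA cosDpihalf.
have d1 := is_derive1_powR x u0.
have d2 := is_derive_linear_expR p u.
have d3 : is_derive u (1 : R) (fun u : R => cos (q * u + th)) (- q * sin (q * u + th)).
  by apply: is_derive_eq; rewrite /GRing.scale /=; ring.
by apply: is_derive_eq; rewrite /GRing.scale /=; ring.
Qed.

Lemma gamma_kernel_continuous x p q th u : 0 < u -> {for u, continuous (gamma_kernel x p q th)}.
Proof.
move=> u0; apply/differentiable_continuous/derivable1_diffP.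
by rewrite -[x](subrK 1); have [] := gamma_kernel_is_derive (x - 1) p q th u0.
Qed.

Lemma measurable_gamma_kernel x p q th : measurable_fun `]0 : R, +oo[ (gamma_kernel x p q th).
Proof.
apply: open_continuous_measurable_fun; first exact: interval_open.
by move=> u; rewrite inE /= in_itv /= andbT => u0; exact: gamma_kernel_continuous.
Qed.

Lemma gamma_abs_integrable x p : 0 < x -> 0 < p ->
  mu.-integrable `]0, +oo[ (EFin \o (fun u : R => u `^ (x - 1) * expR (- (p * u)))).
Proof.
move=> x0 p0; set C := growth_const x p.
have C0 : 0 <= C by exact: growth_const_ge0.
have kE y u : gamma_kernel y p 0 0 u = u `^ (y - 1) * expR (- (p * u)).
  by rewrite /gamma_kernel mul0r addr0 cos0 mulr1.
(* The derivative of u^x exp (- p u) misses x times the kernel by p u^x exp (- p u), which is at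
   most p C exp (- p u / 2). Adding the latter gives a nonnegative derivative of the bounded [F]
   lying above the kernel. *)
pose f u := x * gamma_kernel x p 0 0 u - p * gamma_kernel (x + 1) p 0 0 u + p * C * expR (- (p / 2 * u)).
pose F u := gamma_kernel (x + 1) p 0 0 u - 2 * C * expR (- (p / 2 * u)).
have f_ge u : 0 < u -> x * (u `^ (x - 1) * expR (- (p * u))) <= f u.
  move=> u0; rewrite /f !kE addrK -addrA lerDl addrC subr_ge0 -mulrA.
  by apply: ler_wpM2l; [exact: ltW | exact: powR_expR_bound].
have k0 u : 0 <= u `^ (x - 1) * expR (- (p * u)) by rewrite mulr_ge0 ?powR_ge0 ?expR_ge0.
have ce (c u : R) : {for u, continuous (fun u : R => expR (- (c * u)))}.
  by apply/differentiable_continuous/derivable1_diffP; have [] := is_derive_linear_expR c u.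
have intf : mu.-integrable `]0, +oo[ (EFin \o f).
  apply: (@half_line_integrable R f F _ _ (C + 2 * C)).
  - move=> u u0; have d1 := gamma_kernel_is_derive x p 0 0 u0.
    have d2 := is_derive_linear_expR (p / 2) u.
    by apply: is_derive_eq; rewrite /GRing.scale /= /f mul0r addr0; field.
  - move=> u u0; apply: cvgD; last by apply: cvgM; [exact: cvg_cst | exact: ce].
    by apply: cvgB; (apply: cvgM; [exact: cvg_cst | exact: gamma_kernel_continuous]).
  - move=> u u0; apply: le_trans (f_ge u u0); exact: mulr_ge0 (ltW x0) (k0 u).
  - move=> u u0; have e1 : expR (- (p / 2 * u)) <= 1.
      by rewrite -expR0 ler_expR oppr_le0 mulr_ge0 ?(ltW u0) // divr_ge0 // ltW.
    apply: le_trans (ler_normB _ _) _; apply: lerD.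
      rewrite kE addrK ger0_norm ?mulr_ge0 ?powR_ge0 ?expR_ge0 //.
      apply: le_trans (powR_expR_bound x0 p0 u0) _.
      by rewrite -[leRHS]mulr1 ler_wpM2l.
    rewrite ger0_norm ?mulr_ge0 ?expR_ge0 //.
    by rewrite -[leRHS]mulr1 ler_wpM2l // mulr_ge0.
have := RintegrableZr (measurable_itv _) x^-1 intf; apply: le_integrable => //.
  apply/measurable_EFinP; have := measurable_gamma_kernel x p 0 0.
  by rewrite (_ : gamma_kernel x p 0 0 = fun u => u `^ (x - 1) * expR (- (p * u))) //; apply/funext => u; exact: kE.
move=> u; rewrite /= in_itv /= andbT => u0; rewrite lee_fin ger0_norm //.
apply: le_trans (ler_norm _); rewrite ler_pdivlMr // mulrC; exact: f_ge.
Qed.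

Lemma gamma_kernel_integrable x p q th : 0 < x -> 0 < p ->
  mu.-integrable `]0, +oo[ (EFin \o gamma_kernel x p q th).
Proof.
move=> x0 p0; apply: le_integrable (gamma_abs_integrable x0 p0) => //.
  by apply/measurable_EFinP; exact: measurable_gamma_kernel.
move=> u _; rewrite /= lee_fin; apply: le_trans (gamma_kernel_norm _ _ _ _ _) _.
exact: ler_norm.
Qed.

(** Integration by parts of u^x against exp (- w u), in real form; the boundary terms vanish as x >
    0 and p > 0. *)
Lemma gamma_integral_parts x p q th : 0 < x -> 0 < p ->
  x * gamma_integral x p q th =
  p * gamma_integral (x + 1) p q th - q * gamma_integral (x + 1) p q (th + pi / 2).
Proof.
move=> x0 p0; have x1 : 0 < x + 1 by lra.
pose f u := x * gamma_kernel x p q th u - p * gamma_kernel (x + 1) p q th u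
     + q * gamma_kernel (x + 1) p q (th + pi / 2) u.
have Kb u : 0 < u -> `|gamma_kernel (x + 1) p q th u| <= growth_const x p * expR (- (p / 2 * u)).
  move=> u0; apply: le_trans (gamma_kernel_norm _ _ _ _ _) _.
  by rewrite addrK; exact: powR_expR_bound.
have i0 := gamma_kernel_integrable q th x0 p0.
have i1 := gamma_kernel_integrable q th x1 p0.
have i2 := gamma_kernel_integrable q (th + pi / 2) x1 p0.
have mD : measurable (`]0 : R, +oo[%classic) by exact: measurable_itv.
have ixp : mu.-integrable `]0, +oo[ (EFin \o (fun u => x * gamma_kernel x p q th u - p * gamma_kernel (x + 1) p q th u)).
  under [X in _.-integrable _ (_ \o X)]eq_fun do rewrite -mulNr.
  by apply: RintegrableD => //; exact: RintegrableZl.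
have iq : mu.-integrable `]0, +oo[ (EFin \o (fun u => q * gamma_kernel (x + 1) p q (th + pi / 2) u)).
  exact: RintegrableZl.
have intf : mu.-integrable `]0, +oo[ (EFin \o f) by exact: RintegrableD.
have e0 : \int[mu]_(u in `]0, +oo[) f u = 0 - 0.
  apply: (@half_line_integral R f (gamma_kernel (x + 1) p q th)) => //.
  - by move=> u u0; exact: gamma_kernel_is_derive.
  - move=> u u0; apply: cvgD; last by apply: cvgM; [exact: cvg_cst | exact: gamma_kernel_continuous].
    by apply: cvgB; (apply: cvgM; [exact: cvg_cst | exact: gamma_kernel_continuous]).
  - have h : (fun m => (m.+2%:R^-1 : R) `^ x) @ \oo --> (0 : R).
      apply: ((cvg_at_rightP _ _ _).1 (powR_cvg0 x0)); split => [m|]; first by rewrite invr_gt0.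
      apply: (le_cvg0 _ cvg_harmonic) => m; rewrite invr_ge0 ler0n /=.
      by rewrite lef_pV2 ?posrE ?ltr0n // ler_nat.
    apply: cvg0_abs; apply: (le_cvg0 _ h) => m; rewrite normr_ge0 /=.
    apply: le_trans (gamma_kernel_norm _ _ _ _ _) _; rewrite addrK -[leRHS]mulr1.
    by apply: ler_wpM2l; rewrite ?powR_ge0 // -expR0 ler_expR oppr_le0 mulr_ge0 ?invr_ge0 // ltW.
  - apply: cvg0_abs; pose C := growth_const x p / (p / 2).
    have h : (fun m => C * m.+1%:R^-1 : R) @ \oo --> (0 : R).
      by rewrite -[X in _ --> X](mulr0 C); apply: cvgM; [exact: cvg_cst | exact: cvg_harmonic].
    apply: (le_cvg0 _ h) => m; rewrite normr_ge0 /=.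
    apply: le_trans (Kb _ _) _; first by rewrite ltr0n.
    rewrite /C -(mulrA (growth_const x p)); apply: ler_wpM2l; first exact: growth_const_ge0.
    rewrite expRN -invfM lef_pV2 ?posrE ?expR_gt0 //; last by rewrite mulr_gt0 // divr_gt0.
    apply: le_trans (expR_ge1Dx _); rewrite -[leLHS]add0r lerD //.
    by rewrite ler_pM2l ?divr_gt0 // ler_nat.
move: e0; rewrite subrr /f RintegralD // RintegralB ?RintegralZl //; [|exact: RintegrableZl..].
by rewrite -!/(gamma_integral _ _ _ _); lra.
Qed.

Lemma gamma_integral_pi x p q th : 0 < x -> 0 < p ->
  gamma_integral x p q (th + pi / 2 + pi / 2) = - gamma_integral x p q th.
Proof.
move=> x0 p0; rewrite -mulN1r -RintegralZl //; last exact: gamma_kernel_integrable.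
apply: eq_Rintegral => u _; rewrite /gamma_kernel !addrA !cosDpihalf.
by rewrite sinD cos_pihalf sin_pihalf mulr0 mulr1 add0r; ring.
Qed.

Lemma gamma_kernelS x p q th u : 0 < u ->
  gamma_kernel (x + 1) p q th u = u * gamma_kernel x p q th u.
Proof.
move=> u0; rewrite /gamma_kernel addrK.
have -> : u `^ x = u * u `^ (x - 1).
  rewrite powRB ?powRr1 ?(ltW u0) //; last by apply/implyP => _; rewrite gt_eqF.
  by rewrite mulrCA divff ?mulr1 // gt_eqF.
by rewrite -!mulrA.
Qed.

Lemma gamma_integral_is_derive x p q th (s : R) : 0 < x -> 0 < 1 + s * (p - 1) ->
  is_derive s (1 : R) (fun s : R => gamma_integral x (1 + s * (p - 1)) (s * q) th)
    (- (p - 1) * gamma_integral (x + 1) (1 + s * (p - 1)) (s * q) th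
     + q * gamma_integral (x + 1) (1 + s * (p - 1)) (s * q) (th + pi / 2)).
Proof.
move=> x0 ps0; have x1 : 0 < x + 1 by lra.
set ps := 1 + s * (p - 1) in ps0 *.
(* Within distance e of s the decay rate stays above ps / 2, which provides one dominating function;
   the added 1 covers p = 1. *)
pose e := ps / (2 * (`|p - 1| + 1)).
have n0 : 0 < `|p - 1| + 1 by rewrite ltr_wpDl.
have e0 : 0 < e by rewrite divr_gt0 // mulr_gt0.
pose f (s u : R) := gamma_kernel x (1 + s * (p - 1)) (s * q) th u.
have near_ps (t : R) : `]s - e, s + e[%classic t -> ps / 2 <= 1 + t * (p - 1).
  rewrite /= in_itv /= => /andP[t1 t2].
  have h : `|(t - s) * (p - 1)| <= ps / 2.
    rewrite normrM; apply: le_trans (_ : e * (`|p - 1| + 1) <= _).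
      apply: ler_pM => //; last by rewrite lerDl.
      by rewrite ler_norml; apply/andP; split; lra.
    by rewrite /e le_eqVlt; apply/orP; left; apply/eqP; field; rewrite gt_eqF.
  have -> : 1 + t * (p - 1) = ps + (t - s) * (p - 1) by rewrite /ps; ring.
  by move: h; rewrite ler_norml => /andP[]; move: ((t - s) * _) => X; lra.
have ph : 0 < ps / 2 by rewrite divr_gt0.
have dfs (t u : R) : is_derive t (1 : R) (f ^~ u)
    (- (p - 1) * (u * gamma_kernel x (1 + t * (p - 1)) (t * q) th u)
     + q * (u * gamma_kernel x (1 + t * (p - 1)) (t * q) (th + pi / 2) u)).
  rewrite /f /gamma_kernel addrA cosDpihalf.
  by apply: is_derive_eq; rewrite /GRing.scale /=; ring.
pose G (u : R) := (`|p - 1| + `|q|) * (u `^ x * expR (- (ps / 2 * u))).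
have G0 u : 0 <= G u by rewrite !mulr_ge0 ?powR_ge0 ?expR_ge0.
have mD : measurable (`]0 : R, +oo[%classic) by exact: measurable_itv.
have iG : mu.-integrable `]0, +oo[ (EFin \o G).
  apply: RintegrableZl => //.
  by have := gamma_abs_integrable x1 ph; rewrite addrK.
have sI : `]s - e, s + e[%classic s by rewrite /= in_itv /=; apply/andP; split; lra.
have intf t : `]s - e, s + e[%classic t -> mu.-integrable `]0, +oo[ (EFin \o f t).
  by move=> /near_ps h; apply: gamma_kernel_integrable => //; exact: lt_le_trans h.
have derf (t u : R) : `]s - e, s + e[%classic t -> `]0, +oo[%classic u -> derivable (f ^~ u) t 1.
  by move=> _ _; have [] := dfs t u.
have kb (t th' u : R) : `]s - e, s + e[%classic t -> 0 < u ->
    `|u * gamma_kernel x (1 + t * (p - 1)) (t * q) th' u| <= u `^ x * expR (- (ps / 2 * u)).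
  move=> /near_ps h u0; rewrite -gamma_kernelS //.
  apply: le_trans (gamma_kernel_norm _ _ _ _ _) _; rewrite addrK.
  by apply: ler_wpM2l; rewrite ?powR_ge0 // ler_expR lerN2 ler_pM2r.
have G_ub (t u : R) : `]s - e, s + e[%classic t -> `]0, +oo[%classic u -> `|partial1of2 f t u| <= G u.
  move=> It; rewrite /= in_itv /= andbT => u0; rewrite partial1of2E; have [_ ->] := dfs t u.
  have -> : G u = `|p - 1| * (u `^ x * expR (- (ps / 2 * u))) + `|q| * (u `^ x * expR (- (ps / 2 * u))).
    exact: mulrDl.
  apply: le_trans (ler_normD _ _) _; apply: lerD; rewrite normrM ?normrN.
    by apply: ler_wpM2l => //; exact: kb.
  by apply: ler_wpM2l => //; exact: kb.
have dI := @derivable_under_integral R _ _ mu f `]0, +oo[ mD s (s - e) (s + e) sI intf derf G G0 iG G_ub.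
have vI := @differentiation_under_integral R _ _ mu f `]0, +oo[ mD s (s - e) (s + e) sI intf derf G G0 iG G_ub.
split; first exact: dI.
rewrite -derive1E; apply: etrans vI _.
have i1 := gamma_kernel_integrable (s * q) th x1 ps0.
have i2 := gamma_kernel_integrable (s * q) (th + pi / 2) x1 ps0.
rewrite -!RintegralZl // -RintegralD //; [|exact: RintegrableZl..].
apply: eq_Rintegral => u; rewrite inE /= in_itv /= andbT => u0.
by rewrite partial1of2E; have [_ ->] := dfs s u; rewrite !gamma_kernelS.
Qed.

(** The integral of u^(x-1) exp (- w u) over the half-line. *)
Definition cgamma x (w : R[i]) : R[i] :=
  gamma_integral x (complex.Re w) (complex.Im w) 0 +i*
  gamma_integral x (complex.Re w) (complex.Im w) (pi / 2).

Lemma cgamma_parts x w : 0 < x -> 0 < complex.Re w -> x%:C * cgamma x w = w * cgamma (x + 1) w.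
Proof.
move=> x0 w0; have x1 : 0 < x + 1 by lra.
have e1 := gamma_integral_parts (complex.Im w) 0 x0 w0.
have e2 := gamma_integral_parts (complex.Im w) (pi / 2) x0 w0.
have e3 := gamma_integral_pi (complex.Im w) 0 x1 w0; rewrite add0r in e1 e3.
rewrite e3 mulrN opprK in e2.
by apply: complex_eqP; [rewrite ReZ ReM; exact: e1 | rewrite ImZ ImM; exact: e2].
Qed.

Lemma cgamma1 x : cgamma x 1 = (Gamma_pos x)%:C.
Proof.
rewrite /cgamma /=; congr (_ +i* _).
  by apply: eq_Rintegral => u _; rewrite /gamma_kernel mul1r mul0r addr0 cos0 mulr1.
rewrite /gamma_integral (_ : (fun u => _) = cst 0); first by rewrite /Rintegral integral0_eq.
by apply/funext => u; rewrite /gamma_kernel mul0r add0r cos_pihalf mulr0.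
Qed.

(** Instead of rotating a contour: along the segment from 1 to w, integration by parts gives the
    differential equation of w^(-x), so the product with w^x is constant. *)
Theorem cgamma_cpow x w : 0 < x -> 0 < complex.Re w ->
  cgamma x w = (Gamma_pos x)%:C * cpow w (- x).
Proof.
move=> x0 w0; pose ws (s : R) : R[i] := 1 - s%:C * (1 - w).
have wsE s : (complex.Re (ws s) = 1 + s * (complex.Re w - 1)) * (complex.Im (ws s) = s * complex.Im w).
  by case: w @ws {w0} => p q /=; split; ring.
pose J s := cgamma x (ws s); pose V s := cpow (ws s) x.
have x1 : 0 < x + 1 by lra.
have key (s : R) : 0 <= s <= 1 -> is_derive s (1 : R) (fun t : R => complex.Re (J t * V t)) 0 /\
    is_derive s (1 : R) (fun t : R => complex.Im (J t * V t)) 0.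
  move=> /andP[s0 s1].
  have ps0 : 0 < complex.Re (ws s).
    rewrite wsE; have -> : 1 + s * (complex.Re w - 1) = (1 - s) + s * complex.Re w by ring.
    have [->|sn] := eqVneq s 1; first by rewrite subrr add0r mul1r.
    have h : 0 <= s * complex.Re w by rewrite mulr_ge0 // ltW.
    have s2 : s < 1 by rewrite lt_neqAle sn.
    by move: (s * _) h => X h; lra.
  have ps1 := ps0; rewrite wsE in ps1.
  have [dV1 dV2] := @cpow_is_derive R 1 (1 - w) x s ps0.
  have dJ1 := gamma_integral_is_derive (complex.Im w) 0 x0 ps1.
  have dJ2 := gamma_integral_is_derive (complex.Im w) (pi / 2) x0 ps1.
  have epi := gamma_integral_pi (s * complex.Im w) 0 x1 ps1.
  rewrite add0r in epi; rewrite epi in dJ2; rewrite add0r in dJ1.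
  have JE t : J t = gamma_integral x (1 + t * (complex.Re w - 1)) (t * complex.Im w) 0 +i*
     gamma_integral x (1 + t * (complex.Re w - 1)) (t * complex.Im w) (pi / 2).
    by rewrite /J /cgamma !wsE.
  apply: (@is_derive_mul0 R J V s (- (w - 1) * cgamma (x + 1) (ws s)) _ _ _ dV1 dV2).
  - under eq_fun do rewrite JE /=; apply: is_derive_eq dJ1 _.
    by rewrite ReM /cgamma !wsE /=; case: (w) => p q /=; ring.
  - under eq_fun do rewrite JE /=; apply: is_derive_eq dJ2 _.
    by rewrite ImM /cgamma !wsE /=; case: (w) => p q /=; ring.
  - have wn0 : ws s != 0 by exact: Re_gt0_neq0.
    have := cgamma_parts x0 ps0; rewrite -/(J s) -/(ws s) -/(V s) => h.
    have -> : cgamma (x + 1) (ws s) = x%:C * J s / ws s by rewrite h mulrAC divff ?mul1r.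
    by field.
have e : J 1 * V 1 = J 0 * V 0.
  apply: complex_eqP.
    by apply: (@const_segment R (fun s => complex.Re (J s * V s))) => s /key [].
  by apply: (@const_segment R (fun s => complex.Im (J s * V s))) => s /key [].
have w1 : ws 1 = w by rewrite /ws rmorph1; ring.
have w2 : ws 0 = 1 by rewrite /ws rmorph0; ring.
have c1 : cpow 1 x = 1 by have := @cpow_real R 1 x ltr01; rewrite powR1.
rewrite /J /V w1 w2 cgamma1 c1 mulr1 in e.
by rewrite -e -(mulrA (cgamma x w)) -cpowD ?Re_gt0_normc // subrr cpow0 mulr1.
Qed.

(** Raising x by n is n steps of the functional equation, whose ratios are those of [bin_coef]. This
    link makes averages against Gamma densities produce coefficients of the backward Euler
    symbol. *)
Theorem cgamma_bin_coef x w n : 0 < x -> 0 < complex.Re w ->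
  cgamma (x + n%:R) w = (n`!)%:R * ((Gamma_pos x)%:C * bin_coef w (- x) n).
Proof.
move=> x0 w0; have wn0 : w != 0 by exact: Re_gt0_neq0.
elim: n => [|n IH]; first by rewrite addr0 mul1r; exact: cgamma_cpow.
have xn : 0 < x + n%:R by rewrite ltr_wpDr.
have h := cgamma_parts xn w0.
have -> : cgamma (x + n.+1%:R) w = (x + n%:R)%:C * cgamma (x + n%:R) w / w.
  by rewrite h mulrAC divff // mul1r -addrA natr1.
rewrite IH /= factS natrM opprK addrC.
have n0 : n.+1%:R != 0 :> R[i] by rewrite pnatr_eq0.
by field; rewrite wn0 -mulrS ?natr1 n0.
Qed.

Lemma Gamma_pos1 : Gamma_pos 1 = 1 :> R.
Proof.
have h := @half_line_integral R (fun u => expR (- (1 * u))) (fun u => - expR (- (1 * u))).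
transitivity (\int[mu]_(u in `]0, +oo[) expR (- (1 * u))).
  by apply: eq_Rintegral => u _; rewrite subrr powRr0 mul1r mul1r.
rewrite (h _ _ (-1) 0) ?sub0r ?opprK //.
- by move=> u _; apply: is_derive_eq; rewrite /GRing.scale /=; ring.
- move=> u _; apply/differentiable_continuous/derivable1_diffP.
  by have [] := is_derive_linear_expR 1 u.
- apply: cvgN; have hm : (fun m => (m.+2%:R^-1 : R)) @ \oo --> (0 : R).
    apply: (le_cvg0 _ cvg_harmonic) => m; rewrite invr_ge0 ler0n /=.
    by rewrite lef_pV2 ?posrE ?ltr0n // ler_nat.
  apply: (@squeeze_cvgr _ _ _ R (fun m => 1 - m.+2%:R^-1) (fun=> 1)); last exact: cvg_cst.
    apply: nearW => m; rewrite mul1r expR_ge1Dx /= -[leRHS]expR0 ler_expR oppr_le0.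
    by rewrite invr_ge0.
  by rewrite -[X in _ --> X]subr0; apply: cvgB; [exact: cvg_cst | exact: hm].
- rewrite -oppr0; apply: cvgN; apply: (le_cvg0 _ cvg_harmonic) => m.
  rewrite expR_ge0 mul1r expRN /=; rewrite lef_pV2 ?posrE ?expR_gt0 ?ltr0n //.
  apply: le_trans (expR_ge1Dx _); rewrite -[m.+2%:R]natr1 -[m.+1%:R in leLHS]add0r.
  by rewrite addrA -natr1; lra.
- have := gamma_abs_integrable ltr01 ltr01; rewrite subrr.
  by under [X in _.-integrable _ (_ \o X) -> _]eq_fun do rewrite powRr0 mul1r.
Qed.

Lemma Gamma_pos_gt0 x : 0 < x -> 0 < Gamma_pos x.
Proof.
move=> x0; have i0 := gamma_abs_integrable x0 ltr01.
apply: (@lt_le_trans _ _ (\int[mu]_(u in `[1, 2]) (2 `^ (- `|x - 1|) * expR (- 2)))).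
  rewrite Rintegral_cst //= lebesgue_measure_itv /= lte_fin ltr1n /=.
  by apply: mulr_gt0; [rewrite mulr_gt0 ?powR_gt0 ?expR_gt0 | lra].
have sub : `[1 : R, 2]%classic `<=` `]0, +oo[%classic.
  by move=> u /=; rewrite !in_itv /= andbT => /andP[h _]; lra.
have i1 : mu.-integrable `[1, 2] (EFin \o (fun u : R => u `^ (x - 1) * expR (- (1 * u)))).
  by apply: integrableS i0.
apply: (@le_trans _ _ (\int[mu]_(u in `[1, 2]) (u `^ (x - 1) * expR (- (1 * u))))).
  apply: le_Rintegral => //.
    apply: continuous_compact_integrable; first exact: segment_compact.
    by apply: continuous_subspaceT => u; exact: cvg_cst.
  move=> u /=; rewrite in_itv /= => /andP[u1 u2]; apply: ler_pM; rewrite ?powR_ge0 ?expR_ge0 //.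
    have u0 : 0 < u by lra.
    rewrite /powR !gt_eqF // ler_expR.
    have lu0 : 0 <= ln u by rewrite ln_ge0.
    have lu2 : ln u <= ln 2 by rewrite ler_ln ?posrE //.
    have n1 : - `|x - 1| <= x - 1 by rewrite lerNl -normrN ler_norm.
    have n2 : 0 <= `|x - 1| by [].
    apply: (@le_trans _ _ (- `|x - 1| * ln u)); last exact: ler_wpM2r.
    by rewrite !mulNr lerN2; exact: ler_wpM2l.
  by rewrite ler_expR mul1r lerN2.
rewrite /Gamma_pos /Rintegral.
have mf : measurable_fun `]0 : R, +oo[ (fun u : R => (u `^ (x - 1) * expR (- (1 * u)))%:E).
  by have /integrableP[] := i0.
have E : (\int[mu]_(u in `]0%R, +oo[) (u `^ (x - 1) * expR (- u))%:E =
          \int[mu]_(u in `]0%R, +oo[) (u `^ (x - 1) * expR (- (1 * u)))%:E)%E.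
  by apply: eq_integral => u _; rewrite mul1r.
rewrite E; apply: fine_le.
- exact: integrable_fin_num i1.
- exact: integrable_fin_num i0.
apply: ge0_subset_integral => // u _; by rewrite lee_fin mulr_ge0 ?powR_ge0 ?expR_ge0.
Qed.

End GammaIntegrals.

(** * Averages against Gamma densities *)

Section ShiftInvariance.
Variable R : realType.
Local Notation mu := (@lebesgue_measure R).

Lemma ge0_integral_shift (s : R) (f : R -> \bar R) : measurable_fun setT f ->
  (forall x, 0 <= f x)%E -> (\int[mu]_x f (x + s)%R = \int[mu]_x f x)%E.
Proof.
move=> mf f0.
have mfs : measurable_fun setT (fun x : R => f (x + s)).
  by apply: (measurableT_comp mf); exact: measurable_funD.
rewrite (ge0_integral_reflect 0 mfs) // (ge0_integral_reflect s mf) //.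
by apply: eq_integral => x _; rewrite sub0r addrC.
Qed.

Lemma Rintegrable_shift (s : R) (f : R -> R) : mu.-integrable setT (EFin \o f) ->
  mu.-integrable setT (EFin \o (fun x => f (x + s))).
Proof.
move=> /integrableP[mf fi]; apply/integrableP; split.
  apply/measurable_EFinP; apply: measurableT_comp; first exact/measurable_EFinP.
  exact: measurable_funD.
rewrite (ge0_integral_shift s (f := fun x => `|(f x)%:E|%E)) //.
exact: measurableT_comp.
Qed.

Lemma Rintegral_shift (s : R) (f : R -> R) : measurable_fun setT f ->
  \int[mu]_x f (x + s) = \int[mu]_x f x.
Proof.
move=> mf; rewrite /Rintegral; congr fine.
rewrite integralE [RHS]integralE; congr (_ - _)%E.
  apply: etrans (ge0_integral_shift s (f := (fun x => (f x)%:E)^\+)%E _ _) => //.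
    by apply: eq_integral => x _; rewrite !funepos.unlock.
  by apply: measurable_funepos; exact/measurable_EFinP.
apply: etrans (ge0_integral_shift s (f := (fun x => (f x)%:E)^\-)%E _ _) => //.
  by apply: eq_integral => x _; rewrite !funeneg.unlock.
by apply: measurable_funeneg; exact/measurable_EFinP.
Qed.

End ShiftInvariance.

(** * Gamma densities, their moments and addition formula *)

Section GammaDensity.
Variables (R : realType) (tau : R).
Hypothesis tau0 : 0 < tau.
Local Notation mu := (@lebesgue_measure R).

(* Density of the sum of n+1 independent exponential variables of mean tau. *)
Definition gden (n : nat) (t : R) : R :=
  if 0 < t then expR (- (tau^-1 * t)) * (t / tau) ^+ n / (n`!%:R * tau) else 0.

Lemma gden_ge0 n t : 0 <= gden n t.
Proof.
rewrite /gden; case: ifP => // t0.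
by rewrite !mulr_ge0 ?expR_ge0 ?exprn_ge0 ?invr_ge0 ?mulr_ge0 ?divr_ge0 // ?invr_ge0 ltW.
Qed.

Lemma measurable_gden n : measurable_fun setT (gden n).
Proof.
apply: measurable_fun_ifT => //; first exact: measurable_fun_ltr.
apply: measurable_funM => //; apply: measurable_funM.
  by apply: (measurableT_comp (@measurable_expR R)); apply: measurableT_comp.
by apply: measurable_funX; exact: measurable_funM.
Qed.

Lemma gden_kernel x p q th (n : nat) u : 0 < u ->
  gamma_kernel x p q th u * gden n u =
  (n`!%:R * tau ^+ n.+1)^-1 * gamma_kernel (x + n%:R) (p + tau^-1) q th u.
Proof.
move=> u0; rewrite /gden u0 /gamma_kernel.
have -> : u `^ (x + n%:R - 1) = u `^ (x - 1) * u ^+ n.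
  rewrite addrAC [LHS]powRD; [|by apply/implyP => _; rewrite gt_eqF].
  by rewrite powR_mulrn // ltW.
have -> : expR (- ((p + tau^-1) * u)) = expR (- (p * u)) * expR (- (tau^-1 * u)).
  by rewrite -expRD mulrDl opprD.
rewrite expr_div_n exprSr; field.
by rewrite expf_neq0 ?pnatr_eq0 -?lt0n ?fact_gt0 ?gt_eqF.
Qed.

Lemma positive_half_restrict (f : R -> R) : (forall t, t <= 0 -> f t = 0) ->
  f = f \_ `]0, +oo[.
Proof.
move=> f0; apply/funext => t; rewrite patchE mem_setE /= in_itv /= andbT.
by case: ltP => // /f0.
Qed.

Lemma Rintegral_half (f : R -> R) : (forall t, t <= 0 -> f t = 0) ->
  \int[mu]_t f t = \int[mu]_(t in `]0, +oo[) f t.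
Proof. by move=> f0; rewrite [in LHS](positive_half_restrict f0) [RHS]Rintegral_mkcond. Qed.

Lemma Rintegrable_half (f : R -> R) : (forall t, t <= 0 -> f t = 0) ->
  mu.-integrable `]0, +oo[ (EFin \o f) -> mu.-integrable setT (EFin \o f).
Proof.
move=> f0; have [h _] := @integrable_mkcond _ _ R mu `]0, +oo[ (EFin \o f) (measurable_itv _).
by move=> /h; rewrite restrict_EFin -positive_half_restrict.
Qed.

Lemma gden_gamma_integrable x p q th n : 0 < x -> 0 <= p ->
  mu.-integrable setT (EFin \o (fun u : R => gamma_kernel x p q th u * gden n u)).
Proof.
move=> x0 p0; have tv0 : 0 < tau^-1 by rewrite invr_gt0.
apply: Rintegrable_half => [t t0|]; first by rewrite /gden ltNge t0 mulr0.
have i1 : mu.-integrable `]0, +oo[ (EFin \o gamma_kernel (x + n%:R) (p + tau^-1) q th).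
  by apply: gamma_kernel_integrable; [rewrite ltr_wpDr | rewrite ltr_wpDl].
have := RintegrableZl (measurable_itv _) (n`!%:R * tau ^+ n.+1)^-1 i1.
apply: eq_integrable => // u; rewrite inE /= in_itv /= andbT => u0.
by rewrite gden_kernel.
Qed.

Lemma gden_gamma_integral x p q th n :
  \int[mu]_u (gamma_kernel x p q th u * gden n u) =
  \int[mu]_(u in `]0, +oo[) ((n`!%:R * tau ^+ n.+1)^-1 * gamma_kernel (x + n%:R) (p + tau^-1) q th u).
Proof.
rewrite Rintegral_half => [|t t0]; last by rewrite /gden ltNge t0 mulr0.
apply: eq_Rintegral => u; rewrite inE /= in_itv /= andbT => u0; exact: gden_kernel.
Qed.

Lemma gamma_kernel100 u : 0 < u -> gamma_kernel 1 0 0 0 u = 1 :> R.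
Proof. by move=> u0; rewrite /gamma_kernel subrr powRr0 !mul0r oppr0 expR0 addr0 cos0 !mulr1. Qed.

Lemma gden_integrable n : mu.-integrable setT (EFin \o gden n).
Proof.
have := @gden_gamma_integrable 1 0 0 0 n ltr01 (lexx _); apply: eq_integrable => // u _ /=.
rewrite /gden; case: ifP => u0; last by rewrite mulr0.
by rewrite gamma_kernel100 // mul1r.
Qed.

Lemma gden_integral n : \int[mu]_u gden n u = 1.
Proof.
have tv0 : 0 < tau^-1 by rewrite invr_gt0.
have -> : \int[mu]_u gden n u = \int[mu]_u (gamma_kernel 1 0 0 0 u * gden n u).
  apply: eq_Rintegral => u _; rewrite /gden; case: ifP => u0; last by rewrite mulr0.
  by rewrite gamma_kernel100 // mul1r.
rewrite gden_gamma_integral RintegralZl //; last first.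
  by apply: gamma_kernel_integrable; [rewrite ltr_wpDr | rewrite add0r].
rewrite add0r -/(gamma_integral _ _ _ _).
suff -> : gamma_integral (1 + n%:R) tau^-1 0 0 = n`!%:R * tau ^+ n.+1.
  by rewrite mulVf // mulf_neq0 ?expf_neq0 ?gt_eqF // ltr0n fact_gt0.
elim: n => [|n IH].
  rewrite addr0 fact0 mul1r expr1.
  have := @cgamma_cpow R 1 (tau^-1)%:C ltr01 tv0.
  rewrite Gamma_pos1 mul1r cpow_real // => /(congr1 (@complex.Re R)) /= ->.
  by rewrite powR_inv1 ?invr_ge0 ?(ltW tau0) // invrK.
have n1 : 0 < 1 + n%:R :> R by rewrite ltr_wpDr.
have := @gamma_integral_parts R (1 + n%:R) tau^-1 0 0 n1 tv0.
rewrite mul0r subr0 IH -addrA natr1 => h.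
have -> : gamma_integral (1 + n.+1%:R) tau^-1 0 0 = tau * (tau^-1 * gamma_integral (1 + n.+1%:R) tau^-1 0 0).
  by rewrite mulVKf ?gt_eqF.
rewrite -h factS natrM !exprS [1 + n%:R]addrC natr1; ring.
Qed.

Lemma gden_shift n t : t * gden n t = tau * n.+1%:R * gden n.+1 t.
Proof.
rewrite /gden; case: ifP => t0; last by rewrite !mulr0.
rewrite factS natrM exprS; field.
by rewrite nat1r !pnatr_eq0 -lt0n fact_gt0 gt_eqF.
Qed.

(* The second moment about n tau, although the mean is (n+1) tau. *)
Lemma gden_moment n : mu.-integrable setT (EFin \o (fun t => (t - n%:R * tau) ^+ 2 * gden n t)) /\
  \int[mu]_t ((t - n%:R * tau) ^+ 2 * gden n t) = tau ^+ 2 * n.+2%:R.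
Proof.
pose A : R := tau ^+ 2 * n.+1%:R * n.+2%:R.
pose B : R := - (2 * n%:R * tau ^+ 2 * n.+1%:R).
pose C : R := n%:R ^+ 2 * tau ^+ 2.
have e t : (t - n%:R * tau) ^+ 2 * gden n t = A * gden n.+2 t + B * gden n.+1 t + C * gden n t.
  have e2 : t ^+ 2 * gden n t = A * gden n.+2 t.
    by rewrite expr2 -mulrA gden_shift mulrCA gden_shift /A; ring.
  have -> : (t - n%:R * tau) ^+ 2 * gden n t = t ^+ 2 * gden n t - 2 * n%:R * tau * (t * gden n t) + C * gden n t.
    by rewrite /C; ring.
  by rewrite e2 gden_shift /B; ring.
have i k c : mu.-integrable setT (EFin \o (fun t => c * gden k t)).
  by apply: RintegrableZl => //; exact: gden_integrable.
have i1 : mu.-integrable setT (EFin \o (fun t => A * gden n.+2 t + B * gden n.+1 t)) by exact: RintegrableD.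
have -> : (fun t => (t - n%:R * tau) ^+ 2 * gden n t) = (fun t => A * gden n.+2 t + B * gden n.+1 t + C * gden n t).
  by apply/funext.
split; first exact: RintegrableD.
rewrite RintegralD // RintegralD // !RintegralZl ?gden_integral //; try exact: gden_integrable.
by rewrite /A /B /C -(natr1 n.+1) -(natr1 n); ring.
Qed.

(** The binomial theorem for (u + s)^n. It is the reason why averaging turns convolution in time
    into a Cauchy product in n. *)
Lemma gden_add n u s : 0 < u -> 0 < s ->
  gden n (u + s) = tau * \sum_(i < n.+1) gden i u * gden (n - i) s.
Proof.
move=> u0 s0; rewrite /gden u0 s0 addr_gt0 // mulrDr opprD expRD mulrDl.
rewrite [s / tau]lock [u / tau]lock addrC exprDn mulr_sumr mulr_suml mulr_sumr.
rewrite -!lock; apply: eq_bigr => i _.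
have iN : (i <= n)%N by rewrite -ltnS.
rewrite -mulr_natr (_ : 'C(n, i)%:R = n`!%:R / (i`!%:R * (n - i)`!%:R)).
  by field; rewrite !pnatr_eq0 -!lt0n !fact_gt0 gt_eqF.
apply: (@mulIf _ (i`!%:R * (n - i)`!%:R)); first by rewrite mulf_neq0 // pnatr_eq0 -lt0n fact_gt0.
by rewrite divfK ?mulf_neq0 ?pnatr_eq0 -?lt0n ?fact_gt0 // -!natrM bin_fact.
Qed.

Lemma gden_bounded n : exists B, forall t, gden n t <= B.
Proof.
have tv0 : 0 < tau^-1 by rewrite invr_gt0.
have c0 : 0 <= (n`!%:R * tau)^-1 :> R by rewrite invr_ge0 mulr_ge0 // ltW.
case: n c0 => [|n] c0.
  exists (1 * (0`!%:R * tau)^-1) => t; rewrite /gden; case: ifP => t0; last by rewrite mul1r.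
  apply: ler_wpM2r => //; rewrite expr0 mulr1 -expR0 ler_expR oppr_le0.
  by rewrite mulr_ge0 // ltW.
have n0 : 0 < n.+1%:R :> R by rewrite ltr0n.
exists (growth_const n.+1%:R tau^-1 / tau ^+ n.+1 * (n.+1`!%:R * tau)^-1) => t.
have g0 : 0 <= growth_const n.+1%:R tau^-1 / tau ^+ n.+1 :> R.
  by rewrite divr_ge0 ?growth_const_ge0 // exprn_ge0 // ltW.
rewrite /gden; case: ifP => t0; last exact: mulr_ge0.
apply: ler_wpM2r => //; rewrite expr_div_n mulrA; apply: ler_wpM2r.
  by rewrite invr_ge0 exprn_ge0 // ltW.
rewrite mulrC -powR_mulrn ?(ltW t0) //; apply: le_trans (powR_expR_bound n0 tv0 t0) _.
rewrite -[leRHS]mulr1; apply: ler_wpM2l; first exact: growth_const_ge0.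
by rewrite -expR0 ler_expR oppr_le0 mulr_ge0 ?(ltW t0) // divr_ge0 // ltW.
Qed.

End GammaDensity.

(** * Averages of convolutions *)

Section Averaging.
Variables (R : realType) (tau : R).
Hypothesis tau0 : 0 < tau.
Local Notation mu := (@lebesgue_measure R).
Local Notation gden := (gden tau).

Definition conv (k m : R -> R) (t : R) : R := \int[mu]_s (k (t - s) * m s).

Definition averageable (k : R -> R) : Prop :=
  [/\ measurable_fun setT k, forall u, u <= 0 -> k u = 0 &
      forall i, mu.-integrable setT (EFin \o (fun u => k u * gden i u))].

Definition avg (k : R -> R) (n : nat) : R := \int[mu]_u (k u * gden n u).

Lemma shifted_average (k : R -> R) n s : averageable k -> 0 < s ->
  mu.-integrable setT (EFin \o (fun t => k (t - s) * gden n t)) /\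
  \int[mu]_t (k (t - s) * gden n t) = tau * \sum_(i < n.+1) avg k i * gden (n - i) s.
Proof.
move=> [mk k0 ik] s0.
pose F (i : 'I_n.+1) u := k u * gden i u * (tau * gden (n - i) s).
have E u : k u * gden n (u + s) = \sum_(i < n.+1) F i u.
  have [u0|u0] := leP u 0; first by rewrite k0 // mul0r big1 // => i _; rewrite /F k0 // !mul0r.
  rewrite (gden_add tau0 _ u0 s0) !mulr_sumr; apply: eq_bigr => i _; rewrite /F; ring.
have iF i : mu.-integrable setT (EFin \o F i) by apply: RintegrableZr => //; exact: ik.
have [iS eS] := Rintegral_sum (index_enum 'I_n.+1) measurableT iF.
have iE : mu.-integrable setT (EFin \o (fun u => k u * gden n (u + s))).
  by rewrite (_ : (fun u => _) = (fun u => \sum_(i < n.+1) F i u)) //; apply/funext.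
have := Rintegrable_shift (- s) iE; under [X in _.-integrable _ (_ \o X)]eq_fun do rewrite subrK.
move=> iH; split=> //.
have mH : measurable_fun setT (fun t : R => k (t - s) * gden n t).
  by have /integrableP[/measurable_EFinP] := iH.
rewrite -(Rintegral_shift s mH); under eq_Rintegral do rewrite addrK E.
rewrite eS mulr_sumr; apply: eq_bigr => i _; rewrite /F (RintegralZr _ measurableT (ik i)).
by rewrite /avg mulrCA.
Qed.

Lemma averageable_abs k : averageable k -> averageable (fun u => `|k u|).
Proof.
move=> [mk k0 ik]; split.
- exact: measurableT_comp.
- by move=> u u0; rewrite k0 // normr0.
- move=> i; have := integrable_norm (ik i); apply: eq_integrable => // u _ /=.
  by rewrite normrM (ger0_norm (gden_ge0 tau0 _ _)).
Qed.

(** Fubini for k(t - s) m(s) times the density in t: integrating first in t gives a finite sum by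
    [gden_add], first in s the convolution. Integrability holds for every t, so [conv] is the inner
    integral at each point. *)
Theorem avg_conv (k m : R -> R) n : averageable k -> averageable m ->
  (forall t, mu.-integrable setT (EFin \o (fun s => k (t - s) * m s))) ->
  mu.-integrable setT (EFin \o (fun t => conv k m t * gden n t)) /\
  avg (conv k m) n = tau * \sum_(i < n.+1) avg k i * avg m (n - i).
Proof.
move=> ak am ikm; have [mk k0 ik] := ak; have [mm m0 im] := am.
pose H (z : R * R) : R := k (z.2 - z.1) * m z.1 * gden n z.2.
have mH : measurable_fun setT H.
  apply: measurable_funM; first apply: measurable_funM.
  - by apply: (measurableT_comp mk); apply: measurable_funB.
  - exact: (measurableT_comp mm measurable_fst).
  - by apply: measurableT_comp; [exact: measurable_gden | exact: measurable_snd].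
have inner (k' : R -> R) (y s : R) : averageable k' -> (s <= 0 -> y = 0) ->
   \int[mu]_t (k' (t - s) * y * gden n t) = tau * \sum_(i < n.+1) avg k' i * (y * gden (n - i) s).
  move=> ak' ys; have [s0|s0] := leP s 0.
    rewrite ys //; rewrite [LHS](_ : _ = 0); last first.
      by rewrite /Rintegral integral0_eq // => t _; rewrite mulr0 mul0r.
    by rewrite big1 ?mulr0 // => i _; rewrite mul0r mulr0.
  have [i1 e1] := shifted_average n ak' s0.
  under eq_Rintegral do rewrite mulrAC; rewrite RintegralZr // e1 -mulrA mulr_suml.
  by congr (_ * _); apply: eq_bigr => i _; rewrite -mulrA [y * _]mulrC.
have inner_int (k' : R -> R) (y s : R) : averageable k' -> (s <= 0 -> y = 0) ->
   mu.-integrable setT (EFin \o (fun t => k' (t - s) * y * gden n t)).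
  move=> ak' ys; have [s0|s0] := leP s 0.
    rewrite ys //; under [X in _.-integrable _ (_ \o X)]eq_fun do rewrite mulr0 mul0r.
    exact: integrable0.
  have [i1 e1] := shifted_average n ak' s0.
  by under [X in _.-integrable _ (_ \o X)]eq_fun do rewrite mulrAC; exact: RintegrableZr.
have aak := averageable_abs ak.
have sumint (y : R -> R) (c : 'I_n.+1 -> R) :
    (forall i, mu.-integrable setT (EFin \o (fun u => y u * gden i u))) ->
    mu.-integrable setT (EFin \o (fun s => tau * \sum_(i < n.+1) c i * (y s * gden (n - i) s))) /\
    \int[mu]_s (tau * \sum_(i < n.+1) c i * (y s * gden (n - i) s)) =
    tau * \sum_(i < n.+1) c i * avg y (n - i).
  move=> iy.
  have iF (i : 'I_n.+1) : mu.-integrable setT (EFin \o (fun s => c i * (y s * gden (n - i) s))).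
    by apply: RintegrableZl => //; exact: iy.
  have [iS eS] := Rintegral_sum (index_enum 'I_n.+1) measurableT iF.
  split; first exact: RintegrableZl.
  rewrite RintegralZl // eS; congr (_ * _); apply: eq_bigr => i _.
  by rewrite RintegralZl //; exact: iy.
(* Tonelli: the same computation with |k| and |m| bounds the integral of |H|. *)
have iH : (mu \x mu)%E.-integrable setT (EFin \o H).
  apply/integrable12ltyP; first exact/measurable_EFinP.
  have [am1 am2 am3] := averageable_abs am.
  have [is1 _] := sumint (fun s => `|m s|) (fun i => avg (fun u => `|k u|) i) am3.
  have /integrableP[_] := is1; apply: le_lt_trans; apply: ge0_le_integral => //.
  - by move=> s _; exact: integral_ge0.
  - have mHa : measurable_fun setT (fun z => `|(EFin \o H) z|)%E.
      by apply: measurableT_comp => //; exact/measurable_EFinP.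
    exact: (@measurable_fun_fubini_tonelli_F _ _ _ _ R mu _ mHa).
  - apply: measurableT_comp => //; by have /integrableP[] := is1.
  move=> s _ /=.
  have hy : s <= 0 -> `|m s| = 0 by move=> /m0 ->; rewrite normr0.
  have ii := inner_int _ _ _ aak hy.
  rewrite -(inner _ _ _ aak hy) ger0_norm; last first.
    apply: Rintegral_ge0 => t _; by rewrite mulr_ge0 ?gden_ge0 ?mulr_ge0.
  rewrite fineK; last exact: integrable_fin_num.
  rewrite le_eqVlt; apply/orP; left; apply/eqP; apply: eq_integral => t _.
  by rewrite /H /= !normrM (ger0_norm (gden_ge0 tau0 _ _)).
have convE t : \int[mu]_s H (s, t) = conv k m t * gden n t.
  by rewrite /H /= RintegralZr.
have iHt t : mu.-integrable setT (EFin \o (fun s => H (s, t))).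
  by rewrite /H /=; apply: RintegrableZr => //; exact: ikm.
have GE : fubini_G mu (EFin \o H) = EFin \o (fun t => conv k m t * gden n t).
  apply/funext => t; rewrite /fubini_G /= -convE fineK //.
  exact: (integrable_fin_num measurableT (iHt t)).
have FE : fubini_F mu (EFin \o H) = EFin \o (fun s => tau * \sum_(i < n.+1) avg k i * (m s * gden (n - i) s)).
  apply/funext => s; rewrite /fubini_F /=.
  have hy : s <= 0 -> m s = 0 by move=> /m0.
  rewrite -(inner _ _ _ ak hy) fineK //.
  exact: (integrable_fin_num measurableT (inner_int _ _ _ ak hy)).
split.
  rewrite -GE -[fubini_G _ _]/(fubini_F mu (fun z : R * R => (H (z.2, z.1))%:E)).
  apply: integrable_fubini_F; apply/integrable12ltyP.
    apply/measurable_EFinP; apply: (measurableT_comp mH).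
    by apply/measurable_fun_pairP; split; [exact: measurable_snd | exact: measurable_fst].
  by apply: (proj1 (integrable21ltyP _ _ _)) iH; exact/measurable_EFinP.
have [_ <-] := sumint m (fun i => avg k i) im.
rewrite /avg /Rintegral; congr fine.
have eG := congr1 (fun g => integral mu setT g) GE.
have eF := congr1 (fun g => integral mu setT g) FE.
exact: etrans (esym eG) (etrans (esym (Fubini iH)) eF).
Qed.

End Averaging.

Section ComplexAveraging.
Variables (R : realType) (tau : R).
Hypothesis tau0 : 0 < tau.
Local Notation mu := (@lebesgue_measure R).

Lemma averageableD k m : averageable tau k -> averageable tau m -> averageable tau (fun u => k u + m u).
Proof.
move=> [k1 k2 k3] [m1 m2 m3]; split; first exact: measurable_funD.
  by move=> u u0; rewrite k2 // m2 // addr0.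
by move=> i; under [X in _.-integrable _ (_ \o X)]eq_fun do rewrite mulrDl; exact: RintegrableD.
Qed.

Lemma averageableZ c k : averageable tau k -> averageable tau (fun u => c * k u).
Proof.
move=> [k1 k2 k3]; split; first exact: measurable_funM.
  by move=> u u0; rewrite k2 // mulr0.
by move=> i; under [X in _.-integrable _ (_ \o X)]eq_fun do rewrite -mulrA; exact: RintegrableZl.
Qed.

Lemma averageableB k m : averageable tau k -> averageable tau m -> averageable tau (fun u => k u - m u).
Proof.
move=> ak am; have := averageableD ak (averageableZ (-1) am).
by under eq_fun do rewrite mulN1r.
Qed.

Lemma avgD k m n : averageable tau k -> averageable tau m ->
  avg tau (fun u => k u + m u) n = avg tau k n + avg tau m n.
Proof.
move=> [k1 k2 k3] [m1 m2 m3]; rewrite /avg; under eq_Rintegral do rewrite mulrDl.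
by rewrite RintegralD.
Qed.

Lemma avgZ c k n : averageable tau k -> avg tau (fun u => c * k u) n = c * avg tau k n.
Proof.
move=> [k1 k2 k3]; rewrite /avg; under eq_Rintegral do rewrite -mulrA.
by rewrite RintegralZl.
Qed.

Lemma avgB k m n : averageable tau k -> averageable tau m ->
  avg tau (fun u => k u - m u) n = avg tau k n - avg tau m n.
Proof.
move=> ak am; have := avgD n ak (averageableZ (-1) am); rewrite avgZ // mulN1r => <-.
by congr avg; apply/funext => u; rewrite mulN1r.
Qed.

Lemma averageable_conv k m : averageable tau k -> averageable tau m ->
  (forall t, mu.-integrable setT (EFin \o (fun s => k (t - s) * m s))) ->
  averageable tau (conv k m).
Proof.
move=> ak am ikm; have h n := avg_conv tau0 n ak am ikm.
have [_ k0 _] := ak; have [_ m0 _] := am.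
have c0 u : u <= 0 -> conv k m u = 0.
  move=> u0; rewrite /conv /Rintegral integral0_eq // => s _.
  have [s0|s0] := leP s 0; first by rewrite m0 // mulr0.
  by rewrite k0 ?mul0r //; lra.
split=> // [|i]; last by have [] := h i.
have [/integrableP[/measurable_EFinP m1 _] _] := h 0%N.
(* Fubini gives measurability of the convolution times the density; multiplying by the reciprocal of
   the positive density of order 0 recovers the convolution. *)
have -> : conv k m = fun t => (conv k m t * gden tau 0 t) * (expR (tau^-1 * t) * tau).
  apply/funext => t; have [t0|t0] := leP t 0; first by rewrite c0 // !mul0r.
  have e0 : expR (tau^-1 * t) != 0 by rewrite gt_eqF ?expR_gt0.
  by rewrite /gden t0 expr0 fact0 mul1r mulr1 expRN; field; rewrite e0 gt_eqF.
apply: measurable_funM => //; apply: measurable_funM => //.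
by apply: (measurableT_comp (@measurable_expR R)); exact: measurable_funM.
Qed.

Lemma averageable_integrable (g : R -> R) : (forall u, u <= 0 -> g u = 0) ->
  mu.-integrable setT (EFin \o g) -> averageable tau g.
Proof.
move=> g0 ig; have /integrableP[/measurable_EFinP mg _] := ig; split=> // i.
have [B hB] := gden_bounded tau0 i.
have := RintegrableZr measurableT B ig; apply: le_integrable => //.
  by apply/measurable_EFinP; apply: measurable_funM => //; exact: measurable_gden.
move=> u _ /=; rewrite lee_fin !normrM; apply: ler_wpM2l => //.
by rewrite ger0_norm ?gden_ge0 // (le_trans (hB u)) // ler_norm.
Qed.

Definition cavg (w : R -> R[i]) (n : nat) : R[i] :=
  avg tau (fun u => complex.Re (w u)) n +i* avg tau (fun u => complex.Im (w u)) n.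

Definition caverageable (w : R -> R[i]) : Prop :=
  averageable tau (fun u => complex.Re (w u)) /\ averageable tau (fun u => complex.Im (w u)).

Definition cconv (k m : R -> R[i]) (t : R) : R[i] :=
  (conv (fun u => complex.Re (k u)) (fun u => complex.Re (m u)) t
   - conv (fun u => complex.Im (k u)) (fun u => complex.Im (m u)) t) +i*
  (conv (fun u => complex.Re (k u)) (fun u => complex.Im (m u)) t
   + conv (fun u => complex.Im (k u)) (fun u => complex.Re (m u)) t).

Definition convolvable (k m : R -> R[i]) : Prop := forall t,
  [/\ mu.-integrable setT (EFin \o (fun s => complex.Re (k (t - s)) * complex.Re (m s))),
      mu.-integrable setT (EFin \o (fun s => complex.Im (k (t - s)) * complex.Im (m s))),
      mu.-integrable setT (EFin \o (fun s => complex.Re (k (t - s)) * complex.Im (m s))) &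
      mu.-integrable setT (EFin \o (fun s => complex.Im (k (t - s)) * complex.Re (m s)))].

Lemma cavg_cconv k m n : caverageable k -> caverageable m -> convolvable k m ->
  caverageable (cconv k m) /\ cavg (cconv k m) n = tau%:C * cauchy_prod (cavg k) (cavg m) n.
Proof.
move=> [k1 k2] [m1 m2] km.
have i11 t : mu.-integrable setT (EFin \o (fun s => complex.Re (k (t - s)) * complex.Re (m s))) by have [] := km t.
have i22 t : mu.-integrable setT (EFin \o (fun s => complex.Im (k (t - s)) * complex.Im (m s))) by have [] := km t.
have i12 t : mu.-integrable setT (EFin \o (fun s => complex.Re (k (t - s)) * complex.Im (m s))) by have [] := km t.
have i21 t : mu.-integrable setT (EFin \o (fun s => complex.Im (k (t - s)) * complex.Re (m s))) by have [] := km t.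
have a11 := averageable_conv k1 m1 i11; have a22 := averageable_conv k2 m2 i22.
have a12 := averageable_conv k1 m2 i12; have a21 := averageable_conv k2 m1 i21.
split; first by split; [exact: averageableB | exact: averageableD].
have [_ e11] := avg_conv tau0 n k1 m1 i11; have [_ e22] := avg_conv tau0 n k2 m2 i22.
have [_ e12] := avg_conv tau0 n k1 m2 i12; have [_ e21] := avg_conv tau0 n k2 m1 i21.
apply: complex_eqP; rewrite ?ReZ ?ImZ.
  rewrite [LHS](avgB n a11 a22) e11 e22 -mulrBr -sumrB Re_sum; congr (_ * _).
rewrite [LHS](avgD n a12 a21) e12 e21 -mulrDr; congr (_ * _).
by rewrite -big_split /= Im_sum; apply: eq_bigr => i _; rewrite ImM.
Qed.

Lemma caverageableD v w : caverageable v -> caverageable w -> caverageable (fun u => v u + w u).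
Proof.
move=> [v1 v2] [w1 w2]; split; under eq_fun do rewrite ?ReD ?ImD; exact: averageableD.
Qed.

Lemma caverageableZ (c : R[i]) w : caverageable w -> caverageable (fun u => c * w u).
Proof.
move=> [w1 w2]; split.
  under eq_fun do rewrite ReM; apply: averageableB; exact: averageableZ.
under eq_fun do rewrite ImM; apply: averageableD; exact: averageableZ.
Qed.

Lemma cavgD v w n : caverageable v -> caverageable w ->
  cavg (fun u => v u + w u) n = cavg v n + cavg w n.
Proof.
move=> [v1 v2] [w1 w2]; apply: complex_eqP; rewrite ?ReD ?ImD /=.
  by rewrite -avgD //; congr avg; apply/funext => u; rewrite ReD.
by rewrite -avgD //; congr avg; apply/funext => u; rewrite ImD.
Qed.

Lemma cavgZ (c : R[i]) w n : caverageable w -> cavg (fun u => c * w u) n = c * cavg w n.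
Proof.
move=> [w1 w2]; have z1 x := averageableZ x w1; have z2 x := averageableZ x w2.
apply: complex_eqP; rewrite ?ReM ?ImM /=.
  by rewrite -!avgZ // -avgB //; congr avg; apply/funext => u; rewrite ReM.
by rewrite -!avgZ // -avgD //; congr avg; apply/funext => u; rewrite ImM.
Qed.

Lemma caverageable0 : caverageable (fun=> 0).
Proof.
by split; split=> // i; under [X in _.-integrable _ (_ \o X)]eq_fun do rewrite mul0r; exact: integrable0.
Qed.

Lemma cavg_sum (J : Type) (r : seq J) (w : J -> R -> R[i]) n : (forall j, caverageable (w j)) ->
  caverageable (fun u => \sum_(j <- r) w j u) /\
  cavg (fun u => \sum_(j <- r) w j u) n = \sum_(j <- r) cavg (w j) n.
Proof.
move=> aw; elim: r => [|j r [IH1 IH2]].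
  have -> : (fun u : R => \sum_(j <- [::]) w j u) = fun=> 0 by apply/funext => u; rewrite big_nil.
  split; first exact: caverageable0.
  have -> : cavg (fun=> 0) n = cavg (fun u => 0 * (0 : R[i])) n by congr cavg; apply/funext => u; rewrite mul0r.
  by rewrite big_nil (cavgZ 0 n caverageable0) mul0r.
have -> : (fun u : R => \sum_(k <- j :: r) w k u) = fun u => w j u + \sum_(k <- r) w k u.
  by apply/funext => u; rewrite big_cons.
by split; [exact: caverageableD | rewrite cavgD // IH2 big_cons].
Qed.

Definition heaviside (u : R) : R := if 0 < u then 1 else 0.

Lemma measurable_heaviside : measurable_fun setT heaviside.
Proof. by apply: measurable_fun_ifT => //; exact: measurable_fun_ltr. Qed.

Lemma heaviside_gden i u : heaviside u * gden tau i u = gden tau i u.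
Proof. by rewrite /heaviside /gden; case: ifP => _; rewrite ?mul1r ?mul0r. Qed.

Lemma averageable_heaviside : averageable tau heaviside.
Proof.
split; first exact: measurable_heaviside.
  by move=> u u0; rewrite /heaviside ltNge u0.
by move=> i; under [X in _.-integrable _ (_ \o X)]eq_fun do rewrite heaviside_gden; exact: gden_integrable.
Qed.

Lemma avg_heaviside n : avg tau heaviside n = 1.
Proof. by rewrite /avg; under eq_Rintegral do rewrite heaviside_gden; exact: gden_integral. Qed.

Lemma heaviside_convolvable (g : R -> R) t : mu.-integrable setT (EFin \o g) ->
  mu.-integrable setT (EFin \o (fun s => heaviside (t - s) * g s)).
Proof.
move=> ig; have /integrableP[/measurable_EFinP mg _] := ig.
apply: le_integrable ig => //.
  apply/measurable_EFinP; apply: measurable_funM => //.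
  by apply: (measurableT_comp measurable_heaviside); exact: measurable_funB.
move=> s _ /=; rewrite lee_fin normrM /heaviside; case: ifP => _.
  by rewrite normr1 mul1r.
by rewrite normr0 mul0r.
Qed.

End ComplexAveraging.

(** * Averages of the fractional kernel *)

Section FractionalKernel.
Variables (R : realType) (tau al : R) (c : R[i]).
Hypotheses (tau0 : 0 < tau) (Hal : 0 < al < 1) (c0 : 0 < complex.Re c).
Local Notation mu := (@lebesgue_measure R).

Definition frac_part (th u : R) : R :=
  if 0 < u then (Gamma_pos (1 - al))^-1 * gamma_kernel (1 - al) (complex.Re c) (complex.Im c) th u
  else 0.

(* u^(-al) exp (- c u) / Gamma (1 - al) *)
Definition frac_kernel (u : R) : R[i] := frac_part 0 u +i* frac_part (pi / 2) u.

Let x0 : 0 < 1 - al. Proof. by case/andP: Hal; rewrite subr_gt0. Qed.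

Lemma averageable_frac_part th : averageable tau (frac_part th).
Proof.
split.
- have -> : frac_part th = (fun u => (Gamma_pos (1 - al))^-1 *
      gamma_kernel (1 - al) (complex.Re c) (complex.Im c) th u) \_ `]0, +oo[.
    by apply/funext => u; rewrite /frac_part /patch mem_setE /= in_itv /= andbT.
  apply: (measurable_restrictT _ _).1; first exact: measurable_itv.
  by apply: measurable_funM => //; exact: measurable_gamma_kernel.
- by move=> u u0; rewrite /frac_part ltNge u0.
- move=> i; have := RintegrableZl measurableT (Gamma_pos (1 - al))^-1
    (gden_gamma_integrable tau0 (complex.Im c) th i x0 (ltW c0)).
  apply: eq_integrable => // u _ /=; rewrite /frac_part.
  case: ifP => u0; first by rewrite mulrA.
  by rewrite /gden u0 !mulr0.
Qed.

Lemma caverageable_frac_kernel : caverageable tau frac_kernel.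
Proof. by split; exact: averageable_frac_part. Qed.

Lemma avg_frac_part th n : avg tau (frac_part th) n =
  (Gamma_pos (1 - al))^-1 * (n`!%:R * tau ^+ n.+1)^-1 *
  gamma_integral (1 - al + n%:R) (complex.Re c + tau^-1) (complex.Im c) th.
Proof.
have tv0 : 0 < tau^-1 by rewrite invr_gt0.
transitivity ((Gamma_pos (1 - al))^-1 * \int[mu]_u
   (gamma_kernel (1 - al) (complex.Re c) (complex.Im c) th u * gden tau n u)).
  rewrite -RintegralZl //; last exact: gden_gamma_integrable (ltW c0).
  apply: eq_Rintegral => u _; rewrite /frac_part.
  case: ifP => u0; first by rewrite mulrA.
  by rewrite /gden u0 !mulr0.
rewrite gden_gamma_integral // RintegralZl ?mulrA //.
by apply: gamma_kernel_integrable; [rewrite ltr_wpDr | rewrite addr_gt0].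
Qed.

Lemma bin_coef_scale (w : R[i]) (r a : R) n : 0 < r -> 0 < complex.Re w ->
  bin_coef (r%:C * w) a n = (r `^ a / r ^+ n)%:C * bin_coef w a n.
Proof.
move=> r0 w0; have rn0 : r%:C != 0 by rewrite eq_complex /= gt_eqF.
have wn0 : w != 0 by exact: Re_gt0_neq0.
elim: n => [|n IH] /=; first by rewrite expr0 divr1 cpow_scale.
have n0 : n.+1%:R != 0 :> R[i] by rewrite pnatr_eq0.
have rX : (r ^+ n)%:C != 0 by rewrite eq_complex /= negb_and expf_neq0 // gt_eqF.
rewrite IH exprSr !rmorphM !fmorphV !rmorphM /=.
by field; rewrite ?rn0 ?rX ?wn0 ?nat1r ?n0.
Qed.

Lemma cavg_frac_kernel n : tau%:C * cavg tau frac_kernel n =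
  (tau `^ (1 - al))%:C * bin_coef (1 + tau%:C * c) (al - 1) n.
Proof.
have tv0 : 0 < tau^-1 by rewrite invr_gt0.
have w0 : 0 < complex.Re (1 + tau%:C * c) by rewrite ReD ReZ ltr_wpDr // mulr_ge0 // ltW.
(* The exponential of the density shifts c by 1 / tau, which is the base 1 + tau c of the scheme up
   to scaling. *)
have cw : c + (tau^-1)%:C = (tau^-1)%:C * (1 + tau%:C * c).
  by rewrite mulrDr mulr1 mulrA -rmorphM mulVf ?gt_eqF // mul1r addrC.
have -> : cavg tau frac_kernel n = ((Gamma_pos (1 - al))^-1 * (n`!%:R * tau ^+ n.+1)^-1)%:C *
    cgamma (1 - al + n%:R) (c + (tau^-1)%:C).
  rewrite /cavg /frac_kernel /= !avg_frac_part /cgamma ReD ImD /= addr0.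
  by apply: complex_eqP; rewrite ?ReZ ?ImZ.
rewrite cgamma_bin_coef //; last by rewrite ReD addr_gt0.
rewrite opprB cw bin_coef_scale //.
have G0 : (Gamma_pos (1 - al))%:C != 0 by rewrite eq_complex /= gt_eqF // Gamma_pos_gt0.
rewrite -(rmorph_nat (real_complex R) n`!) !mulrA -!rmorphM; congr (_%:C * _).
have -> : tau^-1 `^ (al - 1) = tau `^ (1 - al).
  by rewrite -(powR_inv1 (ltW tau0)) -powRrM mulN1r opprB.
have Gn0 : Gamma_pos (1 - al) != 0 by rewrite gt_eqF // Gamma_pos_gt0.
rewrite exprVn invrK exprS; field.
by rewrite Gn0 pnatr_eq0 -lt0n fact_gt0 expf_neq0 ?gt_eqF.
Qed.

End FractionalKernel.

(** * The averaged solution satisfies the scheme exactly *)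

Section ExactScheme.
Variable R : realType.
Local Notation mu := (@lebesgue_measure R).

(** Coefficients of (w - z)^a = (w - z) (w - z)^(a-1). *)
Lemma bin_coef_step (w : R[i]) (a : R) n : 0 < complex.Re w ->
  bin_coef w a n = w * bin_coef w (a - 1) n - shiftc (bin_coef w (a - 1)) n.
Proof.
move=> w0; have wn0 : w != 0 by exact: Re_gt0_neq0.
have cE : cpow w a = w * cpow w (a - 1).
  by rewrite -{2}(cpow1 w0) -cpowD ?Re_gt0_normc // addrC subrK.
case: n => [|n]; first by rewrite /= subr0 cE.
have n0 k : k.+1%:R != 0 :> R[i] by rewrite pnatr_eq0.
elim: n => [|n IH].
  by rewrite /= cE !rmorphB rmorph0 rmorph1 mul1r; field; exact: wn0.
have S m b : bin_coef w b m.+1 = bin_coef w b m * ((m%:R - b)%:C / (m.+1%:R * w)) by [].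
rewrite S {}IH [shiftc _ n.+1]/= [shiftc _ n.+2]/= (S n.+1 (a - 1)) [in RHS](S n (a - 1)) (S n (a - 1)).
rewrite !rmorphB !rmorph1 !rmorph_nat.
move: (bin_coef w (a - 1) n) => X.
have n1 : n.+1%:R != 0 :> R[i] by rewrite pnatr_eq0.
have n2 : n.+2%:R != 0 :> R[i] by rewrite pnatr_eq0.
move: n1 n2; rewrite -(addn2 n) -(addn1 n) !natrD => n1 n2; field.
by rewrite wn0 n1 n2.
Qed.

Lemma cauchy_prod_shiftcl (p q : nat -> R[i]) n :
  cauchy_prod (shiftc p) q n = shiftc (cauchy_prod p q) n.
Proof.
case: n => [|n] /=; first by rewrite /cauchy_prod big_ord_recl big_ord0 mul0r addr0.
by rewrite cauchy_prod_recl mul0r add0r; apply: eq_bigr => k _; rewrite subSS.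
Qed.

Variables (I : finType) (al la tau : R) (c : I -> R[i]) (A : I -> I -> R[i]).
Variable g : I -> R -> R[i].
Hypotheses (Hal : 0 < al < 1) (la0 : 0 < la) (tau0 : 0 < tau).
Hypothesis c0 : forall i, 0 < complex.Re (c i).
Hypothesis g0 : forall i u, u <= 0 -> g i u = 0.
Hypothesis ig : forall i, cintegrable setT (g i).

Definition primitive (i : I) (t : R) : R[i] :=
  conv (@heaviside R) (fun s => complex.Re (g i s)) t +i*
  conv (@heaviside R) (fun s => complex.Im (g i s)) t.

(** As (exp (c t) v)' = exp (c t) (v' + c v), the tempered Caputo derivative is the fractional
    kernel convolved with v' + c v. *)
Definition driver (i : I) (t : R) : R[i] := g i t + c i * primitive i t.

Hypothesis kd : forall i, convolvable (frac_kernel al (c i)) (driver i).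

(** The averages see the whole half-line, so beyond the final time the source is defined as whatever
    the extended solution satisfies. *)
Definition residual_source (i : I) (t : R) : R[i] :=
  cconv (frac_kernel al (c i)) (driver i) t - (la `^ al)%:C * primitive i t
  - \sum_j A i j * primitive j t.

Lemma caverageable_g i : caverageable tau (g i).
Proof.
by have [i1 i2] := ig i; split; apply: averageable_integrable => // u u0; rewrite g0.
Qed.

Lemma caverageable_primitive i : caverageable tau (primitive i).
Proof.
have [a1 a2] := caverageable_g i; have [i1 i2] := ig i.
by split; (apply: averageable_conv => //; [exact: averageable_heaviside | move=> t; exact: heaviside_convolvable]).
Qed.

(** The averages of the Heaviside function all equal 1, so the averaged primitive is tau times the
    partial sums of the averages of g. *)
Lemma cavg_primitive i n : tau%:C * cavg tau (g i) n =
  cavg tau (primitive i) n - shiftc (cavg tau (primitive i)) n.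
Proof.
have [a1 a2] := caverageable_g i; have [i1 i2] := ig i.
have U m : cavg tau (primitive i) m = tau%:C * \sum_(k < m.+1) cavg tau (g i) k.
  have [_ e1] := avg_conv tau0 m (averageable_heaviside tau0) a1 (fun t => heaviside_convolvable t i1).
  have [_ e2] := avg_conv tau0 m (averageable_heaviside tau0) a2 (fun t => heaviside_convolvable t i2).
  have rev (F : nat -> R) : \sum_(k < m.+1) avg tau (@heaviside R) k * F (m - k)%N = \sum_(k < m.+1) F k.
    under eq_bigr do rewrite avg_heaviside // mul1r.
    rewrite (reindex_inj rev_ord_inj) /=; apply: eq_bigr => k _.
    by rewrite subSS subKn // -ltnS.
  rewrite rev in e1; rewrite rev in e2.
  by apply: complex_eqP; rewrite ?ReZ ?ImZ ?Re_sum ?Im_sum; [exact: e1 | exact: e2].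
case: n => [|n] /=; first by rewrite U big_ord_recl big_ord0 addr0 subr0.
by rewrite !U -mulrBr [X in _ = _ * (X - _)]big_ord_recr /= addrAC subrr add0r.
Qed.

(** In generating functions, tau times the averaged driver is (1 + tau c - z) U, and the averaged
    kernel is a multiple of (1 + tau c - z)^(al-1); their product is the power al of the symbol,
    without discretization error. *)
Theorem exact_scheme n i :
  scheme_lhs (fun i => tau%:C * c i) al (tau * la) (fun i j => (tau `^ al)%:C * A i j)
    (fun m i => cavg tau (primitive i) m) n i =
  (tau `^ al)%:C * cavg tau (residual_source i) n.
Proof.
set U := cavg tau (primitive i).
have w0 : 0 < complex.Re (1 + tau%:C * c i) by rewrite ReD ReZ ltr_wpDr // mulr_ge0 // ltW.
set w := 1 + tau%:C * c i in w0 *.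
have ap := caverageable_primitive.
have ad : caverageable tau (driver i).
  by apply: caverageableD; [exact: caverageable_g | exact: caverageableZ].
have [ac ec] := cavg_cconv tau0 n (caverageable_frac_kernel tau0 Hal (c0 i)) ad (kd i).
have [as_ es] := @cavg_sum R tau I (index_enum I) (fun j t => A i j * primitive j t) n
  (fun j => caverageableZ (A i j) (ap j)).
have e1 : cavg tau (residual_source i) n =
    cavg tau (cconv (frac_kernel al (c i)) (driver i)) n - (la `^ al)%:C * U n -
    \sum_j A i j * cavg tau (primitive j) n.
  have z1 := caverageableZ (- (la `^ al)%:C) (ap i).
  have z2 := caverageableZ (-1) as_.
  transitivity (cavg tau (fun t => (cconv (frac_kernel al (c i)) (driver i) t +
     - (la `^ al)%:C * primitive i t) + -1 * \sum_j A i j * primitive j t) n).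
    by congr cavg; apply/funext => t; rewrite /residual_source mulN1r mulNr.
  rewrite cavgD //; last exact: caverageableD.
  rewrite cavgD // !cavgZ // es mulN1r mulNr; congr (_ - _).
  by apply: eq_bigr => j _; rewrite cavgZ.
have aE m : tau%:C * cavg tau (driver i) m = w * U m - shiftc U m.
  rewrite /driver cavgD; [|exact: caverageable_g|exact: caverageableZ].
  by rewrite cavgZ // mulrDr cavg_primitive -/U /w mulrDl mul1r mulrA; ring.
have B n' : (tau `^ al)%:C * (tau%:C * cavg tau (frac_kernel al (c i)) n') =
    tau%:C * bin_coef w (al - 1) n'.
  rewrite cavg_frac_kernel // mulrA -rmorphM -powRD; last first.
    by apply/implyP => _; rewrite gt_eqF.
  by rewrite addrC subrK powRr1 // ltW.
have e2 : (tau `^ al)%:C * cavg tau (cconv (frac_kernel al (c i)) (driver i)) n =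
    cauchy_prod (bin_coef w al) U n.
  rewrite ec /cauchy_prod !mulr_sumr.
  transitivity (\sum_(k < n.+1) bin_coef w (al - 1) k * (w * U (n - k)%N - shiftc U (n - k)%N)).
    apply: eq_bigr => k _; rewrite -aE.
    have := B k; move: (cavg _ (driver i) _) (cavg _ _ _) (bin_coef _ _ _) => X Y Z hB.
    have -> : (tau `^ al)%:C * (tau%:C * (Y * X)) = ((tau `^ al)%:C * (tau%:C * Y)) * X by ring.
    by rewrite hB; ring.
  have -> : \sum_(k < n.+1) bin_coef w (al - 1) k * (w * U (n - k)%N - shiftc U (n - k)%N) =
      w * cauchy_prod (bin_coef w (al - 1)) U n - cauchy_prod (bin_coef w (al - 1)) (shiftc U) n.
    by rewrite /cauchy_prod mulr_sumr -sumrB; apply: eq_bigr => k _; rewrite mulrBr mulrCA.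
  rewrite cauchy_prod_shiftc -cauchy_prod_shiftcl /cauchy_prod mulr_sumr -sumrB.
  by apply: eq_bigr => k _; rewrite (bin_coef_step al k w0) mulrBl mulrA.
have e3 : cauchy_prod (symb (tau%:C * c i) al (tau * la)) U n =
    cauchy_prod (bin_coef w al) U n - ((tau * la) `^ al)%:C * U n.
  rewrite /cauchy_prod /symb; under eq_bigr do rewrite mulrBl.
  rewrite sumrB; congr (_ - _); rewrite big_ord_recl /= mul1r subn0 big1 ?addr0 // => k _.
  by rewrite !mul0r.
rewrite /scheme_lhs -/U e3 e1 !mulrBr e2 mulrA -rmorphM -powRM ?(ltW tau0) ?(ltW la0) //.
by congr (_ - _ - _); rewrite mulr_sumr; apply: eq_bigr => j _; rewrite mulrA.
Qed.

End ExactScheme.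

(** * Convolutions with weakly singular kernels *)

Section Primitives.
Variable R : realType.
Local Notation mu := (@lebesgue_measure R).

Lemma dominated_Rintegral (f_ : nat -> R -> R) (f B : R -> R) :
  (forall n, measurable_fun setT (f_ n)) -> measurable_fun setT f ->
  (forall x, (fun n => f_ n x) @ \oo --> f x) ->
  mu.-integrable setT (EFin \o B) -> (forall n x, `|f_ n x| <= B x) ->
  (fun n => \int[mu]_x f_ n x) @ \oo --> \int[mu]_x f x.
Proof.
move=> mf_ mf cf iB fB.
have [] := @dominated_convergence _ _ R mu setT measurableT (fun n => EFin \o f_ n) (EFin \o f) (EFin \o B).
- by move=> n; apply/measurable_EFinP; apply: mf_.
- by apply/measurable_EFinP; apply: mf.
- by apply: aeW => x _; apply: cvg_EFin; [exact: nearW | exact: cf].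
- exact: iB.
- by apply: aeW => x n _; rewrite /= lee_fin.
by move=> iF _ h; apply: fine_cvg; rewrite /Rintegral fineK ?integrable_fin_num.
Qed.

Lemma Rintegrable_patch (a b : R) (g : R -> R) : mu.-integrable `[a, b] (EFin \o g) ->
  mu.-integrable setT (EFin \o (g \_ `]a, b[)).
Proof.
move=> ig; have [h _] := @integrable_mkcond _ _ R mu `]a, b[ (EFin \o g) (measurable_itv _).
rewrite -restrict_EFin; apply: h; apply: integrableS ig => //.
by move=> x /=; rewrite !in_itv /= => /andP[/ltW -> /ltW ->].
Qed.

Lemma Rintegral_oo_cc (g : R -> R) (a b : R) : mu.-integrable `[a, b] (EFin \o g) ->
  \int[mu]_(s in `]a, b[) g s = \int[mu]_(s in `[a, b]) g s.
Proof.
move=> ig; rewrite Rintegral_itv_bndo_bndc; last first.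
  by apply: integrableS ig => // x /=; rewrite !in_itv /= => /andP[/ltW -> /ltW ->].
rewrite Rintegral_itv_obnd_cbnd //.
by apply: integrableS ig => // x /=; rewrite !in_itv /= => /andP[/ltW -> ->].
Qed.

Lemma conv_heaviside_patch (T t : R) (g : R -> R) : 0 <= t <= T ->
  mu.-integrable `[0, T] (EFin \o g) ->
  conv (@heaviside R) (g \_ `]0, T[) t = \int[mu]_(s in `[0, t]) g s.
Proof.
move=> /andP[t0 tT] ig; rewrite -Rintegral_oo_cc; last first.
  by apply: integrableS ig => // x /=; rewrite !in_itv /= => /andP[-> /le_trans]; exact.
rewrite /conv [RHS]Rintegral_mkcond; apply: eq_Rintegral => s _.
rewrite /heaviside /patch !mem_setE /= !in_itv /= subr_gt0.
have [st|ts] := ltP s t; last by rewrite mul0r andbF.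
by rewrite mul1r (lt_le_trans st tT).
Qed.

Lemma conv_heaviside_after (T t : R) (g : R -> R) : T <= t ->
  conv (@heaviside R) (g \_ `]0, T[) t = conv (@heaviside R) (g \_ `]0, T[) T.
Proof.
move=> Tt; rewrite /conv; apply: eq_Rintegral => s _.
rewrite /heaviside /patch !mem_setE /= !in_itv /= !subr_gt0.
have [sT|Ts] := ltP s T; first by rewrite (lt_le_trans sT Tt).
by rewrite andbF !mulr0.
Qed.

Lemma integrable_tail (g : R -> R) e : mu.-integrable setT (EFin \o g) -> 0 < e ->
  exists2 M : R, 0 <= M &
    mu.-integrable setT (EFin \o (fun x => if M < `|g x| then `|g x| else 0)) /\
    \int[mu]_x (if M < `|g x| then `|g x| else 0) <= e.
Proof.
move=> ig e0; have /integrableP[/measurable_EFinP mg _] := ig.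
have mn : measurable_fun setT (fun x => `|g x|) by exact: measurableT_comp.
have iB : mu.-integrable setT (EFin \o (fun x => `|g x|)) by exact: integrable_norm.
pose F (n : nat) x : R := if n%:R < `|g x| then `|g x| else 0.
have mF n : measurable_fun setT (F n).
  by apply: measurable_fun_ifT => //; exact: measurable_fun_ltr.
have FB n x : `|F n x| <= `|g x| by rewrite /F; case: ifP => _; rewrite ?normr_id ?normr0.
have cF x : (fun n => F n x) @ \oo --> (0 : R).
  apply/cvgrPdist_le => d d0; exists (Num.truncn `|g x|).+1 => // n /= hn.
  rewrite /F ltNge (_ : `|g x| <= n%:R) ?subrr ?normr0 ?(ltW d0) //.
  apply/ltW/(lt_le_trans (truncnS_gt _)); by rewrite ler_nat.
have := dominated_Rintegral mF (@measurable_cst _ _ _ _ _ (0 : R)) cF iB FB.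
rewrite [X in _ --> X](_ : _ = 0); last by rewrite /Rintegral integral0_eq.
move=> /cvgrPdist_le /(_ e e0)[n _ /(_ n (leqnn n))] /=.
rewrite sub0r normrN => h; exists n%:R => //; split.
  apply: le_integrable iB => //; first by apply/measurable_EFinP; exact: (mF n).
  by move=> x _ /=; rewrite lee_fin normr_id; exact: (FB n).
exact: le_trans (ler_norm _) h.
Qed.

Lemma conv_heaviside_diff (g : R -> R) (s t : R) : mu.-integrable setT (EFin \o g) -> t <= s ->
  conv (@heaviside R) g s - conv (@heaviside R) g t = \int[mu]_(u in `[t, s[) g u.
Proof.
move=> ig ts; rewrite /conv -RintegralB //; [|exact: heaviside_convolvable..].
rewrite [RHS]Rintegral_mkcond; apply: eq_Rintegral => u _.
rewrite /heaviside /patch mem_setE /= in_itv /= !subr_gt0.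
have [ut|tu] := ltP u t; first by rewrite (lt_le_trans ut ts) subrr.
by case: ltP => _; rewrite ?mul1r !mul0r subr0.
Qed.

(** Uniform continuity in a form adapted to second moments. The part of |g| above M contributes at
    most e / 2, and M |s - t| <= e / 2 + M^2 (s - t)^2 / (2 e). *)
Lemma primitive_modulus (g : R -> R) e : mu.-integrable setT (EFin \o g) -> 0 < e ->
  exists2 K, 0 <= K & forall s t,
    `|conv (@heaviside R) g s - conv (@heaviside R) g t| <= e + K * (s - t) ^+ 2.
Proof.
move=> ig e0; have e20 : 0 < e / 2 by rewrite divr_gt0.
have [M M0 [iM hM]] := integrable_tail ig e20; exists (M ^+ 2 / (2 * e)).
  by rewrite divr_ge0 ?mulr_ge0 ?exprn_ge0 // ltW.
have main s t : t <= s ->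
    `|conv (@heaviside R) g s - conv (@heaviside R) g t| <= e + M ^+ 2 / (2 * e) * (s - t) ^+ 2.
  move=> ts; rewrite conv_heaviside_diff //.
  have iA (A : set R) (f : R -> R) : measurable A -> mu.-integrable setT (EFin \o f) -> mu.-integrable A (EFin \o f).
    by move=> mA; apply: integrableS.
  have i1 : mu.-integrable `[t, s[ (EFin \o g) by apply: iA.
  apply: le_trans (le_normr_Rintegral _ i1) _ => //.
  have fin : (mu `[t, s[ < +oo)%E.
    by rewrite lebesgue_measure_itv /= lte_fin; case: ifP => _; rewrite ?ltry // -EFinD ltry.
  have iT : mu.-integrable `[t, s[ (EFin \o (fun x => if M < `|g x| then `|g x| else 0)) by apply: iA.
  have ic : mu.-integrable `[t, s[ (EFin \o (fun=> M)) by apply: measurable_bounded_integrable => //; exact: bounded_cst.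
  apply: (@le_trans _ _ (\int[mu]_(u in `[t, s[) (M + (if M < `|g u| then `|g u| else 0)))).
    apply: le_Rintegral => //; [exact: integrable_norm | exact: RintegrableD |].
    by move=> u _; case: ltP => h; rewrite ?addr0 // lerDr.
  rewrite RintegralD //.
  have -> : \int[mu]_(u in `[t, s[) M = M * (s - t).
    rewrite Rintegral_cst //; congr (_ * _).
    have E : mu `[t, s[ = (if (t < s)%R then (s - t)%:E else 0)%E by rewrite lebesgue_measure_itv /= lte_fin.
    apply: etrans (congr1 fine E) _.
    case: ltP => // st; by rewrite (_ : s = t) ?subrr //; apply/eqP; rewrite eq_le ts st.
  have h2 : \int[mu]_(u in `[t, s[) (if M < `|g u| then `|g u| else 0) <= e / 2.
    apply: le_trans hM; rewrite Rintegral_mkcond; apply: le_Rintegral => //.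
      have [h _] := @integrable_mkcond _ _ R mu `[t, s[ (EFin \o (fun x => if M < `|g x| then `|g x| else 0)) (measurable_itv _).
      by rewrite -restrict_EFin; exact: h.
    have h u : 0 <= (if M < `|g u| then `|g u| else 0) by case: ifP.
    by move=> u _; rewrite patchE; case: ifP => // _; exact: h.
  have : M * (s - t) <= e / 2 + M ^+ 2 / (2 * e) * (s - t) ^+ 2.
    rewrite -subr_ge0 (_ : _ - _ = (e - M * (s - t)) ^+ 2 / (2 * e)); last by field; rewrite gt_eqF.
    by rewrite divr_ge0 ?sqr_ge0 // mulr_ge0 // ltW.
  lra.
move=> s t; have [/main//|/ltW/main] := leP t s.
by rewrite distrC -[t - s]opprB sqrrN.
Qed.

End Primitives.

Section Reflection.
Variable R : realType.
Local Notation mu := (@lebesgue_measure R).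

Lemma Rintegrable_reflect (c : R) (f : R -> R) : mu.-integrable setT (EFin \o f) ->
  mu.-integrable setT (EFin \o (fun x => f (c - x))).
Proof.
move=> /integrableP[mf fi]; apply/integrableP; split.
  apply/measurable_EFinP; apply: measurableT_comp; first exact/measurable_EFinP.
  exact: measurable_funB.
rewrite -(ge0_integral_reflect c (f := fun x => `|(f x)%:E|%E)) //.
exact: measurableT_comp.
Qed.

Lemma Rintegral_reflectT (c : R) (f : R -> R) : measurable_fun setT f ->
  \int[mu]_x f (c - x) = \int[mu]_x f x.
Proof.
move=> mf; rewrite /Rintegral; congr fine.
rewrite integralE [RHS]integralE; congr (_ - _)%E.
  apply: etrans (esym (ge0_integral_reflect c (f := (fun x => (f x)%:E)^\+)%E _ _)) => //.
    by apply: eq_integral => x _; rewrite !funepos.unlock.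
  by apply: measurable_funepos; exact/measurable_EFinP.
apply: etrans (esym (ge0_integral_reflect c (f := (fun x => (f x)%:E)^\-)%E _ _)) => //.
  by apply: eq_integral => x _; rewrite !funeneg.unlock.
by apply: measurable_funeneg; exact/measurable_EFinP.
Qed.

End Reflection.

(* Past the time T from which m is constant, the convolution with a weakly
   singular kernel k stays bounded and is right-continuous at T. *)
Section ConvolutionAfter.
Variables (R : realType) (al T C M : R) (k m : R -> R).
Hypotheses (al0 : 0 < al) (C0 : 0 <= C).
Local Notation mu := (@lebesgue_measure R).
Hypothesis k0 : forall u, u <= 0 -> k u = 0.
Hypothesis kcont : forall u, 0 < u -> {for u, continuous k}.
Hypothesis kbound : forall u, 0 < u -> `|k u| <= C * u `^ (- al).
Hypothesis ik : mu.-integrable setT (EFin \o k).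
Hypothesis mm : measurable_fun setT m.
Hypothesis mT : forall s, T <= s -> m s = M.
Hypothesis im : mu.-integrable setT (EFin \o (fun s => if s < T then (T - s) `^ (- al) * `|m s| else 0)).

(** The integrand is split at T. The part after T is reflected by s |-> t - s, which frees [k] from
    t, so that one function dominates all t >= T. *)
Let before t s := if s < T then k (t - s) * m s else 0.
Let after t s := M * (if s <= t - T then k s else 0).
Let bnd s := C * (if s < T then (T - s) `^ (- al) * `|m s| else 0) + `|M| * `|k s|.

Let mk : measurable_fun setT k. Proof. by have /integrableP[/measurable_EFinP]  := ik. Qed.

Let mbefore t : measurable_fun setT (before t).
Proof.
apply: measurable_fun_ifT => //; first exact: measurable_fun_ltr.
by apply: measurable_funM => //; apply: (measurableT_comp mk); exact: measurable_funB.
Qed.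

Let mafter t : measurable_fun setT (after t).
Proof.
apply: measurable_funM => //; apply: measurable_fun_ifT => //; exact: measurable_fun_ler.
Qed.

Let before_le t s : T <= t -> `|before t s| <= C * (if s < T then (T - s) `^ (- al) * `|m s| else 0).
Proof.
move=> Tt; rewrite /before; case: ifP => sT; last by rewrite normr0 mulr0.
have s0 : 0 < T - s by rewrite subr_gt0.
have t0 : 0 < t - s by rewrite subr_gt0 (lt_le_trans sT).
rewrite normrM mulrA; apply: ler_wpM2r => //; apply: le_trans (kbound t0) _.
apply: ler_wpM2l => //; rewrite !powRN lef_pV2 ?posrE ?powR_gt0 //.
by apply: ge0_ler_powR; rewrite ?nnegrE ?(ltW al0) ?(ltW s0) ?(ltW t0) // lerB.
Qed.

Let after_le t s : `|after t s| <= `|M| * `|k s|.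
Proof.
by rewrite /after normrM; apply: ler_wpM2l => //; case: ifP => _; rewrite ?normr0.
Qed.

Let ibefore t : T <= t -> mu.-integrable setT (EFin \o before t).
Proof.
move=> Tt; apply: le_integrable (RintegrableZl measurableT C im) => //.
  by apply/measurable_EFinP; apply: mbefore.
by move=> s _ /=; rewrite lee_fin; apply: le_trans (before_le s Tt) (ler_norm _).
Qed.

Let iafter t : mu.-integrable setT (EFin \o after t).
Proof.
apply: le_integrable (RintegrableZl measurableT `|M| (integrable_norm ik)) => //.
  by apply/measurable_EFinP; apply: mafter.
by move=> s _ /=; rewrite lee_fin; apply: le_trans (after_le _ s) (ler_norm _).
Qed.

Let ibnd : mu.-integrable setT (EFin \o bnd).
Proof.
apply: RintegrableD => //; first exact: RintegrableZl.
by apply: RintegrableZl => //; exact: integrable_norm.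
Qed.

Let split_integrand t : T <= t ->
  (fun s => k (t - s) * m s) = (fun s => before t s + after t (t - s)).
Proof.
move=> Tt; apply/funext => s; rewrite /before /after.
have [sT|Ts] := ltP s T; first by rewrite ifF ?mulr0 ?addr0 //; apply/negbTE; rewrite -ltNge; lra.
by rewrite ifT ?add0r ?mT 1?mulrC //; lra.
Qed.

Lemma conv_after_integrable t : T <= t ->
  mu.-integrable setT (EFin \o (fun s => k (t - s) * m s)).
Proof.
move=> Tt; rewrite split_integrand //; apply: RintegrableD => //; first exact: ibefore.
exact: (Rintegrable_reflect t (iafter t)).
Qed.

Let conv_split t : T <= t -> conv k m t = \int[mu]_s (before t s + after t s).
Proof.
move=> Tt; rewrite /conv split_integrand // !RintegralD ?(Rintegral_reflectT t (mafter t)) //.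
- exact: ibefore.
- exact: ibefore.
- exact: (Rintegrable_reflect t (iafter t)).
Qed.

Let sum_le t s : T <= t -> `|before t s + after t s| <= bnd s.
Proof. by move=> Tt; apply: le_trans (ler_normD _ _) (lerD (before_le s Tt) (after_le t s)). Qed.

Lemma conv_after_bounded : exists B, forall t, T <= t -> `|conv k m t| <= B.
Proof.
exists (\int[mu]_s bnd s) => t Tt; rewrite conv_split //.
have iS : mu.-integrable setT (EFin \o (fun s => before t s + after t s)).
  by apply: RintegrableD => //; exact: ibefore.
apply: le_trans (le_normr_Rintegral measurableT iS) _.
by apply: le_Rintegral => //; [exact: integrable_norm | move=> s _; exact: sum_le].
Qed.

Lemma conv_after_right_continuous : conv k m t @[t --> T^'+] --> conv k m T.
Proof.
apply/cvg_at_rightP => u [uT cu]; rewrite (conv_split (lexx T)).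
have -> : (fun n => conv k m (u n)) = (fun n => \int[mu]_s (before (u n) s + after (u n) s)).
  by apply/funext => n; rewrite conv_split // ltW.
apply: (dominated_Rintegral _ _ _ ibnd).
- by move=> n; exact: measurable_funD.
- exact: measurable_funD.
- move=> s; apply: cvgD.
    rewrite /before; case: ltP => sT; last exact: cvg_cst.
    apply: cvgMl; apply: (@cvg_comp _ _ _ (fun n => u n - s) k _ (nbhs (T - s))).
      by apply: cvgB => //; exact: cvg_cst.
    by apply: kcont; rewrite subr_gt0.
  rewrite /after subrr; apply: cvgMr; have [s0|s0] := leP s 0.
    under eq_fun do rewrite k0 // if_same.
    by rewrite k0 //; exact: cvg_cst.
  apply/cvgrPdist_le => e e0; have /cvgrPdist_lt /(_ s s0) := cu; apply: filterS => n /=.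
  rewrite distrC => /(le_lt_trans (ler_norm _)) hn.
  by rewrite ifF ?subrr ?normr0 ?(ltW e0) //; apply/negbTE; rewrite -ltNge.
- by move=> n s; apply: sum_le; exact: ltW.
Qed.

End ConvolutionAfter.

(** * The semidiscrete solution *)

Section ComplexIntegrals.
Variable R : realType.
Local Notation mu := (@lebesgue_measure R).

Lemma cexpD (z w : R[i]) : cexp (z + w) = cexp z * cexp w.
Proof.
rewrite /cexp ReD ImD expRD rmorphM -polarM.
exact: mulrACA.
Qed.

Lemma cexp_real (x : R) : cexp x%:C = (expR x)%:C.
Proof. by rewrite /cexp /= cos0 sin0 mulr1. Qed.

Lemma normc_cexp (z : R[i]) : normc (cexp z) = expR (complex.Re z).
Proof. by rewrite /cexp normcM normc_polar mulr1 normc_real ger0_norm ?expR_ge0. Qed.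

Lemma ae_eq_Rintegral (D : set R) (f h : R -> R) : measurable D ->
  mu.-integrable D (EFin \o f) -> measurable_fun D h ->
  {ae mu, forall x, D x -> f x = h x} ->
  mu.-integrable D (EFin \o h) /\ \int[mu]_(x in D) h x = \int[mu]_(x in D) f x.
Proof.
move=> mD /integrableP[mf fi] mh fh.
have mh' : measurable_fun D (EFin \o h) by apply/measurable_EFinP.
split.
  apply/integrableP; split=> //; apply: le_lt_trans fi; rewrite le_eqVlt; apply/orP; left; apply/eqP.
  apply: ae_eq_integral => //; [exact: measurableT_comp | exact: measurableT_comp |].
  apply: filterS fh; first exact: (ae_filter_ringOfSetsType mu).
  by move=> x /= h1 Dx; rewrite h1.
rewrite /Rintegral; congr fine; apply/esym; apply: ae_eq_integral => //.
apply: filterS fh; first exact: (ae_filter_ringOfSetsType mu).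
by move=> x /= h1 Dx; rewrite h1.
Qed.

Lemma cintZ (D : set R) (z : R[i]) (w : R -> R[i]) : measurable D -> cintegrable D w ->
  cintegrable D (fun s => z * w s) /\ cint D (fun s => z * w s) = z * cint D w.
Proof.
move=> mD [w1 w2].
have i1 x : mu.-integrable D (EFin \o (fun s => x * complex.Re (w s))) by exact: RintegrableZl.
have i2 x : mu.-integrable D (EFin \o (fun s => x * complex.Im (w s))) by exact: RintegrableZl.
have i3 x : mu.-integrable D (EFin \o (fun s => - (x * complex.Im (w s)))).
  by under [X in _.-integrable _ (_ \o X)]eq_fun do rewrite -mulNr; exact: i2.
split.
  split; under [X in _.-integrable _ (_ \o X)]eq_fun do rewrite ?ReM ?ImM; exact: RintegrableD.
apply: complex_eqP; rewrite ?ReM ?ImM /=.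
  under eq_Rintegral do rewrite ReM; rewrite RintegralB // !RintegralZl //.
under eq_Rintegral do rewrite ImM; rewrite RintegralD // !RintegralZl //.
Qed.

Lemma cconv_cint (k m : R -> R[i]) t : convolvable k m ->
  cconv k m t = cint setT (fun s => k (t - s) * m s).
Proof.
move=> /(_ t)[i1 i2 i3 i4]; apply: complex_eqP => /=.
  by rewrite -RintegralB //; apply: eq_Rintegral => s _; rewrite ReM.
by rewrite -RintegralD //; apply: eq_Rintegral => s _; rewrite ImM.
Qed.

End ComplexIntegrals.

(** * Continuation of the solution beyond the final time *)

Section Extension.
Variables (R : realType) (T : R) (I : finType) (g : I -> R -> R[i]).
Local Notation mu := (@lebesgue_measure R).
Hypothesis ig : forall i, cintegrable `[0, T] (g i).

(** Extending the derivative by zero freezes the primitive at its value at T. *)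
Definition extend (i : I) (s : R) : R[i] := if 0 < s < T then g i s else 0.

Lemma Re_extend i : (fun s => complex.Re (extend i s)) = (fun s => complex.Re (g i s)) \_ `]0, T[.
Proof. by apply/funext => s; rewrite /extend patchE mem_setE /= in_itv /=; case: ifP. Qed.

Lemma Im_extend i : (fun s => complex.Im (extend i s)) = (fun s => complex.Im (g i s)) \_ `]0, T[.
Proof. by apply/funext => s; rewrite /extend patchE mem_setE /= in_itv /=; case: ifP. Qed.

Lemma extend_integrable i : cintegrable setT (extend i).
Proof.
have [i1 i2] := ig i.
by split; rewrite ?Re_extend ?Im_extend; exact: Rintegrable_patch.
Qed.

Lemma extend_le0 i s : s <= 0 -> extend i s = 0.
Proof. by move=> s0; rewrite /extend ltNge s0. Qed.

Lemma primitive_extend i t : 0 <= t <= T -> primitive extend i t = cint `[0, t] (g i).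
Proof.
move=> tT; have [i1 i2] := ig i.
by rewrite /primitive Re_extend Im_extend !conv_heaviside_patch.
Qed.

Lemma primitive_after i t : T <= t -> primitive extend i t = primitive extend i T.
Proof.
by move=> tT; rewrite /primitive Re_extend Im_extend !(conv_heaviside_after _ tT).
Qed.

Lemma primitive_le0 i t : t <= 0 -> primitive extend i t = 0.
Proof.
move=> t0; rewrite /primitive; apply: complex_eqP; rewrite /= /conv /Rintegral integral0_eq // => s _.
  have [s0|s0] := leP s 0; first by rewrite extend_le0 ?mulr0.
  by rewrite /heaviside ltNge (_ : t - s <= 0) ?mul0r //; lra.
have [s0|s0] := leP s 0; first by rewrite extend_le0 ?mulr0.
by rewrite /heaviside ltNge (_ : t - s <= 0) ?mul0r //; lra.
Qed.

End Extension.

(** * The time operator as a convolution *)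

Section SemidiscreteSource.
Variables (R : realType) (I : finType) (al la T : R) (a : I -> R[i]).
Variables (g v : I -> R -> R[i]).
Local Notation mu := (@lebesgue_measure R).
Hypotheses (Hal : 0 < al < 1) (T0 : 0 < T).
Let c i := la%:C - a i.
Hypothesis c0 : forall i, 0 < complex.Re (c i).
Hypothesis ig : forall i, cintegrable `[0, T] (g i).
Hypothesis hv : forall i t, 0 <= t <= T -> v i t = cint `[0, t] (g i).
Hypothesis hcap : forall i t, 0 < t <= T ->
  cintegrable `[0, t] (caputo_integrand al (untemper la (a i) (v i)) t).

Local Notation gE := (extend T g).
Local Notation d := (driver c gE).

Lemma untemperE i : untemper la (a i) (v i) = fun s => cexp (c i * s%:C) * v i s.
Proof.
apply/funext => s.
by rewrite /untemper -cexp_real -cexpD /c mulrBl -rmorphM.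
Qed.

Lemma cexp_mul_is_derive (z : R[i]) (w : R -> R[i]) (w' : R[i]) (s : R) :
  is_derive s (1 : R) (fun t => complex.Re (w t)) (complex.Re w') ->
  is_derive s (1 : R) (fun t => complex.Im (w t)) (complex.Im w') ->
  cderiv (fun t => cexp (z * t%:C) * w t) s = cexp (z * s%:C) * (w' + z * w s).
Proof.
move=> d1 d2; set p := complex.Re z; set q := complex.Im z.
have zt (t : R) : z * t%:C = (p * t) +i* (q * t).
  by apply: complex_eqP; rewrite ?ReM ?ImM /= !mulr0 ?subr0 ?add0r.
have e1 : (fun t : R => complex.Re (cexp (z * t%:C) * w t)) =
    fun t : R => expR (p * t) * (cos (q * t) * complex.Re (w t) - sin (q * t) * complex.Im (w t)).
  by apply/funext => t; rewrite zt /cexp -mulrA ReZ ReM.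
have e2 : (fun t : R => complex.Im (cexp (z * t%:C) * w t)) =
    fun t : R => expR (p * t) * (cos (q * t) * complex.Im (w t) + sin (q * t) * complex.Re (w t)).
  by apply/funext => t; rewrite zt /cexp -mulrA ImZ ImM.
have f1 : is_derive s (1 : R) (fun t : R => expR (p * t)) (p * expR (p * s)).
  by apply: is_derive_eq; rewrite /GRing.scale /=; ring.
have f2 : is_derive s (1 : R) (fun t : R => cos (q * t)) (- q * sin (q * s)).
  by apply: is_derive_eq; rewrite /GRing.scale /=; ring.
have f3 : is_derive s (1 : R) (fun t : R => sin (q * t)) (q * cos (q * s)).
  by apply: is_derive_eq; rewrite /GRing.scale /=; ring.
have g1 : is_derive s (1 : R) (fun t : R => expR (p * t) * (cos (q * t) * complex.Re (w t) - sin (q * t) * complex.Im (w t)))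
    (expR (p * s) * ((cos (q * s) * complex.Re w' + complex.Re (w s) * (- q * sin (q * s)))
     - (sin (q * s) * complex.Im w' + complex.Im (w s) * (q * cos (q * s))))
     + (cos (q * s) * complex.Re (w s) - sin (q * s) * complex.Im (w s)) * (p * expR (p * s))).
  by apply: is_derive_eq; rewrite /GRing.scale /=; ring.
have g2 : is_derive s (1 : R) (fun t : R => expR (p * t) * (cos (q * t) * complex.Im (w t) + sin (q * t) * complex.Re (w t)))
    (expR (p * s) * ((cos (q * s) * complex.Im w' + complex.Im (w s) * (- q * sin (q * s)))
     + (sin (q * s) * complex.Re w' + complex.Re (w s) * (q * cos (q * s))))
     + (cos (q * s) * complex.Im (w s) + sin (q * s) * complex.Re (w s)) * (p * expR (p * s))).
  by apply: is_derive_eq; rewrite /GRing.scale /=; ring.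
have [_ h1] := g1; have [_ h2] := g2.
rewrite /cderiv e1 e2 !derive1E h1 h2 zt /cexp; apply: complex_eqP => /=.
  by rewrite -mulrA ReZ ReM ReD ImD ReM ImM /= -/p -/q; ring.
by rewrite -mulrA ImZ ImM ReD ImD ReM ImM /= -/p -/q; ring.
Qed.

Lemma driver_inside i s : 0 < s < T -> d i s = g i s + c i * v i s.
Proof.
move=> /[dup] sT /andP[s0 s1].
by rewrite /driver primitive_extend ?hv ?(ltW s0) ?(ltW s1) // /extend sT.
Qed.

Lemma ae_cderiv_untemper i : {ae mu, forall s, 0 < s < T ->
  cderiv (untemper la (a i) (v i)) s = cexp (c i * s%:C) * d i s}.
Proof.
have [i1 i2] := ig i.
have v0 : v i 0 = 0.
  rewrite hv ?lexx ?(ltW T0) // /cint set_itv1 !Rintegral_set1; exact: complex_eqP.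
have h1 := @ae_is_derive R T _ (fun t => complex.Re (v i t)) i1.
have h2 := @ae_is_derive R T _ (fun t => complex.Im (v i t)) i2.
have e1 t : 0 <= t <= T -> complex.Re (v i t) = complex.Re (v i 0) + \int[mu]_(s in `[0, t]) complex.Re (g i s).
  by move=> tT; rewrite v0 add0r hv.
have e2 t : 0 <= t <= T -> complex.Im (v i t) = complex.Im (v i 0) + \int[mu]_(s in `[0, t]) complex.Im (g i s).
  by move=> tT; rewrite v0 add0r hv.
apply: filterS2 (h1 e1) (h2 e2); first exact: (ae_filter_ringOfSetsType mu).
move=> s d1 d2 sT; rewrite driver_inside // untemperE.
exact: cexp_mul_is_derive (d1 sT) (d2 sT).
Qed.

Lemma measurable_driver i :
  measurable_fun setT (fun s => complex.Re (d i s)) /\ measurable_fun setT (fun s => complex.Im (d i s)).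
Proof.
have a1 := caverageable_g ltr01 (fun i u => @extend_le0 R T I g i u) (extend_integrable ig) i.
have a2 := caverageable_primitive ltr01 (fun i u => @extend_le0 R T I g i u) (extend_integrable ig) i.
by have [[m1 _ _] [m2 _ _]] := caverageableD a1 (caverageableZ (c i) a2).
Qed.

Let W i t s : R[i] := ((t - s) `^ (- al))%:C * (cexp (c i * s%:C) * d i s).

(** The pointwise derivative is known only almost everywhere; [W] replaces it by the driver, which
    is measurable on the whole line. *)
Lemma caputo_integral i t : 0 < t <= T -> cintegrable `[0, t] (W i t) /\
  cint `[0, t] (W i t) = cint `[0, t] (caputo_integrand al (untemper la (a i) (v i)) t).
Proof.
move=> /[dup] tT /andP[t0 tT']; have [c1 c2] := hcap i tT.
have [m1 m2] := measurable_driver i.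
have mp : measurable_fun setT (fun s : R => (t - s) `^ (- al)).
  by apply: (measurableT_comp (measurable_powR _)); exact: measurable_funB.
have zs (s : R) : c i * s%:C = (complex.Re (c i) * s) +i* (complex.Im (c i) * s).
  by apply: complex_eqP; rewrite ?ReM ?ImM /= !mulr0 ?subr0 ?add0r.
have me : measurable_fun setT (fun s : R => expR (complex.Re (c i) * s)).
  by apply: (measurableT_comp (@measurable_expR R)); exact: measurable_funM.
have mc : measurable_fun setT (fun s : R => cos (complex.Im (c i) * s)).
  apply: (measurableT_comp (f := @cos R)); last exact: measurable_funM.
  by apply: continuous_measurable_fun; exact: continuous_cos.
have ms : measurable_fun setT (fun s : R => sin (complex.Im (c i) * s)).
  apply: (measurableT_comp (f := @sin R)); last exact: measurable_funM.
  by apply: continuous_measurable_fun; exact: continuous_sin.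
have mW1 : measurable_fun setT (fun s => complex.Re (W i t s)).
  under eq_fun do rewrite ReZ zs /cexp -mulrA ReZ ReM /=.
  apply: measurable_funM => //; apply: measurable_funM => //.
  by apply: measurable_funB; apply: measurable_funM.
have mW2 : measurable_fun setT (fun s => complex.Im (W i t s)).
  under eq_fun do rewrite ImZ zs /cexp -mulrA ImZ ImM /=.
  apply: measurable_funM => //; apply: measurable_funM => //.
  by apply: measurable_funD; apply: measurable_funM.
(* The derivative is identified inside the open interval only, so the endpoints are discarded as a
   null set. *)
have ends : {ae mu, forall s, s != 0 /\ s != t}.
  exists ([set 0] `|` [set t]); split.
  - by apply: measurableU; exact: measurable_set1.
  - by apply: null_set_setU => //; exact: lebesgue_measure_set1.
  - by move=> s /= h; apply: contrapT => h2; apply: h; split; apply/eqP => e; apply: h2; [left|right].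
have ae : {ae mu, forall s, `[0, t]%classic s ->
    caputo_integrand al (untemper la (a i) (v i)) t s = W i t s}.
  apply: filterS2 ends (ae_cderiv_untemper i); first exact: (ae_filter_ringOfSetsType mu).
  move=> s [s0 s1] h /=; rewrite in_itv /= => /andP[h0 h1].
  have s0' : 0 < s by rewrite lt_neqAle eq_sym s0 h0.
  have s1' : s < t by rewrite lt_neqAle s1 h1.
  by rewrite /caputo_integrand h // s0' (lt_le_trans s1').
have ae1 : {ae mu, forall s, `[0, t]%classic s ->
    complex.Re (caputo_integrand al (untemper la (a i) (v i)) t s) = complex.Re (W i t s)}.
  by apply: filterS ae; [exact: (ae_filter_ringOfSetsType mu) | move=> s h Ds; rewrite h].
have ae2 : {ae mu, forall s, `[0, t]%classic s ->
    complex.Im (caputo_integrand al (untemper la (a i) (v i)) t s) = complex.Im (W i t s)}.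
  by apply: filterS ae; [exact: (ae_filter_ringOfSetsType mu) | move=> s h Ds; rewrite h].
have [w1 e1] := ae_eq_Rintegral (measurable_itv _) c1 (measurable_funTS mW1) ae1.
have [w2 e2] := ae_eq_Rintegral (measurable_itv _) c2 (measurable_funTS mW2) ae2.
by split; [split | apply: complex_eqP].
Qed.

Lemma driver_le0 i s : s <= 0 -> d i s = 0.
Proof. by move=> s0; rewrite /driver extend_le0 // primitive_le0 // mulr0 addr0. Qed.

Lemma driver_after i s : T <= s -> d i s = c i * primitive gE i T.
Proof. by move=> Ts; rewrite /driver primitive_after // /extend ltNge [s < T]ltNge Ts andbF add0r. Qed.

(** For s >= 0 the factor exp (c s) has modulus at least 1, so the integrability of the Caputo
    integrand passes to the driver without it. *)
Lemma singular_driver_integrable i t : 0 < t <= T ->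
  mu.-integrable setT (EFin \o (fun s => if s < t then (t - s) `^ (- al) * normc (d i s) else 0)).
Proof.
move=> /[dup] tT /andP[t0 _]; have [[w1 w2] _] := caputo_integral i tT.
have [m1 m2] := measurable_driver i.
have mp : measurable_fun setT (fun s : R => (t - s) `^ (- al) * normc (d i s)).
  apply: measurable_funM.
    by apply: (measurableT_comp (measurable_powR _)); exact: measurable_funB.
  rewrite (_ : (fun s => normc _) = fun s => Num.sqrt (complex.Re (d i s) ^+ 2 + complex.Im (d i s) ^+ 2)).
    apply: (measurableT_comp (f := @Num.sqrt R)).
      by apply: continuous_measurable_fun; exact: sqrt_continuous.
    by apply: measurable_funD; exact: measurable_funX.
  by apply/funext => s; rewrite -normc_sqr sqrtr_sqr ger0_norm ?normc_ge0.
have iw : mu.-integrable `[0, t] (EFin \o (fun s => (t - s) `^ (- al) * normc (d i s))).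
  have := RintegrableD (measurable_itv `[0, t]) (integrable_norm w1) (integrable_norm w2).
  apply: le_integrable => //; first by apply/measurable_EFinP; exact: measurable_funTS mp.
  move=> s /=; rewrite in_itv /= => /andP[s0 st].
  rewrite lee_fin ger0_norm ?mulr_ge0 ?powR_ge0 ?normc_ge0 //.
  apply: le_trans (ler_norm _); apply: le_trans (normc_le_ReIm _).
  rewrite normcM normc_real ger0_norm ?powR_ge0 // normcM normc_cexp.
  apply: ler_wpM2l; first exact: powR_ge0.
  rewrite -[leLHS]mul1r; apply: ler_wpM2r; first exact: normc_ge0.
  rewrite -expR0 ler_expR ReM /= mulr0 subr0 mulr_ge0 // ltW //; exact: c0.
apply: eq_integrable (Rintegrable_patch iw) => // s _ /=.
rewrite patchE mem_setE /= in_itv /=.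
have [s0|s0] := leP s 0; first by rewrite driver_le0 // normc0 mulr0 if_same.
by case: ifP.
Qed.

Lemma frac_kernelE i u : 0 < u ->
  frac_kernel al (c i) u = ((Gamma_pos (1 - al))^-1 * u `^ (- al))%:C * cexp (- (c i * u%:C)).
Proof.
move=> u0; rewrite /frac_kernel /frac_part u0 /gamma_kernel (_ : 1 - al - 1 = - al); last by ring.
apply: complex_eqP; rewrite ?ReZ ?ImZ /cexp ?ReZ ?ImZ /= ?ReN ?ImN ?ReM ?ImM /= !mulr0 ?subr0 ?add0r.
  by rewrite addr0 cosN; ring.
by rewrite cosDpihalf sinN; ring.
Qed.

Lemma frac_part_le i th u : 0 < u -> `|frac_part al (c i) th u| <= (Gamma_pos (1 - al))^-1 * u `^ (- al).
Proof.
move=> u0; have G0 : 0 <= (Gamma_pos (1 - al))^-1.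
  by rewrite invr_ge0 ltW // Gamma_pos_gt0 // subr_gt0; case/andP: Hal.
rewrite /frac_part u0 normrM ger0_norm //; apply: ler_wpM2l => //.
apply: le_trans (gamma_kernel_norm _ _ _ _ _) _; rewrite (_ : 1 - al - 1 = - al); last by ring.
rewrite -[leRHS]mulr1; apply: ler_wpM2l; rewrite ?powR_ge0 // -expR0 ler_expR oppr_le0.
by rewrite mulr_ge0 ?(ltW u0) // ltW //; exact: c0.
Qed.

Lemma frac_part_integrable i th : mu.-integrable setT (EFin \o frac_part al (c i) th).
Proof.
apply: Rintegrable_half; first by move=> t t0; rewrite /frac_part ltNge t0.
have x0 : 0 < 1 - al by rewrite subr_gt0; case/andP: Hal.
have := RintegrableZl (measurable_itv _) (Gamma_pos (1 - al))^-1
  (gamma_kernel_integrable (complex.Im (c i)) th x0 (c0 i)).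
apply: eq_integrable => // u; rewrite inE /= in_itv /= andbT => u0.
by rewrite /frac_part u0.
Qed.

Lemma frac_part_continuous i th u : 0 < u -> {for u, continuous (frac_part al (c i) th)}.
Proof.
move=> u0; have h : {for u, continuous (fun x : R => (Gamma_pos (1 - al))^-1 *
    gamma_kernel (1 - al) (complex.Re (c i)) (complex.Im (c i)) th x)}.
  by apply: cvgMr; exact: gamma_kernel_continuous.
rewrite /prop_for /continuous_at /frac_part u0.
apply: cvg_trans h; apply: near_eq_cvg; near=> x.
by rewrite (_ : 0 < x = true) //; near: x; exact: lt_nbhsr.
Unshelve. all: by end_near. Qed.

Section Part.
Variables (th : R) (i : I) (m : R -> R) (M : R).
Hypothesis mm : measurable_fun setT m.
Hypothesis md : forall s, `|m s| <= normc (d i s).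
Hypothesis mT : forall s, T <= s -> m s = M.
Local Notation k := (frac_part al (c i) th).

Lemma part_before_integrable t : 0 < t <= T ->
  mu.-integrable setT (EFin \o (fun s => if s < t then (t - s) `^ (- al) * `|m s| else 0)).
Proof.
move=> tT; apply: le_integrable (singular_driver_integrable i tT) => //.
  apply/measurable_EFinP; apply: measurable_fun_ifT => //; first exact: measurable_fun_ltr.
  apply: measurable_funM; last exact: measurableT_comp.
  by apply: (measurableT_comp (measurable_powR _)); exact: measurable_funB.
move=> s _ /=; rewrite lee_fin; case: ifP => _ //.
rewrite normrM normr_id normrM; apply: ler_wpM2l => //.
by apply: le_trans (md s) (ler_norm _).
Qed.

Let G0 : 0 <= (Gamma_pos (1 - al))^-1.
Proof. by rewrite invr_ge0 ltW // Gamma_pos_gt0 // subr_gt0; case/andP: Hal. Qed.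
Let k0 u : u <= 0 -> k u = 0. Proof. by move=> u0; rewrite /frac_part ltNge u0. Qed.
Let al0 : 0 < al. Proof. by case/andP: Hal. Qed.
Let TT : 0 < T <= T. Proof. by rewrite T0 lexx. Qed.

(** For t <= 0 the integrand vanishes, up to T the Caputo integrability dominates it, and beyond T
    the driver is constant after T. *)
Lemma part_integrable t : mu.-integrable setT (EFin \o (fun s => k (t - s) * m s)).
Proof.
have [t0|t0] := leP t 0.
  rewrite (_ : (fun s : R => k (t - s) * m s) = fun=> 0); first exact: integrable0.
  apply/funext => s.
  have [s0|s0] := leP s 0; last by rewrite k0 ?mul0r //; lra.
  by have := md s; rewrite driver_le0 // normc0 normr_le0 => /eqP ->; rewrite mulr0.
have [tT|Tt] := leP t T; last first.
  exact: (conv_after_integrable al0 G0 (@frac_part_le i th) (frac_part_integrable i th) mm mT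
    (part_before_integrable TT) (ltW Tt)).
have mk : measurable_fun setT k by have /integrableP[/measurable_EFinP] := frac_part_integrable i th.
have tT2 : 0 < t <= T by rewrite t0.
apply: le_integrable (RintegrableZl measurableT (Gamma_pos (1 - al))^-1 (part_before_integrable tT2)) => //.
  apply/measurable_EFinP; apply: measurable_funM => //.
  by apply: (measurableT_comp mk); exact: measurable_funB.
move=> s _ /=; rewrite lee_fin; apply: le_trans (ler_norm _); case: ltP => st; last first.
  by rewrite k0 ?mul0r ?normr0 ?mulr0 // subr_le0.
rewrite normrM mulrA; apply: ler_wpM2r => //.
by apply: frac_part_le; rewrite subr_gt0.
Qed.

Lemma part_bounded : exists B, forall t, T <= t -> `|conv k m t| <= B.
Proof.
exact: (conv_after_bounded al0 G0 (@frac_part_le i th) (frac_part_integrable i th) mm mT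
    (part_before_integrable TT)).
Qed.

Lemma part_right_continuous : conv k m t @[t --> T^'+] --> conv k m T.
Proof.
exact: (conv_after_right_continuous al0 G0 k0 (@frac_part_continuous i th) (@frac_part_le i th)
    (frac_part_integrable i th) mm mT (part_before_integrable TT)).
Qed.

End Part.

Lemma driver_convolvable i : convolvable (frac_kernel al (c i)) (d i).
Proof.
have [m1 m2] := measurable_driver i.
have r s : `|complex.Re (d i s)| <= normc (d i s) by exact: ler_Re_normc.
have q s : `|complex.Im (d i s)| <= normc (d i s) by exact: ler_Im_normc.
have rT s : T <= s -> complex.Re (d i s) = complex.Re (c i * primitive gE i T).
  by move=> /driver_after ->.
have qT s : T <= s -> complex.Im (d i s) = complex.Im (c i * primitive gE i T).
  by move=> /driver_after ->.
by move=> t; split; apply: part_integrable; eauto.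
Qed.

(** The factor exp (- c (t - s)) = exp (- c t) exp (c s) splits into the outer multiplier of [Lt]
    and the exponential inside the Caputo derivative. *)
Lemma cconv_driver i t : 0 < t <= T ->
  cconv (frac_kernel al (c i)) (d i) t = Lt al la (a i) (v i) t + (la `^ al)%:C * v i t.
Proof.
move=> /[dup] tT /andP[t0 tT'].
have x0 : 0 < 1 - al by rewrite subr_gt0; case/andP: Hal.
rewrite /Lt addrNK /caputo /Gamma x0; have [iW <-] := caputo_integral i tT.
rewrite cconv_cint; last exact: driver_convolvable.
set z := (Gamma_pos (1 - al))^-1%:C * cexp (- (c i * t%:C)).
have [izW <-] : cintegrable `[0, t] (fun s => z * W i t s) /\ cint `[0, t] (fun s => z * W i t s) =
    cexp (a i * t%:C) * (expR (- (la * t)))%:C * ((Gamma_pos (1 - al))^-1%:C * cint `[0, t] (W i t)).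
  have [h1 ->] := cintZ z (measurable_itv _) iW; split=> //.
  rewrite -cexp_real -cexpD /z [in LHS](mulrC (_^-1)%:C) -(mulrA (cexp _)); congr (cexp _ * _).
  by rewrite /c mulrBl opprB -rmorphM rmorphN.
have E s : frac_kernel al (c i) (t - s) * d i s = if 0 < s < t then z * W i t s else 0.
  have [s0|s0] := leP s 0; first by rewrite driver_le0 // mulr0.
  have [st|ts] := ltP s t; last first.
    rewrite (_ : frac_kernel _ _ _ = 0) ?mul0r // /frac_kernel /frac_part ltNge subr_le0 ts /=.
    exact: complex_eqP.
  rewrite frac_kernelE ?subr_gt0 // /W /z rmorphM /=.
  have -> : cexp (- (c i * (t - s)%:C)) = cexp (- (c i * t%:C)) * cexp (c i * s%:C).
    by rewrite -cexpD rmorphB mulrBr opprB addrC.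
  by move: (_ `^ _)%:C (cexp _) (cexp _) (d i s) (_^-1)%:C => *; ring.
have [j1 j2] := izW.
apply: complex_eqP => /=.
  rewrite -Rintegral_oo_cc // [RHS]Rintegral_mkcond; apply: eq_Rintegral => s _.
  by rewrite E patchE mem_setE /= in_itv /=; case: ifP.
rewrite -Rintegral_oo_cc // [RHS]Rintegral_mkcond; apply: eq_Rintegral => s _.
by rewrite E patchE mem_setE /= in_itv /=; case: ifP.
Qed.

End SemidiscreteSource.

(** * Convergence as the time step tends to zero *)

Section AverageEstimates.
Variable R : realType.
Local Notation mu := (@lebesgue_measure R).

(** Up to T the modulus of [Phi] applies; just after T right continuity adds e / 2; farther away
    boundedness suffices, since a constant is at most a multiple of (s - t)^2 there. *)
Lemma glue_modulus (T : R) (phi Phi : R -> R) : 0 < T ->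
  (forall e, 0 < e -> exists2 K, 0 <= K & forall s t, 0 <= s <= T -> 0 <= t <= T ->
    `|Phi s - Phi t| <= e + K * (s - t) ^+ 2) ->
  (forall t, 0 < t <= T -> phi t = Phi t) ->
  (exists B, forall t, T <= t -> `|phi t| <= B) ->
  phi t @[t --> T^'+] --> phi T ->
  forall e, 0 < e -> exists2 K, 0 <= K & forall s t, 0 < s -> 0 <= t <= T ->
    `|phi s - Phi t| <= e + K * (s - t) ^+ 2.
Proof.
move=> T0 hPhi hphi [B hB] cphi e e0; have e20 : 0 < e / 2 by rewrite divr_gt0.
have [K1 K10 h1] := hPhi _ e20.
have /cvgrPdist_le /(_ _ e20) [r /= r0 hr] := cphi.
have TT : 0 < T <= T by rewrite T0 lexx.
have TT' : 0 <= T <= T by rewrite lexx ltW.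
have phiT := hphi T TT.
have B0 : 0 <= B by exact: le_trans (normr_ge0 _) (hB T (lexx T)).
have sq0 (x : R) : 0 <= x ^+ 2 by rewrite sqr_ge0.
have Phi_le t : 0 <= t <= T -> `|Phi t| <= B + e + K1 * T ^+ 2.
  move=> tT; have := h1 t T tT TT'; have := hB T (lexx T); rewrite phiT => hT.
  have : K1 * (t - T) ^+ 2 <= K1 * T ^+ 2.
    apply: ler_wpM2l => //; rewrite -sqrrN opprB; case/andP: tT => t0 tT.
    by rewrite ler_pXn2r ?nnegrE ?subr_ge0 ?(ltW T0) // gerBl.
  have := ler_normD (Phi t - Phi T) (Phi T); rewrite subrK; lra.
set B2 := B + (B + e + K1 * T ^+ 2) in Phi_le *.
have B20 : 0 <= B2.
  by have := mulr_ge0 K10 (sq0 T); rewrite /B2; lra.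
(* [B2] bounds |phi s - Phi t| for all s past T, and s - t >= r once s - T >= r. *)
exists (K1 + B2 / r ^+ 2); first by rewrite addr_ge0 // divr_ge0.
move=> s t s0 tT; have := sq0 (s - t) => st0.
have c0 : 0 <= B2 / r ^+ 2 * (s - t) ^+ 2 by rewrite mulr_ge0 // divr_ge0.
have k0 : 0 <= K1 * (s - t) ^+ 2 by rewrite mulr_ge0.
rewrite mulrDl; have [sT|Ts] := leP s T.
  by have := h1 s t; rewrite hphi ?s0 ?sT ?(ltW s0) // => /(_ isT tT); lra.
case/andP: (tT) => t0 t1; have [sr|rs] := ltP (s - T) r.
  have := hr s; rewrite /= distrC ger0_norm ?subr_ge0 ?(ltW Ts) // => /(_ sr Ts) h2.
  have h3 := h1 T t TT' tT.
  have : K1 * (T - t) ^+ 2 <= K1 * (s - t) ^+ 2.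
    by apply: ler_wpM2l => //; rewrite ler_pXn2r ?nnegrE //; lra.
  have := ler_normD (phi s - phi T) (Phi T - Phi t).
  rewrite phiT addrA subrK in h2 *; rewrite distrC in h2; lra.
have : B2 <= B2 / r ^+ 2 * (s - t) ^+ 2.
  rewrite mulrAC ler_pdivlMr ?exprn_gt0 //; apply: ler_wpM2l => //.
  by rewrite ler_pXn2r ?nnegrE //; lra.
have := ler_normB (phi s) (Phi t); have := hB s (ltW Ts); have := Phi_le t tT.
by rewrite /B2; lra.
Qed.

(** Chebyshev's argument: the quadratic modulus integrates to the second moment of the density about
    n tau. *)
Lemma avg_estimate (tau : R) (phi : R -> R) (n : nat) (y e K : R) : 0 < tau -> 0 <= e -> 0 <= K ->
  averageable tau phi -> (forall s, 0 < s -> `|phi s - y| <= e + K * (s - n%:R * tau) ^+ 2) ->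
  `|avg tau phi n - y| <= e + K * (tau ^+ 2 * n.+2%:R).
Proof.
move=> tau0 e0 K0 [p1 p2 p3] h.
have [im em] := gden_moment tau0 n; have ig := gden_integrable tau0 n.
have iy : mu.-integrable setT (EFin \o (fun s => y * gden tau n s)) by exact: RintegrableZl.
have -> : avg tau phi n - y = \int[mu]_s (phi s * gden tau n s - y * gden tau n s).
  by rewrite RintegralB // RintegralZl // gden_integral // mulr1.
have iB : mu.-integrable setT (EFin \o (fun s => e * gden tau n s + K * ((s - n%:R * tau) ^+ 2 * gden tau n s))).
  by apply: RintegrableD => //; exact: RintegrableZl.
have -> : e + K * (tau ^+ 2 * n.+2%:R) =
    \int[mu]_s (e * gden tau n s + K * ((s - n%:R * tau) ^+ 2 * gden tau n s)).
  rewrite RintegralD //; [|exact: RintegrableZl..].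
  by rewrite !RintegralZl // gden_integral // em mulr1.
have iD : mu.-integrable setT (EFin \o (fun s => phi s * gden tau n s - y * gden tau n s)).
  have := RintegrableD measurableT (p3 n) (RintegrableZl measurableT (- y) ig).
  by under [X in _.-integrable _ (_ \o X) -> _]eq_fun do rewrite mulNr.
apply: le_trans (le_normr_Rintegral measurableT iD) _.
apply: le_Rintegral => //; first exact: integrable_norm.
move=> s _; rewrite -mulrBl normrM (ger0_norm (gden_ge0 tau0 _ _)) mulrA -mulrDl.
have [s0|s0] := ltP 0 s; first by apply: ler_wpM2r; [exact: gden_ge0 | exact: h].
by rewrite /gden ltNge s0 !mulr0.
Qed.

End AverageEstimates.

(** * Convergence of the discrete solutions for a fixed grid *)

Section SemidiscreteLimit.
Variables (R : realType) (I : finType) (al la T : R) (a : I -> R[i]) (A : I -> I -> R[i]).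
Variables (g v gf F : I -> R -> R[i]).
Local Notation mu := (@lebesgue_measure R).
Hypotheses (Hal : 0 < al < 1) (la0 : 0 < la) (T0 : 0 < T).
Let c i := la%:C - a i.
Hypothesis c0 : forall i, 0 < complex.Re (c i).
Hypothesis ig : forall i, cintegrable `[0, T] (g i).
Hypothesis hv : forall i t, 0 <= t <= T -> v i t = cint `[0, t] (g i).
Hypothesis igf : forall i, cintegrable `[0, T] (gf i).
Hypothesis hF : forall i t, 0 <= t <= T -> F i t = cint `[0, t] (gf i).
Hypothesis hcap : forall i t, 0 < t <= T ->
  cintegrable `[0, t] (caputo_integrand al (untemper la (a i) (v i)) t).
Hypothesis heq : forall i t, 0 < t <= T ->
  Lt al la (a i) (v i) t = \sum_j A i j * v j t + F i t.

Local Notation gE := (extend T g).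
Local Notation d := (driver c gE).
Local Notation res := (residual_source al la c A gE).

Lemma residual_inside i t : 0 < t <= T -> res i t = F i t.
Proof.
move=> /[dup] tT /andP[t0 tT']; have tT2 : 0 <= t <= T by rewrite ltW.
have pv j : primitive gE j t = v j t by rewrite primitive_extend // hv.
rewrite /residual_source (cconv_driver Hal T0 c0 ig hv hcap i tT) heq // pv.
by under [X in _ - X]eq_bigr do rewrite pv; ring.
Qed.

Lemma primitive_modulus_Re (w : I -> R -> R[i]) i e : cintegrable `[0, T] (w i) -> 0 < e ->
  exists2 K, 0 <= K & forall s t,
  `|complex.Re (primitive (extend T w) i s) - complex.Re (primitive (extend T w) i t)| <= e + K * (s - t) ^+ 2.
Proof.
move=> [w1 _]; apply: primitive_modulus.
by rewrite Re_extend; exact: Rintegrable_patch.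
Qed.

Lemma primitive_modulus_Im (w : I -> R -> R[i]) i e : cintegrable `[0, T] (w i) -> 0 < e ->
  exists2 K, 0 <= K & forall s t,
  `|complex.Im (primitive (extend T w) i s) - complex.Im (primitive (extend T w) i t)| <= e + K * (s - t) ^+ 2.
Proof.
move=> [_ w1]; apply: primitive_modulus.
by rewrite Im_extend; exact: Rintegrable_patch.
Qed.

Let affine_after (phi h1 h2 : R -> R) (q : R) :
  (forall t, T <= t -> phi t = h1 t + h2 t + q) ->
  (exists B, forall t, T <= t -> `|h1 t| <= B) -> (exists B, forall t, T <= t -> `|h2 t| <= B) ->
  h1 t @[t --> T^'+] --> h1 T -> h2 t @[t --> T^'+] --> h2 T ->
  (exists B, forall t, T <= t -> `|phi t| <= B) /\ phi t @[t --> T^'+] --> phi T.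
Proof.
move=> E [B1 b1] [B2 b2] k1 k2; split.
  exists (B1 + B2 + `|q|) => t tT; rewrite E //.
  have := ler_normD (h1 t + h2 t) q; have := ler_normD (h1 t) (h2 t); have := b1 t tT; have := b2 t tT; lra.
rewrite E //; have : (h1 t + h2 t + q) @[t --> T^'+] --> h1 T + h2 T + q.
  by apply: cvgD; [exact: cvgD | exact: cvg_cst].
apply: cvg_trans; apply: near_eq_cvg; near=> t.
by rewrite E //; near: t; exact: nbhs_right_ge.
Unshelve. all: by end_near. Qed.

Let negated (h : R -> R) : (exists B, forall t, T <= t -> `|h t| <= B) -> h t @[t --> T^'+] --> h T ->
  (exists B, forall t, T <= t -> `|- h t| <= B) /\ - h t @[t --> T^'+] --> - h T.
Proof.
by move=> [B b] k; split; [exists B => t tT; rewrite normrN; exact: b | exact: cvgN].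
Qed.

(** Past T the primitives are constant, so the residual is a sum of convolutions with weakly
    singular kernels and a constant. *)
Lemma residual_after i :
  [/\ exists B, forall t, T <= t -> `|complex.Re (res i t)| <= B,
      complex.Re (res i t) @[t --> T^'+] --> complex.Re (res i T),
      exists B, forall t, T <= t -> `|complex.Im (res i t)| <= B &
      complex.Im (res i t) @[t --> T^'+] --> complex.Im (res i T)].
Proof.
have [m1 m2] := measurable_driver la a ig i.
have r s : `|complex.Re (d i s)| <= normc (d i s) by exact: ler_Re_normc.
have q s : `|complex.Im (d i s)| <= normc (d i s) by exact: ler_Im_normc.
have rT s : T <= s -> complex.Re (d i s) = complex.Re (c i * primitive gE i T).
  by move=> Ts; rewrite /c driver_after.
have qT s : T <= s -> complex.Im (d i s) = complex.Im (c i * primitive gE i T).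
  by move=> Ts; rewrite /c driver_after.
have b1 th := part_bounded Hal T0 c0 ig hv hcap th m1 r rT.
have b2 th := part_bounded Hal T0 c0 ig hv hcap th m2 q qT.
have k1 th := part_right_continuous Hal T0 c0 ig hv hcap (th := th) m1 r rT.
have k2 th := part_right_continuous Hal T0 c0 ig hv hcap (th := th) m2 q qT.
pose Q := - (la `^ al)%:C * primitive gE i T - \sum_j A i j * primitive gE j T.
have E t : T <= t -> res i t = cconv (frac_kernel al (c i)) (d i) t + Q.
  move=> tT; rewrite /residual_source /Q (primitive_after _ _ tT) mulNr addrA.
  by under eq_bigr do rewrite (primitive_after _ _ tT).
have [n1 n2] := negated (b2 (pi / 2)) (k2 (pi / 2)).
have [] := @affine_after (fun t => complex.Re (res i t)) _ _ (complex.Re Q) _ (b1 0) n1 (k1 0) n2.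
  by move=> t /E ->; rewrite ReD.
have [] := @affine_after (fun t => complex.Im (res i t)) _ _ (complex.Im Q) _ (b2 0) (b1 (pi / 2)) (k2 0) (k1 (pi / 2)).
  by move=> t /E ->; rewrite ImD.
by [].
Qed.

Lemma residual_modulus i e : 0 < e -> exists2 K, 0 <= K & forall s t, 0 < s -> 0 <= t <= T ->
  `|complex.Re (res i s) - complex.Re (F i t)| <= e + K * (s - t) ^+ 2 /\
  `|complex.Im (res i s) - complex.Im (F i t)| <= e + K * (s - t) ^+ 2.
Proof.
move=> e0; have [b1 k1 b2 k2] := residual_after i.
have FE t : 0 <= t <= T -> F i t = primitive (extend T gf) i t.
  by move=> tT; rewrite primitive_extend // hF.
have P1 e' : 0 < e' -> exists2 K, 0 <= K & forall s t, 0 <= s <= T -> 0 <= t <= T ->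
    `|complex.Re (F i s) - complex.Re (F i t)| <= e' + K * (s - t) ^+ 2.
  move=> e'0; have [K K0 h] := primitive_modulus_Re (igf i) e'0.
  by exists K => // s t sT tT; rewrite !FE.
have P2 e' : 0 < e' -> exists2 K, 0 <= K & forall s t, 0 <= s <= T -> 0 <= t <= T ->
    `|complex.Im (F i s) - complex.Im (F i t)| <= e' + K * (s - t) ^+ 2.
  move=> e'0; have [K K0 h] := primitive_modulus_Im (igf i) e'0.
  by exists K => // s t sT tT; rewrite !FE.
have [K1 K10 h1] := glue_modulus (phi := fun t => complex.Re (res i t)) T0 P1
  (fun t tT => congr1 (@complex.Re R) (residual_inside i tT)) b1 k1 e0.
have [K2 K20 h2] := glue_modulus (phi := fun t => complex.Im (res i t)) T0 P2
  (fun t tT => congr1 (@complex.Im R) (residual_inside i tT)) b2 k2 e0.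
exists (K1 + K2) => [|s t s0 tT]; first exact: addr_ge0.
have := sqr_ge0 (s - t) => q0; have := mulr_ge0 K10 q0; have := mulr_ge0 K20 q0.
by have := h1 s t s0 tT; have := h2 s t s0 tT; rewrite mulrDl; split; lra.
Qed.

Let averageable_res tau i : 0 < tau -> caverageable tau (res i).
Proof.
move=> tau0; have kd := driver_convolvable Hal T0 c0 ig hv hcap i.
have i1 := extend_integrable ig; have i0 j u := @extend_le0 R T I g j u.
have ap j := caverageable_primitive tau0 (fun i => i0 i) i1 j.
have ad : caverageable tau (d i).
  by apply: caverageableD; [exact: (caverageable_g tau0 (fun i => i0 i) i1) | exact: caverageableZ].
have [ac _] := cavg_cconv tau0 0 (caverageable_frac_kernel tau0 Hal (c0 i)) ad kd.
have [as_ _] := @cavg_sum R tau I (index_enum I) (fun j t => A i j * primitive gE j t) 0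
  (fun j => caverageableZ (A i j) (ap j)).
have := caverageableD (caverageableD ac (caverageableZ (- (la `^ al)%:C) (ap i))) (caverageableZ (-1) as_).
by congr caverageable; apply/funext => t; rewrite /residual_source mulN1r mulNr.
Qed.

Lemma averages_close eta : 0 < eta -> exists2 dl, 0 < dl & forall tau n i,
  0 < tau -> tau < dl -> n%:R * tau <= T ->
  normc (cavg tau (res i) n - F i (n%:R * tau)) <= eta /\
  normc (cavg tau (primitive gE i) n - v i (n%:R * tau)) <= eta.
Proof.
move=> eta0; have e0 : 0 < eta / 4 by rewrite divr_gt0.
have hK i : exists K, 0 <= K /\ forall s t, 0 < s -> 0 <= t <= T ->
    [/\ `|complex.Re (res i s) - complex.Re (F i t)| <= eta / 4 + K * (s - t) ^+ 2,
        `|complex.Im (res i s) - complex.Im (F i t)| <= eta / 4 + K * (s - t) ^+ 2,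
        `|complex.Re (primitive gE i s) - complex.Re (v i t)| <= eta / 4 + K * (s - t) ^+ 2 &
        `|complex.Im (primitive gE i s) - complex.Im (v i t)| <= eta / 4 + K * (s - t) ^+ 2].
  have [K1 K10 h1] := residual_modulus i e0.
  have [K2 K20 h2] := primitive_modulus_Re (ig i) e0.
  have [K3 K30 h3] := primitive_modulus_Im (ig i) e0.
  exists (K1 + K2 + K3); split=> [|s t s0 tT]; first by rewrite !addr_ge0.
  have q0 := sqr_ge0 (s - t); have := mulr_ge0 K10 q0; have := mulr_ge0 K20 q0; have := mulr_ge0 K30 q0.
  have [r1 r2] := h1 s t s0 tT; have := h2 s t; have := h3 s t.
  rewrite (primitive_extend ig _ tT) -hv // !mulrDl; split; lra.
have [K hK'] := choice hK.
pose KK := \sum_i K i; have K0 i : 0 <= K i by have [] := hK' i.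
have KK0 : 0 <= KK by apply: sumr_ge0.
have KKi i : K i <= KK by rewrite /KK (bigD1 i) //= lerDl sumr_ge0.
have den : 0 < 4 * (KK * (T + 2) + 1) by rewrite mulr_gt0 // ltr_wpDl // mulr_ge0 // ltW // addr_gt0.
(* For tau <= 1 and n tau <= T the second moment tau^2 (n + 2) is at most tau (T + 2), and the
   second bound makes KK times this at most eta / 4. *)
exists (Num.min 1 (eta / (4 * (KK * (T + 2) + 1)))); first by rewrite lt_min ltr01 divr_gt0.
move=> tau n i tau0; rewrite lt_min => /andP[tau1 tau2] nT.
have tT : 0 <= n%:R * tau <= T by rewrite nT mulr_ge0 // ltW.
have [_ hi] := hK' i.
have small : K i * (tau ^+ 2 * n.+2%:R) <= eta / 4.
  have t1 : tau ^+ 2 * n.+2%:R <= tau * (T + 2).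
    rewrite expr2 -mulrA; apply: ler_wpM2l; first exact: ltW.
    by rewrite -natr1 -natr1 mulrC; lra.
  apply: (@le_trans _ _ (KK * (tau * (T + 2)))).
    apply: ler_pM => //; rewrite mulr_ge0 // exprn_ge0 // ltW //.
  have : tau * (4 * (KK * (T + 2) + 1)) <= eta by rewrite -ler_pdivlMr // ltW.
  lra.
have est phi y : averageable tau phi -> (forall s, 0 < s -> `|phi s - y| <= eta / 4 + K i * (s - n%:R * tau) ^+ 2) ->
    `|avg tau phi n - y| <= eta / 2.
  move=> ap h; have := avg_estimate tau0 (ltW e0) (K0 i) ap h; lra.
have [a1 a2] := averageable_res i tau0.
have [a3 a4] := caverageable_primitive tau0 (fun i u => @extend_le0 R T I g i u) (extend_integrable ig) i.
have cl z y : `|complex.Re z - complex.Re y| <= eta / 2 -> `|complex.Im z - complex.Im y| <= eta / 2 ->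
    normc (z - y) <= eta.
  by move=> h1 h2; have := normc_le_ReIm (z - y); rewrite ReD ImD ReN ImN; lra.
split; apply: cl; apply: est => // s s0; by have [] := hi s (n%:R * tau) s0 tT.
Qed.

Variables (ka M : R).
Hypotheses (Hka : 0 < ka) (HM : 0 <= M).
Hypothesis Hs : forall tau i, 0 < tau -> symbol_params (tau%:C * c i) al (tau * la) ka M.
Hypothesis A_diss : forall x : I -> R[i], complex.Re (vdot x (fun i => \sum_j A i j * x j)) <= 0.

Lemma diss_scale (s : R) (x : I -> R[i]) : 0 <= s ->
  complex.Re (vdot x (fun i => \sum_j (s%:C * A i j) * x j)) <= 0.
Proof.
move=> s0; have -> : vdot x (fun i => \sum_j (s%:C * A i j) * x j) =
    s%:C * vdot x (fun i => \sum_j A i j * x j).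
  rewrite -vdotZr; congr vdot; apply/funext => i; rewrite mulr_sumr.
  by apply: eq_bigr => j _; rewrite mulrA.
by rewrite ReZ mulr_ge0_le0.
Qed.

(** The averages [U] of the extended solution satisfy the scheme with an averaged source. Hence u -
    U solves it with a uniformly small source and is small by stability, while U is close to v by
    concentration of the densities. *)
Theorem semidiscrete_limit e : 0 < e -> exists2 dl, 0 < dl & forall tau u,
  0 < tau -> tau < dl ->
  (forall n i, n%:R * tau <= T ->
    scheme_lhs (fun i => tau%:C * c i) al (tau * la) (fun i j => (tau `^ al)%:C * A i j) u n i =
    (tau `^ al)%:C * F i (n%:R * tau)) ->
  forall n, n%:R * tau <= T -> vnorm (fun i => u n i - v i (n%:R * tau)) <= e.
Proof.
move=> e0; set S := `|stab_const al ka M|; set P := (T + 1) `^ al.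
have S0 : 0 <= S by exact: normr_ge0.
have P0 : 0 <= P by exact: powR_ge0.
(* The number of grid points enters the threshold on tau only, not the constant of the final
   estimate. *)
have q0 : 0 < 2 * (#|I|%:R + 1) * (S * P + 1) :> R.
  have h1 : 0 < #|I|%:R + 1 :> R by rewrite ltr_wpDl.
  have h2 : 0 < S * P + 1 by rewrite ltr_wpDl // mulr_ge0.
  by rewrite !mulr_gt0.
have [dl dl0 hdl] := averages_close (divr_gt0 e0 q0); set eta := e / _ in hdl.
have eta0 : 0 <= eta by rewrite divr_ge0 ?ltW.
exists (Num.min 1 dl); first by rewrite lt_min ltr01.
move=> tau u tau0; rewrite lt_min => /andP[tau1 taud] hu n nT.
have nv (x : I -> R[i]) : (forall i, normc (x i) <= eta) -> vnorm x <= #|I|%:R * (2 * eta).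
  move=> hx; apply: le_trans (vnorm_le_sum x) _.
  rewrite mulr_natl -sumr_const; apply: ler_sum => i _.
  by have := ler_Re_normc (x i); have := ler_Im_normc (x i); have := hx i; lra.
have nu0 : 0 <= #|I|%:R * (2 * eta).
  by apply: mulr_ge0 => //; apply: mulr_ge0.
pose U m i := cavg tau (primitive gE i) m.
have kT k : (k <= n)%N -> k%:R * tau <= T.
  by move=> kn; apply: le_trans nT; rewrite ler_pM2r // ler_nat.
have tal0 : 0 <= tau `^ al by exact: powR_ge0.
have eq0 k i : (k <= n)%N ->
   scheme_lhs (fun i => tau%:C * c i) al (tau * la) (fun i j => (tau `^ al)%:C * A i j)
     (fun m k => u m k - U m k) k i = (tau `^ al)%:C * (F i (k%:R * tau) - cavg tau (res i) k).
  move=> kn; rewrite scheme_sub hu ?kT // /U mulrBr; congr (_ - _).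
  apply: exact_scheme => //; first by move=> j s; exact: extend_le0.
    exact: extend_integrable.
  by move=> j; exact: (driver_convolvable Hal T0 c0 ig hv hcap j).
have h1 : vnorm (fun i => u n i - U n i) <= stab_const al ka M * n.+1%:R `^ al *
    (tau `^ al * (#|I|%:R * (2 * eta))).
  apply: (scheme_stable Hal _ Hka HM (fun i => Hs i tau0) (a := fun i j => (tau `^ al)%:C * A i j) _ _ eq0 _ (leqnn n)).
  - by rewrite mulr_gt0.
  - by move=> x; exact: diss_scale.
  - exact: mulr_ge0.
  - move=> k kn; rewrite (vnormZ (tau `^ al)%:C) normc_real ger0_norm //; apply: ler_wpM2l => //.
    apply: nv => i; have [+ _] := hdl tau k i tau0 taud (kT k kn).
    by rewrite -normc_opp opprB.
have h2 : vnorm (fun i => U n i - v i (n%:R * tau)) <= #|I|%:R * (2 * eta).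
  by apply: nv => i; have [] := hdl tau n i tau0 taud nT.
(* The growth (n+1)^al of the stability bound is compensated by tau^al, since (n + 1) tau <= T +
   1. *)
have h3 : stab_const al ka M * n.+1%:R `^ al * (tau `^ al * (#|I|%:R * (2 * eta))) <=
    S * P * (#|I|%:R * (2 * eta)).
  rewrite mulrA; apply: ler_wpM2r => //.
  rewrite -mulrA -powRM ?(ltW tau0) //.
  apply: (@le_trans _ _ (S * (n.+1%:R * tau) `^ al)).
    by apply: ler_wpM2r; [exact: powR_ge0 | exact: ler_norm].
  apply: ler_wpM2l => //; apply: ge0_ler_powR; rewrite ?nnegrE ?mulr_ge0 ?addr_ge0 ?(ltW tau0) ?(ltW T0) //.
    by case/andP: Hal => /ltW.
  by rewrite -natr1 mulrDl mul1r lerD // ltW.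
have -> : (fun i => u n i - v i (n%:R * tau)) = (fun i => (u n i - U n i) + (U n i - v i (n%:R * tau))).
  by apply/funext => i; rewrite addrA subrK.
apply: le_trans (vnormD _ _) _.
have : #|I|%:R * (2 * eta) * (S * P + 1) <= e.
  have : eta * (2 * (#|I|%:R + 1) * (S * P + 1)) <= e by rewrite /eta divfK // gt_eqF.
  have : 0 <= eta * (2 * (S * P + 1)) by apply: mulr_ge0 => //; apply: mulr_ge0 => //; apply: addr_ge0 => //; exact: mulr_ge0.
  lra.
lra.
Qed.

End SemidiscreteLimit.

(** * The error estimate *)

Section DiscretizationError.
Variables (R : realType) (I : finType) (al la T : R) (a : I -> R[i]) (A : I -> I -> R[i]).
Variables (g v gf F : I -> R -> R[i]).
Local Notation mu := (@lebesgue_measure R).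
Hypotheses (Hal : 0 < al < 1) (la0 : 0 < la) (T0 : 0 < T).
Let c i := la%:C - a i.
Hypothesis c0 : forall i, 0 < complex.Re (c i).
Hypothesis ig : forall i, cintegrable `[0, T] (g i).
Hypothesis hv : forall i t, 0 <= t <= T -> v i t = cint `[0, t] (g i).
Hypothesis igf : forall i, cintegrable `[0, T] (gf i).
Hypothesis hF : forall i t, 0 <= t <= T -> F i t = cint `[0, t] (gf i).
Hypothesis hcap : forall i t, 0 < t <= T ->
  cintegrable `[0, t] (caputo_integrand al (untemper la (a i) (v i)) t).
Hypothesis heq : forall i t, 0 < t <= T ->
  Lt al la (a i) (v i) t = \sum_j A i j * v j t + F i t.
Variables (ka M : R).
Hypotheses (Hka : 0 < ka) (HM : 0 <= M).
Hypothesis Hs : forall tau i, 0 < tau -> symbol_params (tau%:C * c i) al (tau * la) ka M.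
Hypothesis A_diss : forall x : I -> R[i], complex.Re (vdot x (fun i => \sum_j A i j * x j)) <= 0.

Definition euler_lhs (tau : R) (u : nat -> I -> R[i]) : nat -> I -> R[i] :=
  scheme_lhs (fun i => tau%:C * c i) al (tau * la) (fun i j => (tau `^ al)%:C * A i j) u.

Definition euler_solution (tau : R) (L : nat) (u : nat -> I -> R[i]) : Prop :=
  forall n i, (n <= L)%N -> euler_lhs tau u n i = (tau `^ al)%:C * F i (n%:R * tau).

(** Formed with the density of F, which is measurable, in place of its pointwise derivative. *)
Definition source_integral (t : R) : \bar R :=
  (\int[mu]_(s in `[0%R, t]) ((t - s) `^ (al - 1) * vnorm (fun i => gf i s))%:E)%E.

Lemma half_step_const_ge0 : 0 <= half_step_const al ka M.
Proof. by apply: addr_ge0; [apply: mulr_ge0 => //; exact: diff_const_ge0 | exact: decay_const_ge0]. Qed.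

Lemma halving_distance (tau : R) (L n : nat) uc uf : 0 < tau -> L.*2%:R * tau <= T ->
  euler_solution (2 * tau) L uc -> euler_solution tau L.*2 uf -> (n <= L)%N ->
  ((vnorm (fun i => uc n i - uf n.*2 i))%:E <=
   (half_step_const al ka M * tau)%:E * source_integral (n.*2%:R * tau))%E.
Proof.
move=> tau0 LT hc hf nL.
(* The source of the scheme multiplied by tau^al; the coarse scheme then carries the extra factor
   2^al. *)
pose G (k : nat) (i : I) : R[i] := (tau `^ al)%:C * F i (k%:R * tau).
have G0 : G 0%N =1 fun=> 0.
  move=> i; rewrite /G mul0r hF ?lexx ?(ltW T0) // /cint set_itv1 !Rintegral_set1.
  by rewrite (_ : 0 +i* 0 = 0) ?mulr0.
have al2 : (2 * tau) `^ al = 2 `^ al * tau `^ al by rewrite powRM // ltW.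
have hc' k i : (k <= L)%N -> scheme_lhs (fun i => 2 * (tau%:C * c i)) al (2 * (tau * la))
     (fun i j => (2 `^ al)%:C * ((tau `^ al)%:C * A i j)) uc k i = (2 `^ al)%:C * G k.*2 i.
  move=> kL; have := hc k i kL; rewrite /euler_lhs al2 /G.
  have -> : (fun i => (2 * tau)%:C * c i) = fun i => 2 * (tau%:C * c i).
    by apply/funext => j; rewrite rmorphM rmorph_nat mulrA.
  have -> : (fun i j => (2 `^ al * tau `^ al)%:C * A i j) = fun i j => (2 `^ al)%:C * ((tau `^ al)%:C * A i j).
    by apply/funext => j; apply/funext => j'; rewrite rmorphM mulrA.
  rewrite -(mulrA 2 tau la) => ->; rewrite rmorphM -mulrA -muln2 natrM.
  by rewrite (_ : k%:R * (2 * tau) = k%:R * 2 * tau) // mulrA.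
have tla : 0 < tau * la by rewrite mulr_gt0.
have := halving_error Hal tla Hka HM (fun i => Hs i tau0)
  (fun x => diss_scale A_diss x (powR_ge0 tau al)) G0 hc' hf nL.
set S := \sum_(k < n.*2) _ => hS; pose w s := vnorm (fun i => gf i s).
have w0 s : 0 <= w s by exact: vnorm_ge0.
have iw : mu.-integrable `[0, T] (EFin \o w) := vnorm_integrable (measurable_itv _) (g := fun s i => gf i s) igf.
have nT : n.*2%:R * tau <= T.
  by apply: le_trans LT; rewrite ler_pM2r // ler_nat leq_double.
have H0 := half_step_const_ge0.
have S_le : S <= half_step_const al ka M * \sum_(k < n.*2) tau `^ al * ((n.*2 - k)%:R `^ al / (n.*2 - k)%:R) *
      \int[mu]_(s in `[k%:R * tau, k.+1%:R * tau[) w s.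
  rewrite /S mulr_sumr; apply: ler_sum => k _; rewrite -!mulrA; apply: ler_wpM2l => //.
  rewrite [leRHS]mulrCA; apply: ler_wpM2l; first exact: powR_ge0.
  rewrite [leRHS]mulrCA; apply: ler_wpM2l; first by rewrite invr_ge0.
  have kn := ltn_ord k.
  have k0 : 0 <= k%:R * tau by rewrite mulr_ge0 // ltW.
  have kk : k%:R * tau <= k.+1%:R * tau by rewrite ler_pM2r // ler_nat.
  have kT : k.+1%:R * tau <= T by apply: le_trans nT; rewrite ler_pM2r // ler_nat.
  have -> : vnorm (fun i => G k.+1 i - G k i) =
      tau `^ al * vnorm (fun i => cint `[k%:R * tau, k.+1%:R * tau[ (gf i)).
    rewrite -[X in X * _]ger0_norm ?powR_ge0 // -normc_real -vnormZ; congr vnorm.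
    apply/funext => i; rewrite /G -mulrBr hF ?(le_trans k0 kk) // hF ?k0 ?(le_trans kk) //.
    by rewrite (cint_increment _ _ (igf i)) ?k0.
  apply: ler_wpM2l; rewrite ?powR_ge0 //.
  apply: (vnorm_cint_le (measurable_itv _) (g := fun s i => gf i s)) => i; have [i1 i2] := igf i.
  have sub : `[k%:R * tau, k.+1%:R * tau[ `<=` `[0, T].
    move=> s /=; rewrite !in_itv /= => /andP[s1 /ltW s2].
    by rewrite (le_trans k0 s1) (le_trans s2 kT).
  by split; [apply: integrableS i1 | apply: integrableS i2].
apply: le_trans (_ : (S%:E <= _)%E); first by rewrite lee_fin.
apply: le_trans (_ : ((half_step_const al ka M * _)%:E <= _)%E); first by rewrite lee_fin; exact: S_le.
rewrite !EFinM -muleA; apply: lee_wpmul2l; first by rewrite lee_fin.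
have hW := weighted_cells_le Hal tau0 nT w0 iw.
exact: hW.
Qed.

(** The halving from tau / 2^j to tau / 2^(j+1) changes the value at the fixed time n tau by at most
    H tau s / 2^(j+1), with s the source integral at n tau. These bounds sum to at most H tau s, and
    the remaining distance to v is arbitrarily small. *)
Theorem discretization_error (L : nat) u (tau := T / L%:R) : (0 < L)%N ->
  euler_solution tau L u -> forall n, (n <= L)%N ->
  ((vnorm (fun i => u n i - v i (n%:R * tau)))%:E <=
   ((half_step_const al ka M + 1) * tau)%:E * source_integral (n%:R * tau))%E.
Proof.
move=> L0 hu n nL; set H := half_step_const al ka M.
have H0 : 0 <= H by exact: half_step_const_ge0.
have Lr : 0 < L%:R :> R by rewrite ltr0n.
have tau0 : 0 < tau by rewrite divr_gt0.
have LT : L%:R * tau = T by rewrite /tau mulrCA divff ?mulr1 // gt_eqF.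
have S0 : (0 <= source_integral (n%:R * tau))%E.
  by apply: integral_ge0 => s _; rewrite lee_fin mulr_ge0 ?powR_ge0 ?vnorm_ge0.
(* An infinite source integral makes the bound trivial, provided its factor is positive; this is
   what the added 1 ensures. *)
case SE : (source_integral (n%:R * tau)) S0 => [s| |] // S0; last first.
  by rewrite gt0_muley ?leey // lte_fin mulr_gt0 // ltr_wpDl.
rewrite lee_fin in S0; rewrite -EFinM lee_fin.
pose t_ (j : nat) : R := tau / 2 ^+ j.
have p2 j : 0 < 2 ^+ j :> R by rewrite exprn_gt0.
have t0 j : 0 < t_ j by rewrite divr_gt0.
have tS j : t_ j = 2 * t_ j.+1 by rewrite /t_ exprS; field; rewrite gt_eqF.
have nt m j : (m * 2 ^ j)%:R * t_ j = m%:R * tau.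
  by rewrite /t_ natrM natrX; field; rewrite gt_eqF.
have hex j : exists w, forall m i, euler_lhs (t_ j) w m i = (t_ j `^ al)%:C * F i (m%:R * t_ j).
  apply: (scheme_solvable Hal Hka HM (fun i => Hs i (t0 j))) => x.
  exact: (diss_scale A_diss x (powR_ge0 (t_ j) al)).
have [w hw] := choice hex.
have step j : vnorm (fun i => w j (n * 2 ^ j)%N i - w j.+1 (n * 2 ^ j.+1)%N i) <= H * tau * s / 2 ^+ j.+1.
  have dd m : (m * 2 ^ j).*2 = (m * 2 ^ j.+1)%N by rewrite expnS -muln2 -mulnA (mulnC 2).
  have := @halving_distance (t_ j.+1) (L * 2 ^ j) (n * 2 ^ j) (w j) (w j.+1) (t0 _).
  rewrite !dd !nt LT lexx -tS SE -EFinM lee_fin => h.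
  rewrite (_ : H * tau * s / 2 ^+ j.+1 = H * t_ j.+1 * s); last by rewrite /t_; field; rewrite gt_eqF.
  by apply: h; rewrite ?leq_mul2r ?nL ?orbT // => m i _; exact: hw.
have tele J : vnorm (fun i => w 0%N n i - w J (n * 2 ^ J)%N i) <= H * tau * s * (1 - (2 ^+ J)^-1).
  elim: J => [|J IH].
    rewrite expn0 muln1 expr0 invr1 subrr mulr0.
    by rewrite (_ : (fun i => _) = fun=> 0) ?vnorm0 //; apply/funext => i; rewrite subrr.
  rewrite (_ : (fun i => _) = fun i => (w 0%N n i - w J (n * 2 ^ J)%N i) +
     (w J (n * 2 ^ J)%N i - w J.+1 (n * 2 ^ J.+1)%N i)); last first.
    by apply/funext => i; rewrite addrA subrK.
  apply: le_trans (vnormD _ _) _; apply: le_trans (lerD IH (step J)) _.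
  by rewrite le_eqVlt; apply/orP; left; apply/eqP; rewrite exprS; field; rewrite gt_eqF.
have u0 i : u n i = w 0%N n i.
  have e0 : t_ 0%N = tau by rewrite /t_ expr0 divr1.
  apply: (scheme_unique Hal Hka HM (fun i => Hs i tau0)
    (fun x => diss_scale A_diss x (powR_ge0 tau al)) (L := L) _ i nL) => m k mL.
  by have := hw 0%N m k; rewrite e0 => h; rewrite -[LHS]/(euler_lhs tau u m k) hu // -h.
have main e : 0 < e -> vnorm (fun i => u n i - v i (n%:R * tau)) <= H * tau * s + e.
  (* The number J of halvings depends on the grid and on e, but the telescoped bound does not depend
     on J. *)
  move=> e0; have [dl dl0 hdl] := semidiscrete_limit Hal la0 T0 c0 ig hv igf hF hcap heq Hka HM Hs A_diss e0.
  have [J hJ] : exists J, t_ J < dl.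
    exists (Num.truncn (tau / dl)).+1.
    rewrite /t_ ltr_pdivrMr // mulrC -ltr_pdivrMr //.
    apply: lt_le_trans (truncnS_gt _) _.
    by rewrite -natrX ler_nat ltnW // ltn_expl.
  have hn : vnorm (fun i => w J (n * 2 ^ J)%N i - v i (n%:R * tau)) <= e.
    have := hdl (t_ J) (w J) (t0 J) hJ (fun m i _ => hw J m i) (n * 2 ^ J)%N.
    by rewrite nt; apply; rewrite -LT ler_pM2r // ler_nat.
  rewrite (_ : (fun i => _) = fun i => (w 0%N n i - w J (n * 2 ^ J)%N i) +
     (w J (n * 2 ^ J)%N i - v i (n%:R * tau))); last first.
    by apply/funext => i; rewrite addrA subrK u0.
  apply: le_trans (vnormD _ _) (lerD (le_trans (tele J) _) hn).
  by rewrite -[leRHS]mulr1; apply: ler_wpM2l; rewrite ?gerBl ?invr_ge0 ?exprn_ge0 // !mulr_ge0 // ltW.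
apply: (@le_trans _ _ (H * tau * s)); first by apply/ler_addgt0Pr => e /main.
by apply: ler_wpM2r => //; apply: ler_wpM2r; [exact: ltW | rewrite lerDl].
Qed.

End DiscretizationError.

(** * Data of the problem *)

Section EulerCoefficients.
Variable R : realType.

(** At z = rho the terms are differences of convergent, hence bounded, partial sums. *)
Lemma pscvg_pscoef_bounded (p : nat -> R[i]) :
  (forall z, normc z < 1 -> exists P, pscvg p z P) -> pscoef_bounded p.
Proof.
move=> hp rho /andP[rho0 rho1].
have nr : normc rho%:C = rho by rewrite normc_real ger0_norm.
have [P hP] : exists P, pscvg p rho%:C P by apply: hp; rewrite nr.
have [N hN] := cvg0_leP hP ltr01.
pose B := 1 + \sum_(m < N) normc (psum p rho%:C m - P).
have hB m : normc (psum p rho%:C m - P) <= B.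
  have s0 : 0 <= \sum_(m < N) normc (psum p rho%:C m - P) by apply: sumr_ge0 => j _; exact: normc_ge0.
  have [Nm|mN] := leqP N m.
    by have := hN m Nm; rewrite ger0_norm ?normc_ge0 // /B; lra.
  rewrite /B (bigD1 (Ordinal mN)) //= addrCA lerDl addr_ge0 // sumr_ge0 // => j _; exact: normc_ge0.
exists (2 * B) => k.
have -> : normc (p k) * rho ^+ k = normc ((psum p rho%:C k.+1 - P) - (psum p rho%:C k - P)).
  rewrite {1}/psum big_ord_recr /= -/(psum p rho%:C k).
  have -> : psum p rho%:C k + p k * rho%:C ^+ k - P - (psum p rho%:C k - P) = p k * rho%:C ^+ k by ring.
  by rewrite normcM normcX nr.
by apply: le_trans (ler_normcB _ _) _; have := hB k; have := hB k.+1; lra.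
Qed.

(** The coefficients d are given only through their generating function; the identity theorem
    recovers them. *)
Lemma euler_coeffs_symb (al la rho l tau ka M : R) (r U : R * R -> R) d (x : R * R) :
  Omega_bar l x -> euler_coeffs al la rho l tau r U d ->
  symbol_params (tau%:C * (la%:C - acoef rho r U x)) al (tau * la) ka M ->
  forall k, d k x = symb (tau%:C * (la%:C - acoef rho r U x)) al (tau * la) k.
Proof.
move=> Ox hd Hb; set b := tau%:C * _ in Hb *.
have hc z : normc z < 1 -> pscvg (d ^~ x) z (cpow (1 + b - z) al - ((tau * la) `^ al)%:C).
  move=> z1; have := hd x Ox z z1; rewrite /pscvg.
  by rewrite (_ : 1 - z + (tau * la)%:C - tau%:C * acoef rho r U x = 1 + b - z) // /b rmorphM; ring.
have bd : pscoef_bounded (d ^~ x).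
  by apply: pscvg_pscoef_bounded => z z1; eexists; exact: hc.
have bs := pscoef_bounded_symb Hb.
move=> k; apply: (pscoef_unique bd bs) => z z1.
by rewrite (pscvg_pseval bd z1 (hc z z1)) (pscvg_pseval bs z1 (pscvg_symb Hb z1)).
Qed.

End EulerCoefficients.

(** * The sector condition from the data *)

Section DataBounds.
Variable R : realType.

Lemma sup_lt0_bound (D : set (R * R)) (r : R * R -> R) : sup [set r x | x in D] < 0 ->
  forall x, D x -> r x <= sup [set r x | x in D].
Proof.
move=> s0 x Dx; have hs : has_sup [set r x | x in D].
  by apply: contrapT => /sup_out e; rewrite e ltxx in s0.
by apply: (sup_upper_bound hs); exists x.
Qed.

(** If th is the infimum of the angles, then |y| / sqrt (rr^2 + y^2) <= cos th, that is |y| <= cot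
    th * |rr|; so M = cot th. *)
Lemma angle_condition (D : set (R * R)) (rr y : R * R -> R) :
  (exists x, D x) ->
  (forall x, D x -> rr x < 0) ->
  0 < inf [set acos (`|y x| / Num.sqrt (rr x ^+ 2 + y x ^+ 2)) | x in D] ->
  exists2 M, 0 <= M & forall x, D x -> `|y x| <= M * - rr x.
Proof.
set E := [set _ | x in D]; move=> [x0 Dx0] hr hinf.
pose q x := `|y x| / Num.sqrt (rr x ^+ 2 + y x ^+ 2).
have r2 x : D x -> 0 < rr x ^+ 2 by move=> /hr h; rewrite -sqrrN exprn_gt0 // oppr_gt0.
have w0 x : D x -> 0 < Num.sqrt (rr x ^+ 2 + y x ^+ 2).
  by move=> Dx; rewrite sqrtr_gt0 ltr_pwDl ?sqr_ge0 // r2.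
have q0 x : D x -> 0 <= q x by move=> Dx; rewrite divr_ge0 // ltW // w0.
have q1 x : D x -> q x <= 1.
  move=> Dx; rewrite ler_pdivrMr ?w0 // mul1r -sqrtr_sqr ler_sqrt ?lerDr ?(ltW (r2 _ Dx)) //.
  by rewrite addr_ge0 ?sqr_ge0.
have qI x : D x -> -1 <= q x <= 1.
  by move=> Dx; rewrite q1 // (le_trans (lerN10 _)) // q0.
have lbE : has_lbound E.
  by exists 0 => _ [x Dx <-]; apply: acos_ge0; exact: qI.
have infE x : D x -> inf E <= acos (q x) by move=> Dx; apply: ge_inf => //; exists x.
set th := inf E in hinf infE.
(* The quotients are nonnegative, so every angle is at most pi / 2 and the cotangent is
   nonnegative. *)
have thpi : th <= pi / 2.
  apply: le_trans (infE _ Dx0) _; rewrite -[_ / _](@acos0 R).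
  have p0 := pi_ge0 R; have p2 : pi / 2 <= pi :> R by lra.
  have := @ltr_cos R (acos 0) (acos (q x0)).
  rewrite !in_itv /= !acos_ge0 ?acos_lepi ?qI ?lerN10 ?ler01 //= => /(_ isT isT).
  rewrite !acosK ?in_itv /= ?qI ?lerN10 ?ler01 // => h.
  by rewrite leNgt -h ltNge q0.
have pi0 := pi_gt0 R.
have s0 : 0 < sin th by apply: sin_gt0_pi; rewrite hinf /=; lra.
have c0 : 0 <= cos th by apply: cos_ge0_pihalf; rewrite thpi andbT; lra.
exists (cos th / sin th) => [|x Dx]; first by rewrite divr_ge0 // ltW.
have qc : q x <= cos th.
  have := @ltr_cos R (acos (q x)) th.
  rewrite !in_itv /= acos_ge0 ?acos_lepi ?qI //= (ltW hinf) /= => /(_ isT).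
  have -> : th <= pi by lra.
  move=> /(_ isT); rewrite acosK ?in_itv /= ?qI // => h.
  by rewrite leNgt h -leNgt infE.
have nr0 : 0 <= - rr x by rewrite oppr_ge0 ltW // hr.
have yc : `|y x| <= cos th * Num.sqrt (rr x ^+ 2 + y x ^+ 2) by rewrite -ler_pdivrMr ?w0.
have sq : `|y x| ^+ 2 <= cos th ^+ 2 * (rr x ^+ 2 + y x ^+ 2).
  rewrite -[X in _ * X]sqr_sqrtr ?addr_ge0 ?sqr_ge0 // -exprMn.
  by rewrite ler_pXn2r ?nnegrE // mulr_ge0 ?sqrtr_ge0.
have cs := cos2Dsin2 th.
rewrite mulrAC ler_pdivlMr // -(@ler_pXn2r _ 2) ?nnegrE ?mulr_ge0 ?(ltW s0) //.
rewrite !exprMn sqrrN; rewrite real_normK ?num_real // in sq *.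
have -> : sin th ^+ 2 = 1 - cos th ^+ 2 by lra.
by lra.
Qed.

End DataBounds.

(** * Grid vectors as functions on pairs of indices *)

Section GridVectors.
Variables (R : realType) (N : nat).
Local Notation m := (2 * N).-1.
Local Notation I := ('I_m * 'I_m)%type.

Definition grid_entries (v : gridvec R N) (P : I) : R[i] := v P.1 P.2.

Lemma l2norm_vnorm h (v : gridvec R N) : 0 <= h -> l2norm h v = h * vnorm (grid_entries v).
Proof.
move=> h0; rewrite /l2norm /vnorm pair_big /= sqrtrM ?sqr_ge0 //.
by rewrite sqrtr_sqr ger0_norm.
Qed.

Lemma gidx_bound (p : 'I_m) : (0 < N)%N -> `|(gidx p)%:~R| < N%:R :> R.
Proof.
move=> N0; rewrite -intr_norm -[N%:R]/(N%:Z%:~R) ltr_int /gidx.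
by have := ltn_ord p; lia.
Qed.

Lemma gpoint_Omega (l : R) (p q : 'I_m) : (0 < N)%N -> 0 < l -> Omega l (gpoint (l / N%:R) p q).
Proof.
move=> N0 l0; have Nr : 0 < N%:R :> R by rewrite ltr0n.
have h (k : 'I_m) : - l < (gidx k)%:~R * (l / N%:R) < l.
  have /ltr_normlP[h1 h2] := gidx_bound k N0.
  rewrite mulrA ltr_pdivlMr // ltr_pdivrMr // mulNr !(mulrC l) -mulNr !ltr_pM2r // h2 andbT; lra.
by split; exact: h.
Qed.

Lemma Omega_subset_bar (l : R) x : Omega l x -> Omega_bar l x.
Proof. by move=> [/andP[h1 h2] /andP[h3 h4]]; split; rewrite !ltW. Qed.

End GridVectors.

(* [sup] of an empty or unbounded set is 0, so [sup _ < 0] includes that r is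
   bounded above. *)
Theorem theorem4p1 (R : realType) (alpha lambda beta gamma sigma rho l T : R)
    (r U : R * R -> R) (f : R -> R * R -> R[i])
    (halpha : 0 < alpha < 1) (hlambda : 0 < lambda) (hbeta : 0 < beta < 2)
    (hgamma : 0 <= gamma) (hsigma : beta < sigma <= 2) (hl : 0 < l) (hT : 0 < T)
    (hr : sup [set r x | x in Omega_bar l] < 0)
    (htheta : 0 < inf [set acos (`|rho * U x|
                         / Num.sqrt (r x ^+ 2 + (rho * U x) ^+ 2))
                       | x in Omega_bar l])
    (hf0 : forall x, Omega l x -> f 0 x = 0)
    (hfL : LinfL2 T l f)
    (hfac : forall N : nat, (0 < N)%N -> forall p q : 'I_((2 * N).-1),
       abs_cont T (fun t => gridV N (l / N%:R) (f t) p q))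
    (hfint : forall N : nat, (0 < N)%N -> forall t : R, 0 < t <= T ->
       (srcint N alpha (l / N%:R) f t < +oo)%E) :
  exists C : R, 0 < C /\
    forall (N : nat) (G : R -> gridvec R N), (0 < N)%N ->
      let h := l / N%:R in
      semidiscrete_sol alpha lambda beta gamma sigma rho l T h r U f G ->
    forall (L : nat) (d : nat -> R * R -> R[i]) (Gn : nat -> gridvec R N),
      (0 < L)%N ->
      let tau := T / L%:R in
      euler_coeffs alpha lambda rho l tau r U d ->
      fullydiscrete_sol L alpha beta gamma sigma l h tau f d Gn ->
    forall n : nat, (1 <= n <= L)%N ->
      ((l2norm h (G (n%:R * tau) - Gn n))%:E
         <= (C * tau)%:E * srcint N alpha h f (n%:R * tau))%E.
Proof.
set s := sup _ in hr.
have rs x : Omega_bar l x -> r x <= s by exact: sup_lt0_bound.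
have O0 : exists x : R * R, Omega_bar l x.
  by exists (0, 0); split => /=; rewrite oppr_le0 ltW.
have r_lt0 x : Omega_bar l x -> r x < 0 by move=> /rs /le_lt_trans; apply.
have [M M0 hM] := angle_condition (y := fun x => rho * U x) O0 r_lt0 htheta.
(* Chosen so that (1 + ka) lambda = lambda - s, which is at most Re b = lambda - r. *)
pose ka := - s / lambda; have ka0 : 0 < ka by rewrite divr_gt0 ?oppr_gt0.
pose b x := lambda%:C - acoef rho r U x.
have Reb x : complex.Re (b x) = lambda - r x by rewrite /b ReD ReN.
have Imb x : complex.Im (b x) = - (rho * U x) by rewrite /b ImD ImN /= add0r.
have Reb_ge x : Omega_bar l x -> (1 + ka) * lambda <= complex.Re (b x).
  move=> /rs h; rewrite Reb mulrDl mul1r /ka divfK ?gt_eqF //; lra.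
have Reb_gt0 x : Omega_bar l x -> 0 < complex.Re (b x).
  by move=> /r_lt0 h; rewrite Reb; lra.
have params x (tau : R) : Omega_bar l x -> 0 < tau ->
    symbol_params (tau%:C * b x) alpha (tau * lambda) ka M.
  move=> Ox tau0; split=> //; first exact: mulr_gt0.
    by rewrite ReZ mulrCA; apply: ler_wpM2l; [exact: ltW | exact: Reb_ge].
  rewrite ReZ ImZ normrM gtr0_norm // mulrCA; apply: ler_wpM2l; first exact: ltW.
  rewrite Imb normrN; apply: le_trans (hM x Ox) _; apply: ler_wpM2l => //.
  by rewrite Reb lerDr ltW.
(* The constant depends on alpha, on the ratio of sup r to lambda and on the sector opening M
   only. *)
exists (half_step_const alpha ka M + 1).
split; first by rewrite ltr_wpDl // half_step_const_ge0.
move=> N G N0 h [hGac hG0 hGsol] L d Gn L0 tau hd hGn n /andP[n1 nL].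
have h0 : 0 < h by rewrite divr_gt0 // ltr0n.
have tau0 : 0 < tau by rewrite divr_gt0 // ltr0n.
have LT : L%:R * tau = T by rewrite /tau mulrCA divff ?mulr1 // pnatr_eq0 -lt0n.
have [A [hA Adiss]] := @fracLap_dissipative R N l beta gamma sigma h hbeta h0.
pose m := (2 * N).-1; pose x_ (P : 'I_m * 'I_m) : R * R := gpoint h P.1 P.2.
have Ox P : Omega l (x_ P) by exact: gpoint_Omega.
have Oxb P : Omega_bar l (x_ P) by exact: Omega_subset_bar.
have hexG (P : 'I_m * 'I_m) : exists g : R -> R[i], cintegrable `[0, T] g /\
    forall t, 0 <= t <= T -> G t P.1 P.2 = cint `[0, t] g.
  have [g [ig e]] := hGac P.1 P.2; exists g; split=> // t tT.
  by rewrite e // hG0 mxE add0r.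
have hexf (P : 'I_m * 'I_m) : exists gf : R -> R[i], cintegrable `[0, T] gf /\
    forall t, 0 <= t <= T -> f t (x_ P) = cint `[0, t] gf.
  have [gf [ig e]] := hfac N N0 P.1 P.2; exists gf; split=> // t tT.
  by have := e t tT; rewrite !mxE (hf0 _ (Ox P)) add0r.
have [g hg] := choice hexG; have [gf hgf] := choice hexf.
have ig P := (hg P).1; have hv P := (hg P).2; have igf P := (hgf P).1; have hF P := (hgf P).2.
have hcap P t : 0 < t <= T -> cintegrable `[0, t]
    (caputo_integrand alpha (untemper lambda (acoef rho r U (x_ P)) (fun t => G t P.1 P.2)) t).
  by move=> tT; have [] := hGsol t tT P.1 P.2.
have heq P t : 0 < t <= T -> Lt alpha lambda (acoef rho r U (x_ P)) (fun t => G t P.1 P.2) t =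
    \sum_K A P K * G t K.1 K.2 + f t (x_ P).
  by move=> tT; have [_ ->] := hGsol t tT P.1 P.2; rewrite hA mxE -surjective_pairing.
(* The fully discrete scheme multiplied by tau^alpha, with its coefficients identified as those of
   the symbol. *)
have hu : euler_solution alpha lambda (fun P => acoef rho r U (x_ P)) A (fun P t => f t (x_ P)) tau L
    (fun k P => Gn k P.1 P.2).
  move=> k P kL; have /matrixP /(_ P.1 P.2) := hGn k kL.
  rewrite [LHS]mxE summxE [RHS]mxE hA -surjective_pairing [fun_of_matrix (gridV _ _ _) _ _]mxE => e.
  have tal : (tau `^ alpha)%:C != 0 by rewrite eq_complex /= gt_eqF // powR_gt0.
  rewrite /euler_lhs /scheme_lhs.
  have -> : cauchy_prod (symb (tau%:C * (lambda%:C - acoef rho r U (x_ P))) alpha (tau * lambda))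
      (fun k => Gn k P.1 P.2) k = (tau `^ alpha)%:C * (\sum_K A P K * Gn k K.1 K.2 + f (k%:R * tau) (x_ P)).
    rewrite -[f _ _]/(f _ (gpoint h P.1 P.2)) -e mulrA -rmorphM mulfV ?gt_eqF ?powR_gt0 // mul1r.
    apply: eq_bigr => j _; rewrite !mxE; congr (_ * _); apply/esym.
    exact: (euler_coeffs_symb (Oxb P) hd (params _ tau (Oxb P) tau0)).
  rewrite mulrDr mulr_sumr addrAC.
  by under [X in _ - X]eq_bigr do rewrite -mulrA; rewrite subrr add0r.
have err := @discretization_error R _ alpha lambda T (fun P => acoef rho r U (x_ P)) A g
  (fun P t => G t P.1 P.2) gf (fun P t => f t (x_ P)) halpha hlambda hT (fun P => Reb_gt0 _ (Oxb P))
  ig hv igf hF hcap heq ka M ka0 M0 (fun t P => params _ t (Oxb P)) Adiss L _ L0 hu n nL.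
have nT : n%:R * tau <= T by rewrite -LT ler_pM2r // ler_nat.
rewrite l2norm_vnorm ?(ltW h0) // EFinM.
have -> : vnorm (grid_entries (G (n%:R * tau) - Gn n)) =
    vnorm (fun P => Gn n P.1 P.2 - G (n%:R * tau) P.1 P.2).
  by rewrite -vnormN; congr vnorm; apply/funext => P; rewrite /grid_entries !mxE opprB.
apply: le_trans (lee_wpmul2l _ err) _; first by rewrite lee_fin ltW.
rewrite muleCA; apply: lee_wpmul2l.
  by rewrite lee_fin mulr_ge0 ?(ltW tau0) // addr_ge0 // half_step_const_ge0.
have mD : measurable `[0, n%:R * tau] by exact: measurable_itv.
have sub : `[0, n%:R * tau] `<=` `[0, T].
  by move=> t /=; rewrite !in_itv /= => /andP[-> /= /le_trans]; exact.
have mw : measurable_fun `[0, n%:R * tau]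
    (fun t => ((n%:R * tau - t) `^ (alpha - 1) * vnorm (fun P => gf P t))%:E).
  apply/measurable_EFinP; apply: measurable_funM.
    by apply: measurable_funTS; apply: (measurableT_comp (measurable_powR _)); exact: measurable_funB.
  apply: (measurable_vnorm (g := fun t P => gf P t)) => P; have [i1 i2] := igf P.
  by split; [apply: integrableS i1 | apply: integrableS i2].
rewrite /source_integral -ge0_integralZl //; last 2 first.
- by move=> t _; rewrite lee_fin mulr_ge0 ?powR_ge0 ?vnorm_ge0.
- by rewrite lee_fin ltW.
(* The integrand of [srcint] contains the pointwise derivative of f, whose measurability is not
   assumed; it is compared almost everywhere with the density. *)
apply: ae_ge0_le_integral_lower => //.
- exact: measurable_funeM.
- by move=> t _; rewrite -EFinM lee_fin mulr_ge0 ?(ltW h0) // mulr_ge0 ?powR_ge0 ?vnorm_ge0.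
- by move=> t _; rewrite lee_fin mulr_ge0 ?powR_ge0 // /l2norm sqrtr_ge0.
(* The derivative of f agrees with the density only inside ]0, T[, and the upper endpoint may equal
   T. *)
have ends : {ae @lebesgue_measure R, forall t, t != 0 /\ t != n%:R * tau}.
  exists ([set 0] `|` [set n%:R * tau]); split.
  - by apply: measurableU; exact: measurable_set1.
  - by apply: null_set_setU => //; exact: lebesgue_measure_set1.
  - by move=> t /= ht; apply: contrapT => h2; apply: ht; split; apply/eqP => e; apply: h2; [left|right].
have der : {ae @lebesgue_measure R, forall t, forall P, 0 < t < T -> dt f t (x_ P) = gf P t}.
  apply: (@filter_forall _ _ (fun P t => 0 < t < T -> dt f t (x_ P) = gf P t) _
    (ae_filter_ringOfSetsType (@lebesgue_measure R))).
  move=> P; have [i1 i2] := igf P.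
  have e1 t : 0 <= t <= T -> complex.Re (f t (x_ P)) = complex.Re (f 0 (x_ P)) +
      \int[@lebesgue_measure R]_(u in `[0, t]) complex.Re (gf P u).
    by move=> tT; rewrite (hf0 _ (Ox P)) add0r hF.
  have e2 t : 0 <= t <= T -> complex.Im (f t (x_ P)) = complex.Im (f 0 (x_ P)) +
      \int[@lebesgue_measure R]_(u in `[0, t]) complex.Im (gf P u).
    by move=> tT; rewrite (hf0 _ (Ox P)) add0r hF.
  apply: filterS2 (ae_is_derive i1 e1) (ae_is_derive i2 e2); first exact: (ae_filter_ringOfSetsType (@lebesgue_measure R)).
  move=> t d1 d2 tT; rewrite /dt /cderiv !derive1E.
  have [_ ->] := d1 tT; have [_ ->] := d2 tT; exact: complex_eqP.
apply: filterS2 ends der; first exact: (ae_filter_ringOfSetsType (@lebesgue_measure R)).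
move=> t [t0 t1] ht /=; rewrite in_itv /= => /andP[t2 t3].
have tT : 0 < t < T.
  by rewrite lt_neqAle eq_sym t0 t2 (lt_le_trans _ nT) // lt_neqAle t1.
rewrite -EFinM lee_fin mulrCA l2norm_vnorm ?(ltW h0) //.
rewrite le_eqVlt; apply/orP; left; apply/eqP; do 2 congr (_ * _); congr vnorm.
by apply/funext => P; rewrite /grid_entries mxE ht.
Qed.
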